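(* Let $\Gamma$ be a triangulation of $A_{p,q}$, let $\gamma$ be an arc in $\Gamma$, and let $T=\bigoplus_{\delta\in\Gamma}\phi(\delta)$ be the tilting sheaf in $\mathrm{coh}\text{-}\mathbb{X}(p,q)$ corresponding to $\Gamma$. Then $$\phi(\mu_\Gamma(\gamma))=\mu_T(\phi(\gamma)).$$
   Context: Sheaves. Let $\mathbf{k}$ be an algebraically closed field and $1\le p\le q$ integers. $\mathbb{L}(p,q)$ is the abelian group on generators $\vec{x}_1,\vec{x}_2$ with relation $p\vec{x}_1=q\vec{x}_2=:\vec{c}$. $S=\mathbf{k}[x_1,x_2]$ is $\mathbb{L}(p,q)$-graded with $\deg x_i=\vec{x}_i$. $\mathrm{coh}\text{-}\mathbb{X}(p,q)$ is the quotient of the category of finitely generated $\mathbb{L}(p,q)$-graded $S$-modules by the Serre subcategory of finite dimensional modules; $\mathcal{O}$ is the image of $S$, and $\mathcal{O}(\vec{x})$ its grading shifts. $S_{\infty,i}^{(j)}$ ($i\in\mathbb{Z}/p$), resp. $S_{0,i}^{(j)}$ ($i\in\mathbb{Z}/q$), is the uniserial torsion sheaf of length $j\ge1$ with top $S_{\infty,i}=\mathrm{coker}(x_1:\mathcal{O}((i-1)\vec{x}_1)\to\mathcal{O}(i\vec{x}_1))$, resp. $S_{0,i}=\mathrm{coker}(x_2:\mathcal{O}((i-1)\vec{x}_2)\to\mathcal{O}(i\vec{x}_2))$. A sheaf $T$ is tilting if $\mathrm{Ext}^1(T,T)=0$ and $\mathrm{Hom}(T,X)=0=\mathrm{Ext}^1(T,X)$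 implies $X=0$ (taken multiplicity-free, up to isomorphism). If $T=\overline{T}\oplus X$ and $T'=\overline{T}\oplus X'$ are tilting sheaves with $X\not\cong X'$ indecomposable, then $X'$ (which is uniquely determined by $T$ and $X$) is called the mutation of $X$ with respect to $T$, $X'=\mu_T(X)$. Annulus. Let $\mathbb{U}=\mathbb{R}\times[0,1]$ and $\pi:\mathbb{U}\to A_{p,q}$ the quotient by $(x,y)\sim(x+1,y)$; $y=1$ covers the inner boundary, $y=0$ the outer boundary; the marked points are the images of $(\tfrac{i}{p},1)$ and $(\tfrac{j}{q},0)$, $i,j\in\mathbb{Z}$. Let $[D^{i/p}_{j/q}]$ be the homotopy class of the image in $A_{p,q}$ of the oriented arc in $\mathbb{U}$ from $(\tfrac{j}{q},0)$ to $(\tfrac{i}{p},1)$, and for $j-i\ge2$ let $[D^{i/p,j/p}]$, $[D_{i/q,j/q}]$ be those of the arcs from $(\tfrac{i}{p},1)$ to $(\tfrac{j}{p},1)$ and from $(\tfrac{i}{q},0)$ to $(\tfrac{j}{q},0)$. Such a class is an arc of $A_{p,q}$ if it has a representative without self-intersection in the interior. A triangulation of $A_{p,q}$ is a maximal collection of (homotopy classes of) arcs that do not intersect in the interior of $A_{p,q}$, always taken with the orientations of $[D^{i/p}_{j/q}]$, $[D^{i/p,j/p}]$ and $[D_{i/q,j/q}]$, i.e. arcs joining the two boundary components are oriented from the outer boundary to the inner boundary, and arcs with both endpoints on the same boundary component are oriented so that their lifts to $\mathbb{U}$ go from the endpoint with smaller $x$-coordinate to the endpoint with larger $x$-coordinate.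 The flip $\mu_\Gamma(\gamma)$ of $\gamma\in\Gamma$ is the other diagonal $\gamma'$ (oriented by the same rule: from the outer to the inner boundary if it joins the two boundary components, and in the direction of increasing $x$-coordinate of its lifts to $\mathbb{U}$ if both its endpoints lie on the same boundary component) of the quadrilateral formed by the two triangles of $\Gamma$ containing $\gamma$; replacing $\gamma$ by $\gamma'$ gives a new triangulation. $\phi$ is defined by $[D^{i/p}_{j/q}]\mapsto\mathcal{O}(i\vec{x}_1-j\vec{x}_2)$, $[D^{(i-j-1)/p,\,i/p}]\mapsto S_{\infty,i}^{(j)}$, $[D_{-i/q,\,(j-i+1)/q}]\mapsto S_{0,i}^{(j)}$ ($j\geq 1$ in the last two); $\Gamma\mapsto\bigoplus_{\delta\in\Gamma}\phi(\delta)$ is the bijection between triangulations and tilting sheaves. *)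

(* Defs.v *)
From HB Require Import structures.
From mathcomp Require Import all_boot all_order all_algebra.
From mathcomp Require Import generic_quotient ring_quotient finmap.
From mathcomp Require Import boolp classical_sets functions set_interval.
From mathcomp Require Import reals topology.
From mathcomp Require Import normedtype.
Import Order.TTheory GRing.Theory Num.Theory.
Import numFieldNormedType.Exports.

Set Implicit Arguments.
Unset Strict Implicit.
Unset Printing Implicit Defensive.

Local Open Scope ring_scope.
Local Open Scope quotient_scope.

Section GradingGroup.
Context (p q : nat).

Definition Lrel : {pred int * int} :=
  fun u => `[< exists n : int, u = (n * p%:Z, - (n * q%:Z)) >].

Lemma Lrel_closed : zmod_closed Lrel.
Proof.
split; first by apply/asboolP; exists 0; rewrite !mul0r oppr0.
move=> _ _ /asboolP[m ->] /asboolP[n ->]; apply/asboolP; exists (m - n).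
by rewrite !mulrBl; congr (_, _); rewrite /= opprB opprK addrC.
Qed.

HB.instance Definition _ := GRing.isZmodClosed.Build _ Lrel Lrel_closed.

Definition L : zmodType := Quotient.quot Lrel.

Definition e1 : L := \pi_L (1, 0).
Definition e2 : L := \pi_L (0, 1).

Lemma L_eq (u v : int * int) : (\pi_L u == \pi_L v) = Lrel (u - v).
Proof. by rewrite -Quotient.idealrBE. Qed.

Lemma L_relation : e1 *+ p = e2 *+ q.
Proof.
rewrite -!raddfMn; apply/eqP; rewrite L_eq; apply/asboolP; exists 1.
have -> n : ((1, 0) : int * int) *+ n = (n%:Z, 0).
  by elim: n => // n IH; rewrite mulrS IH intS.
have -> n : ((0, 1) : int * int) *+ n = (0, n%:Z).
  by elim: n => // n IH; rewrite mulrS IH intS.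
by rewrite !mul1r; congr (_, _); rewrite /= ?subr0 ?sub0r.
Qed.

End GradingGroup.

Arguments e1 {p q}.
Arguments e2 {p q}.

Section GradedRing.
Context (k : closedFieldType) (p q : nat).

(* k[x2][x1]: the coefficient of x1^a x2^b in f is f`_a`_b *)
Definition S : comNzRingType := {poly {poly k}}.
Definition x1 : S := 'X.
Definition x2 : S := 'X%:P.

Definition mdeg (a b : nat) : L p q := e1 *+ a + e2 *+ b.

Definition Shc (x : L p q) (f : S) : S :=
  \poly_(a < size f) \poly_(b < size f`_a)
    (if mdeg a b == x then f`_a`_b else 0).

Lemma coef_Shc x f a b :
  (Shc x f)`_a`_b = if mdeg a b == x then f`_a`_b else 0.
Proof.
rewrite coef_poly; case: ltnP => ha; last first.
  by rewrite (nth_default _ ha) !coef0 if_same.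
rewrite coef_poly; case: ltnP => hb //.
by rewrite (nth_default _ hb) if_same.
Qed.

Lemma S_ext (f g : S) : (forall a b, f`_a`_b = g`_a`_b) -> f = g.
Proof. by move=> e; apply/polyP => a; apply/polyP => b. Qed.

Lemma ShcB x : {morph Shc x : f g / f - g}.
Proof.
move=> f g; apply: S_ext => a b.
by rewrite coef_Shc !coefB !coef_Shc; case: eqP; rewrite ?subr0.
Qed.

Lemma Shc_proj x y f : Shc x (Shc y f) = if x == y then Shc y f else 0.
Proof.
apply: S_ext => a b; have [->|xy] := eqVneq x y.
  by rewrite !coef_Shc; case: eqP.
rewrite !coef_Shc !coef0; have [->|//] := eqVneq (mdeg a b) x.
by rewrite (negPf xy).
Qed.

Lemma Shc_sum f : exists s : seq (L p q), uniq s /\ f = \sum_(x <- s) Shc x f.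
Proof.
pose N := \max_(a < size f) size (f`_a)%R.
exists (undup [seq mdeg a b | a <- iota 0 (size f), b <- iota 0 N]).
split; first exact: undup_uniq.
apply: S_ext => a b; rewrite !coef_sum.
under eq_bigr do rewrite coef_Shc.
have [fab0|fab] := eqVneq f`_a`_b 0.
  by rewrite big1 ?fab0 // => x _; rewrite if_same.
have ha : (a < size f)%N.
  by rewrite ltnNge; apply: contra fab => h; rewrite (nth_default _ h) coef0.
have hb : (b < N)%N.
  apply: (@leq_trans (size f`_a)).
    by rewrite ltnNge; apply: contra fab => h; rewrite (nth_default _ h).
  exact: (leq_bigmax (Ordinal ha)).
rewrite (bigD1_seq (mdeg a b)) ?undup_uniq //=; last first.
  rewrite mem_undup; apply/allpairsP; exists (a, b).
  by rewrite !mem_iota.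
rewrite eqxx big1 ?addr0 // => x.
by rewrite eq_sym => /negPf ->.
Qed.

Lemma Shc_mul x y s f :
  Shc y s = s -> Shc x f = f -> Shc (x + y) (s * f) = s * f.
Proof.
move=> hs hf; apply: S_ext => a b; rewrite coef_Shc.
have [//|ne] := eqVneq (mdeg a b) (x + y).
rewrite coefM coef_sum big1 // => i _; rewrite coefM big1 // => j _.
rewrite -hs -hf !coef_Shc.
have [e|] := eqVneq (mdeg i j) y; last by rewrite mul0r.
have [e'|] := eqVneq (mdeg (a - i) (b - j)) x; last by rewrite mulr0.
case/negP: ne; rewrite -e -e' /mdeg addrACA -!mulrnDr !subnK //.
  by rewrite -ltnS.
by rewrite -ltnS.
Qed.

Lemma Shc_mulh x y s f :
  Shc y s = s -> Shc (x + y) (s * f) = s * Shc x f.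
Proof.
move=> hs; have [t [ut ef]] := Shc_sum f.
have h0 z : Shc z 0 = 0 by have := ShcB z 0 0; rewrite !subrr.
have hD z : {morph Shc z : g h / g + h}.
  by move=> g h; have := ShcB z (g + h) h; rewrite addrK => ->; rewrite subrK.
rewrite ef mulr_sumr !(big_morph _ (hD _) (h0 _)) mulr_sumr.
apply: eq_bigr => z _; rewrite Shc_proj.
have hz : Shc (z + y) (s * Shc z f) = s * Shc z f.
  by apply: Shc_mul; rewrite ?Shc_proj ?eqxx.
by rewrite -hz Shc_proj (inj_eq (addIr y)) hz; case: eqP; rewrite ?mulr0.
Qed.

Lemma Shc_x1 : Shc e1 x1 = x1.
Proof.
apply: S_ext => a b; rewrite coef_Shc /x1 coefX.
case: a => [|[|a]] /=; rewrite ?coef0 ?if_same //.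
rewrite coefC; case: b => [|b]; rewrite ?if_same //.
by rewrite /mdeg mulr0n addr0 eqxx.
Qed.

Lemma Shc_x2 : Shc e2 x2 = x2.
Proof.
apply: S_ext => a b; rewrite coef_Shc /x2 coefC.
case: a => [|a] /=; rewrite ?coef0 ?if_same // coefX.
case: b => [|[|b]] //=; rewrite ?if_same //.
by rewrite /mdeg mulr0n add0r eqxx.
Qed.

End GradedRing.

Arguments Shc {k p q}.
Arguments x1 {k}.
Arguments x2 {k}.

(* A grading M = (+)_x M_x is given by its homogeneous projections hc x,
   so M_x is the set of m with hc x m = m. *)
Record coh (k : closedFieldType) (p q : nat) := Coh {
  car :> lmodType (S k);
  hc : L p q -> car -> car;
  hcB : forall x, {morph hc x : m n / m - n};
  hc_proj : forall x y m, hc x (hc y m) = if x == y then hc y m else 0;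
  hc_sum : forall m, exists s : seq (L p q),
    uniq s /\ m = \sum_(x <- s) hc x m;
  hc_mul : forall x y s m,
    Shc y s = s -> hc x m = m -> hc (x + y) (s *: m) = s *: m;
  fin_gen : exists e : seq car, forall m, exists a : nat -> S k,
    m = \sum_(i < size e) a i *: e`_i
}.

Section FiniteDimension.
Context (k : closedFieldType).

Definition scalk (M : lmodType (S k)) (c : k) (m : M) : M := c%:P%:P *: m.

(* For k-subspaces Q <= P of M: P / Q is finite dimensional over k. *)
Definition fin_dim_quot (M : lmodType (S k)) (P Q : M -> Prop) : Prop :=
  exists e : seq M, forall m, P m ->
    exists c : nat -> k, Q (m - \sum_(i < size e) scalk (c i) e`_i).

Lemma scalkA (M : lmodType (S k)) a b (m : M) :
  scalk a (scalk b m) = scalk (a * b) m.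
Proof. by rewrite /scalk scalerA !polyCM. Qed.

Lemma scalkDl (M : lmodType (S k)) a b (m : M) :
  scalk (a + b) m = scalk a m + scalk b m.
Proof. by rewrite /scalk !polyCD scalerDl. Qed.

Lemma scalk_sum (M : lmodType (S k)) a n (c : nat -> k) (e : seq M) :
  scalk a (\sum_(i < n) scalk (c i) e`_i) = \sum_(i < n) scalk (a * c i) e`_i.
Proof.
rewrite /scalk scaler_sumr; apply: eq_bigr => i _.
by rewrite scalerA !polyCM.
Qed.

Lemma fin_dim_trans (M : lmodType (S k)) (P Q R : M -> Prop) :
  fin_dim_quot P Q -> fin_dim_quot Q R -> fin_dim_quot P R.
Proof.
move=> [e he] [f hf]; exists (e ++ f) => m /he[c /hf[d hd]].
exists (fun i => if (i < size e)%N then c i else d (i - size e)%N).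
rewrite size_cat big_split_ord /= opprD addrA.
rewrite (eq_bigr (fun i : 'I__ => scalk (c i) e`_i)); last first.
  by move=> i _; rewrite nth_cat !ltn_ord.
rewrite [X in _ - X](eq_bigr (fun i : 'I__ => scalk (d i) f`_i)) // => i _.
by rewrite nth_cat !ltnNge !leq_addr /= addnC addnK.
Qed.

Lemma fin_dim_lin (M : lmodType (S k)) n (T : 'rV[k]_n -> M -> Prop) :
  (forall a b b' m m', T b m -> T b' m' ->
    T (a *: b + b') (scalk a m + m')) ->
  exists e : seq M, forall b m, T b m ->
    exists c : nat -> k, T 0 (m - \sum_(i < size e) scalk (c i) e`_i).
Proof.
move=> lT.
suff H r : exists e : seq M, forall (b : 'rV[k]_n) m,
    (forall i : 'I_n, (r <= i)%N -> b ord0 i = 0) -> T b m ->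
    exists c : nat -> k, T 0 (m - \sum_(i < size e) scalk (c i) e`_i).
  have [e he] := H n; exists e => b m; apply: he => i.
  by rewrite leqNgt ltn_ord.
elim: r => [|r [e he]].
  exists [::] => b m hb Tb; exists (fun=> 0); rewrite big_ord0 subr0.
  suff -> : 0 = b by [].
  by apply/rowP => i; rewrite hb // mxE.
have [[b1 [m1 [hb1 T1 [j jr b1j]]]]|no] := pselect (exists (b1 : 'rV[k]_n) m1,
    [/\ forall i : 'I_n, (r < i)%N -> b1 ord0 i = 0, T b1 m1 &
        exists2 j : 'I_n, j = r :> nat & b1 ord0 j != 0]); last first.
  exists e => b m hb Tb; apply: (he b) => // i; rewrite leq_eqVlt.
  case/predU1P => [ri|/hb//]; apply: contrapT => bi; apply: no.
  by exists b, m; split => //; exists i => //; apply/eqP.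
exists (m1 :: e) => b m hb Tb.
pose a := b ord0 j / b1 ord0 j.
have Tb' := lT (- a) _ _ _ _ T1 Tb.
have [i ri|c hc] := he _ _ _ Tb'.
  rewrite !mxE; move: ri; rewrite leq_eqVlt => /predU1P[ri|ri].
    have -> : i = j by apply: val_inj; rewrite /= jr.
    by rewrite /a mulNr divfK // addNr.
  by rewrite hb1 // hb // mulr0 addr0.
exists (fun i => if i is i'.+1 then c i' else a).
rewrite /= big_ord_recl /= opprD addrA.
suff -> : m - scalk a m1 = scalk (- a) m1 + m by [].
by rewrite /scalk !polyCN scaleNr addrC.
Qed.

End FiniteDimension.

Section Category.
Context (k : closedFieldType) (p q : nat).
Local Notation coh := (coh k p q).
Local Obligation Tactic := idtac.

Lemma hc0 (M : coh) x : hc x (0 : M) = 0.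
Proof. by have := hcB x (0 : M) 0; rewrite !subrr. Qed.

Lemma hcD (M : coh) x : {morph @hc k p q M x : m n / m + n}.
Proof. by move=> m n; have := hcB x (m + n) n; rewrite addrK => ->; rewrite subrK. Qed.

Lemma hc_bigsum (M : coh) x (s : seq (L p q)) (m : M) :
  hc x (\sum_(y <- s) hc y m) = \sum_(y <- s) hc x (hc y m).
Proof. exact: (big_morph (hc x) (hcD x) (hc0 M x)). Qed.

(* Objects of coh-X(p,q) are finitely generated graded modules.  In the Serre
   quotient, Hom(M, N) = colim Hom(M', N/N') over the graded submodules
   M' <= M with M/M' finite dimensional and the finite dimensional graded
   submodules N' <= N.  A triple (M', N', f : M' -> N/N') is the same
   thing as its graph {(m, n) | m in M', f m = n + N'}, a graded submodule of
   M x N with first projection M' and {n | (0, n) in the graph} = N'. *)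
Record qhom (M N : coh) := QHom {
  graph :> M -> N -> Prop;
  graph0 : graph 0 0;
  graph_lin : forall s m n m' n',
    graph m n -> graph m' n' -> graph (s *: m + m') (s *: n + n');
  graph_hc : forall x m n, graph m n -> graph (hc x m) (hc x n);
  graph_dom : fin_dim_quot (fun _ : M => True) (fun m => exists n, graph m n);
  graph_ind : fin_dim_quot (fun n : N => graph 0 n) (fun n => n = 0)
}.

(* Two triples are identified in the colimit iff the difference of the maps,
   on the intersection of the domains, has a finite dimensional image. *)
Definition qeq (M N : coh) (f g : qhom M N) : Prop :=
  fin_dim_quot (fun d : N => exists m n n', [/\ f m n, g m n' & d = n - n'])
               (fun d => d = 0).

Program Definition qid (M : coh) : qhom M M := {| graph := fun m n => n = m |}.
Next Obligation. by []. Qed.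
Next Obligation. by move=> M s m n m' n' -> ->. Qed.
Next Obligation. by move=> M x m n ->. Qed.
Next Obligation. by move=> M; exists [::] => m _; exists (fun=> 0), (m - \sum_(i < 0) scalk 0 [::]`_i). Qed.
Next Obligation.
by move=> M; exists [::] => m ->; exists (fun=> 0); rewrite big_ord0 subr0.
Qed.

Program Definition qzero (M N : coh) : qhom M N := {| graph := fun _ n => n = 0 |}.
Next Obligation. by []. Qed.
Next Obligation. by move=> M N s m n m' n' -> ->; rewrite scaler0 addr0. Qed.
Next Obligation. by move=> M N x m n ->; rewrite hc0. Qed.
Next Obligation. by move=> M N; exists [::] => m _; exists (fun=> 0), 0. Qed.
Next Obligation.
by move=> M N; exists [::] => m ->; exists (fun=> 0); rewrite big_ord0 subr0.
Qed.

Lemma qcomp_lin (M N P : coh) (g : qhom N P) (f : qhom M N) s m n m' n' :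
  (exists l, f m l /\ g l n) -> (exists l, f m' l /\ g l n') ->
  exists l, f (s *: m + m') l /\ g l (s *: n + n').
Proof.
move=> [l [h1 h2]] [l' [h1' h2']].
by exists (s *: l + l'); split; apply: graph_lin.
Qed.

Lemma graph_sub (M N : coh) (f : qhom M N) m n m' n' :
  f m n -> f m' n' -> f (m - m') (n - n').
Proof.
move=> h h'; have := graph_lin (-1) h' h.
by rewrite !scaleN1r ![- _ + _]addrC.
Qed.

Lemma comb_lin (M : lmodType (S k)) (e : seq M) a (b b' : 'rV[k]_(size e)) :
  \sum_i scalk ((a *: b + b') ord0 i) e`_i =
  scalk a (\sum_i scalk (b ord0 i) e`_i) + \sum_i scalk (b' ord0 i) e`_i.
Proof.
rewrite /scalk scaler_sumr -big_split /=; apply: eq_bigr => i _.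
by rewrite !mxE !polyCD !polyCM scalerDl scalerA.
Qed.

Lemma comb_row (M : lmodType (S k)) (e : seq M) (c : nat -> k) :
  \sum_(i < size e) scalk ((\row_i c i : 'rV_(size e)) ord0 i) e`_i =
  \sum_(i < size e) scalk (c i) e`_i.
Proof. by apply: eq_bigr => i _; rewrite mxE. Qed.

Lemma comb0 (M : lmodType (S k)) (e : seq M) :
  \sum_(i < size e) scalk ((0 : 'rV_(size e)) ord0 i) e`_i = 0.
Proof. by rewrite big1 // => i _; rewrite mxE /scalk !polyC0 scale0r. Qed.

Lemma qcomp_dom (M N P : coh) (g : qhom N P) (f : qhom M N) :
  fin_dim_quot (fun _ : M => True)
    (fun m => exists n, exists l, f m l /\ g l n).
Proof.
apply: fin_dim_trans (graph_dom f) _.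
have [e he] := graph_dom g.
pose T (b : 'rV[k]_(size e)) m :=
  exists l r, f m l /\ g (l - \sum_i scalk (b ord0 i) e`_i) r.
have [a b b' m m' [l [r [h1 h2]]] [l' [r' [h1' h2']]]|s hs] := @fin_dim_lin k M _ T.
  exists (scalk a l + l'), (scalk a r + r'); split; first exact: graph_lin.
  rewrite comb_lin /scalk opprD addrACA -scalerBr.
  exact: graph_lin.
exists s => m [l fl]; have [c [r hr]] := he l I.
have [|d [l' [r' [h1 h2]]]] := hs (\row_i c i) m.
  by exists l, r; rewrite comb_row.
exists d, r', l'; split=> //.
by move: h2; rewrite comb0 subr0.
Qed.

Lemma qcomp_ind (M N P : coh) (g : qhom N P) (f : qhom M N) :
  fin_dim_quot (fun n : P => exists l, f 0 l /\ g l n) (fun n => n = 0).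
Proof.
apply: fin_dim_trans (graph_ind g).
have [e he] := graph_ind f.
pose T (b : 'rV[k]_(size e)) r := g (\sum_i scalk (b ord0 i) e`_i) r.
have [a b b' r r' h h'|s hs] := @fin_dim_lin k P _ T.
  by rewrite /T comb_lin /scalk; apply: graph_lin.
exists s => r [l [fl gl]]; have [c /eqP] := he l fl.
rewrite subr_eq0 => /eqP el.
have [|d] := hs (\row_i c i) r; first by rewrite /T comb_row -el.
by rewrite /T comb0 => hd; exists d.
Qed.

Definition qcomp (M N P : coh) (g : qhom N P) (f : qhom M N) : qhom M P.
Proof.
refine (@QHom M P (fun m n => exists l, f m l /\ g l n)
  _ (@qcomp_lin M N P g f) _ (qcomp_dom g f) (qcomp_ind g f)).
  by exists 0; split; apply: graph0.
move=> x m n [l [h1 h2]]; exists (hc x l).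
by split; apply: graph_hc.
Defined.

Definition is_zero (X : coh) : Prop := qeq (qid X) (qzero X X).

Definition is_iso (M N : coh) (f : qhom M N) : Prop :=
  exists g : qhom N M, qeq (qcomp g f) (qid M) /\ qeq (qcomp f g) (qid N).

Definition iso (M N : coh) : Prop := exists f : qhom M N, is_iso f.

Definition mono (M N : coh) (f : qhom M N) : Prop :=
  forall (Z : coh) (g h : qhom Z M), qeq (qcomp f g) (qcomp f h) -> qeq g h.

Definition epi (M N : coh) (f : qhom M N) : Prop :=
  forall (Z : coh) (g h : qhom N Z), qeq (qcomp g f) (qcomp h f) -> qeq g h.

Definition is_kernel (K M N : coh) (i : qhom K M) (f : qhom M N) : Prop :=
  [/\ qeq (qcomp f i) (qzero K N), mono i &
      forall (Z : coh) (g : qhom Z M), qeq (qcomp f g) (qzero Z N) ->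
        exists h : qhom Z K, qeq (qcomp i h) g].

Definition is_cokernel (M N C : coh) (c : qhom N C) (f : qhom M N) : Prop :=
  [/\ qeq (qcomp c f) (qzero M C), epi c &
      forall (Z : coh) (g : qhom N Z), qeq (qcomp g f) (qzero M Z) ->
        exists h : qhom C Z, qeq (qcomp h c) g].

Definition short_exact (X E Y : coh) (i : qhom X E) (c : qhom E Y) : Prop :=
  is_kernel i c /\ is_cokernel c i.

Definition Hom_zero (X Y : coh) : Prop :=
  forall f : qhom X Y, qeq f (qzero X Y).

(* Ext^1(Y, X) = 0 for the Yoneda Ext^1: every extension of Y by X splits. *)
Definition Ext1_zero (Y X : coh) : Prop :=
  forall (E : coh) (i : qhom X E) (c : qhom E Y), short_exact i c ->
    exists r : qhom E X, qeq (qcomp r i) (qid X).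

Definition sub_le (Y Z X : coh) (i : qhom Y X) (j : qhom Z X) : Prop :=
  exists h : qhom Y Z, qeq (qcomp j h) i.

Definition uniserial (X : coh) : Prop :=
  forall (Y Z : coh) (i : qhom Y X) (j : qhom Z X), mono i -> mono j ->
    sub_le i j \/ sub_le j i.

Definition has_length (X : coh) (n : nat) : Prop :=
  exists (Y : nat -> coh) (i : forall a, qhom (Y a) X),
    [/\ is_zero (Y 0%N), is_iso (i n),
        forall a, (a <= n)%N -> mono (i a) &
        forall a, (a < n)%N ->
          [/\ sub_le (i a) (i a.+1), ~ sub_le (i a.+1) (i a) &
              forall (Z : coh) (j : qhom Z X), mono j ->
                sub_le (i a) j -> sub_le j (i a.+1) ->
                sub_le j (i a) \/ sub_le (i a.+1) j]].

Definition maximal_sub (Y X : coh) (i : qhom Y X) : Prop :=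
  [/\ mono i, ~ is_iso i &
      forall (Z : coh) (j : qhom Z X), mono j -> sub_le i j ->
        sub_le j i \/ is_iso j].

Definition is_radical (R X : coh) (r : qhom R X) : Prop :=
  mono r /\
  forall (Z : coh) (j : qhom Z X), mono j ->
    (sub_le j r <->
     forall (Y : coh) (i : qhom Y X), maximal_sub i -> sub_le j i).

(* top X = X / rad X *)
Definition is_top (X Y : coh) : Prop :=
  exists (R : coh) (r : qhom R X) (c : qhom X Y),
    is_radical r /\ is_cokernel c r.

Definition dsum_hc (M N : coh) (x : L p q) (u : (M * N)%type) : (M * N)%type :=
  (hc x u.1, hc x u.2).

Lemma hc_notin (M : coh) (s : seq (L p q)) (m : M) x :
  m = \sum_(y <- s) hc y m -> x \notin s -> hc x m = 0.
Proof.
move=> em xs; rewrite {1}em hc_bigsum big_seq big1 // => y ys.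
by rewrite hc_proj; case: eqP => // e; rewrite e ys in xs.
Qed.

Lemma hc_uniq_sum (M : coh) (s : seq (L p q)) (m : M) : uniq s ->
  (forall x, x \notin s -> hc x m = 0) -> m = \sum_(x <- s) hc x m.
Proof.
move=> us hs; have [t [ut et]] := hc_sum m.
rewrite [LHS]et (bigID (mem s)) /= [X in _ + X]big1 ?addr0; last first.
  by move=> x /hs.
rewrite [RHS](bigID (mem t)) /= [X in _ = _ + X]big1 ?addr0; last first.
  by move=> x; apply: hc_notin et.
rewrite -big_filter -[RHS]big_filter; apply: perm_big.
by apply: uniq_perm; rewrite ?filter_uniq // => x; rewrite !mem_filter andbC.
Qed.

Lemma dsum_sum (M N : coh) (u : (M * N)%type) : exists s : seq (L p q),
  uniq s /\ u = \sum_(x <- s) dsum_hc x u.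
Proof.
case: u => m n; have [s [us es]] := hc_sum m; have [t [ut et]] := hc_sum n.
exists (undup (s ++ t)); split; first exact: undup_uniq.
have -> : \sum_(x <- undup (s ++ t)) dsum_hc x (m, n) =
    (\sum_(x <- undup (s ++ t)) hc x m, \sum_(x <- undup (s ++ t)) hc x n).
  elim: (undup _) => [|y l IH]; first by rewrite !big_nil.
  by rewrite !big_cons IH.
congr (_, _); apply: hc_uniq_sum; rewrite ?undup_uniq // => x;
  rewrite mem_undup mem_cat negb_or => /andP[].
  by move=> xs _; apply: hc_notin es xs.
by move=> _ xt; apply: hc_notin et xt.
Qed.

Lemma dsum_fin_gen (M N : coh) : exists e : seq (M * N)%type,
  forall u : (M * N)%type, exists a : nat -> S k,
    u = \sum_(i < size e) a i *: e`_i.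
Proof.
have [e he] := fin_gen M; have [f hf] := fin_gen N.
exists ([seq (m, 0) | m <- e] ++ [seq (0, n) | n <- f]) => -[m n].
have [a ->] := he m; have [b ->] := hf n.
exists (fun i => if (i < size e)%N then a i else b (i - size e)%N).
rewrite size_cat !size_map big_split_ord /=.
have pD (a1 a2 : M) (b1 b2 : N) : (a1, b1) + (a2, b2) = (a1 + a2, b1 + b2) by [].
have pZ c (a1 : M) (b1 : N) : c *: (a1, b1) = (c *: a1, c *: b1) by [].
have sum1 (l : nat) (F : 'I_l -> M) :
    \sum_i (F i, 0 : N) = (\sum_i F i, 0).
  by elim: l F => [|l IH] F; rewrite ?big_ord0 // !big_ord_recl IH pD addr0.
have sum2 (l : nat) (F : 'I_l -> N) :
    \sum_i (0 : M, F i) = (0, \sum_i F i).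
  by elim: l F => [|l IH] F; rewrite ?big_ord0 // !big_ord_recl IH pD addr0.
rewrite (eq_bigr (fun i : 'I_(size e) => (a i *: e`_i, 0 : N))); last first.
  move=> i _; rewrite nth_cat size_map !ltn_ord (nth_map 0) //.
  by rewrite pZ scaler0.
rewrite [X in _ + X](eq_bigr (fun i : 'I_(size f) => (0 : M, b i *: f`_i))).
  by rewrite sum1 sum2 pD addr0 add0r.
move=> i _; rewrite nth_cat size_map !ltnNge !leq_addr /= addnC addnK.
by rewrite (nth_map 0) // pZ scaler0.
Qed.

Program Definition dsum (M N : coh) : coh :=
  {| car := (M * N)%type; hc := @dsum_hc M N |}.
Next Obligation. by move=> M N x [m n] [m' n']; congr (_, _); apply: hcB. Qed.
Next Obligation.
by move=> M N x y [m n]; rewrite /dsum_hc /= !hc_proj; case: ifP.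
Qed.
Next Obligation. exact: dsum_sum. Qed.
Next Obligation.
by move=> M N x y s [m n] hs [hm hn]; congr (_, _); apply: hc_mul.
Qed.
Next Obligation. exact: dsum_fin_gen. Qed.

Lemma triv_eq (u v : 'rV[S k]_0) : u = v.
Proof. by rewrite (thinmx0 u) (thinmx0 v). Qed.

Program Definition zero_sheaf : coh :=
  {| car := 'rV[S k]_0; hc := fun _ u => u |}.
Next Obligation. by move=> x u v. Qed.
Next Obligation. by move=> x y u; apply: triv_eq. Qed.
Next Obligation. by move=> u; exists [::]; split=> //; apply: triv_eq. Qed.
Next Obligation. by []. Qed.
Next Obligation. by exists [::] => u; exists (fun=> 0); apply: triv_eq. Qed.

Definition big_dsum (s : seq coh) : coh := foldr dsum zero_sheaf s.

Definition indecomposable (X : coh) : Prop :=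
  ~ is_zero X /\
  forall Y Z : coh, iso X (dsum Y Z) -> is_zero Y \/ is_zero Z.

Definition multiplicity_free (T : coh) : Prop :=
  forall Y Z : coh, iso T (dsum (dsum Y Y) Z) -> is_zero Y.

Definition tilting (T : coh) : Prop :=
  [/\ Ext1_zero T T,
      forall X : coh, Hom_zero T X -> Ext1_zero T X -> is_zero X &
      multiplicity_free T].

(* X' = mu_T(X), as the graph of the partial function mu_T *)
Definition is_mutation (T X X' : coh) : Prop :=
  [/\ indecomposable X, indecomposable X', ~ iso X X' &
      exists T0 : coh,
        [/\ iso T (dsum T0 X), tilting T & tilting (dsum T0 X')]].

(* O(x)_y = S_(x + y) *)
Program Definition O (x : L p q) : coh :=
  {| car := (S k)^o; hc := fun y f => Shc (x + y) f |}.
Next Obligation. by move=> x y f g; apply: ShcB. Qed.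
Next Obligation.
by move=> x y z f /=; rewrite Shc_proj (inj_eq (addrI x)).
Qed.
Next Obligation.
move=> x f; have [s [us es]] := @Shc_sum k p q f.
exists [seq y - x | y <- s]; split; first by rewrite map_inj_uniq //; apply: addIr.
by rewrite big_map {1}es; apply: eq_bigr => y _; rewrite addrC subrK.
Qed.
Next Obligation.
by move=> x y z s f hs hf /=; rewrite addrA; apply: Shc_mul.
Qed.
Next Obligation.
move=> x; exists [:: 1] => f; exists (fun=> f).
by rewrite big_ord1 /= [RHS]mulr1.
Qed.

(* A homogeneous f in S_y acts as a morphism O(x) -> O(x + y). *)
Program Definition mulq (x y : L p q) (f : S k) (hf : Shc y f = f) :
  qhom (O x) (O (x + y)) := {| graph := fun (m n : S k) => n = f * m |}.
Next Obligation. by move=> x y f hf; apply/esym; exact: (mulr0 f). Qed.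
Next Obligation.
move=> x y f hf s m n m' n' -> ->.
have E (a b c d : S k) : b * (a * c) + a * d = a * (b * c + d).
  by rewrite mulrDr mulrCA.
exact: E.
Qed.
Next Obligation.
by move=> x y f hf z m n /= ->; rewrite addrAC Shc_mulh.
Qed.
Next Obligation.
move=> x y f hf; exists [::] => m _; exists (fun=> 0), (f * (m : S k)).
by rewrite big_ord0 subr0.
Qed.
Next Obligation.
move=> x y f hf; exists [::] => m ->; exists (fun=> 0).
by rewrite big_ord0 subr0; exact: (mulr0 f).
Qed.

Definition torsion (M : coh) : Prop :=
  forall m : M, exists2 s : S k, s != 0 & s *: m = 0.

(* S_{oo,i} = coker (x1 : O((i - 1) x1) -> O(i x1)) *)
Definition is_simple_inf (i : int) (Y : coh) : Prop :=
  exists c : qhom (O (e1 *~ (i - 1) + e1)) Y,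
    is_cokernel c (mulq (e1 *~ (i - 1)) (Shc_x1 k p q)).

(* S_{0,i} = coker (x2 : O((i - 1) x2) -> O(i x2)) *)
Definition is_simple_zero (i : int) (Y : coh) : Prop :=
  exists c : qhom (O (e2 *~ (i - 1) + e2)) Y,
    is_cokernel c (mulq (e2 *~ (i - 1)) (Shc_x2 k p q)).

(* X is the sheaf S_{oo,i}^(j); i stands for its class in Z/p *)
Definition is_torsion_inf (i : int) (j : nat) (X : coh) : Prop :=
  [/\ torsion X, uniserial X, has_length X j &
      exists Y : coh, is_simple_inf i Y /\ is_top X Y].

(* X is the sheaf S_{0,i}^(j); i stands for its class in Z/q *)
Definition is_torsion_zero (i : int) (j : nat) (X : coh) : Prop :=
  [/\ torsion X, uniserial X, has_length X j &
      exists Y : coh, is_simple_zero i Y /\ is_top X Y].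

End Category.

Section Annulus.
Context (R : realType).
Local Open Scope classical_set_scope.

Definition unit_itv : topologicalType := `[0 : R, 1]%classic.

Definition rval (t : unit_itv) : R := set_val t.

Lemma unit_itv_bounds (t : unit_itv) : 0 <= rval t <= 1.
Proof. by have := set_valP t; rewrite /= in_itv. Qed.

Definition mk_itv (x : R) (hx : 0 <= x <= 1) : unit_itv :=
  exist _ x (mem_set (hx : `[0, 1]%classic x)).

Definition i0 : unit_itv := mk_itv (introT andP (conj (lexx 0) ler01)).
Definition i1 : unit_itv := mk_itv (introT andP (conj ler01 (lexx 1))).

Definition strip : topologicalType := (R * unit_itv)%type.

Definition strip_rel (u v : strip) : bool :=
  (u.1 - v.1 \is a Num.int) && (u.2 == v.2).

Lemma strip_rel_equiv : equiv_class_of strip_rel.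
Proof.
split=> [u|u v|v u w].
- by rewrite /strip_rel subrr rpred0 eqxx.
- by rewrite /strip_rel -opprB rpredN eq_sym.
- move=> /andP[h1 /eqP e1] /andP[h2 /eqP e2].
  rewrite /strip_rel e1 e2 eqxx andbT.
  by rewrite -(subrK v.1 u.1) -addrA rpredD.
Qed.

Canonical strip_rel_canonical := EquivRelPack strip_rel_equiv.

Definition annulus : topologicalType := quotient_topology {eq_quot strip_rel}.

Definition proj (u : strip) : annulus := \pi_(quotient_topology {eq_quot strip_rel}) u.

Lemma proj_eq (u v : strip) : (proj u == proj v) = strip_rel u v.
Proof. by apply/eqP/idP => /(@eqmodP strip strip_rel_canonical u v). Qed.

Definition annulus_interior : set annulus :=
  [set proj u | u in [set u : strip | 0 < rval u.2 < 1]].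

Definition homotopic (c c' : unit_itv -> annulus) : Prop :=
  exists H : unit_itv * unit_itv -> annulus,
    [/\ continuous H,
        forall t, H (i0, t) = c t, forall t, H (i1, t) = c' t,
        forall s, H (s, i0) = c i0 & forall s, H (s, i1) = c i1].

Lemma conv_bounds (t a b : unit_itv) :
  0 <= (1 - rval t) * rval a + rval t * rval b <= 1.
Proof.
have /andP[t0 t1] := unit_itv_bounds t.
have /andP[a0 a1] := unit_itv_bounds a.
have /andP[b0 b1] := unit_itv_bounds b.
have t1' : 0 <= 1 - rval t by rewrite subr_ge0.
rewrite addr_ge0 ?mulr_ge0 //=.
rewrite -[leRHS](subrK (rval t)) lerD //.
  by rewrite ler_piMr.
by rewrite ler_piMr.
Qed.

Definition segment (u v : strip) (t : unit_itv) : strip :=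
  ((1 - rval t) * u.1 + rval t * v.1, mk_itv (conv_bounds t u.2 v.2)).

Context (p q : nat).

(* Inner i is the point (i/p, 1) and Outer j the point (j/q, 0). *)
Inductive marked := Inner of int | Outer of int.

Definition point_of (u : marked) : strip :=
  match u with
  | Inner i => (i%:~R / p%:R, i1)
  | Outer j => (j%:~R / q%:R, i0)
  end.

Definition hclass := set (unit_itv -> annulus).

(* [D] for D an arc from u to v in the strip; the strip being convex, the
   class does not depend on D, and we take D to be straight. *)
Definition arc_class (u v : marked) : hclass :=
  [set c | homotopic (proj \o segment (point_of u) (point_of v)) c].

Definition oriented (u v : marked) : bool :=
  match u, v with
  | Outer _, Inner _ => true
  | Inner i, Inner j => i + 2 <= j
  | Outer i, Outer j => i + 2 <= j
  | Inner _, Outer _ => false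
  end.

Definition inside (t : unit_itv) : Prop := 0 < rval t < 1.

(* Representatives meet the boundary only at their endpoints: a curve allowed
   to run along the boundary could avoid every crossing in the interior. *)
Definition simple_rep (g : hclass) (c : unit_itv -> annulus) : Prop :=
  [/\ g c, forall t, inside t -> annulus_interior (c t) &
      forall s t, inside s -> inside t -> c s = c t -> s = t].

Definition is_arc (g : hclass) : Prop :=
  (exists u v, oriented u v /\ g = arc_class u v) /\
  (exists c, simple_rep g c).

Definition noncrossing (g d : hclass) : Prop :=
  exists c c', [/\ simple_rep g c, simple_rep d c' &
    forall s t, inside s -> inside t -> c s <> c' t].

Definition triangulation (G : {fset hclass}) : Prop :=
  [/\ forall g, g \in G -> is_arc g,
      forall g d, g \in G -> d \in G -> g <> d -> noncrossing g d &
      forall d, is_arc d -> (forall g, g \in G -> noncrossing d g) -> d \in G].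

Definition boundary_side (u v : marked) : Prop :=
  match u, v with
  | Inner i, Inner j | Outer i, Outer j => j = i + 1 \/ i = j + 1
  | _, _ => False
  end.

(* u and v are joined by a boundary segment or by a lift of an arc of G *)
Definition side (G : {fset hclass}) (u v : marked) : Prop :=
  [\/ boundary_side u v,
      oriented u v /\ arc_class u v \in G |
      oriented v u /\ arc_class v u \in G].

(* Triangles are given by the vertices of a lift to the strip; no two sides
   cross and all marked points lie on the boundary, so that three points
   joined pairwise by sides bound a triangle of the triangulation. *)
Definition triangle (G : {fset hclass}) (u v w : marked) : Prop :=
  [/\ side G u v, side G v w & side G u w].

(* g' = mu_G(g): g lifts to the common side uv of the two triangles uvw and
   uvz, and g' is the class of the other diagonal wz of the quadrilateral. *)
Definition is_flip (G : {fset hclass}) (g g' : hclass) : Prop :=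
  exists u v w z,
    [/\ oriented u v /\ g = arc_class u v,
        triangle G u v w, triangle G u v z, w <> z &
        oriented w z /\ g' = arc_class w z].

Context (k : closedFieldType).

Definition is_phi (phi : hclass -> coh k p q) : Prop :=
  [/\ forall i j : int,
        iso (phi (arc_class (Outer j) (Inner i))) (O k (e1 *~ i - e2 *~ j)),
      forall (i : int) (j : nat), (1 <= j)%N ->
        is_torsion_inf i j
          (phi (arc_class (Inner (i - j%:Z - 1)) (Inner i))) &
      forall (i : int) (j : nat), (1 <= j)%N ->
        is_torsion_zero i j
          (phi (arc_class (Outer (- i)) (Outer (j%:Z - i + 1))))].

Definition sheaf_of (phi : hclass -> coh k p q) (G : {fset hclass}) :
  coh k p q := big_dsum [seq phi d | d <- enum_fset G].

End Annulus.

(* Main.v *)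
(* Lifting arcs to the strip turns arcs into chords between marked points of its boundary,
   ordered cyclically, and two arcs can be drawn without crossing iff no lifts of them have
   interleaving endpoints.  If representatives C, C' of interleaving chords did not meet, the
   angle of C(s) - C'(t) would lift continuously to the square [0,1]^2, while its values along
   the four sides force a nonzero total variation; conversely segments and flat parabolas
   realize non-interleaving chords disjointly.

   A sheaf X has no Hom and Ext^1 from the sheaf of a chord iff some power of x1 or x2 acts
   bijectively on a localization of X, or X has no Cech cohomology in one degree.  These
   conditions compose: if zw crosses uv, the conditions for zw and for the four sides of the
   quadrilateral uzvw give the condition for uv.  By induction on the number of crossings, the
   chords of a triangulation imply the conditions for all chords, so X = 0; as the flipped
   chord crosses only the one it replaces, the flipped collection generates as well.  Rigidity
   is read off degrees, and the summands are bricks no two of which are isomorphic, so the sum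
   is multiplicity free. *)

Require Import Defs.
From HB Require Import structures.
From Corelib Require Setoid Morphisms.
From Stdlib Require List.
From mathcomp Require Import all_boot all_order all_algebra finmap.
From mathcomp Require Import generic_quotient ring_quotient ring lra zify.
From mathcomp Require Import boolp classical_sets functions reals.
From mathcomp Require Import interval_inference topology normedtype.
From mathcomp Require Import realfun trigo.
Import Order.TTheory GRing.Theory Num.Theory.
Import numFieldNormedType.Exports.

Set Implicit Arguments.
Unset Strict Implicit.
Unset Printing Implicit Defensive.

Local Open Scope ring_scope.
Local Open Scope quotient_scope.

(** * Noetherian modules *)

(** Derived functors and the Grothendieck group are avoided: Hilbert's basis theorem turns each
    finite dimensionality condition into one about multiplication by large powers of the two
    variables, so that morphisms, exactness and lifting are checked on elements. As [phi] is given
    only up to isomorphism, and its torsion values only by length, top and uniseriality, these are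
    first identified with explicit cokernels. For the flipped collection, the crossing induction
    still runs over the old triangulation, once the new diagonal and the four sides have given back
    the old diagonal. Between two summands there may be nonzero maps in one direction, but round
    trips vanish; this suffices to see that an endomorphism with identity diagonal entries has no
    kernel, which yields multiplicity freeness. On the topological side, maximality of a
    triangulation calls for actual disjoint curves, whereas crossing calls for an obstruction valid
    for arbitrary continuous representatives. *)

Section Noetherian.

Definition submod (R : nzRingType) (M : lmodType R) (P : M -> Prop) : Prop :=
  P 0 /\ forall a m n, P m -> P n -> P (a *: m + n).

Lemma submodD (R : nzRingType) (M : lmodType R) (P : M -> Prop) m n :
  submod P -> P m -> P n -> P (m + n).
Proof. by move=> [_ h] hm hn; rewrite -[m]scale1r; apply: h. Qed.

Lemma submodZ (R : nzRingType) (M : lmodType R) (P : M -> Prop) a m :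
  submod P -> P m -> P (a *: m).
Proof. by move=> [h0 h] hm; rewrite -[_ *: _]addr0; apply: h. Qed.

Lemma submodB (R : nzRingType) (M : lmodType R) (P : M -> Prop) m n :
  submod P -> P m -> P n -> P (m - n).
Proof.
by move=> sP hm hn; rewrite -scaleN1r; apply: submodD => //; apply: submodZ.
Qed.

Lemma submod_sum (R : nzRingType) (M : lmodType R) (P : M -> Prop)
    (I : Type) (r : seq I) (F : I -> M) :
  submod P -> (forall i, P (F i)) -> P (\sum_(i <- r) F i).
Proof.
move=> sP hF; elim: r => [|i r IH]; first by rewrite big_nil; case: sP.
by rewrite big_cons; apply: submodD.
Qed.

Fixpoint lspan (R : nzRingType) (M : lmodType R) (s : seq M) (m : M) : Prop :=
  if s is x :: s' then exists a m', lspan s' m' /\ m = a *: x + m' else m = 0.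

Lemma lspan_submod (R : nzRingType) (M : lmodType R) (s : seq M) : submod (lspan s).
Proof.
elim: s => [|x s [IH0 IH]] /=.
  by split=> // a m n -> ->; rewrite scaler0 addr0.
split; first by exists 0, 0; rewrite scale0r addr0.
move=> a m n [b [m' [hm' ->]]] [c [n' [hn' ->]]].
exists (a * b + c), (a *: m' + n'); split; first exact: IH.
by rewrite scalerDr scalerA scalerDl addrACA.
Qed.

Lemma lspanP (R : nzRingType) (M : lmodType R) (s : seq M) m :
  lspan s m <-> exists a : nat -> R, m = \sum_(i < size s) a i *: s`_i.
Proof.
elim: s m => [|x s IH] m /=.
  by split=> [->|[a ->]]; [exists (fun=> 0)|]; rewrite big_ord0.
split=> [[a [m' [/IH[b ->] ->]]]|[a ->]].
  by exists (fun i => if i is i'.+1 then b i' else a); rewrite big_ord_recl.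
rewrite big_ord_recl; exists (a 0%N), (\sum_(i < size s) a i.+1 *: s`_i).
by split=> //; apply/IH; exists (fun i => a i.+1).
Qed.

Lemma lspan_mem (R : nzRingType) (M : lmodType R) (s : seq M) m :
  m \in s -> lspan s m.
Proof.
elim: s => [|x s IH] //=; rewrite inE => /predU1P[->|/IH h].
  by exists 1, 0; rewrite scale1r addr0; split=> //; case: (lspan_submod s).
by exists 0, m; rewrite scale0r add0r.
Qed.

Lemma lspan_min (R : nzRingType) (M : lmodType R) (P : M -> Prop) (s : seq M) :
  submod P -> (forall m, m \in s -> P m) -> forall m, lspan s m -> P m.
Proof.
move=> sP; elim: s => [|x s IH] hs m /=; first by move->; case: sP.
move=> [a [m' [hm' ->]]]; case: (sP) => _; apply; first by apply: hs; rewrite mem_head.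
by apply: IH hm' => y ys; apply: hs; rewrite inE ys orbT.
Qed.

Lemma lspan_sub (R : nzRingType) (M : lmodType R) (s t : seq M) m :
  {subset s <= t} -> lspan s m -> lspan t m.
Proof.
by move=> st; apply: lspan_min; [apply: lspan_submod|move=> x /st/lspan_mem].
Qed.

Definition fgen (R : nzRingType) (M : lmodType R) (P : M -> Prop) : Prop :=
  exists s : seq M, (forall m, m \in s -> P m) /\ (forall m, P m -> lspan s m).

Definition noetherian (R : nzRingType) : Prop :=
  forall P : R^o -> Prop, submod P -> fgen P.

(** Induction on the generators: the coefficients at [x] of the elements of [P] form an ideal [I].
    Lifts of generators of [I], together with generators of the part of [P] inside the span of [e],
    generate [P]. *)
Lemma noetherian_fgen (R : nzRingType) (M : lmodType R) (e : seq M) (P : M -> Prop) :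
  noetherian R -> submod P -> (forall m, P m -> lspan e m) -> fgen P.
Proof.
move=> nR; elim: e P => [|x e IH] P sP he.
  by exists [::]; split=> // m /he.
pose I (a : R^o) := exists m, lspan e m /\ P ((a : R) *: x + m).
have sI : submod I.
  have [l0 ll] := lspan_submod e; case: (sP) => p0 pl.
  split; first by exists 0; rewrite scale0r addr0.
  move=> a b c [m [hm Pm]] [n [hn Pn]]; exists (a *: m + n); split; first exact: ll.
  have -> : (a *: b + c : R) *: x + (a *: m + n) = a *: ((b : R) *: x + m) + ((c : R) *: x + n).
    by rewrite scalerDr !scalerA scalerDl addrACA.
  exact: pl.
have [s [hs1 hs2]] := nR I sI.
(* For [a] in [I], [w a] completes [a *: x] to an element of [P]; elsewhere it is a default. *)
have /choice[w hw] : forall a : R^o, exists m, I a -> lspan e m /\ P ((a : R) *: x + m).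
  move=> a; have [[m hm]|nI] := pselect (I a); first by exists m.
  by exists 0.
have [|m []//|t [ht1 ht2]] := IH (fun m => lspan e m /\ P m).
  split; first by split; [case: (lspan_submod e)|case: sP].
  by move=> a m n [h1 h2] [h3 h4]; split; [apply: (lspan_submod e).2|apply: sP.2].
exists ([seq (a : R) *: x + w a | a <- s] ++ t); split.
  move=> m; rewrite mem_cat => /orP[/mapP[a /hs1/hw[_ h] ->//]|/ht1[]//].
move=> m Pm; have [a [m' [hm' em]]] := he _ Pm.
have Ia : I a by exists m'; rewrite -em.
have [b hb] : exists u : M, [/\ lspan [seq (a : R) *: x + w a | a <- s] u,
    P u & lspan e (u - a *: x)].
  have := hs2 _ Ia; move: (a : R^o) => c; elim: (s) hs1 c => [|y s' IHs] hs c /=.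
    move=> ->; exists 0; rewrite scale0r subr0.
    by split=> //; [case: sP|case: (lspan_submod e)].
  move=> [f [m0 [h1 ->]]].
  have [|u [u1 u2 u3]] := IHs _ _ h1; first by move=> z zs; apply: hs; rewrite inE zs orbT.
  have [wy1 wy2] := hw y (hs y (mem_head _ _)).
  exists (f *: ((y : R) *: x + w y) + u); split.
  - by exists f, u.
  - exact: sP.2.
  - have -> : f *: ((y : R) *: x + w y) + u - ((f * (y : R) + (m0 : R)) *: x)
       = f *: w y + (u - (m0 : R) *: x).
      rewrite scalerDr scalerDl scalerA opprD addrACA; congr (_ + _).
      by rewrite addrAC subrr add0r.
    exact: (lspan_submod e).2.
have [hb1 hb2 hb3] := hb.
rewrite -(subrK b m).
apply: submodD; first exact: lspan_submod.
  apply: (@lspan_sub _ _ t); first by move=> y; rewrite mem_cat => ->; rewrite orbT.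
  apply: ht2; split; last exact: submodB.
  rewrite em; have -> : a *: x + m' - b = m' - (b - a *: x).
    by rewrite opprB addrCA addrA.
  by apply: submodB => //; apply: lspan_submod.
by apply: lspan_sub hb1 => y; rewrite mem_cat => ->.
Qed.

Lemma noetherian_field (F : fieldType) : noetherian F.
Proof.
move=> P sP; have [[a [Pa a0]]|no] := pselect (exists a : F^o, P a /\ a != 0).
  exists [:: a]; split=> [m|m _]; first by rewrite inE => /eqP->.
  exists ((m : F) / (a : F)), 0; rewrite addr0; split=> //.
  by rewrite /GRing.scale /= divfK.
exists [::]; split=> // m Pm /=.
by apply: contrapT => /eqP m0; apply: no; exists m.
Qed.

(* Hilbert's basis theorem; the polynomials of P of bounded size form a submodule
   of a finitely generated R-module, so only the leading coefficients matter. *)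
Lemma noetherian_poly (R : comNzRingType) : noetherian R -> noetherian {poly R}.
Proof.
move=> nR P sP.
pose I (a : R^o) := exists (f : {poly R}) n, [/\ P f, (size f <= n.+1)%N & f`_n = a].
have PM (h f : {poly R}) : P f -> P (h * f).
  by move=> Pf; exact: (@submodZ _ {poly R}^o P h f sP Pf).
have PD (h f : {poly R}) : P f -> P h -> P (f + h).
  by move=> Pf Ph; exact: (@submodD _ {poly R}^o P f h sP Pf Ph).
have shift (f : {poly R}) j : P f -> P ('X^j * f) by apply: PM.
have szX (f : {poly R}) j n : (size f <= n)%N -> (size ('X^j * f)%R <= j + n)%N.
  move=> h; apply: leq_trans (size_polyMleq _ _) _.
  by rewrite size_polyXn addSn /= leq_add2l.
have sI : submod I.
  split; first by exists 0, 0%N; rewrite size_poly0 coef0; split=> //; case: sP.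
  move=> a b c [f [n [Pf sf <-]]] [g [m [Pg sg <-]]].
  exists (a%:P * ('X^m * f) + 'X^n * g), (n + m)%N; split.
  - by apply: PD (shift _ _ Pg); apply: PM; apply: shift.
  - apply: leq_trans (size_polyD _ _) _; rewrite geq_max; apply/andP; split.
      rewrite mul_polyC; apply: leq_trans (size_scale_leq _ _) _.
      by apply: leq_trans (szX _ m _ sf) _; rewrite addnC addSn.
    by apply: leq_trans (szX _ n _ sg) _; rewrite addnS.
  - rewrite coefD coefCM !coefXnM !ltnNge leq_addl leq_addr /= addnK.
    by rewrite addnC addnK.
have [s [hs1 hs2]] := nR I sI.
(* The lifts of the generators of [I] are multiplied by powers of the variable until they share one
   degree [n]; every element of [I] is then the coefficient at [n] of a combination of them. *)
have [n [t [ht1 ht2 ht3]]] : exists n (t : seq {poly R}),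
   [/\ forall f, f \in t -> P f, (forall f, f \in t -> (size f <= n.+1)%N) &
     forall a, lspan s a -> exists f, [/\ lspan (t : seq {poly R}^o) f, P f,
       (size f <= n.+1)%N & f`_n = a]].
  elim: (s) hs1 => [|a s' IH] hs1.
    exists 0%N, [::]; split=> // a /= ->; exists 0; split=> //; first by case: sP.
      by rewrite size_poly0.
    by rewrite coef0.
  have [|n [t [h1 h2 h3]]] := IH.
    by move=> x xs; apply: hs1; rewrite inE xs orbT.
  have [f [m [Pf sf ef]]] := hs1 a (mem_head _ _).
  exists (n + m)%N, ('X^n * f :: [seq 'X^m * g | g <- t]); split.
  - move=> g; rewrite inE => /predU1P[->|/mapP[g' /h1 h ->]]; exact: shift.
  - move=> g; rewrite inE => /predU1P[->|/mapP[g' /h2 h ->]].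
      by apply: leq_trans (szX _ n _ sf) _; rewrite addnS.
    by apply: leq_trans (szX _ m _ h) _; rewrite addnS addnC.
  - move=> b /= [c [b' [/h3[g [g1 g2 g3 <-]] ->]]].
    have hXg : lspan ([seq 'X^m * g | g <- t] : seq {poly R}^o) ('X^m * g).
      elim: (t) g g1 {g2 g3} => [|y t' IHt] g /=; first by move->; exact: mulr0.
      move=> [u [v [/IHt hv ->]]]; exists u, ('X^m * v); split=> //.
      by rewrite /GRing.scale /= mulrDr mulrCA.
    have hle : (size ('X^m * g)%R <= (n + m).+1)%N.
      by apply: leq_trans (szX _ m _ g3) _; rewrite addnS addnC.
    exists (c%:P * ('X^n * f) + 'X^m * g); split.
    + by exists c%:P, ('X^m * g).
    + by apply: PD (shift _ _ g2); apply: PM; apply: shift.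
    + apply: leq_trans (size_polyD _ _) _; rewrite geq_max hle andbT.
      rewrite mul_polyC; apply: leq_trans (size_scale_leq _ _) _.
      by apply: leq_trans (szX _ n _ sf) _; rewrite addnS.
    + rewrite coefD coefCM !coefXnM !ltnNge leq_addl leq_addr /= addnK.
      by rewrite addnC addnK ef.
pose Pn (f : {poly R}) := P f /\ (size f <= n)%N.
have [||u [hu1 hu2]] := @noetherian_fgen R {poly R} [seq 'X^i | i <- iota 0 n] Pn nR.
- split; first by split; [case: sP|rewrite size_poly0].
  move=> a f g [Pf sf] [Pg sg]; split.
    by rewrite -mul_polyC; apply: PD Pg; apply: PM.
  apply: leq_trans (size_polyD _ _) _; rewrite geq_max sg andbT.
  exact: leq_trans (size_scale_leq _ _) sf.
- move=> f [_ sf]; have -> : f = \sum_(i <- iota 0 n) f`_i *: 'X^i.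
    rewrite -{1}(coefK f) poly_def.
    rewrite (big_ord_widen n (fun i => f`_i *: 'X^i) sf) big_mkcond /=.
    have -> : iota 0 n = index_iota 0 n by rewrite /index_iota subn0.
    rewrite big_mkord; apply: eq_bigr => i _.
    by case: ltnP => // h; rewrite nth_default // scale0r.
  have lsm : submod (lspan [seq 'X^i : {poly R} | i <- iota 0 n]) by apply: lspan_submod.
  rewrite big_seq_cond big_mkcond /=; apply: submod_sum => // i.
  case: ifP => [|_]; last by case: lsm.
  rewrite andbT => hi; apply: submodZ => //; apply: lspan_mem; exact: map_f.
exists ((t : seq {poly R}^o) ++ u); split=> [f|f Pf].
  by rewrite mem_cat => /orP[/ht1|/hu1[]].
have lS : submod (lspan ((t : seq {poly R}^o) ++ u)) by apply: lspan_submod.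
have lU (g : {poly R}) : lspan u g -> lspan ((t : seq {poly R}^o) ++ u) g.
  move=> hg; apply: (@lspan_sub _ _ (u : seq {poly R}^o)).
    by move=> y; rewrite mem_cat => ->; rewrite orbT.
  elim: (u) g hg => [|y u' IHu] g //= [a [g' [/IHu h ->]]].
  by exists a%:P, g'; split=> //; rewrite -mul_polyC.
have [m] := ubnP (size (f : {poly R})); elim: m f Pf => // m IH f Pf sf.
have [sfn|sfn] := leqP (size (f : {poly R})) n; first by apply: lU; apply: hu2.
pose d := (size (f : {poly R})).-1.
have sfd : size (f : {poly R}) = d.+1 by rewrite prednK //; apply: leq_ltn_trans sfn.
have [|g [g1 g2 g3 g4]] := ht3 (f : {poly R})`_d.
  by apply: hs2; exists f, d; rewrite sfd.
rewrite -(subrK ('X^(d - n) * g) f); apply: (submodD lS); last first.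
  apply: (@submodZ _ {poly R}^o _ 'X^(d - n) g) => //.
  by apply: lspan_sub g1 => y; rewrite mem_cat => ->.
apply: IH; first exact: (submodB sP Pf (shift _ _ g2)).
have hnd : (n <= d)%N by rewrite -ltnS -sfd.
apply: leq_trans (_ : d.+1 <= m)%N; last by rewrite -sfd -ltnS.
rewrite ltnS; apply/leq_sizeP => j; rewrite leq_eqVlt => /predU1P[<-|dj].
  by rewrite coefB coefXnM ltnNge leq_subr /= subKn // g4 subrr.
rewrite coefB [X in X - _]nth_default ?sfd // coefXnM.
case: ltnP => [|hj]; first by rewrite subr0.
rewrite [X in _ - X]nth_default ?subr0 //; apply: leq_trans g3 _.
by rewrite ltn_subRL subnK.
Qed.

End Noetherian.

(** * Graded modules up to finite dimension *)

Ltac mring := rewrite ?scalerA; congr (_ *: _); rewrite ?exprD; ring.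

Section Grading.
Context (k : closedFieldType) (p q : nat).
Local Notation coh := (coh k p q).

(** The boolean index lets both variables be treated at once, [~~ i] being the other one. *)
Definition xv (i : bool) : S k := if i then x1 else x2.
Definition ee (i : bool) : L p q := if i then e1 else e2.

Lemma Shc_xv i : Shc (ee i) (xv i) = xv i.
Proof. by case: i; [apply: Shc_x1|apply: Shc_x2]. Qed.

Lemma Shc1 : Shc (0 : L p q) (1 : S k) = 1.
Proof.
apply: S_ext => a b; rewrite coef_Shc coef1.
case: a => [|a] /=; last by rewrite !coef0 if_same.
rewrite coef1; case: b => [|b]; last by rewrite if_same.
by rewrite /mdeg !mulr0n addr0 eqxx.
Qed.

Lemma ShcX (d : L p q) (s : S k) n : Shc d s = s -> Shc (d *+ n) (s ^+ n) = s ^+ n.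
Proof.
move=> h; elim: n => [|n IH]; first by rewrite mulr0n expr0 Shc1.
by rewrite mulrSr exprS; apply: Shc_mul.
Qed.

Lemma Shc_xvX i n : Shc (ee i *+ n) (xv i ^+ n) = xv i ^+ n.
Proof. exact/ShcX/Shc_xv. Qed.

Definition homog (M : coh) (d : L p q) (m : M) : Prop := hc d m = m.

Lemma homB (M : coh) d (m n : M) : homog d m -> homog d n -> homog d (m - n).
Proof. by rewrite /homog hcB => -> ->. Qed.

Lemma homD (M : coh) d (m n : M) : homog d m -> homog d n -> homog d (m + n).
Proof. by rewrite /homog hcD => -> ->. Qed.

Lemma homN (M : coh) d (m : M) : homog d m -> homog d (- m).
Proof. by move=> h; rewrite -sub0r; apply: homB => //; apply: hc0. Qed.

Lemma hom0 (M : coh) d : homog d (0 : M). Proof. exact: hc0. Qed.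

Lemma hom_hc (M : coh) d (m : M) : homog d (hc d m).
Proof. by rewrite /homog hc_proj eqxx. Qed.

Lemma homZ (M : coh) d y s (m : M) : Shc y s = s -> homog d m -> homog (d + y) (s *: m).
Proof. by move=> hs hm; apply: hc_mul. Qed.

Lemma hom_xv (M : coh) d i n (m : M) :
  homog d m -> homog (d + ee i *+ n) (xv i ^+ n *: m).
Proof. by apply: homZ; apply: Shc_xvX. Qed.

Lemma Shc0 (d : L p q) : Shc d (0 : S k) = 0 :> S k.
Proof. by apply: S_ext => a b; rewrite coef_Shc !coef0 if_same. Qed.

Lemma ShcD (d : L p q) : {morph (Shc d : S k -> S k) : f g / f + g}.
Proof.
by move=> f g; apply: S_ext => a b; rewrite coef_Shc !coefD !coef_Shc; case: ifP; rewrite ?addr0.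
Qed.

Lemma hcZ (M : coh) d x s (m : M) : homog d m -> hc x (s *: m) = Shc (x - d) s *: m.
Proof.
move=> hm; have [t [ut es]] := Shc_sum p q s.
rewrite {1}es scaler_suml (big_morph (hc x) (hcD x) (hc0 M x)).
rewrite [in RHS]es (big_morph (Shc (x - d)) (ShcD _) (Shc0 _)) scaler_suml.
apply: eq_bigr => y _.
have hy : homog (d + y) (Shc y s *: m) by apply: homZ; rewrite ?Shc_proj ?eqxx.
rewrite -{1}hy hc_proj Shc_proj hy subr_eq [y + d]addrC.
by case: eqP => // _; rewrite scale0r.
Qed.

Lemma hom_sum (M : coh) (P : M -> Prop) (m : M) :
  submod P -> (forall d, P (hc d m)) -> P m.
Proof.
by move=> sP hP; have [s [_ ->]] := hc_sum m; apply: submod_sum.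
Qed.

Section Ev.
Context (M : coh).
Implicit Types (P Q : M -> Prop) (m n : M).

(* By noetherianity a graded subquotient P/Q is finite dimensional iff [ev Q m] for all m in P,
   so null elements are those killed in the Serre quotient. *)
Definition ev P m := exists N, forall i, P (xv i ^+ N *: m).
Definition null m := ev (fun n => n = 0) m.
(** [m] vanishes after inverting [xv i]. *)
Definition tors i m := exists N, xv i ^+ N *: m = 0.

Lemma submod0 : submod (fun m : M => m = 0).
Proof. by split=> // a m n -> ->; rewrite scaler0 addr0. Qed.

Lemma ev_leq P m N N' : submod P -> (N <= N')%N ->
  (forall i, P (xv i ^+ N *: m)) -> forall i, P (xv i ^+ N' *: m).
Proof.
move=> sP NN' h i; rewrite -(subnK NN') exprD -scalerA; exact: submodZ.
Qed.

Lemma ev_submod P : submod P -> submod (ev P).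
Proof.
move=> sP; split; first by exists 0%N => i; rewrite scaler0; case: sP.
move=> a m n [N hN] [N' hN']; exists (maxn N N') => i.
rewrite scalerDr scalerA mulrC -scalerA; apply: sP.2.
  exact: (ev_leq sP (leq_maxl _ _) hN).
exact: (ev_leq sP (leq_maxr _ _) hN').
Qed.

Lemma ev_in P m : submod P -> P m -> ev P m.
Proof. by move=> sP Pm; exists 0%N => i; rewrite expr0 scale1r. Qed.

Lemma ev_sub P Q m : (forall n, P n -> Q n) -> ev P m -> ev Q m.
Proof. by move=> PQ [N h]; exists N => i; apply: PQ. Qed.

Lemma ev_vars P m : submod P ->
  (forall i, exists N, P (xv i ^+ N *: m)) -> ev P m.
Proof.
move=> sP h; have [N1 h1] := h true; have [N2 h2] := h false.
exists (N1 + N2)%N; case; last first.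
  by rewrite exprD -scalerA; apply: submodZ.
by rewrite addnC exprD -scalerA; apply: submodZ.
Qed.

Lemma ev_xv P m : submod P ->
  (forall i, exists N, ev P (xv i ^+ N *: m)) -> ev P m.
Proof.
move=> sP h; apply: ev_vars => // i; have [N [N' /(_ i) h1]] := h i.
by exists (N' + N)%N; rewrite exprD -scalerA.
Qed.

Lemma ev_ev P m : submod P -> ev (ev P) m -> ev P m.
Proof. by move=> sP [N h]; apply: ev_xv => // i; exists N. Qed.

Lemma null_submod : submod null. Proof. exact/ev_submod/submod0. Qed.
Lemma null0 : null 0. Proof. by case: null_submod. Qed.
Lemma nullD m n : null m -> null n -> null (m + n).
Proof. exact: submodD null_submod. Qed.
Lemma nullB m n : null m -> null n -> null (m - n).
Proof. exact: submodB null_submod. Qed.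
Lemma nullZ s m : null m -> null (s *: m).
Proof. exact: submodZ null_submod. Qed.
Lemma nullN m : null m -> null (- m).
Proof. by rewrite -scaleN1r; apply: nullZ. Qed.

Lemma null_tors m : null m <-> forall i, tors i m.
Proof.
split; first by move=> [N h] i; exists N.
by apply: ev_vars submod0.
Qed.

Lemma null_xv m : (forall i, exists N, null (xv i ^+ N *: m)) -> null m.
Proof. exact: ev_xv submod0. Qed.

Lemma tors_xv i N m : tors i (xv i ^+ N *: m) -> tors i m.
Proof. by move=> [N' h]; exists (N' + N)%N; rewrite exprD -scalerA. Qed.

End Ev.

End Grading.

Arguments xv {k}.
Arguments ee {p q}.

Section GradingGroupFacts.
Context (p q : nat) (p0 : (0 < p)%N) (q0 : (0 < q)%N).

Definition lel (a b : int) : L p q := e1 *~ a + e2 *~ b.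

Lemma lel_pi a b : lel a b = \pi_(L p q) (a, b).
Proof.
rewrite /lel /e1 /e2 -!raddfMz -raddfD; congr (\pi_(L p q) _).
have E1 n : ((1, 0) : int * int) *+ n = (n%:Z, 0).
  by elim: n => // n IH; rewrite mulrS IH intS.
have E2 n : ((0, 1) : int * int) *+ n = (0, n%:Z).
  by elim: n => // n IH; rewrite mulrS IH intS.
have F1 (n : int) : ((1, 0) : int * int) *~ n = (n, 0).
  case: n => n; rewrite ?NegzE ?mulrNz -?pmulrn E1 //.
have F2 (n : int) : ((0, 1) : int * int) *~ n = (0, n).
  case: n => n; rewrite ?NegzE ?mulrNz -?pmulrn E2 //.
by rewrite F1 F2; congr pair; rewrite /= ?addr0 ?add0r.
Qed.

Lemma lel_eq a b c d :
  lel a b = lel c d <-> exists n : int, a - c = n * p%:Z /\ b - d = - (n * q%:Z).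
Proof.
rewrite !lel_pi; split.
  by move/eqP; rewrite L_eq => /asboolP[n [h1 h2]]; exists n.
move=> [n [h1 h2]]; apply/eqP; rewrite L_eq; apply/asboolP; exists n.
by congr pair.
Qed.

Lemma lel_ex d : exists a b, d = lel a b.
Proof.
by exists (repr d).1, (repr d).2; rewrite lel_pi -surjective_pairing reprK.
Qed.

Lemma mdeg_lel a b : mdeg p q a b = lel a b.
Proof. by []. Qed.

Lemma ee_lel i (n : nat) : ee i *+ n = lel (if i then n%:Z else 0) (if i then 0 else n%:Z).
Proof. by case: i; rewrite /lel /= mulr0z ?addr0 ?add0r. Qed.

(** Both generators of the grading group have infinite order because [p] and [q] are positive, so
    distinct powers of one variable have distinct degrees. *)
Lemma ee_inj i : injective (fun n => @ee p q i *+ n).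
Proof.
move=> n m /=; rewrite !ee_lel => /lel_eq[t].
case: i => [] [h1 h2].
  have /eqP : t * q%:Z = 0 by rewrite -[LHS]opprK -h2.
  rewrite mulf_eq0 => /orP[/eqP t0|/eqP[]]; last by case: q q0.
  by move: h1; rewrite t0 mul0r => /eqP; rewrite subr_eq0 => /eqP[].
have /eqP : t * p%:Z = 0 by rewrite -h1.
rewrite mulf_eq0 => /orP[/eqP t0|/eqP[]]; last by case: p p0.
by move: h2; rewrite t0 mul0r oppr0 => /eqP; rewrite subr_eq0 => /eqP[].
Qed.

End GradingGroupFacts.

(** * Finite dimensional graded subquotients *)

Section FiniteDimension.
Context (k : closedFieldType) (p q : nat) (p0 : (0 < p)%N) (q0 : (0 < q)%N).
Local Notation coh := (coh k p q).

Lemma noetherianS : noetherian (S k).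
Proof. exact/noetherian_poly/noetherian_poly/noetherian_field. Qed.

Lemma coh_fgen (M : coh) (P : M -> Prop) : submod P -> fgen P.
Proof.
move=> sP; have [e he] := fin_gen M.
by apply: (noetherian_fgen (e := e)) => //; [apply: noetherianS|move=> m _; apply/lspanP].
Qed.

Lemma poly_truncE (R : nzRingType) (h : {poly R}) N :
  h = \sum_(b < N) (h`_b)%:P * 'X^b + drop_poly N h * 'X^N.
Proof.
rewrite -{1}(poly_take_drop N h) /take_poly poly_def; congr (_ + _).
by apply: eq_bigr => b _; rewrite mul_polyC.
Qed.

Lemma poly_trunc (f : S k) N : exists f1 f2,
  f = \sum_(a < N) \sum_(b < N) (f`_a`_b)%:P%:P * (x1 ^+ a * x2 ^+ b) +
      (f1 * x1 ^+ N + f2 * x2 ^+ N).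
Proof.
exists (drop_poly N f), (\sum_(a < N) (drop_poly N f`_a)%:P * x1 ^+ a).
rewrite {1}(poly_truncE f N) addrCA [RHS]addrC; congr (_ + _).
rewrite mulr_suml -big_split /=; apply: eq_bigr => a _.
rewrite {1}(poly_truncE f`_a N) rmorphD rmorph_sum /= mulrDl mulr_suml.
congr (_ + _); last by rewrite polyCM polyC_exp mulrAC.
apply: eq_bigr => b _.
by rewrite polyCM polyC_exp -mulrA; congr (_ * _); rewrite mulrC.
Qed.

Lemma fin_dim_fin (J : finType) (M : lmodType (S k)) (P Q : M -> Prop) (e : J -> M) :
  (forall m, P m -> exists c : J -> k, Q (m - \sum_j scalk (c j) (e j))) ->
  fin_dim_quot P Q.
Proof.
move=> h; exists [seq e j | j <- enum J] => m /h[c hc].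
have [|] := pselect (exists j : J, True); last first.
  move=> nJ; exists (fun=> 0).
  have E : enum J = [::].
    by case E: (enum J) => [|j l] //; case: nJ; exists j.
  move: hc; rewrite E /= big_ord0 big1 // => j; by case: nJ; exists j.
move=> [j0 _]; exists (fun i => c (nth j0 (enum J) i)); rewrite size_map.
suff -> : \sum_(i < size (enum J)) scalk (c (nth j0 (enum J) i)) [seq e j | j <- enum J]`_i
   = \sum_j scalk (c j) (e j) by [].
rewrite -[RHS]big_enum /= (big_nth j0) big_mkord; apply: eq_bigr => i _.
by rewrite (nth_map j0).
Qed.

(** One exponent [N] serves for the finitely many generators of [P]; modulo the [N]-th powers of
    both variables only [N * N] monomial multiples of each generator remain. *)
Lemma fin_dim_ev (M : coh) (P Q : M -> Prop) : submod P -> submod Q ->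
  (forall m, P m -> ev Q m) -> fin_dim_quot P Q.
Proof.
move=> sP sQ h; have [s [hs1 hs2]] := coh_fgen sP.
have [N hN] : exists N, forall m, m \in s -> forall i, Q (xv i ^+ N *: m).
  elim: (s) hs1 => [|x s' IH] hs1; first by exists 0%N.
  have [|N hN] := IH; first by move=> m ms; apply: hs1; rewrite inE ms orbT.
  have [N' hN'] := h x (hs1 _ (mem_head _ _)).
  exists (maxn N N') => m; rewrite inE => /predU1P[->|/hN].
    exact: (ev_leq sQ (leq_maxr _ _) hN').
  exact: (ev_leq sQ (leq_maxl _ _)).
pose e (j : 'I_(size s) * ('I_N * 'I_N)) := (x1 ^+ j.2.1 * x2 ^+ j.2.2) *: s`_j.1.
apply: (@fin_dim_fin _ _ _ _ e) => m /hs2/lspanP[a ->].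
exists (fun j : 'I_(size s) * ('I_N * 'I_N) => (a j.1)`_j.2.1`_j.2.2).
rewrite -(pair_bigA _ (fun (i : 'I_(size s)) (j : 'I_N * 'I_N) => scalk (a i)`_j.1`_j.2 (e (i, j)))) /=.
rewrite -sumrB; apply: submod_sum => // i.
have [f1 [f2 E]] := poly_trunc (a i) N.
rewrite -(pair_bigA _ (fun (u v : 'I_N) => scalk (a i)`_u`_v (e (i, (u, v))))) /=.
set T := \sum_(u < N) _.
have -> : a i *: s`_i = T + (f1 * x1 ^+ N + f2 * x2 ^+ N) *: s`_i.
  rewrite {1}E [LHS]scalerDl; congr (_ + _); rewrite scaler_suml.
  apply: eq_bigr => u _; rewrite scaler_suml; apply: eq_bigr => v _.
  by rewrite /scalk /e scalerA.
rewrite addrAC subrr add0r scalerDl -!scalerA.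
have hi := hN s`_i (mem_nth 0 (ltn_ord i)).
by apply: submodD => //; apply: submodZ => //; [apply: (hi true)|apply: (hi false)].
Qed.

(** For [n] homogeneous, the first [r + 1] powers of a variable applied to [n] are linearly
    dependent modulo [Q], where [r] bounds the dimension. Their degrees are distinct, so the grading
    of [Q] isolates one term of the relation. *)
Lemma ev_fin_dim (M : coh) (P Q : M -> Prop) : submod P -> submod Q ->
  (forall d m, P m -> P (hc d m)) -> (forall d m, Q m -> Q (hc d m)) ->
  fin_dim_quot P Q -> forall m, P m -> ev Q m.
Proof.
move=> sP sQ gP gQ [e he] m Pm.
suff H d n : P n -> homog d n -> ev Q n.
  have [s [_ es]] := hc_sum m; rewrite es; apply: submod_sum; first exact: ev_submod.
  by move=> d; apply: (H d); [apply: gP|apply: hom_hc].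
move=> {m Pm} Pn hn; apply: ev_vars => // i.
pose r := size e.
have /choice[c hcE] : forall a : nat, exists c : nat -> k,
    Q (xv i ^+ a *: n - \sum_(j < r) scalk (c j) e`_j).
  by move=> a; apply: he; apply: submodZ.
pose A := \matrix_(a < r.+1, j < r) c a j.
(* [A] has one more row than columns; a kernel vector is the linear relation. *)
have : kermx A != 0.
  rewrite kermx_eq0 /row_free neq_ltn; apply/orP; left.
  by rewrite ltnS; apply: rank_leq_col.
case/matrix0Pn => u [v kuv].
have kA : row u (kermx A) *m A = 0 by rewrite -row_mul mulmx_ker linear0.
pose w : 'rV[k]_r.+1 := row u (kermx A).
have wv : w 0 v != 0 by rewrite mxE.
have Qs : Q (\sum_(a < r.+1) scalk (w 0 a) (xv i ^+ a *: n)).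
  have -> : \sum_(a < r.+1) scalk (w 0 a) (xv i ^+ a *: n) =
    \sum_(a < r.+1) scalk (w 0 a) (xv i ^+ a *: n - \sum_(j < r) scalk (c a j) e`_j).
    rewrite [RHS](eq_bigr (fun a : 'I_r.+1 => scalk (w 0 a) (xv i ^+ a *: n) -
       scalk (w 0 a) (\sum_(j < r) scalk (c a j) e`_j))); last first.
      by move=> a _; rewrite /scalk scalerBr.
    rewrite sumrB -[LHS]subr0; congr (_ - _); apply/esym.
    rewrite (eq_bigr (fun a : 'I_r.+1 => \sum_(j < r) scalk (w 0 a * c a j) e`_j)); last first.
      by move=> a _; rewrite scalk_sum.
    rewrite exchange_big /= big1 // => j _.
    have := kA; move=> /matrixP/(_ 0 j); rewrite !mxE => h.
    rewrite (_ : \sum_(a < r.+1) _ = scalk (\sum_(a < r.+1) w 0 a * A a j) e`_j).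
      by rewrite h /scalk !polyC0 scale0r.
    rewrite /scalk !(big_morph polyC (@polyCD _) (erefl _)) scaler_suml.
    by apply: eq_bigr => a _; rewrite !mxE.
  by apply: submod_sum => // a; apply: submodZ.
exists v; have := gQ (d + ee i *+ v) _ Qs.
rewrite (big_morph _ (hcD _) (hc0 M _)) (bigD1 v) //= big1 ?addr0.
  have hs : Shc (0 : L p q) ((w 0 v)%:P%:P : S k) = (w 0 v)%:P%:P.
    apply: S_ext => a b; rewrite coef_Shc coefC; case: a => [|a] /=; last by rewrite !coef0 if_same.
    rewrite coefC; case: b => [|b] /=; last by rewrite if_same.
    by rewrite /mdeg !mulr0n addr0 eqxx.
  rewrite /scalk (hcZ _ _ (hom_xv i v hn)).
  rewrite subrr hs => h.
  have := submodZ ((w 0 v)^-1%:P%:P) sQ h.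
  rewrite -/(scalk (w 0 v) _) -/(scalk _ _) scalkA mulVf //.
  by rewrite /scalk !polyC1 scale1r.
move=> a av; rewrite /scalk scalerA.
have ha : homog (d + ee i *+ a) (xv i ^+ a *: n) by apply: hom_xv.
have hs : Shc (0 : L p q) ((w 0 a)%:P%:P : S k) = (w 0 a)%:P%:P.
  apply: S_ext => a' b; rewrite coef_Shc coefC; case: a' => [|a'] /=; last by rewrite !coef0 if_same.
  rewrite coefC; case: b => [|b] /=; last by rewrite if_same.
  by rewrite /mdeg !mulr0n addr0 eqxx.
rewrite -scalerA -[_ *: (_ *: n)](homZ hs ha) hc_proj addr0 (inj_eq (addrI d)).
by case: eqP => // /(ee_inj p0 q0)/val_inj av'; rewrite av' eqxx in av.
Qed.

End FiniteDimension.

(** * Morphisms in the Serre quotient *)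

Section QuotientObject.
Context (k : closedFieldType) (p q : nat).
Local Notation coh := (coh k p q).

Record gsub (M : coh) := GSub {
  gs :> M -> Prop;
  gs_submod : submod gs;
  gs_hc : forall d m, gs m -> gs (hc d m)
}.

Context (M : coh) (Q : gsub M).

Definition gpred : {pred M} := fun m => `[< Q m >].

Lemma gpred_closed : zmod_closed gpred.
Proof.
split; first by apply/asboolP; case: (gs_submod Q).
by move=> m n /asboolP hm /asboolP hn; apply/asboolP; apply: submodB (gs_submod Q) hm hn.
Qed.

HB.instance Definition _ := GRing.isZmodClosed.Build _ gpred gpred_closed.

Definition qmod : Type := Quotient.quot gpred.
HB.instance Definition _ := GRing.Zmodule.on qmod.

Definition qpi (m : M) : qmod := \pi_(Quotient.quot gpred) m.
Definition qrepr (u : qmod) : M := repr (u : Quotient.quot gpred).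

Lemma qpiE m n : qpi m = qpi n <-> Q (m - n).
Proof.
have E : (qpi m == qpi n) = (m - n \in gpred) by rewrite -Quotient.idealrBE.
by split=> [/eqP|h]; [rewrite E => /asboolP|apply/eqP; rewrite E; apply/asboolP].
Qed.

Lemma qpiB : {morph qpi : m n / m - n}.
Proof. exact: (raddfB \pi_(Quotient.quot gpred)). Qed.
Lemma qpiD : {morph qpi : m n / m + n}.
Proof. exact: (raddfD \pi_(Quotient.quot gpred)). Qed.
Lemma qpi0 : qpi 0 = 0. Proof. exact: (raddf0 \pi_(Quotient.quot gpred)). Qed.
Lemma qpi_repr u : qpi (qrepr u) = u. Proof. exact: reprK. Qed.

Definition qscale (a : S k) (u : qmod) : qmod := qpi (a *: qrepr u).

Lemma qscale_pi a m : qscale a (qpi m) = qpi (a *: m).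
Proof.
apply/qpiE; rewrite -scalerBr; apply: submodZ (gs_submod Q) _.
by apply/qpiE; rewrite qpi_repr.
Qed.

Lemma qscaleA a b u : qscale a (qscale b u) = qscale (a * b) u.
Proof. by rewrite -[u]qpi_repr !qscale_pi scalerA. Qed.

Lemma qscale1 : left_id 1 qscale.
Proof. by move=> u; rewrite -[u]qpi_repr !qscale_pi scale1r. Qed.

Lemma qscaleDr : right_distributive qscale +%R.
Proof.
by move=> a u v; rewrite -[u]qpi_repr -[v]qpi_repr -qpiD !qscale_pi scalerDr qpiD.
Qed.

Lemma qscaleDl u : {morph qscale^~ u : a b / a + b}.
Proof. by move=> a b; rewrite -[u]qpi_repr !qscale_pi scalerDl qpiD. Qed.

HB.instance Definition _ := GRing.Zmodule_isLmodule.Build (S k) qmod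
  qscaleA qscale1 qscaleDr qscaleDl.

Lemma qpiZ a m : qpi (a *: m) = a *: qpi m.
Proof. by rewrite -[LHS]qscale_pi. Qed.

Definition qmod_hc (d : L p q) (u : qmod) : qmod := qpi (hc d (qrepr u)).

Lemma qmod_hc_pi d m : qmod_hc d (qpi m) = qpi (hc d m).
Proof.
by apply/qpiE; rewrite -hcB; apply: gs_hc; apply/qpiE; rewrite qpi_repr.
Qed.

Fact qmod_hcB x : {morph qmod_hc x : m n / m - n}.
Proof.
by move=> u v; rewrite -[u]qpi_repr -[v]qpi_repr -qpiB !qmod_hc_pi hcB qpiB.
Qed.

Fact qmod_hc_proj x y m : qmod_hc x (qmod_hc y m) = if x == y then qmod_hc y m else 0.
Proof.
rewrite -[m]qpi_repr !qmod_hc_pi hc_proj; case: eqP => // _.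
exact: qpi0.
Qed.

Fact qmod_hc_sum m : exists s : seq (L p q), uniq s /\ m = \sum_(x <- s) qmod_hc x m.
Proof.
have [s [us es]] := hc_sum (qrepr m); exists s; split=> //.
rewrite -[m]qpi_repr {1}es (big_morph qpi qpiD qpi0).
by apply: eq_bigr => x _; rewrite qmod_hc_pi.
Qed.

Fact qmod_hc_mul x y s m :
  Shc y s = s -> qmod_hc x m = m -> qmod_hc (x + y) (s *: m) = s *: m.
Proof.
move=> hs hm; have -> : m = qpi (hc x (qrepr m)) by rewrite -[LHS]hm.
rewrite -qpiZ qmod_hc_pi; congr qpi.
by apply: hc_mul; rewrite ?hc_proj ?eqxx.
Qed.

Fact qmod_fin_gen : exists e : seq qmod, forall m, exists a : nat -> S k,
    m = \sum_(i < size e) a i *: e`_i.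
Proof.
have [e he] := fin_gen M; exists [seq qpi m | m <- e] => m.
have [a ea] := he (qrepr m); exists a.
rewrite -{1}[m]qpi_repr ea (big_morph qpi qpiD qpi0) size_map.
by apply: eq_bigr => i _; rewrite qpiZ (nth_map 0).
Qed.

Definition Quot : coh :=
  @Coh k p q qmod qmod_hc qmod_hcB qmod_hc_proj qmod_hc_sum qmod_hc_mul qmod_fin_gen.

Definition cpi (m : M) : Quot := qpi m.

Lemma cpiE m n : cpi m = cpi n <-> Q (m - n). Proof. exact: qpiE. Qed.
Lemma cpi0 : cpi 0 = 0. Proof. exact: qpi0. Qed.
Lemma cpi_eq0 m : cpi m = 0 <-> Q m. Proof. by rewrite -cpi0 cpiE subr0. Qed.
Lemma cpiD : {morph cpi : m n / m + n}. Proof. exact: qpiD. Qed.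
Lemma cpiZ a m : cpi (a *: m) = a *: cpi m. Proof. exact: qpiZ. Qed.
Lemma cpi_hc d m : cpi (hc d m) = hc d (cpi m). Proof. exact/esym/qmod_hc_pi. Qed.
Lemma cpi_surj (u : Quot) : exists m, u = cpi m.
Proof. by exists (qrepr u); rewrite /cpi qpi_repr. Qed.

End QuotientObject.

Section Calculus.
Context (k : closedFieldType) (p q : nat) (p0 : (0 < p)%N) (q0 : (0 < q)%N).
Local Notation coh := (coh k p q).

Lemma hcXg (M : coh) d y s (m : M) : Shc y s = s -> hc (d + y) (s *: m) = s *: hc d m.
Proof.
move=> hs; have [t [_ et]] := hc_sum m.
rewrite {1}et scaler_sumr (big_morph _ (hcD _) (hc0 M _)).
rewrite [in RHS]et (big_morph _ (hcD _) (hc0 M _)) scaler_sumr.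
apply: eq_bigr => x _.
rewrite -[s *: _](homZ hs (hom_hc x m)) hc_proj (inj_eq (addIr y)) hc_proj.
by case: eqP => // _; rewrite ?(homZ hs (hom_hc x m)) // scaler0.
Qed.

Lemma hcX (M : coh) d i N (m : M) :
  hc (d + ee i *+ N) (xv i ^+ N *: m) = xv i ^+ N *: hc d m.
Proof. exact/hcXg/Shc_xvX. Qed.

Lemma ev_hc (M : coh) (P : M -> Prop) d m :
  (forall d m, P m -> P (hc d m)) -> ev P m -> ev P (hc d m).
Proof. by move=> gP [N h]; exists N => i; rewrite -hcX; apply: gP. Qed.

Lemma null_hc (M : coh) d (m : M) : null m -> null (hc d m).
Proof. by apply: ev_hc => {}d n ->; apply: hc0. Qed.

Lemma null_sum (M : coh) (m : M) : (forall d, null (hc d m)) -> null m.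
Proof. exact: hom_sum (@null_submod _ _ _ M). Qed.

Section Graph.
Context (M N : coh) (f : qhom M N).

Lemma graphZ s m n : f m n -> f (s *: m) (s *: n).
Proof. by move=> h; have := graph_lin s h (graph0 f); rewrite !addr0. Qed.

Lemma graphD m n m' n' : f m n -> f m' n' -> f (m + m') (n + n').
Proof. by move=> h h'; have := graph_lin 1 h h'; rewrite !scale1r. Qed.

Definition dom m := exists n, f m n.
Definition ran n := exists m, f m n.

Lemma dom_submod : submod dom.
Proof.
split; first by exists 0; apply: graph0.
by move=> a m m' [n h] [n' h']; exists (a *: n + n'); apply: graph_lin.
Qed.

Lemma ran_submod : submod ran.
Proof.
split; first by exists 0; apply: graph0.
by move=> a m m' [n h] [n' h']; exists (a *: n + n'); apply: graph_lin.
Qed.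

Lemma qdom m : ev dom m.
Proof.
apply: (ev_fin_dim p0 q0 _ dom_submod _ _ (graph_dom f)) => //.
by move=> d {}m [n h]; exists (hc d n); apply: graph_hc.
Qed.

Lemma qind n : f 0 n -> null n.
Proof.
apply: (ev_fin_dim p0 q0 _ (@submod0 _ _ _ N) _ _ (graph_ind f)) => //.
- split; first exact: graph0.
  by move=> a m m' h h'; have := graph_lin a h h'; rewrite scaler0 addr0.
- by move=> d m h; rewrite -(hc0 M d); apply: graph_hc.
- by move=> d m ->; apply: hc0.
Qed.

Lemma qval m n n' : f m n -> f m n' -> null (n - n').
Proof. by move=> h h'; apply: qind; rewrite -(subrr m); apply: graph_sub. Qed.

Lemma qnull m n : f m n -> null m -> null n.
Proof.
move=> h [a ha]; apply: null_xv => i; exists a; apply: qind.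
by rewrite -(ha i); apply: graphZ.
Qed.

Lemma qnull2 m m' n n' : f m n -> f m' n' -> null (m - m') -> null (n - n').
Proof. by move=> h h'; apply: qnull; apply: graph_sub. Qed.

End Graph.

Lemma ev_and (M : coh) (P Q : M -> Prop) m : submod P -> submod Q ->
  ev P m -> ev Q m -> ev (fun m => P m /\ Q m) m.
Proof.
move=> sP sQ [a ha] [b hb]; exists (maxn a b) => i; split.
  exact: (ev_leq sP (leq_maxl _ _) ha).
exact: (ev_leq sQ (leq_maxr _ _) hb).
Qed.

(** The axioms of [qhom] with both finite dimensionality conditions in elementwise form; [mkq] makes
    a morphism of such a relation. *)
Record qrel (M N : coh) (r : M -> N -> Prop) : Prop := QRel {
  qr0 : r 0 0;
  qr_lin : forall s m n m' n', r m n -> r m' n' -> r (s *: m + m') (s *: n + n');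
  qr_hc : forall x m n, r m n -> r (hc x m) (hc x n);
  qr_dom : forall m, ev (fun m => exists n, r m n) m;
  qr_ind : forall n, r 0 n -> null n
}.

Definition mkq (M N : coh) (r : M -> N -> Prop) (h : qrel r) : qhom M N.
Proof.
refine (@QHom k p q M N r (qr0 h) (qr_lin h) (qr_hc h) _ _).
- apply: fin_dim_ev => //; last by move=> m _; apply: qr_dom.
  split; first by exists 0; apply: qr0.
  by move=> a m m' [n hn] [n' hn']; exists (a *: n + n'); apply: qr_lin.
- apply: fin_dim_ev; [|exact: submod0|by move=> n; apply: (qr_ind h)].
  split; first exact: qr0.
  by move=> a m n hm hn; have := qr_lin h a hm hn; rewrite scaler0 addr0.
Defined.

(** The differences of values form a graded submodule, which is finite dimensional iff its elements
    are null. *)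
Lemma qeqP (M N : coh) (f g : qhom M N) :
  qeq f g <-> forall m n n', f m n -> g m n' -> null (n - n').
Proof.
have sD : submod (fun d : N => exists m n n', [/\ f m n, g m n' & d = n - n']).
  split; first by exists 0, 0, 0; rewrite subrr; split=> //; apply: graph0.
  move=> a _ _ [m [n [n' [h1 h2 ->]]]] [m1 [n1 [n1' [h3 h4 ->]]]].
  exists (a *: m + m1), (a *: n + n1), (a *: n' + n1').
  split; [exact: graph_lin|exact: graph_lin|].
  by rewrite scalerBr opprD addrACA.
split=> [h m n n' hf hg|h].
  apply: (ev_fin_dim p0 q0 sD (@submod0 _ _ _ N) _ _ h).
  - move=> d _ [m1 [n1 [n1' [h1 h2 ->]]]]; exists (hc d m1), (hc d n1), (hc d n1').
    by split; [apply: graph_hc|apply: graph_hc|rewrite hcB].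
  - by move=> d _ ->; apply: hc0.
  - by exists m, n, n'.
apply: fin_dim_ev => //; first exact: submod0.
by move=> _ [m [n [n' [h1 h2 ->]]]]; apply: h h1 h2.
Qed.

Lemma qeq_ev (M N : coh) (f g : qhom M N) :
  (forall m, ev (fun m => exists n n', [/\ f m n, g m n' & null (n - n')]) m) -> qeq f g.
Proof.
move=> h; apply/qeqP => m n n' hf hg; have [a ha] := h m.
apply: null_xv => i; exists a; have [l [l' [h1 h2 h3]]] := ha i.
have e1 := qval (graphZ (xv i ^+ a) hf) h1.
have e2 := qval (graphZ (xv i ^+ a) hg) h2.
rewrite scalerBr (_ : _ - _ = (xv i ^+ a *: n - l) - (xv i ^+ a *: n' - l') + (l - l')).
  exact: nullD (nullB e1 e2) h3.
by rewrite opprB -addrA [X in _ = _ + X]addrC !subrKA.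
Qed.

Lemma qeq_refl (M N : coh) (f : qhom M N) : qeq f f.
Proof. by apply/qeqP => m n n'; apply: qval. Qed.

Lemma qeq_sym (M N : coh) (f g : qhom M N) : qeq f g -> qeq g f.
Proof.
by move=> /qeqP h; apply/qeqP => m n n' h1 h2; rewrite -opprB; apply: nullN; apply: h h2 h1.
Qed.

Lemma qeq_trans (M N : coh) (f g h : qhom M N) : qeq f g -> qeq g h -> qeq f h.
Proof.
move=> /qeqP h1 /qeqP h2; apply/qeqP => m n n' hf hh.
have [a ha] := qdom g m; apply: null_xv => i; exists a.
have [l hl] := ha i; rewrite scalerBr -(subrKA l).
by apply: nullD; [apply: h1 (graphZ _ hf) hl|apply: h2 hl (graphZ _ hh)].
Qed.

Lemma qcomp_congr (M N P : coh) (f f' : qhom M N) (g g' : qhom N P) :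
  qeq f f' -> qeq g g' -> qeq (qcomp g f) (qcomp g' f').
Proof.
move=> /qeqP h1 /qeqP h2; apply/qeqP => m n n' [l [a1 a2]] [l' [b1 b2]].
have hl := h1 _ _ _ a1 b1.
have [a ha] := qdom g' l; apply: null_xv => i; exists a.
have [z hz] := ha i; rewrite scalerBr -(subrKA z); apply: nullD.
  exact: h2 (graphZ _ a2) hz.
by apply: qnull2 hz (graphZ _ b2) _; rewrite -scalerBr; apply: nullZ.
Qed.

Lemma qcompA (M N P R : coh) (f : qhom M N) (g : qhom N P) (h : qhom P R) :
  qeq (qcomp h (qcomp g f)) (qcomp (qcomp h g) f).
Proof.
apply/qeqP => m n n' [l [[z [a1 a2]] a3]] [l' [b1 [z' [b2 b3]]]].
exact: qnull2 a3 b3 (qnull2 a2 b2 (qval a1 b1)).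
Qed.

Lemma qcomp_idl (M N : coh) (f : qhom M N) : qeq (qcomp (qid N) f) f.
Proof. by apply/qeqP => m n n' [l [a1 ->]]; apply: qval. Qed.

Lemma qcomp_idr (M N : coh) (f : qhom M N) : qeq (qcomp f (qid M)) f.
Proof. by apply/qeqP => m n n' [l [-> a1]]; apply: qval. Qed.

Lemma qeq0P (M N : coh) (f : qhom M N) :
  qeq f (qzero M N) <-> forall m n, f m n -> null n.
Proof.
split=> [/qeqP h m n hf|h]; first by rewrite -[n]subr0; apply: h hf _.
by apply/qeqP => m n _ hf ->; rewrite subr0; apply: h hf.
Qed.

Lemma is_zeroP (M : coh) : is_zero M <-> forall m : M, null m.
Proof. by split=> [/qeq0P h m|h]; [apply: h (erefl m)|apply/qeq0P => m n _; apply: h]. Qed.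

(** With [sur], the elementwise counterparts of [mono] and [epi]: injectivity and surjectivity up to
    null elements. *)
Definition inj (M N : coh) (f : qhom M N) : Prop := forall m n, f m n -> null n -> null m.
Definition sur (M N : coh) (f : qhom M N) : Prop := forall n, ev (ran f) n.

Lemma qinv_rel (M N : coh) (f : qhom M N) : inj f -> sur f -> qrel (fun n m => f m n).
Proof.
move=> jf sf; split.
- exact: graph0.
- by move=> *; apply: graph_lin.
- by move=> *; apply: graph_hc.
- exact: sf.
- by move=> m h; apply: jf h (null0 N).
Qed.

(** The inverse morphism has the transposed graph. *)
Lemma is_isoP (M N : coh) (f : qhom M N) : is_iso f <-> inj f /\ sur f.
Proof.
split=> [[g [/qeqP h1 /qeqP h2]]|[jf sf]].
  split=> [m n hf hn|n].
    have [a ha] := qdom g n; apply: null_xv => i; exists a.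
    have [l hl] := ha i; have := h1 (xv i ^+ a *: m) l _ _ (erefl _).
    move=> /(_ (ex_intro _ _ (conj (graphZ _ hf) hl))) h.
    rewrite -(subKr l (xv i ^+ a *: m)); apply: nullB => //.
    by apply: qnull hl _; apply: nullZ.
  apply: ev_vars => [|i]; first exact: ran_submod.
  have [a /(_ i)[m [l [hg hf]]]] := qdom (qcomp f g) n.
  have [b /(_ i)] := h2 _ _ _ (ex_intro _ _ (conj hg hf)) (erefl _).
  rewrite scalerBr => /eqP; rewrite subr_eq0 scalerA -exprD => /eqP e.
  by exists (b + a)%N, (xv i ^+ b *: l); rewrite -e; apply: graphZ.
exists (mkq (qinv_rel jf sf)); split; apply/qeqP.
  move=> m n _ [l [a1 /= a2]] ->; rewrite -opprB; apply: nullN.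
  apply: jf _ (null0 N); rewrite -(subrr l); exact: graph_sub.
move=> m n _ [l [/= a1 a2]] ->; exact: qval a2 a1.
Qed.

Lemma iso_refl (M : coh) : iso M M.
Proof.
exists (qid M); apply/is_isoP; split=> [m n -> //|n].
by apply: ev_in; [apply: ran_submod|exists n].
Qed.

Lemma iso_sym (M N : coh) : iso M N -> iso N M.
Proof. by move=> [f [g [h1 h2]]]; exists g, f. Qed.

Lemma qcomp_inj (M N P : coh) (f : qhom M N) (g : qhom N P) :
  inj f -> inj g -> inj (qcomp g f).
Proof. by move=> jf jg m n [l [a1 a2]] hn; apply: jf a1 (jg _ _ a2 hn). Qed.

Lemma qcomp_sur (M N P : coh) (f : qhom M N) (g : qhom N P) :
  sur f -> sur g -> sur (qcomp g f).
Proof.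
move=> sf sg n; apply: ev_vars; first exact: ran_submod.
move=> i; have [a /(_ i)[l hl]] := sg n; have [b /(_ i)[m hm]] := sf l.
exists (b + a)%N, m, (xv i ^+ b *: l); split=> //.
by rewrite exprD -scalerA; apply: graphZ.
Qed.

Lemma iso_trans (M N P : coh) : iso M N -> iso N P -> iso M P.
Proof.
move=> [f /is_isoP[jf sf]] [g /is_isoP[jg sg]]; exists (qcomp g f); apply/is_isoP.
by split; [apply: qcomp_inj|apply: qcomp_sur].
Qed.

Lemma is_zero_iso (M N : coh) : iso M N -> is_zero M -> is_zero N.
Proof.
move=> [f /is_isoP[_ sf]] /is_zeroP h; apply/is_zeroP => n.
have [a ha] := sf n; apply: null_xv => i; exists a; have [m hm] := ha i.
exact: qnull hm (h m).
Qed.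

Definition gfun (M N : coh) (f : M -> N) : Prop :=
  [/\ forall m n, f (m + n) = f m + f n, forall s m, f (s *: m) = s *: f m &
      forall d m, f (hc d m) = hc d (f m)].

Lemma gfun_rel (M N : coh) (f : M -> N) : gfun f -> qrel (fun m n => n = f m).
Proof.
move=> [fD fZ fh].
have f0 : f 0 = 0 by rewrite -(scale0r (0 : M)) fZ scale0r.
split=> //.
- by move=> s m n m' n' -> ->; rewrite fD fZ.
- by move=> x m n ->.
- move=> m; exists 0%N => i; by eexists.
- by move=> n ->; rewrite f0; apply: null0.
Qed.

Definition qfun (M N : coh) (f : M -> N) (h : gfun f) : qhom M N := mkq (gfun_rel h).

Lemma hom_O (d y : L p q) (f : O k d) : hc y f = Shc (d + y) (f : S k).
Proof. by []. Qed.

(** Yoneda for line bundles: homogeneous elements of degree [d] are maps from O(-d). *)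
Lemma gfun_elt (M : coh) d (m : M) : homog d m -> @gfun (O k (- d)) M (fun s : S k => s *: m).
Proof.
move=> hm; split=> [s t|s t|y s].
- by rewrite scalerDl.
- by rewrite scalerA.
- by rewrite hom_O (hcZ _ _ hm) addrC.
Qed.

(** A monomorphism is tested on the maps from line bundles given by the homogeneous components of an
    element. *)
Lemma mono_injP (M N : coh) (f : qhom M N) : mono f <-> inj f.
Proof.
split=> [mf m n hf hn|jf Z g h /qeqP e].
  apply: null_sum => d; pose g := qfun (gfun_elt (hom_hc d m)).
  have hd := graph_hc d hf.
  have /mf/qeqP e : qeq (qcomp f g) (qcomp f (qzero _ _)).
    apply/qeqP => s l l' [u [-> hu]] [_ [-> hv]].
    apply: nullB; last exact: qind hv.
    rewrite -(subrK (s *: hc d n) l); apply: nullD.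
      exact: qval hu (graphZ s hd).
    exact/nullZ/null_hc.
  have := e (1 : S k) (hc d m) 0; rewrite subr0; apply=> //.
  by rewrite /= scale1r.
apply/qeqP => z m m' hg hh.
have [a ha] := ev_and (dom_submod f) (dom_submod f) (qdom f m) (qdom f m).
have [b hb] := qdom f m'.
apply: null_xv => i; exists (b + a)%N; rewrite scalerBr.
have [[n hn] _] := ha i; have [n' hn'] := hb i.
have h1 := graphZ (xv i ^+ b) hn; have h2 := graphZ (xv i ^+ a) hn'.
rewrite !scalerA -!exprD [(a + b)%N]addnC in h1 h2.
apply: jf; first exact: graph_sub h1 h2.
apply: e; [exists (xv i ^+ (b + a) *: m)|exists (xv i ^+ (b + a) *: m')]; split=> //.
  exact: (graphZ _ hg).
exact: (graphZ _ hh).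
Qed.

Definition ran_gsub (M N : coh) (f : qhom M N) : gsub N.
Proof.
refine (@GSub k p q N (ran f) (ran_submod f) _).
by move=> d n [m h]; exists (hc d m); apply: graph_hc.
Defined.

Lemma gfun_cpi (M : coh) (Q : gsub M) : gfun (@cpi k p q M Q).
Proof. by split=> *; [apply: cpiD|apply: cpiZ|apply: cpi_hc]. Qed.

(** An epimorphism is tested on the projection of [N] modulo the range of [f]. *)
Lemma epi_sur (M N : coh) (f : qhom M N) : epi f <-> sur f.
Proof.
split=> [ef n|sf Z g h /qeqP e].
  pose g := qfun (gfun_cpi (ran_gsub f)).
  have /ef/qeqP e : qeq (qcomp g f) (qcomp (qzero _ _) f).
    apply/qeqP => m u u' [l [h1 h2]] [l' [h3 h4]]; rewrite h2 h4 subr0.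
    suff -> : cpi (ran_gsub f) l = 0 by apply: null0.
    by apply/cpi_eq0; exists m.
  have [a ha] := e n (cpi _ n) 0 (erefl _) (erefl _).
  exists a => i; have := ha i; rewrite subr0 -cpiZ => /cpi_eq0 //.
apply/qeqP => n z z' hg hh; have [a ha] := sf n.
apply: null_xv => i; exists a; have [m hm] := ha i; rewrite scalerBr.
apply: (e m); [exists (xv i ^+ a *: n)|exists (xv i ^+ a *: n)]; split=> //; exact: graphZ.
Qed.

(** The projection of [N] modulo the range of [f] factors through [c], so what [c] kills dies in
    that quotient. *)
Lemma cokernel_ran (M N C : coh) (c : qhom N C) (f : qhom M N) n l :
  is_cokernel c f -> c n l -> null l -> ev (ran f) n.
Proof.
move=> [_ _ uc] hc hl; pose g := qfun (gfun_cpi (ran_gsub f)).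
have [|h /qeqP eh] := uc _ g.
  apply/qeq0P => m u [l' [h1 h2]]; rewrite h2.
  suff -> : cpi (ran_gsub f) l' = 0 by apply: null0.
  by apply/cpi_eq0; exists m.
have [a ha] := qdom h l; apply: ev_xv; first exact: ran_submod.
move=> i; exists a; have [z hz] := ha i.
have e := eh (xv i ^+ a *: n) z (cpi _ (xv i ^+ a *: n)).
have {e} [|//|b hb] := e; first by exists (xv i ^+ a *: l); split=> //; apply: graphZ.
have [b' hb'] : null (cpi (ran_gsub f) (xv i ^+ a *: n)).
  rewrite -(subKr z (cpi _ _)); apply: nullB; last by exists b.
  by apply: qnull hz _; apply: nullZ.
by exists b' => j; have := hb' j; rewrite -cpiZ => /cpi_eq0.
Qed.

Lemma cokernel_sur (M N C : coh) (c : qhom N C) (f : qhom M N) :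
  is_cokernel c f -> sur c.
Proof. by case=> _ /epi_sur. Qed.

Definition exact2 (M N C : coh) (f : qhom M N) (c : qhom N C) : Prop :=
  (forall m n l, f m n -> c n l -> null l) /\
  (forall n l, c n l -> null l -> ev (ran f) n).

Lemma exact_cokernel (M N C : coh) (f : qhom M N) (c : qhom N C) :
  exact2 f c -> sur c -> is_cokernel c f.
Proof.
move=> [h1 h2] sc; split; last first.
- move=> Z g /qeq0P eg.
  have hr : qrel (fun (l : C) (z : Z) => exists n, c n l /\ g n z).
    split.
    - by exists 0; split; apply: graph0.
    - by move=> s m n m' n' [l [a1 a2]] [l' [a3 a4]]; exists (s *: l + l'); split; apply: graph_lin.
    - by move=> x m n [l [a1 a2]]; exists (hc x l); split; apply: graph_hc.
    - move=> l; apply: ev_vars.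
        split; first by exists 0, 0; split; apply: graph0.
        move=> a u v [z [n [a1 a2]]] [z' [n' [a3 a4]]].
        by exists (a *: z + z'), (a *: n + n'); split; apply: graph_lin.
      move=> i; have [a /(_ i)[n hn]] := sc l; have [b /(_ i)[z hz]] := qdom g n.
      exists (b + a)%N, z, (xv i ^+ b *: n); split=> //.
      by rewrite exprD -scalerA; apply: graphZ.
    - move=> z [n [a1 a2]]; have [a ha] := h2 _ _ a1 (null0 C).
      apply: null_xv => i; exists a; have [m hm] := ha i.
      by apply: (eg m); exists (xv i ^+ a *: n); split=> //; apply: graphZ.
  exists (mkq hr); apply/qeqP => n z z' [l [a1 [n' [a2 a3]]]] a4.
  have a5 := graph_sub a2 a1.
  have [b hb] : ev (ran f) (n' - n) by apply: h2 a5 _; rewrite subrr; apply: null0.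
  apply: null_xv => i; exists b; have [m hm] := hb i.
  apply: (eg m); exists (xv i ^+ b *: (n' - n)); split=> //.
  by apply: graphZ; apply: graph_sub.
- exact/epi_sur.
- by apply/qeq0P => m l [n [a1 a2]]; apply: h1 a1 a2.
Qed.

Lemma exact_kernel (M N C : coh) (f : qhom M N) (c : qhom N C) :
  exact2 f c -> inj f -> is_kernel f c.
Proof.
move=> [h1 h2] jf; split; last first.
- move=> Z g /qeq0P eg.
  have hr : qrel (fun (z : Z) (m : M) => exists n, g z n /\ f m n).
    split.
    - by exists 0; split; apply: graph0.
    - by move=> s m n m' n' [l [a1 a2]] [l' [a3 a4]]; exists (s *: l + l'); split; apply: graph_lin.
    - by move=> x m n [l [a1 a2]]; exists (hc x l); split; apply: graph_hc.
    - move=> z; apply: ev_vars.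
        split; first by exists 0, 0; split; apply: graph0.
        move=> a u v [m [n [a1 a2]]] [m' [n' [a3 a4]]].
        by exists (a *: m + m'), (a *: n + n'); split; apply: graph_lin.
      move=> i; have [a /(_ i)[l [n [a1 a2]]]] := qdom (qcomp c g) z.
      have [b /(_ i)[m hm]] : ev (ran f) n.
        by apply: (h2 _ _ a2); apply: (eg (xv i ^+ a *: z)); exists n.
      exists (b + a)%N, m, (xv i ^+ b *: n); split=> //.
      by rewrite exprD -scalerA; apply: graphZ.
    - by move=> m [n [a1 a2]]; apply: jf a2 (qind a1).
  exists (mkq hr); apply/qeqP => z n n' [m [[n1 [a1 a2]] a3]] a4.
  rewrite -(subrKA n1); apply: nullD; first exact: qval a3 a2.
  exact: qval a1 a4.
- exact/mono_injP.
- by apply/qeq0P => m l [n [a1 a2]]; apply: h1 a1 a2.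
Qed.

Lemma short_exactP (X E Y : coh) (i : qhom X E) (c : qhom E Y) :
  short_exact i c <-> [/\ inj i, sur c & exact2 i c].
Proof.
split=> [[[h1 h2 h3] h4]|[h1 h2 h3]].
  split; [exact/mono_injP|exact: cokernel_sur h4|split].
    by move=> m n l a1 a2; move/qeq0P: h1; apply; exists n; split; [exact: a1|exact: a2].
  by move=> n l a1 a2; apply: cokernel_ran h4 a1 a2.
by split; [apply: exact_kernel|apply: exact_cokernel].
Qed.

End Calculus.

(** * Line bundles and torsion sheaves *)

Section Divisibility.
Context (k : closedFieldType).
Implicit Types (s t g : S k) (i : bool).

(** The coefficient at exponent [a] of [xv i] and [b] of the other variable, whichever polynomial
    layer carries [xv i]. *)
Definition coefv i s (a b : nat) : k := if i then s`_a`_b else s`_b`_a.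

Lemma coefv_ext i s t : (forall a b, coefv i s a b = coefv i t a b) -> s = t.
Proof. by case: i => h; apply: S_ext => a b; [apply: h|apply: (h b a)]. Qed.

Lemma coefvD i s t a b : coefv i (s + t) a b = coefv i s a b + coefv i t a b.
Proof. by case: i; rewrite /coefv !coefD. Qed.

Lemma coefv0 i a b : coefv i 0 a b = 0.
Proof. by case: i; rewrite /coefv !coef0. Qed.

Lemma coef_x1M n s a b : (x1 ^+ n * s)`_a`_b = if (a < n)%N then 0 else s`_(a - n)`_b.
Proof. by rewrite /x1 coefXnM; case: ltnP => // _; rewrite coef0. Qed.

Lemma coef_x2M n s a b : (x2 ^+ n * s)`_a`_b = if (b < n)%N then 0 else s`_a`_(b - n).
Proof. by rewrite /x2 -polyC_exp coefCM coefXnM. Qed.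

Lemma coefv_xM i n s a b :
  coefv i (xv i ^+ n * s) a b = if (a < n)%N then 0 else coefv i s (a - n) b.
Proof. by case: i; rewrite /coefv /xv ?coef_x1M ?coef_x2M. Qed.

Lemma coefv_yM i n s a b :
  coefv i (xv (~~ i) ^+ n * s) a b = if (b < n)%N then 0 else coefv i s a (b - n).
Proof. by case: i; rewrite /coefv /xv ?coef_x1M ?coef_x2M. Qed.

Lemma div_coefv i n s :
  (exists g, s = xv i ^+ n * g) <-> (forall a b, (a < n)%N -> coefv i s a b = 0).
Proof.
split=> [[g ->] a b an|h]; first by rewrite coefv_xM an.
case: i h => h.
  exists (drop_poly n s); apply: (@coefv_ext true) => a b; rewrite coefv_xM.
  case: ltnP => [/h -> //|na]; rewrite /coefv coef_drop_poly subnK //.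
exists (\poly_(a < size s) drop_poly n s`_a).
apply: (@coefv_ext false) => a b; rewrite coefv_xM; case: ltnP => [/h -> //|na].
rewrite /coefv coef_poly; case: ltnP => hb; last by rewrite (nth_default _ hb) !coef0.
by rewrite coef_drop_poly subnK.
Qed.

Lemma div_coprime i n m s t :
  xv (~~ i) ^+ m * s = xv i ^+ n * t -> exists g, s = xv i ^+ n * g.
Proof.
move=> e; apply/div_coefv => a b an.
have := coefv_yM i m s a (b + m); rewrite ltnNge leq_addl /= addnK => <-.
by rewrite e coefv_xM an.
Qed.

Lemma xv_neq0 i n : xv i ^+ n != 0 :> S k.
Proof.
by case: i; rewrite expf_neq0 // /xv /x1 /x2 ?polyX_eq0 ?polyC_eq0 ?polyX_eq0.
Qed.

Lemma xv_inj i n s t : xv i ^+ n * s = xv i ^+ n * t -> s = t.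
Proof. exact/mulfI/xv_neq0. Qed.

Lemma xv_eq0 i n s : xv i ^+ n * s = 0 -> s = 0.
Proof. by move=> h; apply: (@xv_inj i n); rewrite h mulr0. Qed.

End Divisibility.

Section Concrete.
Context (k : closedFieldType) (p q : nat) (p0 : (0 < p)%N) (q0 : (0 < q)%N).
Local Notation coh := (coh k p q).

Definition cyclic (P : coh) (d : L p q) (g : P) : Prop :=
  homog d g /\ forall u, exists s, u = s *: g.

Lemma qhom_homog (M N : coh) (f : qhom M N) d m n :
  homog d m -> f m n -> exists n', homog d n' /\ f m n'.
Proof.
by move=> hm hf; exists (hc d n); split; [apply: hom_hc|rewrite -[m]hm; apply: graph_hc].
Qed.

(** A morphism takes values only after multiplication by a high power. Both variables get the same
    exponent, and [n0] lets a later choice dominate an earlier one. *)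
Lemma qhom_at (M N : coh) (f : qhom M N) d m n0 : homog d m ->
  exists a, (n0 <= a)%N /\ exists v : bool -> N, forall i,
    homog (d + ee i *+ a) (v i) /\ f (xv i ^+ a *: m) (v i).
Proof.
move=> hm; have [a ha] := qdom p0 q0 f m; exists (n0 + a)%N; split; first exact: leq_addr.
have /choice[v hv] : forall i, exists n, homog (d + ee i *+ (n0 + a)) n /\
    f (xv i ^+ (n0 + a) *: m) n.
  move=> i; have [n hn] := ha i.
  apply: (@qhom_homog _ _ _ _ _ (xv i ^+ n0 *: n)); first exact: hom_xv.
  by rewrite exprD -scalerA; apply: graphZ.
by exists v.
Qed.

Lemma qeq_cyclic (P M : coh) (f h : qhom P M) d g : @cyclic P d g ->
  (forall i, exists N n n', [/\ f (xv i ^+ N *: g) n, h (xv i ^+ N *: g) n' & null (n - n')]) ->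
  qeq f h.
Proof.
move=> [hg cg] H; apply: qeq_ev => // m; have [s ->] := cg m.
have sD : submod (fun m : P => exists n n', [/\ f m n, h m n' & null (n - n')]).
  split; first by exists 0, 0; rewrite subrr; split; [apply: graph0|apply: graph0|apply: null0].
  move=> a u v [n [n' [h1 h2 h3]]] [n1 [n1' [h4 h5 h6]]].
  exists (a *: n + n1), (a *: n' + n1'); split; [exact: graph_lin|exact: graph_lin|].
  by rewrite opprD addrACA -scalerBr; apply: nullD => //; apply: nullZ.
apply: submodZ; first exact: ev_submod.
by apply: ev_vars.
Qed.

(** A power of each variable applied to the generator spans a cofinite submodule, so a morphism may
    be prescribed on these two elements as soon as their relations are respected up to null
    elements. *)
Lemma hom_data (P M : coh) d g (N : bool -> nat) (v : bool -> M) : @cyclic P d g ->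
  (forall i, homog (d + ee i *+ N i) (v i)) ->
  (forall s t : S k,
     s *: (xv true ^+ N true *: g) + t *: (xv false ^+ N false *: g) = 0 ->
     null (s *: v true + t *: v false)) ->
  exists f : qhom P M, forall i, f (xv i ^+ N i *: g) (v i).
Proof.
move=> [hg cg] hv H.
pose r u n := exists s t : S k,
   u = s *: (xv true ^+ N true *: g) + t *: (xv false ^+ N false *: g) /\
   null (n - (s *: v true + t *: v false)).
have hlin a m n m' n' : r m n -> r m' n' -> r (a *: m + m') (a *: n + n').
  move=> [s [t [-> h1]]] [s' [t' [-> h2]]].
  exists (a * s + s'), (a * t + t'); split.
    by rewrite !scalerDl !scalerDr !scalerA addrACA.
  rewrite [X in null X](_ : _ = a *: (n - (s *: v true + t *: v false)) +
    (n' - (s' *: v true + t' *: v false))); first by apply: nullD => //; apply: nullZ.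
  by rewrite scalerBr addrACA -opprD !scalerDl scalerDr !scalerA [in RHS]addrACA.
have h0 : r 0 0.
  by exists 0, 0; rewrite !scale0r !addr0 subrr; split=> //; apply: null0.
have hr : qrel r.
  split=> //.
  - move=> x u n [s [t [-> h1]]].
    exists (Shc (x - (d + ee true *+ N true)) s), (Shc (x - (d + ee false *+ N false)) t).
    split; first by rewrite hcD !(hcZ _ _ (hom_xv _ _ hg)).
    have := null_hc x h1; rewrite hcB hcD !(hcZ _ _ (hv _)); exact.
  - move=> u; have [s ->] := cg u; apply: ev_vars.
      split; first by exists 0.
      by move=> a m m' [n hn] [n' hn']; exists (a *: n + n'); apply: hlin.
    case; [exists (N true), (s *: v true), s, 0|exists (N false), (s *: v false), 0, s];
      rewrite !scale0r ?addr0 ?add0r subrr; split; try exact: null0;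
      by rewrite !scalerA mulrC.
  - move=> n [s [t [e h1]]]; rewrite -(subrK (s *: v true + t *: v false) n).
    by apply: nullD => //; apply: H.
exists (mkq hr); case; [exists 1, 0|exists 0, 1];
  by rewrite !scale0r !scale1r ?add0r ?addr0 subrr; split=> //; apply: null0.
Qed.

Definition Ogen (z : L p q) : O k z := (1 : S k).

Lemma cyclic_O z : cyclic (- z) (Ogen z).
Proof.
rewrite /Ogen; split; first by rewrite /homog hom_O subrr Shc1.
by move=> u; exists u; exact/esym/mulr1.
Qed.

(** In [S] the relations between the two powers are the multiples of the Koszul relation, which
    leaves a single compatibility. *)
Lemma hom_data_O (M : coh) z N (v : bool -> M) :
  (forall i, homog (- z + ee i *+ N) (v i)) ->
  null (xv false ^+ N *: v true - xv true ^+ N *: v false) ->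
  exists f : qhom (O k z) M, forall i, f (xv i ^+ N *: Ogen z) (v i).
Proof.
move=> hv hn.
have [s t|f hf] := @hom_data (O k z) M _ (Ogen z) (fun=> N) v (cyclic_O z) hv.
  move=> e0; have {e0}e : s * xv true ^+ N + t * xv false ^+ N = 0.
    by rewrite -[X in s * X]mulr1 -[X in t * X]mulr1.
  have e1 : xv false ^+ N * (- t) = xv true ^+ N * s.
    by apply/eqP; rewrite mulrN eq_sym -addr_eq0 mulrC [X in _ + X]mulrC e.
  have [g eg] := @div_coprime _ true _ _ _ _ e1.
  have es : s = xv false ^+ N * g.
    by apply: (@xv_inj _ true N); rewrite -e1 eg mulrCA.
  rewrite es -[t]opprK eg scaleNr ![_ * g]mulrC -!scalerA -scalerBr.
  exact: nullZ.
by exists f.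
Qed.

Definition div_gsub i b (n : nat) : gsub (O k (@ee p q i *~ b)).
Proof.
refine (@GSub k p q _ (fun s : O k (ee i *~ b) => exists g, (s : S k) = xv i ^+ n * g) _ _).
- split; first by exists 0; rewrite mulr0.
  move=> a s t [g ->] [h ->]; exists (a * g + h).
  by rewrite mulrDr mulrCA.
- move=> d s [g ->]; rewrite hom_O.
  exists (Shc (ee i *~ b + d - ee i *+ n) g).
  by rewrite -(Shc_mulh _ _ (@Shc_xvX k p q i n)) subrK.
Defined.

(** The cokernel of the [n]-th power of [x_i] into O(b x_i): the model of the torsion sheaf of
    length [n] whose top has index [b]. *)
Definition Tq i b n : coh := Quot (div_gsub i b n).

Definition Tgen i b n : Tq i b n := cpi (div_gsub i b n) (1 : S k).

Lemma cyclic_T i b n : cyclic (- (ee i *~ b)) (Tgen i b n).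
Proof.
have [h1 h2] := cyclic_O (ee i *~ b); split.
  by rewrite /homog /Tgen -cpi_hc h1.
move=> u; have [m ->] := cpi_surj u; have [s ->] := h2 m.
by exists s; rewrite /Tgen cpiZ.
Qed.

Lemma Tgen_eq0 i b n s : s *: Tgen i b n = 0 <-> exists g, s = xv i ^+ n * g.
Proof.
rewrite /Tgen -cpiZ cpi_eq0 /= [X in exists g, X = _](_ : _ = s) //.
exact: mulr1.
Qed.

(** As [xv i ^+ n] kills the generator, the only datum is the value on a power of the other
    variable; by coprimality the relations ask just that [xv i ^+ n] kill this value up to null
    elements. *)
Lemma hom_data_T (M : coh) i b n N (m : M) :
  homog (- (ee i *~ b) + ee (~~ i) *+ N) m -> null (xv i ^+ n *: m) ->
  exists f : qhom (Tq i b n) M,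
    f (xv (~~ i) ^+ N *: Tgen i b n) m /\ f (xv i ^+ n *: Tgen i b n) 0.
Proof.
move=> hm hn; pose v j : M := if j == i then 0 else m.
pose e j := if j == i then n else N.
have ni : (~~ i == i) = false by case: (i).
have hv j : homog (- (ee i *~ b) + ee j *+ e j) (v j).
  rewrite /v /e; case: eqP => [_|ji]; first exact: hom0.
  by have -> : j = ~~ i by case: (j) (i) ji => [] [].
have [|f hf] := @hom_data (Tq i b n) M _ _ e v (cyclic_T i b n) hv.
  move=> s t e0.
  have hT (a c : S k) : a *: (xv i ^+ n *: Tgen i b n) +
      c *: (xv (~~ i) ^+ N *: Tgen i b n) = 0 -> null (c *: m).
    rewrite !scalerA -scalerDl => /Tgen_eq0[g eg].
    have : xv (~~ i) ^+ N * c = xv i ^+ n * (g - a).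
      by rewrite mulrBr -eg; ring.
    by move=> /div_coprime[h ->]; rewrite mulrC -scalerA; apply: nullZ.
  move: hT e0; rewrite /v /e; case: (i) => /= hT e0; rewrite scaler0 ?add0r ?addr0.
    exact: hT e0.
  by apply: hT; rewrite addrC; exact: e0.
exists f; split; first by have := hf (~~ i); rewrite /v /e ni.
by have := hf i; rewrite /v /e eqxx.
Qed.

End Concrete.

(** * Cech conditions and lifting along extensions *)

Section Criteria.
Context (k : closedFieldType) (p q : nat) (p0 : (0 < p)%N) (q0 : (0 < q)%N).
Local Notation coh := (coh k p q).

(* Cech-style forms of Hom(O(-d), X) = 0 and Ext^1(O(-d), X) = 0: x1 and x2 generate, up to
   finite dimension, the unit ideal, so a morphism from O(-d) is a compatible pair of
   elements of X localized at x1 and at x2. *)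
Definition injB (X : coh) (d : L p q) : Prop :=
  forall N (m1 m2 : X), homog (d + ee true *+ N) m1 -> homog (d + ee false *+ N) m2 ->
  xv false ^+ N *: m1 = xv true ^+ N *: m2 -> tors true m1 /\ tors false m2.

Definition surB (X : coh) (d : L p q) : Prop :=
  forall N (u : X), homog (d + ee true *+ N + ee false *+ N) u ->
  exists K m1 m2, [/\ homog (d + ee true *+ (N + K)) m1,
    homog (d + ee false *+ (N + K)) m2 &
    (xv true ^+ K * xv false ^+ K) *: u =
      xv false ^+ (N + K) *: m1 - xv true ^+ (N + K) *: m2].

(* The same for the torsion sheaf coker (x_i^n : O(-d - n x_i) -> O(-d)), supported where
   the other variable is invertible: x_i^n is injective, resp. surjective, on the localization
   of X at that variable. *)
Definition injV (X : coh) i (d : L p q) n : Prop :=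
  forall N (m : X), homog (d + ee (~~ i) *+ N) m -> xv i ^+ n *: m = 0 -> tors (~~ i) m.

Definition surV (X : coh) i (d : L p q) n : Prop :=
  forall N (u : X), homog (d + ee i *+ n + ee (~~ i) *+ N) u ->
  exists K m, homog (d + ee (~~ i) *+ (N + K)) m /\
    xv (~~ i) ^+ K *: u = xv i ^+ n *: m.

(** The vanishing of Ext^1(P, X) as lifting of all maps from [P] along extensions by [X]. In this
    form it is tested on a generator of [P] and passes to direct sums in [P]. *)
Definition liftE (P X : coh) : Prop :=
  forall (E Y : coh) (i : qhom X E) (c : qhom E Y), short_exact i c ->
  forall f : qhom P Y, exists h : qhom P E, qeq (qcomp c h) f.

Lemma ran_homog (M N : coh) (f : qhom M N) d n : homog d n -> ran f n ->
  exists m, homog d m /\ f m n.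
Proof.
by move=> hn [m hm]; exists (hc d m); split; [apply: hom_hc|rewrite -hn; apply: graph_hc].
Qed.

Lemma lift_at (P E Y : coh) (c : qhom E Y) (f : qhom P Y) d g : sur c -> homog d g ->
  exists A (e : bool -> E) (w : bool -> Y), forall i,
    [/\ homog (d + ee i *+ A) (e i), f (xv i ^+ A *: g) (w i) & c (e i) (w i)].
Proof.
move=> sc hg; have [a [_ [y hy]]] := qhom_at p0 q0 f 0 hg.
have [b1 h1] := sc (y true); have [b2 h2] := sc (y false).
have h i : exists b, ran c (xv i ^+ (b1 + b2) *: y i) /\ b = 0%N.
  exists 0%N; split=> //; case: i.
    rewrite addnC exprD -scalerA; have [m hm] := h1 true.
    by exists (xv true ^+ b2 *: m); apply: graphZ.
  rewrite exprD -scalerA; have [m hm] := h2 false.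
  by exists (xv false ^+ b1 *: m); apply: graphZ.
have /choice[e he] : forall i, exists e, homog (d + ee i *+ (b1 + b2 + a)) e /\
    c e (xv i ^+ (b1 + b2) *: y i).
  move=> i; have [_ [hr _]] := h i; apply: ran_homog hr.
  by rewrite addnC mulrnDr addrA; apply: hom_xv; have [] := hy i.
exists (b1 + b2 + a)%N, e, (fun i => xv i ^+ (b1 + b2) *: y i) => i.
have [h3 h4] := he i; split=> //; rewrite exprD -scalerA.
by apply: graphZ; have [] := hy i.
Qed.

(** The two local lifts differ on the overlap by an element of [X]. [surB] writes it as a
    coboundary, and subtracting its two parts makes the lifts glue by [hom_data_O]. *)
Lemma lift_O (X : coh) z : surB X (- z) -> liftE (O k z) X.
Proof.
move=> sX E Y i c /(short_exactP p0 q0)[ji sc [ex1 ex2]] f.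
have [A [e [w hew]]] := lift_at f sc (cyclic_O k z).1.
have [e1 f1 c1] := hew true; have [e2 f2 c2] := hew false.
(* The obstruction to gluing; its image in [Y] is null, so it comes from [X] up to powers of the
   variables. *)
pose W := xv false ^+ A *: e true - xv true ^+ A *: e false.
have hW : homog (- z + ee true *+ A + ee false *+ A) W.
  apply: homB; first exact: hom_xv.
  by rewrite addrAC; apply: hom_xv.
have cW : c W (xv false ^+ A *: w true - xv true ^+ A *: w false).
  by apply: graph_sub; apply: graphZ.
have nW : null (xv false ^+ A *: w true - xv true ^+ A *: w false).
  apply: (qval p0 q0 (graphZ (xv false ^+ A) f1)).
  have := graphZ (xv true ^+ A) f2; congr (f _ _).
  by rewrite !scalerA mulrC.
have [N2 hN2] := ex2 _ _ cW nW.
have [xi [hxi ixi]] := ran_homog (hom_xv true N2 hW) (hN2 true).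
have {hxi}hu : homog (- z + ee true *+ (A + N2) + ee false *+ (A + N2)) (xv false ^+ N2 *: xi).
  have := hom_xv false N2 hxi; congr homog.
  by rewrite !mulrnDr !addrA; congr (_ + _); rewrite addrAC.
have iu := graphZ (xv false ^+ N2) ixi.
have [K [m1 [m2 [h1 h2 hu']]]] := sX _ _ hu.
(* The corrections have images under [i] only after a further power, made common as [M]. *)
have [M [l1 [l2 [[hl1 il1] [hl2 il2]]]]] : exists M l1 l2,
    (homog (- z + ee true *+ (A + N2 + K) + ee true *+ M) l1 /\ i (xv true ^+ M *: m1) l1) /\
    (homog (- z + ee false *+ (A + N2 + K) + ee false *+ M) l2 /\ i (xv false ^+ M *: m2) l2).
  have [a [_ [v hv]]] := qhom_at p0 q0 i 0 h1.
  have [b [ab [v' hv']]] := qhom_at p0 q0 i a h2.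
  have [u1 u2] := hv true; have [u3 u4] := hv' false.
  exists b, (xv true ^+ (b - a) *: v true), (v' false); split; split=> //.
    have -> : @ee p q true *+ b = ee true *+ a + ee true *+ (b - a) by rewrite -mulrnDr subnKC.
    by rewrite addrA; apply: hom_xv.
  by rewrite -{1}(subnK ab) exprD -scalerA; apply: graphZ.
pose B := (A + N2 + K + M)%N.
pose v j := if j then xv true ^+ (N2 + K + M) *: e true - l1
            else xv false ^+ (N2 + K + M) *: e false - l2.
have hv j : homog (- z + ee j *+ B) (v j).
  case: j; apply: homB; try by rewrite /B mulrnDr addrA.
    by rewrite /B -!addnA mulrnDr addrA !addnA; apply: hom_xv.
  by rewrite /B -!addnA mulrnDr addrA !addnA; apply: hom_xv.
have nv : null (xv false ^+ B *: v true - xv true ^+ B *: v false).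
  have g1 := graphZ (xv true ^+ (K + M) * xv false ^+ (K + M)) iu.
  have g2 := graph_sub (graphZ (xv false ^+ B) il1) (graphZ (xv true ^+ B) il2).
  have E1 : xv false ^+ B *: (xv true ^+ M *: m1) - xv true ^+ B *: (xv false ^+ M *: m2) =
     (xv true ^+ (K + M) * xv false ^+ (K + M)) *: (xv false ^+ N2 *: xi).
    have -> : (xv true ^+ (K + M) * xv false ^+ (K + M)) *: (xv false ^+ N2 *: xi) =
        (xv true ^+ M * xv false ^+ M) *: ((xv true ^+ K * xv false ^+ K) *: (xv false ^+ N2 *: xi)).
      by rewrite [RHS]scalerA; congr (_ *: _); rewrite !exprD; ring.
    rewrite hu' scalerBr !scalerA /B; congr (_ *: _ - _ *: _); rewrite !exprD; ring.
  rewrite E1 in g2; have := qval p0 q0 g1 g2; congr null.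
  rewrite /v /W /B !scalerBr !scalerA [in RHS]opprD [in RHS]addrACA -[in RHS]opprD.
  by congr (_ *: _ - _ *: _ - _); rewrite ?exprD; ring.
have [h hh] := hom_data_O hv nv; exists h.
apply: (qeq_cyclic p0 q0 (cyclic_O k z)) => j.
have [J hJ] := qdom p0 q0 c (if j then l1 else l2); have [l cl] := hJ j.
have nl : null l.
  case: (j) cl => cl; [apply: ex1 (graphZ _ il1) cl|apply: ex1 (graphZ _ il2) cl].
exists (J + B)%N, (xv j ^+ (J + (N2 + K + M)) *: w j - l),
  (xv j ^+ (J + (N2 + K + M)) *: w j); split.
- exists (xv j ^+ J *: v j); split.
    by rewrite exprD -scalerA; apply: graphZ.
  have -> : xv j ^+ J *: v j = xv j ^+ (J + (N2 + K + M)) *: e j - xv j ^+ J *: (if j then l1 else l2).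
    by rewrite [in RHS]exprD -scalerA -scalerBr /v; case: (j).
  apply: graph_sub => //; apply: graphZ; by have [] := hew j.
- have [_ fj _] := hew j; have := graphZ (xv j ^+ (J + (N2 + K + M))) fj.
  congr (f _ _); rewrite scalerA; congr (_ *: _); rewrite -exprD /B; congr (_ ^+ _).
  by rewrite addnC; rewrite !addnA [(A + J)%N]addnC.
- by rewrite addrAC subrr add0r; apply: nullN.
Qed.

(** One local lift, where the other variable is inverted, is enough. The obstruction is that
    [xv i ^+ n] need not kill it, and [surV] divides this obstruction by [xv i ^+ n] inside [X]. *)
Lemma lift_T (X : coh) i b n : surV X i (- (ee i *~ b)) n -> liftE (Tq k p q i b n) X.
Proof.
move=> sX E Y io c /(short_exactP p0 q0)[ji sc [ex1 ex2]] f.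
set d := - (ee i *~ b) in sX *.
have [hg _] := cyclic_T k p q i b n.
have [A [e [w hew]]] := lift_at f sc hg.
have [e1 f1 c1] := hew (~~ i).
have g0 : xv i ^+ n *: Tgen k p q i b n = 0 by apply/Tgen_eq0; exists 1; rewrite mulr1.
have nW : null (xv i ^+ n *: w (~~ i)).
  apply: (qind p0 q0 (f := f)); have := graphZ (xv i ^+ n) f1; congr (f _ _).
  by rewrite scalerA mulrC -scalerA g0 scaler0.
have [N2 hN2] := ex2 _ _ (graphZ (xv i ^+ n) c1) nW.
have hxi0 : homog (d + ee i *+ n + ee (~~ i) *+ (A + N2)) (xv (~~ i) ^+ N2 *: (xv i ^+ n *: e (~~ i))).
  rewrite mulrnDr addrA; apply: hom_xv; rewrite addrAC; exact: hom_xv.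
have [xi [hxi ixi]] := ran_homog hxi0 (hN2 (~~ i)).
have [K [m [hm em]]] := sX _ _ hxi.
have [M [_ [v hv]]] := qhom_at p0 q0 io 0 hm.
have [hl il] := hv (~~ i).
pose B := (A + N2 + K + M)%N.
pose e' := xv (~~ i) ^+ (N2 + K + M) *: e (~~ i) - v (~~ i).
have he' : homog (d + ee (~~ i) *+ B) e'.
  apply: homB; last by rewrite /B mulrnDr addrA.
  by rewrite /B -!addnA mulrnDr addrA !addnA; apply: hom_xv.
have ne' : null (xv i ^+ n *: e').
  have g1 := graphZ (xv (~~ i) ^+ (K + M)) ixi.
  have g2 := graphZ (xv i ^+ n) il.
  have E1 : xv i ^+ n *: (xv (~~ i) ^+ M *: m) = xv (~~ i) ^+ (K + M) *: xi.
    rewrite addnC exprD -[RHS]scalerA em !scalerA; congr (_ *: _); ring.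
  rewrite E1 in g2; have := qval p0 q0 g1 g2; congr null.
  rewrite /e' scalerBr !scalerA; congr (_ *: _ - _); rewrite ?exprD; ring.
have [h [h1 h2]] := hom_data_T he' ne'; exists h.
apply: (qeq_cyclic p0 q0 (cyclic_T k p q i b n)) => j.
have [->|jni] := eqVneq j i.
  exists n, 0, 0; rewrite subrr g0; split; last exact: null0.
    by exists 0; split; apply: graph0.
  exact: graph0.
have {jni}-> : j = ~~ i by case: (j) (i) jni => [] [].
have [J hJ] := qdom p0 q0 c (v (~~ i)); have [l cl] := hJ (~~ i).
have nl : null l by apply: ex1 (graphZ _ il) cl.
exists (J + B)%N, (xv (~~ i) ^+ (J + (N2 + K + M)) *: w (~~ i) - l),
  (xv (~~ i) ^+ (J + (N2 + K + M)) *: w (~~ i)); split.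
- exists (xv (~~ i) ^+ J *: e'); split.
    by rewrite exprD -scalerA; apply: graphZ.
  by rewrite /e' scalerBr scalerA -exprD; apply: graph_sub => //; apply: graphZ.
- have := graphZ (xv (~~ i) ^+ (J + (N2 + K + M))) f1.
  congr (f _ _); rewrite scalerA -exprD /B; congr (_ ^+ _ *: _).
  by rewrite addnC !addnA [(A + J)%N]addnC.
- by rewrite addrAC subrr add0r; apply: nullN.
Qed.

Lemma liftE_dsum (A B X : coh) : liftE A X -> liftE B X -> liftE (dsum A B) X.
Proof.
move=> lA lB E Y i c se f.
have gA : @gfun k p q A (dsum A B) (fun a => (a, 0)).
  by split=> *; congr pair; rewrite ?addr0 ?scaler0 ?hc0.
have gB : @gfun k p q B (dsum A B) (fun a => (0, a)).
  by split=> *; congr pair; rewrite ?addr0 ?scaler0 ?hc0.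
have [hA eA] := lA _ _ _ _ se (qcomp f (qfun gA)).
have [hB eB] := lB _ _ _ _ se (qcomp f (qfun gB)).
have hr : @qrel k p q (dsum A B) E (fun u e => exists e1 e2, [/\ hA u.1 e1, hB u.2 e2 & e = e1 + e2]).
  split.
  - by exists 0, 0; rewrite addr0; split=> //; apply: graph0.
  - move=> s u e u' e' [a1 [a2 [x1 x2 ->]]] [b1 [b2 [x3 x4 ->]]].
    exists (s *: a1 + b1), (s *: a2 + b2); rewrite scalerDr addrACA.
    by split=> //; apply: graph_lin.
  - move=> x u e [a1 [a2 [x1 x2 ->]]]; exists (hc x a1), (hc x a2); rewrite hcD.
    by split=> //; apply: graph_hc.
  - move=> [a b]; have [n1 h1] := qdom p0 q0 hA a; have [n2 h2] := qdom p0 q0 hB b.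
    exists (n1 + n2)%N => j; have [l1 hl1] := h1 j; have [l2 hl2] := h2 j.
    exists (xv j ^+ n2 *: l1 + xv j ^+ n1 *: l2), (xv j ^+ n2 *: l1), (xv j ^+ n1 *: l2).
    split=> //=; last by rewrite exprD -scalerA; apply: graphZ.
    by rewrite addnC exprD -scalerA; apply: graphZ.
  - move=> e [a1 [a2 [x1 x2 ->]]].
    by apply: nullD; [apply: qind p0 q0 _ _ hA _ x1|apply: qind p0 q0 _ _ hB _ x2].
exists (mkq hr); apply: qeq_ev => // -[a b].
have [n1 h1] := qdom p0 q0 (qcomp c hA) a; have [n2 h2] := qdom p0 q0 (qcomp c hB) b.
have [n3 h3] := qdom p0 q0 (qcomp f (qfun gA)) a; have [n4 h4] := qdom p0 q0 (qcomp f (qfun gB)) b.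
exists (n1 + n2 + n3 + n4)%N => j.
have up (M N : coh) (g : qhom M N) (m : M) x y : dom g (xv j ^+ x *: m) -> dom g (xv j ^+ (x + y) *: m).
  by move=> hm; rewrite addnC exprD -scalerA; apply: submodZ => //; apply: dom_submod.
have [l1 hl1] : dom (qcomp c hA) (xv j ^+ (n1 + n2 + n3 + n4) *: a) by do 3 apply/up.
have [l2 hl2] : dom (qcomp c hB) (xv j ^+ (n1 + n2 + n3 + n4) *: b).
  by do 2 apply/up; rewrite addnC; apply/up.
have [l3 hl3] : dom (qcomp f (qfun gA)) (xv j ^+ (n1 + n2 + n3 + n4) *: a).
  by apply/up; rewrite addnC; apply/up.
have [l4 hl4] : dom (qcomp f (qfun gB)) (xv j ^+ (n1 + n2 + n3 + n4) *: b).
  by rewrite addnC; apply/up.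
exists (l1 + l2), (l3 + l4); split.
- have [m1 [x1 x2]] := hl1; have [m2 [x3 x4]] := hl2.
  exists (m1 + m2); split; last exact: graphD.
  by exists m1, m2.
- have [m1 [/= -> x2]] := hl3; have [m2 [/= -> x4]] := hl4.
  have := graphD x2 x4; congr (f _ _); congr pair; by rewrite ?addr0 ?add0r.
- rewrite opprD addrACA; apply: nullD.
    by have /(qeqP p0 q0) h := eA; apply: h hl1 hl3.
  by have /(qeqP p0 q0) h := eB; apply: h hl2 hl4.
Qed.

Lemma liftE_zero (P X : coh) : is_zero P -> liftE P X.
Proof.
move=> /(is_zeroP p0 q0) zP E Y i c _ f; exists (qzero P E).
apply/(qeqP p0 q0) => m n n' [l [-> h2]] h3.
by apply: nullB; [apply: (qind p0 q0 h2)|apply: (qnull p0 q0 h3)].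
Qed.

(** A lift [h] of the identity is a section of [c]; the retraction sends [e] to the preimage in [X]
    of [e - h (c e)]. *)
Lemma liftE_Ext1 (P X : coh) : liftE P X -> Ext1_zero P X.
Proof.
move=> lP E i c se; have [h /(qeqP p0 q0) eh] := lP _ _ _ _ se (qid P).
have [ji sc [ex1 ex2]] := (short_exactP p0 q0 i c).1 se.
have hr : qrel (fun (e : E) (x : X) => exists y e', [/\ c e y, h y e' & i x (e - e')]).
  split.
  - by exists 0, 0; rewrite subrr; split; apply: graph0.
  - move=> s e x e1 x1 [y [e' [a1 a2 a3]]] [y1 [e1' [b1 b2 b3]]].
    exists (s *: y + y1), (s *: e' + e1'); rewrite opprD addrACA -scalerBr.
    by split; apply: graph_lin.
  - move=> x e u [y [e' [a1 a2 a3]]]; exists (hc x y), (hc x e'); rewrite -hcB.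
    by split; apply: graph_hc.
  - move=> e; apply: ev_vars.
      split; first by exists 0, 0, 0; rewrite subrr; split; apply: graph0.
      move=> s e0 e1 [x [y [e' [a1 a2 a3]]]] [x1 [y1 [e1' [b1 b2 b3]]]].
      exists (s *: x + x1), (s *: y + y1), (s *: e' + e1'); rewrite opprD addrACA -scalerBr.
      by split; apply: graph_lin.
    move=> j; have [a /(_ j)[e' [y [a1 a2]]]] := qdom p0 q0 (qcomp h c) e.
    have [b /(_ j)[y' hy']] := qdom p0 q0 c e'.
    have cE := graph_sub (graphZ (xv j ^+ b) a1) hy'.
    have nE : null (xv j ^+ b *: y - y').
      rewrite -opprB; apply: nullN; apply: eh _ (erefl _).
      by exists (xv j ^+ b *: e'); split=> //; apply: graphZ.
    have [b' /(_ j)[x hx]] := ex2 _ _ cE nE.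
    exists (b' + (b + a))%N, x, (xv j ^+ (b' + b) *: y), (xv j ^+ (b' + b) *: e').
    split.
    + by rewrite addnA exprD -scalerA; apply: graphZ.
    + exact: graphZ.
    + by rewrite !exprD -!scalerA -scalerBr.
  - move=> x [y [e' [a1 a2 a3]]]; apply: ji a3 _; rewrite sub0r; apply: nullN.
    by apply: (qnull p0 q0 a2); apply: (qind p0 q0 a1).
exists (mkq hr); apply/(qeqP p0 q0) => x x' _ [e [a1 [y [e' [a2 a3 a4]]]]] ->.
rewrite -opprB; apply: nullN; apply: ji (graph_sub a1 a4) _.
rewrite subKr; apply: (qnull p0 q0 a3); exact: ex1 a1 a2.
Qed.

(** The hypotheses present [P] as the cokernel of a free cyclic submodule of [B] with generator [a].
    The pushout of this extension along the map sending [a] to [u] splits, so that map extends to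
    [B], up to null elements and powers of the variables. *)
Lemma push (P B X : coh) (c0 : B -> P) d (a : B) (u : X) : gfun c0 ->
  (forall b, c0 b = 0 <-> exists s, b = s *: a) ->
  (forall y, ev (fun y => exists b, y = c0 b) y) ->
  (forall s, s *: a = 0 -> s = 0) -> homog d a -> homog d u -> Ext1_zero P X ->
  exists (f : qhom B X) N, forall i, exists n,
    f (xv i ^+ N *: a) n /\ null (n - xv i ^+ N *: u).
Proof.
move=> gc kc rc fa ha hu eP.
have [cD cZ ch] := gc.
(* The antidiagonal copy of the cyclic module, by which the sum of [X] and [B] is divided to form
   the pushout [E]. *)
pose Qp (w : dsum X B) := exists s, w = (s *: u, - (s *: a)).
have sQ : submod Qp.
  split; first by exists 0; rewrite !scale0r oppr0.
  move=> s _ _ [t ->] [t' ->]; exists (s * t + t'); rewrite !scalerDl opprD -!scalerA.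
  by congr pair; rewrite /= scalerN.
have hQ x w : Qp w -> Qp (hc x w).
  move=> [s ->]; exists (Shc (x - d) s); congr pair => /=; first by rewrite (hcZ _ _ hu).
  by rewrite -[- (s *: a)]sub0r hcB hc0 (hcZ _ _ ha) sub0r.
pose E := Quot (@GSub k p q (dsum X B) Qp sQ hQ).
pose pi := cpi (@GSub k p q (dsum X B) Qp sQ hQ).
have pi0 w : pi w = 0 <-> Qp w by apply: cpi_eq0.
have piZ s w : pi (s *: w) = s *: pi w by apply: cpiZ.
have piD w w' : pi (w + w') = pi w + pi w' by apply: cpiD.
have pih x w : pi (hc x w) = hc x (pi w) by apply: cpi_hc.
have gi : @gfun k p q X E (fun x => pi (x, 0)).
  split=> [x y|s x|x y]; rewrite -?piD -?piZ -?pih; congr pi; congr pair;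
    by rewrite ?addr0 ?scaler0 ?hc0.
have gb : @gfun k p q B E (fun b => pi (0, b)).
  split=> [x y|s x|x y]; rewrite -?piD -?piZ -?pih; congr pi; congr pair;
    by rewrite ?addr0 ?scaler0 ?hc0.
have c00 : c0 0 = 0 by apply/kc; exists 0; rewrite scale0r.
have hr : @qrel k p q E P (fun e y => exists w, e = pi w /\ y = c0 w.2).
  split.
  - by exists 0; split; [exact: (esym ((pi0 0).2 sQ.1))|].
  - move=> s e y e' y' [w [-> ->]] [w' [-> ->]]; exists (s *: w + w').
    by rewrite piD piZ cD cZ.
  - by move=> x e y [w [-> ->]]; exists (hc x w); rewrite pih ch.
  - move=> e; exists 0%N => i; rewrite expr0 scale1r.
    by have [w ->] := cpi_surj e; exists (c0 w.2), w.
  - move=> y [w [/esym/pi0[s ->] ->]] /=; apply: (ev_in (@submod0 _ _ _ P)).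
    by apply/kc; exists (- s); rewrite scaleNr.
have se : short_exact (qfun gi) (mkq hr).
  apply/(short_exactP p0 q0); split.
  - move=> x _ -> [N hN]; exists N => i; have := hN i.
    rewrite -piZ => /pi0[s []] -> /esym/eqP; rewrite scaler0 oppr_eq0 => /eqP/fa ->.
    by rewrite scale0r.
  - move=> y; have [N hN] := rc y; exists N => i; have [b ->] := hN i.
    by exists (pi (0, b)), (0, b).
  - split=> [x _ y -> [w [e ->]]|e y [w [-> ->]] hy].
      have /pi0[s] : pi ((x, 0) - w) = 0.
        by have := piD ((x, 0) - w) w; rewrite subrK e -{1}[pi w]add0r => /addIr <-.
      case: w e => w1 w2 e [_ ew]; apply: (ev_in (@submod0 _ _ _ P)).
      by apply/kc; exists s; apply: oppr_inj; rewrite -ew /= sub0r.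
    have [N hN] := hy; exists N => i; have := hN i; rewrite -cZ => /kc[s es].
    exists (xv i ^+ N *: w.1 + s *: u) => /=; rewrite -piZ.
    have /pi0 h : Qp (xv i ^+ N *: w - (xv i ^+ N *: w.1 + s *: u, 0)).
      exists (- s); congr pair => /=; first by rewrite opprD addrA subrr add0r scaleNr.
      by rewrite subr0 es scaleNr opprK.
    have := piD (xv i ^+ N *: w - (xv i ^+ N *: w.1 + s *: u, 0)) (xv i ^+ N *: w.1 + s *: u, 0).
    by rewrite subrK h add0r.
have [r /(qeqP p0 q0) er] := eP _ _ _ se.
exists (qcomp r (qfun gb)).
have [N hN] := qdom p0 q0 (qcomp r (qfun gi)) u.
exists N => i; have [n hn] := hN i; exists n; split; last exact: er hn (erefl _).
have [l [/= -> h2]] := hn; exists (pi (0, xv i ^+ N *: a)); split=> //.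
suff -> : pi (0, xv i ^+ N *: a) = pi (xv i ^+ N *: u, 0) by [].
have /pi0 h : Qp ((xv i ^+ N *: u, 0) - (0, xv i ^+ N *: a)).
  by exists (xv i ^+ N); congr pair; rewrite /= ?subr0 ?sub0r.
have := piD ((xv i ^+ N *: u, 0) - (0, xv i ^+ N *: a)) (0, xv i ^+ N *: a).
by rewrite subrK h add0r.
Qed.

End Criteria.

(** * Vanishing of Hom and Ext *)

Section Perpendicular.
Context (k : closedFieldType) (p q : nat) (p0 : (0 < p)%N) (q0 : (0 < q)%N).
Local Notation coh := (coh k p q).

Lemma Hom_injB (X : coh) z : Hom_zero (O k z) X -> injB X (- z).
Proof.
move=> h N m1 m2 h1 h2 e; pose v j := if j then m1 else m2.
have [|//|f hf] := @hom_data_O k p q X z N v; first by case.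
  by rewrite /v e subrr; apply: null0.
have /(qeq0P p0 q0) hz := h f.
have n1 := hz _ _ (hf true); have n2 := hz _ _ (hf false).
by split; [apply: (null_tors m1).1|apply: (null_tors m2).1].
Qed.

Lemma Hom_injV (X : coh) i b n : Hom_zero (Tq k p q i b n) X -> injV X i (- (ee i *~ b)) n.
Proof.
move=> h N m hm e; have [|f [hf _]] := hom_data_T hm (n := n).
  by rewrite e; apply: null0.
by have /(qeq0P p0 q0)/(_ _ _ hf)/null_tors := h f.
Qed.

Lemma kill_null (X : coh) (u : X) : null u -> exists J, (xv true ^+ J * xv false ^+ J) *: u = 0.
Proof. by move=> [J hJ]; exists J; rewrite -scalerA hJ scaler0. Qed.

(** [push] for the Koszul presentation of O(z) by O(z - N x_1) and O(z - N x_2), with kernel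
    generated by [a]. The values of [f] on the two basis vectors form the required coboundary. *)
Lemma Ext_surB (X : coh) z : Ext1_zero (O k z) X -> surB X (- z).
Proof.
move=> eP N u hu.
pose B := dsum (O k (z - ee true *+ N)) (O k (z - ee false *+ N)).
pose c0 (b : B) : O k z := (xv true ^+ N * b.1 + xv false ^+ N * b.2 : S k).
have gc : gfun c0.
  rewrite /c0; split=> [[a b] [a' b']|s [a b]|y [a b]] /=.
  - by rewrite !mulrDr addrACA.
  - have E (c d : S k) : c * (s * a) + d * (s * b) = s * (c * a + d * b) by ring.
    exact: E.
  - change (xv true ^+ N * Shc (z - ee true *+ N + y) (a : S k) +
      xv false ^+ N * Shc (z - ee false *+ N + y) (b : S k) =
      Shc (z + y) (xv true ^+ N * a + xv false ^+ N * b)).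
    rewrite ShcD; congr (_ + _).
      rewrite -(Shc_mulh _ _ (@Shc_xvX k p q true N)); congr (Shc _ _).
      by rewrite addrAC subrK.
    rewrite -(Shc_mulh _ _ (@Shc_xvX k p q false N)); congr (Shc _ _).
    by rewrite addrAC subrK.
pose a : B := (xv false ^+ N : S k, - xv true ^+ N : S k).
have [||||f [M hM]] := push p0 q0 (d := - z + ee true *+ N + ee false *+ N) (a := a) gc _ _ _ _ hu eP.
- move=> [s t]; rewrite /c0 /=; split=> [e|[g [-> ->]]]; last first.
    have E (c d : S k) : c * (g * d) + d * (g * - c) = 0 by ring.
    exact: E.
  have e1 : xv false ^+ N * - (t : S k) = xv true ^+ N * (s : S k).
    by apply/eqP; rewrite mulrN eq_sym -addr_eq0 e.
  have [g eg] := @div_coprime _ true _ _ _ _ e1.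
  exists g; congr pair => /=.
    have -> : (s : S k) = xv false ^+ N * g.
      by apply: (@xv_inj _ true N); rewrite -e1 eg mulrCA.
    exact: mulrC.
  have -> : (t : S k) = - (xv true ^+ N * g) by rewrite -eg opprK.
  rewrite mulrC; exact/esym/mulrN.
- move=> y; exists N => j; pose b : B := if j then (y : S k, 0 : S k) else (0 : S k, y : S k).
  by exists b; rewrite /b /c0; case: (j) => /=; rewrite mulr0 ?addr0 ?add0r.
- move=> s [e _]; apply: (@xv_eq0 _ false N); by rewrite mulrC.
- have E i j : z - ee i *+ N + (- z + ee i *+ N + ee j *+ N) = @ee p q j *+ N.
    by rewrite !addrA [z - _ - z]addrAC subrr sub0r addNr add0r.
  rewrite /homog /a; congr pair.
    change (Shc (z - ee true *+ N + (- z + ee true *+ N + ee false *+ N)) (xv false ^+ N) =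
      xv false ^+ N :> S k).
    by rewrite E Shc_xvX.
  change (Shc (z - ee false *+ N + (- z + ee true *+ N + ee false *+ N)) (- xv true ^+ N) =
      - xv true ^+ N :> S k).
  rewrite [- z + _ + _]addrAC E -[in LHS]sub0r ShcB Shc0 Shc_xvX sub0r //.
have [h1 h2] : homog (- z + ee true *+ N) (((1 : S k), (0 : S k)) : B) /\
    homog (- z + ee false *+ N) (((0 : S k), (1 : S k)) : B).
  have E i : z - ee i *+ N + (- z + ee i *+ N) = 0 :> L p q.
    by rewrite !addrA [z - _ - z]addrAC subrr sub0r addNr.
  split; congr pair.
  - change (Shc (z - ee true *+ N + (- z + ee true *+ N)) (1 : S k) = 1); by rewrite E Shc1.
  - exact: Shc0.
  - exact: Shc0.
  - change (Shc (z - ee false *+ N + (- z + ee false *+ N)) (1 : S k) = 1); by rewrite E Shc1.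
(* The lower bounds [M] and [K1] make [K] dominate all earlier exponents, so that the values can be
   compared. *)
have [K1 [K1M [v1 hv1]]] := qhom_at p0 q0 f M h1.
have [K [K1K [v2 hv2]]] := qhom_at p0 q0 f K1 h2.
have [hv2a hv2b] := hv2 false.
pose w := xv true ^+ (K - K1) *: v1 true.
have [hw fw] : homog (- z + ee true *+ N + ee true *+ K) w /\
   f (xv true ^+ K *: (((1 : S k), (0 : S k)) : B)) w.
  have [g1 g2] := hv1 true; split.
    have -> : @ee p q true *+ K = ee true *+ K1 + ee true *+ (K - K1) by rewrite -mulrnDr subnKC.
    by rewrite [_ + (_ + _)]addrA; apply: hom_xv.
  by rewrite -{1}(subnK K1K) exprD -scalerA; apply: graphZ.
have g1 := graph_sub (graphZ (xv false ^+ (N + K)) fw) (graphZ (xv true ^+ (N + K)) hv2b).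
have [n [g2 g3]] := hM true.
have g4 := graphZ (xv true ^+ (K - M) * xv false ^+ K) g2.
have MK : (M <= K)%N by apply: leq_trans K1K.
have EK : xv true ^+ K = xv true ^+ (K - M) * xv true ^+ M :> S k by rewrite -exprD subnK.
have Ea : xv false ^+ (N + K) *: (xv true ^+ K *: (((1 : S k), (0 : S k)) : B)) -
   xv true ^+ (N + K) *: (xv false ^+ K *: (((0 : S k), (1 : S k)) : B)) =
   (xv true ^+ (K - M) * xv false ^+ K) *: (xv true ^+ M *: a).
  have E (x y : S k) : x * (y * (0 : S k)) = 0 by rewrite !mulr0.
  congr pair.
    change (xv false ^+ (N + K) * (xv true ^+ K * 1) - xv true ^+ (N + K) * (xv false ^+ K * 0) =
       (xv true ^+ (K - M) * xv false ^+ K) * (xv true ^+ M * xv false ^+ N) :> S k).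
    rewrite !exprD EK; ring.
  change (xv false ^+ (N + K) * (xv true ^+ K * 0) - xv true ^+ (N + K) * (xv false ^+ K * 1) =
       (xv true ^+ (K - M) * xv false ^+ K) * (xv true ^+ M * - xv true ^+ N) :> S k).
  rewrite !exprD EK; ring.
rewrite Ea in g1; have g5 := qval p0 q0 g1 g4.
have {}g5 : null ((xv true ^+ K * xv false ^+ K) *: u -
    (xv false ^+ (N + K) *: w - xv true ^+ (N + K) *: v2 false)).
  have g6 := nullZ (xv true ^+ (K - M) * xv false ^+ K) g3.
  have := nullN (nullD g5 g6); congr null.
  rewrite scalerBr subrKA opprB; congr (_ - _).
  rewrite scalerA EK; congr (_ *: _); ring.
have [J hJ] := kill_null g5.
exists (J + K)%N, (xv true ^+ J *: w), (xv false ^+ J *: v2 false).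
have EJ i : @ee p q i *+ (N + (J + K)) = ee i *+ N + ee i *+ K + ee i *+ J.
  by rewrite -!mulrnDr addnA addnAC.
split.
- by rewrite EJ !addrA; apply: hom_xv.
- by rewrite EJ !addrA; apply: hom_xv.
- move/eqP: hJ; rewrite scalerBr subr_eq0 => /eqP hJ.
  transitivity ((xv true ^+ J * xv false ^+ J) *: ((xv true ^+ K * xv false ^+ K) *: u)).
    by mring.
  by rewrite hJ scalerBr; congr (_ - _); mring.
Qed.

(** [push] for a power of the other variable, as a map from the line bundle [B] to the torsion
    sheaf: it is surjective up to powers, with kernel generated by [xv i ^+ n]. *)
Lemma Ext_surV (X : coh) i b n : Ext1_zero (Tq k p q i b n) X ->
  surV X i (- (ee i *~ b)) n.
Proof.
move=> eP N u hu; set d := - (ee i *~ b) in hu *.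
pose B : coh := O k (ee i *~ b - ee (~~ i) *+ N).
pose c0 (s : B) : Tq k p q i b n := cpi (div_gsub k p q i b n) (xv (~~ i) ^+ N * s : S k).
have gc : gfun c0.
  split=> [x y|s x|y x]; rewrite /c0.
  - by rewrite -cpiD; congr cpi; apply: mulrDr.
  - by rewrite -cpiZ; congr cpi; apply: mulrCA.
  - rewrite -cpi_hc; congr cpi.
    change (xv (~~ i) ^+ N * Shc (ee i *~ b - ee (~~ i) *+ N + y) (x : S k) =
       Shc (ee i *~ b + y) (xv (~~ i) ^+ N * (x : S k))).
    rewrite -(Shc_mulh _ _ (@Shc_xvX k p q (~~ i) N)); congr (Shc _ _).
    by rewrite addrAC subrK.
pose a : B := (xv i ^+ n : S k).
have [||||f [M hM]] := push p0 q0 (d := d + ee i *+ n + ee (~~ i) *+ N) (a := a) gc _ _ _ _ hu eP.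
- move=> s; rewrite /c0; split=> [/cpi_eq0[g]|[g ->]].
    by move=> /div_coprime[h ->]; exists h; exact: mulrC.
  apply/cpi_eq0; exists (xv (~~ i) ^+ N * g).
  have E (x y z : S k) : x * (y * z) = z * (x * y) by ring.
  exact: E.
- move=> y; apply: ev_vars.
    split; first by exists 0; rewrite /c0 mulr0; apply/esym/cpi_eq0; exists 0; rewrite mulr0.
    move=> s _ _ [x ->] [x' ->]; exists (s *: x + x').
    by have [h1 h2 _] := gc; rewrite h1 h2.
  move=> j; have [->|jni] := eqVneq j i.
    exists n, 0; have [s ->] := (cyclic_T k p q i b n).2 y.
    rewrite /c0 mulr0 [RHS](_ : _ = 0).
      have g0 : xv i ^+ n *: Tgen k p q i b n = 0 by apply/Tgen_eq0; exists 1; rewrite mulr1.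
      by rewrite scalerA mulrC -scalerA g0 scaler0.
    by apply/cpi_eq0; exists 0; rewrite mulr0.
  have -> : j = ~~ i by case: (j) (i) jni => [] [].
  have [m ->] := cpi_surj y; exists N, m; rewrite /c0 -cpiZ //.
- by move=> s e; apply: (@xv_eq0 _ i n); rewrite mulrC.
- change (Shc (ee i *~ b - ee (~~ i) *+ N + (d + ee i *+ n + ee (~~ i) *+ N)) (xv i ^+ n) =
     xv i ^+ n :> S k).
  rewrite [X in Shc X _](_ : _ = ee i *+ n) ?Shc_xvX //.
  by rewrite /d addrACA addNr addr0 addrA subrr add0r.
have h1 : homog (d + ee (~~ i) *+ N) ((1 : S k) : B).
  change (Shc (ee i *~ b - ee (~~ i) *+ N + (d + ee (~~ i) *+ N)) (1 : S k) = 1).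
  by rewrite /d addrACA subrr addNr addr0 Shc1.
have [K [MK [v hv]]] := qhom_at p0 q0 f M h1.
have [h2 h3] := hv (~~ i).
have [m [h4 h5]] := hM (~~ i).
have g1 := graphZ (xv i ^+ n) h3.
have g2 := graphZ (xv (~~ i) ^+ (K - M)) h4.
have Ea : xv i ^+ n *: (xv (~~ i) ^+ K *: ((1 : S k) : B)) =
   xv (~~ i) ^+ (K - M) *: (xv (~~ i) ^+ M *: a).
  change (xv i ^+ n * (xv (~~ i) ^+ K * 1) = xv (~~ i) ^+ (K - M) * (xv (~~ i) ^+ M * xv i ^+ n) :> S k).
  by rewrite mulr1 mulrA -exprD subnK // mulrC.
rewrite Ea in g1.
have g3 : null (xv (~~ i) ^+ K *: u - xv i ^+ n *: v (~~ i)).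
  have := nullN (nullD (qval p0 q0 g1 g2) (nullZ (xv (~~ i) ^+ (K - M)) h5)); congr null.
  by rewrite scalerBr subrKA opprB scalerA -exprD subnK.
have [J /(_ (~~ i)) hJ] := g3.
exists (J + K)%N, (xv (~~ i) ^+ J *: v (~~ i)); split.
  have -> : @ee p q (~~ i) *+ (N + (J + K)) = ee (~~ i) *+ N + ee (~~ i) *+ K + ee (~~ i) *+ J.
    by rewrite -!mulrnDr addnA addnAC.
  by rewrite !addrA; apply: hom_xv.
move/eqP: hJ; rewrite scalerBr subr_eq0 => /eqP hJ.
by rewrite exprD -scalerA hJ !scalerA mulrC.
Qed.

(** Coordinates on the grading group with the variable [i] first. *)
Definition D i (a b : int) : L p q := ee i *~ a + ee (~~ i) *~ b.

Lemma D_lel i a b : D i a b = if i then lel p q a b else lel p q b a.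
Proof. by case: i; rewrite /D /lel //= addrC. Qed.

Lemma D_ex i d : exists a b, d = D i a b.
Proof.
have [a [b ->]] := lel_ex d; case: i; [exists a, b|exists b, a]; by rewrite D_lel.
Qed.

Lemma D1 i a b n : D i a b + ee i *+ n = D i (a + n%:Z) b.
Proof. by rewrite /D addrAC pmulrn -mulrzDr. Qed.

Lemma D2 i a b n : D i a b + ee (~~ i) *+ n = D i a (b + n%:Z).
Proof. by rewrite /D -addrA pmulrn -mulrzDr. Qed.

Lemma homDE (M : coh) i a b a' b' (m : M) :
  homog (D i a b) m -> a' = a -> b' = b -> homog (D i a' b') m.
Proof. by move=> h -> ->. Qed.

Lemma hD1 (M : coh) i a b n (m : M) : homog (D i a b) m -> homog (D i (a + n%:Z) b) (xv i ^+ n *: m).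
Proof. by rewrite -D1; apply: hom_xv. Qed.

Lemma hD2 (M : coh) i a b n (m : M) :
  homog (D i a b) m -> homog (D i a (b + n%:Z)) (xv (~~ i) ^+ n *: m).
Proof. by rewrite -D2; apply: hom_xv. Qed.

End Perpendicular.

(** The degree of a monomial multiple is read off its syntax; comparing coordinates is then
    linear. *)
Ltac hcore :=
  first [ eassumption
        | eapply hom0
        | (eapply hD1; hcore) | (eapply hD2; hcore) ].
Ltac hdeg :=
  rewrite ?D1 ?D2;
  lazymatch goal with
  | |- homog _ (_ - _) => apply: homB; hdeg
  | |- homog _ (_ + _) => apply: homD; hdeg
  | |- homog _ (- _) => apply: homN; hdeg
  | _ => eapply homDE; [hcore | lia | lia]
  end.

(** * Two out of three for the bijectivity conditions *)

Section Algebra.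
Context (k : closedFieldType) (p q : nat).
Local Notation coh := (coh k p q).
Context (X : coh).

Lemma injBi i d : injB X d <->
  forall N (m m' : X), homog (d + ee i *+ N) m -> homog (d + ee (~~ i) *+ N) m' ->
  xv (~~ i) ^+ N *: m = xv i ^+ N *: m' -> tors i m /\ tors (~~ i) m'.
Proof.
case: i; first by [].
by split=> h N m m' h1 h2 e; have [||//|] := h N m' m.
Qed.

Lemma surBi i d : surB X d <->
  forall N (u : X), homog (d + ee i *+ N + ee (~~ i) *+ N) u ->
  exists K m m', [/\ homog (d + ee i *+ (N + K)) m,
    homog (d + ee (~~ i) *+ (N + K)) m' &
    (xv i ^+ K * xv (~~ i) ^+ K) *: u =
      xv (~~ i) ^+ (N + K) *: m - xv i ^+ (N + K) *: m'].
Proof.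
case: i; first by [].
split=> h N u hu; have := h N u; rewrite addrAC => /(_ hu) [K [m [m' [h1 h2 e]]]];
  exists K, (- m'), (- m); split; try exact: homN;
  by rewrite mulrC e !scalerN opprK addrC.
Qed.

Definition bijB d := injB X d /\ surB X d.
Definition bijV i d n := injV X i d n /\ surV X i d n.

Lemma tors_eq i (m m' : X) N s : xv i ^+ N *: m = s *: m' -> tors i m' -> tors i m.
Proof.
move=> e [J hJ]; exists (J + N)%N.
by rewrite exprD -scalerA e scalerA mulrC -scalerA hJ scaler0.
Qed.

Lemma V_refl i d : bijV i d 0.
Proof.
split=> [N m hm|N u hu]; first by rewrite scale1r => ->; exists 0%N; rewrite scaler0.
by exists 0%N, u; rewrite addn0 !scale1r; rewrite mulr0n addr0 in hu.
Qed.

(** [bijV i d n] says that [xv i ^+ n] is bijective from degree [d] on the localization of [X] at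
    the other variable. This lemma and the next two are two out of three for a composite of such
    maps. *)
Lemma V_trans i d n m : bijV i d n -> bijV i (d + ee i *+ n) m -> bijV i d (n + m).
Proof.
have [a [b ->]] := D_ex i d; move=> [j1 s1] [j2 s2]; split.
  move=> N u hu; rewrite addnC exprD -scalerA => h.
  have [|J hJ] := j2 N (xv i ^+ n *: u) _ h.
    by rewrite D2 in hu; hdeg.
  apply: (@tors_xv _ _ _ _ _ J); apply: (j1 (N + J)%N).
    by rewrite D2 in hu; hdeg.
  by rewrite scalerA mulrC -scalerA hJ.
move=> N u hu; have [|K [v [hv ev]]] := s2 N u.
  by rewrite !D1 D2 in hu *; hdeg.
have [|K' [w [hw ew]]] := s1 (N + K)%N v; first by [].
exists (K' + K)%N, w; split.
  by rewrite D2 in hw *; hdeg.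
by rewrite exprD -scalerA ev scalerA mulrC -scalerA ew scalerA -exprD addnC.
Qed.

Lemma V_left i d n m : bijV i d (n + m) -> bijV i d n -> bijV i (d + ee i *+ n) m.
Proof.
have [a [b ->]] := D_ex i d; move=> [j1 s1] [j2 s2]; split.
  move=> N u hu e; have [K [v [hv ev]]] := s2 N u hu.
  have tv : tors (~~ i) v.
    apply: j1 hv _; rewrite addnC exprD -scalerA -ev scalerA mulrC -scalerA e scaler0 //.
  exact: tors_eq ev tv.
move=> N u hu; have [|K [v [hv ev]]] := s1 N u.
  by rewrite !D1 D2 in hu *; hdeg.
exists K, (xv i ^+ n *: v); split.
  by rewrite D2 in hv; hdeg.
by rewrite ev scalerA -exprD addnC.
Qed.

Lemma V_right i d n m : bijV i d (n + m) -> bijV i (d + ee i *+ n) m -> bijV i d n.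
Proof.
have [a [b ->]] := D_ex i d; move=> [j1 s1] [j2 s2]; split.
  move=> N u hu e; apply: j1 hu _; by rewrite addnC exprD -scalerA e scaler0.
move=> N u hu; have [|K [v [hv ev]]] := s1 N (xv i ^+ m *: u).
  by rewrite !D1 D2 in hu *; hdeg.
have [||J hJ] := j2 (N + K)%N (xv (~~ i) ^+ K *: u - xv i ^+ n *: v).
- by rewrite !D1 !D2 in hu hv *; hdeg.
- rewrite scalerBr scalerA mulrC -scalerA ev scalerA -exprD addnC subrr //.
exists (J + K)%N, (xv (~~ i) ^+ J *: v); split.
  by rewrite D2 in hv *; hdeg.
move: hJ; rewrite scalerBr => /eqP; rewrite subr_eq0 => /eqP e.
by rewrite exprD -scalerA e !scalerA mulrC.
Qed.

(** This lemma and the next two unwind the long exact sequence of Hom(-, X) for the inclusion of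
    O(-d - n x_i) in O(-d) with torsion cokernel: vanishing for two terms gives it for the third. *)
Lemma B_V i d n : bijB d -> bijB (d + ee i *+ n) -> bijV i d n.
Proof.
have [a [b ->]] := D_ex i d; move=> [/(injBi i) j1 /(surBi i) s1] [/(injBi i) j2 _]; split.
  move=> N u hu e; rewrite D2 in hu.
  (* An element over one chart killed by [xv i ^+ n] agrees on the overlap with 0 over the other
     chart. *)
  have [|||_ t] := j1 (N + n)%N 0 (xv (~~ i) ^+ n *: u).
  - exact: hom0.
  - by hdeg.
  - by rewrite scaler0 exprD -scalerA [X in _ *: X]scalerA [X in X *: u]mulrC -scalerA e !scaler0.
  exact: tors_xv t.
move=> N u hu; rewrite D1 D2 in hu.
have [|K [m [m' [hm hm' e]]]] := s1 (N + n)%N (xv i ^+ N *: (xv (~~ i) ^+ n *: u)).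
  by hdeg.
rewrite ?D1 ?D2 in hm hm'.
(* [v] agrees on the overlap with [xv i ^+ n *: m]; injectivity in the shifted degree makes it
   torsion, which exhibits a multiple of [u] as divisible by [xv i ^+ n]. *)
pose v := xv (~~ i) ^+ (n + K) *: u + xv i ^+ n *: m'.
have [|||_ [J hJ]] := j2 (N + n + K)%N (xv i ^+ n *: m) v.
- by hdeg.
- by rewrite /v; hdeg.
- have {}e : xv (~~ i) ^+ (N + n + K) *: m = (xv i ^+ K * xv (~~ i) ^+ K) *: (xv i ^+ N *: (xv (~~ i) ^+ n *: u)) + xv i ^+ (N + n + K) *: m'.
    by rewrite e subrK.
  rewrite scalerA mulrC -scalerA e /v !scalerDr !scalerA; congr (_ *: _ + _ *: _); rewrite !exprD; ring.
exists (J + (n + K))%N, (- (xv (~~ i) ^+ J *: m')); split.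
  by hdeg.
move: hJ; rewrite /v scalerDr => /eqP; rewrite addr_eq0 => /eqP e2.
by rewrite exprD -scalerA e2 scalerN !scalerA mulrC.
Qed.

Lemma V_B i d n : bijV i d n -> bijB d -> bijB (d + ee i *+ n).
Proof.
have [a [b ->]] := D_ex i d; move=> [j1 s1] [/(injBi i) j2 /(surBi i) s2]; split.
  apply/(injBi i) => N m m' hm hm' e.
  have [K [m0 [h0 e0]]] := s1 N m' hm'; rewrite ?D1 ?D2 in hm hm' h0.
  have [|||t1 t2] := j2 (N + K + n)%N (xv i ^+ K *: m) (xv (~~ i) ^+ n *: m0).
  - by hdeg.
  - by hdeg.
  - have -> : xv (~~ i) ^+ (N + K + n) *: (xv i ^+ K *: m) = (xv (~~ i) ^+ (K + n) * xv i ^+ K) *: (xv (~~ i) ^+ N *: m) by mring.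
    have -> : xv i ^+ (N + K + n) *: (xv (~~ i) ^+ n *: m0) = (xv i ^+ (N + K) * xv (~~ i) ^+ n) *: (xv i ^+ n *: m0) by mring.
    by rewrite e -e0; mring.
  by split; [apply: tors_xv t1|apply: tors_eq e0 (tors_xv t2)].
apply/(surBi i) => N u hu; rewrite ?D1 ?D2 in hu.
have [|K [m [m' [hm hm' e]]]] := s2 (N + n)%N (xv (~~ i) ^+ n *: u).
  by hdeg.
rewrite ?D1 ?D2 in hm hm'.
exists (K + n)%N, (xv i ^+ n *: m), (xv i ^+ n *: m'); split; try by hdeg.
transitivity (xv i ^+ n *: ((xv i ^+ K * xv (~~ i) ^+ K) *: (xv (~~ i) ^+ n *: u))); first by mring.
by rewrite e scalerBr; congr (_ - _); mring.
Qed.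

Lemma V_B' i d n : bijV i d n -> bijB (d + ee i *+ n) -> bijB d.
Proof.
have [a [b ->]] := D_ex i d; move=> [j1 s1] [/(injBi i) j2 /(surBi i) s2]; split.
  apply/(injBi i) => N m m' hm hm' e; rewrite ?D1 ?D2 in hm hm'.
  have [|||t1 [J hJ]] := j2 N (xv i ^+ n *: m) (xv i ^+ n *: m').
  - by hdeg.
  - by hdeg.
  - by rewrite scalerA mulrC -scalerA e !scalerA mulrC.
  split; first exact: tors_xv t1.
  apply: (@tors_xv _ _ _ _ _ J); apply: (j1 (N + J)%N); first by hdeg.
  by rewrite scalerA mulrC -scalerA.
apply/(surBi i) => N u hu; rewrite ?D1 ?D2 in hu.
have [|K [m [m' [hm hm' e]]]] := s2 N (xv i ^+ n *: u); first by hdeg.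
have [J [m0 [h0 e0]]] := s1 _ _ hm'.
rewrite ?D1 ?D2 in hm hm' h0.
exists (K + n + J)%N, (xv i ^+ J *: m), (xv (~~ i) ^+ n *: m0); split; try by hdeg.
transitivity ((xv i ^+ J * xv (~~ i) ^+ (J + n)) *: ((xv i ^+ K * xv (~~ i) ^+ K) *: (xv i ^+ n *: u))).
  by mring.
rewrite e scalerBr; congr (_ - _); first by mring.
have -> : (xv i ^+ J * xv (~~ i) ^+ (J + n)) *: (xv i ^+ (N + K) *: m') =
  (xv i ^+ J * xv (~~ i) ^+ n * xv i ^+ (N + K)) *: (xv (~~ i) ^+ J *: m') by mring.
by rewrite e0; mring.
Qed.

Lemma bijB_zero : (forall d, bijB d) -> forall m : X, null m.
Proof.
move=> h m; apply: null_sum => d; have [j _] := h d.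
have [|||t1 t2] := j 0%N (hc d m) (hc d m); rewrite ?mulr0n ?addr0 //; try exact: hom_hc.
by apply/null_tors; case.
Qed.

End Algebra.

(** * Bricks and rigidity *)

Section Computations.
Context (k : closedFieldType) (p q : nat) (p0 : (0 < p)%N) (q0 : (0 < q)%N).
Local Notation coh := (coh k p q).

Definition per (i : bool) : nat := if i then p else q.

Lemma per_gt0 i : (0 < per i)%N. Proof. by case: i. Qed.

Lemma D_eq i a b c d : D p q i a b = D p q i c d <->
  exists n : int, a - c = n * (per i)%:Z /\ b - d = - (n * (per (~~ i))%:Z).
Proof.
rewrite !D_lel; case: i; rewrite lel_eq //; split=> [[n [h1 h2]]|[n [h1 h2]]];
  by exists (- n); rewrite !mulNr ?opprK.
Qed.

Lemma coefv_deg i (y : L p q) (s : S k) a b :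
  Shc y s = s -> coefv i s a b != 0 -> D p q i a%:Z b%:Z = y.
Proof.
move=> <-; rewrite D_lel; case: i; rewrite /coefv coef_Shc mdeg_lel;
  by case: ifP => [/eqP //|_ /eqP].
Qed.

Lemma null_O (z : L p q) (m : O k z) : null m -> m = 0.
Proof. by move=> [N /(_ true)] h; apply: (@xv_eq0 _ true N). Qed.

Definition qscal (M : coh) (c : k) : qhom M M.
Proof.
refine (@qfun k p q M M (scalk c) _).
split=> [m n|s m|d m]; rewrite /scalk; first exact: scalerDr.
  by rewrite !scalerA mulrC.
have hs : Shc (0 : L p q) (c%:P%:P : S k) = c%:P%:P.
  apply: S_ext => a b; rewrite coef_Shc coefC; case: a => [|a] /=; last by rewrite !coef0 if_same.
  rewrite coefC; case: b => [|b] /=; last by rewrite if_same.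
  by rewrite /mdeg !mulr0n addr0 eqxx.
by rewrite -(hcXg d m hs) addr0.
Defined.

Definition brick (X : coh) : Prop :=
  ~ is_zero X /\ forall f : qhom X X, exists c, qeq f (qscal X c).

(** Nonzero maps in one direction are allowed, as they do occur between summands of a tilting sheaf;
    only round trips vanish. *)
Definition orth (X Z : coh) : Prop :=
  forall (f : qhom X Z) (g : qhom Z X), qeq (qcomp g f) (qzero X X).

Lemma orth_Hom1 (X Z : coh) : Hom_zero X Z -> orth X Z.
Proof.
move=> h f g; apply/(qeq0P p0 q0) => m n [l [a1 a2]].
by have /(qeq0P p0 q0) hf := h f; apply: (qnull p0 q0 a2); apply: hf a1.
Qed.

Lemma orth_Hom2 (X Z : coh) : Hom_zero Z X -> orth X Z.
Proof.
by move=> h f g; apply/(qeq0P p0 q0) => m n [l [a1 a2]]; have /(qeq0P p0 q0) := h g; apply; apply: a2.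
Qed.

(** The values on the two powers of the generator agree on the overlap, and by coprimality both come
    from one [s]. *)
Lemma Hom_OO (z w : L p q) (f : qhom (O k z) (O k w)) : exists s : S k,
  Shc (w - z) s = s /\ forall (m n : S k), f m n -> n = s * m.
Proof.
have [N [_ [v hv]]] := qhom_at p0 q0 f 0 (cyclic_O k z).1.
have [h1 f1] := hv true; have [h2 f2] := hv false.
have e : xv false ^+ N * (v true : S k) = xv true ^+ N * (v false : S k).
  have /null_O : null (xv false ^+ N *: v true - xv true ^+ N *: v false).
    apply: (qval p0 q0 (graphZ (xv false ^+ N) f1)).
    have := graphZ (xv true ^+ N) f2; congr (f _ _).
    by rewrite !scalerA mulrC.
  by move/eqP; rewrite subr_eq0 => /eqP.
have [s es] := @div_coprime _ true _ _ _ _ e; exists s; split.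
  apply: (@xv_inj _ true N); rewrite -es -[in RHS](h1 : Shc (w + (- z + ee true *+ N)) (v true : S k) = v true).
  by rewrite addrA es -(Shc_mulh _ _ (@Shc_xvX k p q true N)).
move=> m n fm.
have /null_O/eqP : null ((xv true ^+ N : S k) *: (n : O k w) - (m : S k) *: v true).
  apply: (qval p0 q0 (graphZ (xv true ^+ N) fm)).
  have := graphZ m f1; congr (f _ _).
  have E (a b c : S k) : a * (b * c) = b * (a * c) by ring.
  rewrite [RHS](_ : _ = xv true ^+ N * (m * 1)); last by rewrite mulr1.
  exact: E.
rewrite subr_eq0 => /eqP h; apply: (@xv_inj _ true N).
transitivity (m * (v true : S k)); first exact: h.
by rewrite es; ring.
Qed.

Lemma not_zero_O (z : L p q) : ~ is_zero (O k z).
Proof.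
by move/(is_zeroP p0 q0)/(_ (Ogen k z))/null_O/eqP; rewrite oner_eq0.
Qed.

Lemma brick_O (z : L p q) : brick (O k z).
Proof.
split; first exact: not_zero_O.
move=> f; have [s [hs hf]] := Hom_OO f; rewrite subrr in hs.
have es : s = (s`_0`_0)%:P%:P.
  apply: (@coefv_ext _ true) => a b; rewrite [RHS]/coefv coefC.
  have [z0|nz] := eqVneq (coefv true s a b) 0; last first.
    have := coefv_deg hs nz; have -> : 0 = D p q true 0 0 by rewrite /D !mulr0z addr0.
    move/D_eq => [n [h1 h2]]; move: h1 h2 nz; rewrite !subr0 /= => h1 h2 nz.
    have [-> ->] : a = 0%N /\ b = 0%N by nia.
    by rewrite /= coefC.
  rewrite z0; case: a z0 => [|a] z0; last by rewrite coef0.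
  by rewrite /= coefC; case: b z0 => //= z0; rewrite -[RHS]z0.
exists (s`_0`_0); apply/(qeqP p0 q0) => m n _ h1 ->.
by rewrite (hf _ _ h1) {1}es subrr; apply: null0.
Qed.

(** Nonzero maps in both directions would contain monomials with degrees adding up to 0. Their
    exponents are nonnegative and [p], [q] positive, so all exponents vanish and [z = w]. *)
Lemma orth_O (z w : L p q) : z != w -> orth (O k z) (O k w).
Proof.
move=> zw f g; have [s [hs hf]] := Hom_OO f; have [t [ht hg]] := Hom_OO g.
apply/(qeq0P p0 q0) => m n [l [/hf -> /hg ->]].
suff [->|->] : s = 0 \/ t = 0 by rewrite ?mul0r ?mulr0; apply: null0.
apply: contrapT => /not_orP[s0 t0].
have nz (u : S k) : u <> 0 -> exists a b, coefv true u a b != 0.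
  move=> u0; apply: contrapT => h; apply: u0; apply: (@coefv_ext _ true) => a b.
  by rewrite coefv0; apply: contrapT => /eqP h'; apply: h; exists a, b.
have [a [b /(coefv_deg hs) e1]] := nz _ s0; have [c [d /(coefv_deg ht) e2]] := nz _ t0.
have : D p q true (a + c)%N (b + d)%N = D p q true 0 0.
  rewrite !PoszD /D !mulrzDr addrACA; move: e1 e2; rewrite /D => -> ->.
  by rewrite subrKA subrr !mulr0z addr0.
move/D_eq => [r [h1 h2]]; rewrite !subr0 in h1 h2; rewrite /= in h1 h2.
have [a0 b0] : a = 0%N /\ b = 0%N by nia.
by move: e1; rewrite a0 b0 /D !mulr0z addr0 => /esym/eqP; rewrite subr_eq0 eq_sym (negPf zw).
Qed.

Lemma Tq_kill i b n (u : Tq k p q i b n) : xv i ^+ n *: u = 0.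
Proof.
have [s ->] := (cyclic_T k p q i b n).2 u.
by rewrite scalerA; apply/Tgen_eq0; exists s.
Qed.

Lemma Hom_zero_TO i b n (w : L p q) : Hom_zero (Tq k p q i b n) (O k w).
Proof.
move=> f; apply/(qeq0P p0 q0) => m u fm.
suff -> : u = 0 by apply: null0.
apply: null_O; apply: (@null_xv _ _ _ _ _) => j; exists 0%N; rewrite scale1r.
have := qind p0 q0 (f := f) (n := xv i ^+ n *: u).
rewrite -(Tq_kill m) => /(_ (graphZ _ fm))/null_O h.
by rewrite (@xv_eq0 _ i n u h); apply: null0.
Qed.

Lemma Hom_zero_TT i b n b' n' : Hom_zero (Tq k p q i b n) (Tq k p q (~~ i) b' n').
Proof.
move=> f; apply/(qeq0P p0 q0) => m u fm; apply: null_xv => j.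
have [->|ji] := eqVneq j i.
  exists n; apply: (qind p0 q0 (f := f)).
  by rewrite -(Tq_kill m); apply: graphZ.
exists n'; have -> : j = ~~ i by case: (j) (i) ji => [] [].
by rewrite Tq_kill; apply: null0.
Qed.

Lemma Tgen_null i b n s : null (s *: Tgen k p q i b n) -> exists g, s = xv i ^+ n * g.
Proof.
by move=> [N /(_ (~~ i))]; rewrite scalerA => /Tgen_eq0[g] /div_coprime.
Qed.

Lemma not_zero_T i b n : (0 < n)%N -> ~ is_zero (Tq k p q i b n).
Proof.
move=> n0 /(is_zeroP p0 q0) h; have [g e] := Tgen_null (h (1 *: Tgen k p q i b n)).
have /eqP := congr1 (fun s : S k => coefv i s 0%N 0%N) e.
by rewrite coefv_xM n0 /coefv; case: (i); rewrite coef1 /= coef1 oner_eq0.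
Qed.

(** In a fixed degree the exponents of [xv i] agree modulo [per i]. As [n <= per i], only the
    residue [t] can occur below [n], and a single monomial is left. *)
Lemma Tq_homog i b n b' N (u : Tq k p q i b' n) t : (n <= per i)%N -> (t < per i)%N ->
  (exists r : int, b' - b = t%:Z + r * (per i)%:Z) ->
  homog (- (ee i *~ b) + ee (~~ i) *+ N) u ->
  exists (c : k) e, u = (c%:P%:P * (xv i ^+ t * xv (~~ i) ^+ e)) *: Tgen k p q i b' n /\
    (b' = b -> t = 0%N -> e = N).
Proof.
move=> nP tP [r hr] hu; have [s0 es0] := (cyclic_T k p q i b' n).2 u.
pose y : L p q := D p q i (b' - b) N%:Z.
have [s [hs es]] : exists s, Shc y s = s /\ u = s *: Tgen k p q i b' n.
  exists (Shc y s0); split; first by rewrite Shc_proj eqxx.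
  rewrite -[u]hu es0 (hcZ _ _ (cyclic_T k p q i b' n).1); congr (Shc _ _ *: _).
  rewrite /y /D mulrzBr opprK -pmulrn; rewrite addrAC [_ + ee i *~ b']addrC //.
have hc a c : (a < n)%N -> coefv i s a c != 0 -> a = t /\
    (c%:Z = N%:Z + r * (per (~~ i))%:Z).
  move=> an /(coefv_deg hs)/D_eq[m [h1 h2]].
  have Pi := per_gt0 i.
  have e0 : (a%:Z - t%:Z) = (m + r) * (per i)%:Z by lia.
  have mr : m + r = 0 by nia.
  split; first by move: e0; rewrite mr mul0r; lia.
  have -> : r = - m by lia.
  rewrite mulNr; lia.
have div (s1 : S k) : (forall a c, (a < n)%N -> coefv i s a c = coefv i s1 a c) ->
    u = s1 *: Tgen k p q i b' n.
  move=> h; rewrite es; apply/eqP; rewrite -subr_eq0 -scalerBl; apply/eqP.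
  apply/Tgen_eq0/div_coefv => a c /h e; rewrite coefvD -scaleN1r.
  have -> : coefv i (-1 *: s1) a c = - coefv i s1 a c.
    by rewrite scaleN1r; case: (i); rewrite /coefv !coefN.
  by rewrite e subrr.
have [[a [c [an nz]]]|no] := pselect (exists a c, (a < n)%N /\ coefv i s a c != 0).
  have [at_ ec] := hc _ _ an nz; exists (coefv i s a c), c; split; last first.
    by move=> bb t0; move: hr ec; rewrite bb t0 subrr; have := per_gt0 i; nia.
  apply: div => a' c' an'; rewrite mulrCA.
  have -> : coefv i (xv i ^+ t * ((coefv i s a c)%:P%:P * xv (~~ i) ^+ c)) a' c' =
     if (a' == t) && (c' == c) then coefv i s a c else 0.
    rewrite coefv_xM; case: ltnP => [h|h].
      by rewrite ltn_eqF.
    rewrite mulrC coefv_yM; case: ltnP => [h2|h2].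
      by rewrite [c' == c]ltn_eqF // andbF.
    have E (w : k) x z : coefv i (w%:P%:P : S k) x z = if (x == 0%N) && (z == 0%N) then w else 0.
      case: (i); rewrite /coefv coefC; case: x => [|x] //=; rewrite ?coefC ?coef0 ?andbF //; case: z => [|z] //=; by rewrite ?coef0 ?coefC.
    by rewrite E !subn_eq0 !eqn_leq h h2 !andbT.
  case: eqP => [ea|na] /=; last first.
    by apply/eqP; apply: contrapT => /negP/hc[//|h _]; apply: na.
  case: eqP => [->|nc]; first by rewrite ea at_.
  apply/eqP; apply: contrapT => /negP/(hc _ _ an')[_ h]; apply: nc; lia.
exists 0, N; rewrite polyC0 mul0r; split=> //; apply: div => a c an.
by rewrite coefv0; apply: contrapT => /eqP h; apply: no; exists a, c.
Qed.

Lemma brick_T i b n : (0 < n)%N -> (n <= per i)%N -> brick (Tq k p q i b n).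
Proof.
move=> n0 nP; split; first exact: not_zero_T.
move=> f; have [N [_ [v hv]]] := qhom_at p0 q0 f 0 (cyclic_T k p q i b n).1.
have [h1 f1] := hv (~~ i).
have [|c [e [ev eN]]] := Tq_homog nP (per_gt0 i) _ h1; first by exists 0; rewrite subrr mul0r.
exists c; apply: (qeq_cyclic p0 q0 (cyclic_T k p q i b n)) => j.
have [->|ji] := eqVneq j i.
  exists n, 0, 0; rewrite Tq_kill subrr; split; [exact: graph0|exact: graph0|exact: null0].
have -> : j = ~~ i by case: (j) (i) ji => [] [].
exists N, (v (~~ i)), (scalk c (xv (~~ i) ^+ N *: Tgen k p q i b n)); split=> //.
rewrite ev eN // /scalk expr0 mul1r scalerA subrr; exact: null0.
Qed.

(** The round trip multiplies the generator by [xv i ^+ (t + t')], up to a scalar and powers of the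
    other variable; this is 0 once the exponent reaches [n]. *)
Lemma comp_T_zero i b n b' n' (f : qhom (Tq k p q i b n) (Tq k p q i b' n'))
    (g : qhom (Tq k p q i b' n') (Tq k p q i b n)) N M (c c' : k) t t' e e' :
  f (xv (~~ i) ^+ N *: Tgen k p q i b n)
    ((c%:P%:P * (xv i ^+ t * xv (~~ i) ^+ e)) *: Tgen k p q i b' n') ->
  g (xv (~~ i) ^+ M *: Tgen k p q i b' n')
    ((c'%:P%:P * (xv i ^+ t' * xv (~~ i) ^+ e')) *: Tgen k p q i b n) ->
  [\/ (n <= t + t')%N, c = 0 | c' = 0] -> qeq (qcomp g f) (qzero _ _).
Proof.
move=> f1 g1 h.
have gv := graphZ (xv (~~ i) ^+ M) f1.
have gw := graphZ (c%:P%:P * (xv i ^+ t * xv (~~ i) ^+ e)) g1.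
set z := (X in g _ X) in gw.
have z0 : z = 0.
  rewrite /z; case: h => [h|->|->]; rewrite ?polyC0 ?mul0r ?scale0r ?scaler0 //.
  rewrite -(scaler0 _ (c%:P%:P * c'%:P%:P * (xv (~~ i) ^+ e * xv (~~ i) ^+ e') * xv i ^+ (t + t' - n))).
  rewrite -(Tq_kill (Tgen k p q i b n)) !scalerA; congr (_ *: _).
  transitivity (c%:P%:P * c'%:P%:P * (xv (~~ i) ^+ e * xv (~~ i) ^+ e') * (xv i ^+ t * xv i ^+ t') : S k).
    by ring.
  have E : xv i ^+ t * xv i ^+ t' = xv i ^+ (t + t' - n) * xv i ^+ n :> S k.
    by rewrite -!exprD subnK.
  by rewrite E; ring.
apply: (qeq_cyclic p0 q0 (cyclic_T k p q i b n)) => j.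
have [->|ji] := eqVneq j i.
  exists n, 0, 0; rewrite Tq_kill subrr; split; [exact: graph0|by []|exact: null0].
have -> : j = ~~ i by case: (j) (i) ji => [] [].
exists (M + N)%N, 0, 0; split; [|by []|by rewrite subrr; exact: null0].
exists ((c%:P%:P * (xv i ^+ t * xv (~~ i) ^+ e)) *: (xv (~~ i) ^+ M *: Tgen k p q i b' n')); split.
  rewrite exprD -scalerA; move: gv; congr (f _ _).
  by rewrite !scalerA mulrC.
by rewrite -z0.
Qed.

(** With exponent 0 and [c] nonzero the generator goes locally to a generator, so [xv i ^+ n1] kills
    the target. *)
Lemma map_T_len i b1 n1 b2 n2 (h : qhom (Tq k p q i b1 n1) (Tq k p q i b2 n2)) a e (c : k) :
  h (xv (~~ i) ^+ a *: Tgen k p q i b1 n1)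
    ((c%:P%:P * (xv i ^+ 0 * xv (~~ i) ^+ e)) *: Tgen k p q i b2 n2) ->
  c != 0 -> (n2 <= n1)%N.
Proof.
move=> hh c0; have := graphZ (xv i ^+ n1) hh; rewrite Tq_kill => /(qind p0 q0).
rewrite scalerA => /Tgen_null[G eG].
rewrite leqNgt; apply/negP => lt.
have : xv (~~ i) ^+ e * (c%:P%:P : S k) = xv i ^+ (n2 - n1) * G.
  apply: (@xv_inj _ i n1); rewrite [RHS]mulrA -exprD subnKC; last exact: ltnW.
  by rewrite -eG expr0 mul1r; congr (_ * _); rewrite mulrC.
move=> /div_coprime[G'] /(congr1 (fun s : S k => coefv i s 0%N 0%N))/eqP.
by rewrite coefv_xM subn_gt0 lt /coefv; case: (i); rewrite coefC /= coefC /= (negPf c0).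
Qed.

Lemma int_mod_per i (x : int) : exists t, (t < per i)%N /\ exists r : int, x = t%:Z + r * (per i)%:Z.
Proof.
have Pi := per_gt0 i; have P0 : (per i)%:Z != 0 by lia.
have h := modz_ge0 x P0.
exists `|(x %% (per i)%:Z)%Z|%N; split.
  have := ltz_pmod x (d := (per i)%:Z).
  by rewrite ltz_nat Pi => /(_ isT) h'; rewrite -ltz_nat gez0_abs.
by exists (x %/ (per i)%:Z)%Z; rewrite gez0_abs // addrC -divz_eq.
Qed.

(** The exponents of the two maps are opposite residues modulo [per i]. Either they add up to
    [per i], which is at least [n], or both are 0, and then nonzero maps both ways force equal
    lengths. *)
Lemma orth_T i b n b' n' : (n <= per i)%N -> (n' <= per i)%N ->
  ~ ((exists r : int, b' - b = r * (per i)%:Z) /\ n = n') ->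
  orth (Tq k p q i b n) (Tq k p q i b' n').
Proof.
move=> nP nP' ne f g.
have [N [_ [v hv]]] := qhom_at p0 q0 f 0 (cyclic_T k p q i b n).1.
have [M [_ [w hw]]] := qhom_at p0 q0 g 0 (cyclic_T k p q i b' n').1.
have [h1 f1] := hv (~~ i); have [h2 g1] := hw (~~ i).
have [t [tP ht]] := int_mod_per i (b' - b); have [t' [tP' ht']] := int_mod_per i (b - b').
have [c [e [ev _]]] := Tq_homog nP' tP ht h1.
have [c' [e' [ew _]]] := Tq_homog nP tP' ht' h2.
rewrite ev in f1; rewrite ew in g1; apply: (comp_T_zero f1 g1).
have [r hr] := ht; have [r' hr'] := ht'.
have [t0|tN0] := eqVneq t 0%N; last first.
  apply: Or31; apply: leq_trans nP _; suff -> : (t + t')%N = per i by [].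
  have : (t + t')%N%:Z = - (r + r') * (per i)%:Z by rewrite mulNr mulrDl; lia.
  have : (0 < t + t')%N by lia.
  have : (t + t' < per i + per i)%N by lia.
  move=> u1 u2 u3; have : - (r + r') = 1 by nia.
  by move=> u4; rewrite u4 mul1r in u3; lia.
have t'0 : t' = 0%N.
  have u3 : t'%:Z = - (r + r') * (per i)%:Z by rewrite mulNr mulrDl; lia.
  have : - (r + r') = 0 by nia.
  by move=> u4; rewrite u4 mul0r in u3; lia.
rewrite t0 in f1; rewrite t'0 in g1.
have [->|c0] := eqVneq c 0; first exact: Or32.
have [->|c0'] := eqVneq c' 0; first exact: Or33.
have n1 := map_T_len f1 c0; have n2 := map_T_len g1 c0'.
case: ne; split; last by apply/eqP; rewrite eqn_leq n1 n2.
by exists r; rewrite hr t0 add0r.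
Qed.

Lemma orth_sym (X Z : coh) : brick X -> brick Z -> orth X Z -> ~ iso X Z.
Proof.
move=> [zX _] _ o [f [g [h1 h2]]]; apply: zX.
exact: (qeq_trans p0 q0 (qeq_sym p0 q0 h1) (o f g)).
Qed.

Lemma surB_div (X : coh) d N (u m1 m2 : X) : homog (d + ee true *+ N + ee false *+ N) u ->
  u = xv true ^+ N *: m1 + xv false ^+ N *: m2 ->
  exists K m1 m2, [/\ homog (d + ee true *+ (N + K)) m1,
    homog (d + ee false *+ (N + K)) m2 &
    (xv true ^+ K * xv false ^+ K) *: u =
      xv false ^+ (N + K) *: m1 - xv true ^+ (N + K) *: m2].
Proof.
move=> hu e; exists 0%N, (hc (d + ee true *+ N) m2), (- hc (d + ee false *+ N) m1).
rewrite addn0 !expr0 mulr1 scale1r; split; [exact: hom_hc|exact/homN/hom_hc|].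
have E1 : hc (d + ee true *+ N + ee false *+ N) (xv true ^+ N *: m1) =
    xv true ^+ N *: hc (d + ee false *+ N) m1 by rewrite addrAC hcX.
by rewrite scalerN opprK -[LHS]hu e hcD E1 hcX addrC.
Qed.

(** The first cohomology of a line bundle is carried by the monomials divisible by neither [N]-th
    power; the hypothesis excludes them in the degree at hand. *)
Lemma surB_O (x d : L p q) : (forall N a b : nat,
    D p q true a b = x + d + ee true *+ N + ee false *+ N -> (N <= a)%N \/ (N <= b)%N) ->
  surB (O k x) d.
Proof.
move=> h N u hu.
have [f1 [f2 e]] := poly_trunc (u : S k) N.
rewrite big1 ?add0r in e; last first.
  move=> a _; rewrite big1 // => b _; have [->|nz] := eqVneq ((u : S k)`_a`_b) 0.
    by rewrite !polyC0 mul0r.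
  have hu' : Shc (x + (d + ee true *+ N + ee false *+ N)) (u : S k) = u by [].
  have := coefv_deg (i := true) hu' nz; rewrite !addrA => /h.
  by case; rewrite leqNgt ltn_ord.
have e' : (u : S k) = xv true ^+ N * f1 + xv false ^+ N * f2.
  by rewrite [X in _ = X + _]mulrC [X in _ = _ + X]mulrC.
exact: (@surB_div (O k x) d N u f1 f2 hu e').
Qed.

(** Torsion sheaves have no first cohomology: [K = n] already kills [u]. *)
Lemma surB_T i b n d : surB (Tq k p q i b n) d.
Proof.
move=> N u hu; exists n, 0, 0; rewrite !scaler0 subr0; split; [exact: hom0|exact: hom0|].
case: i u hu => u hu; first by rewrite mulrC -scalerA Tq_kill scaler0.
by rewrite -scalerA Tq_kill scaler0.
Qed.

Lemma surV_div (X : coh) i d n N (u m : X) : homog (d + ee i *+ n + ee (~~ i) *+ N) u ->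
  u = xv i ^+ n *: m ->
  exists K m, homog (d + ee (~~ i) *+ (N + K)) m /\ xv (~~ i) ^+ K *: u = xv i ^+ n *: m.
Proof.
move=> hu e; exists 0%N, (hc (d + ee (~~ i) *+ N) m); rewrite addn0 expr0 scale1r.
by split; [exact: hom_hc|rewrite -hcX addrAC -e hu].
Qed.

Lemma surV_O i (x d : L p q) n : (forall N a b : nat,
    D p q i a b = x + d + ee i *+ n + ee (~~ i) *+ N -> (n <= a)%N) ->
  surV (O k x) i d n.
Proof.
move=> h N u hu.
have [m em] : exists m : S k, (u : S k) = xv i ^+ n * m.
  apply/div_coefv => a b an; apply: contrapT => /eqP nz.
  have hu' : Shc (x + (d + ee i *+ n + ee (~~ i) *+ N)) (u : S k) = u by [].
  by have := coefv_deg hu' nz; rewrite !addrA => /h; rewrite leqNgt an.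
exact: (surV_div (m := (m : O k x)) hu em).
Qed.

Lemma surV_T i b n d n' : (forall N (a c : nat),
    D p q i a c = ee i *~ b + d + ee i *+ n + ee (~~ i) *+ N -> (a < n')%N -> (n <= a)%N) ->
  surV (Tq k p q i b n') i d n.
Proof.
move=> h N u hu.
have hg := (cyclic_T k p q i b n').1.
have [s0 es0] := (cyclic_T k p q i b n').2 u.
pose y : L p q := d + ee i *+ n + ee (~~ i) *+ N - - (ee i *~ b).
have [s [hs es]] : exists s, Shc y s = s /\ u = s *: Tgen k p q i b n'.
  exists (Shc y s0); split; first by rewrite Shc_proj eqxx.
  by rewrite -[u]hu es0 (hcZ _ _ hg).
have hz a c : (a < n')%N -> (a < n)%N -> coefv i s a c = 0.
  move=> an' an; apply: contrapT => /eqP nz; have := coefv_deg hs nz.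
  rewrite /y opprK [_ + ee i *~ b]addrC !addrA => /h/(_ an').
  by rewrite leqNgt an.
have [nn'|nn'] := leqP n n'.
  have [m em] : exists m : S k, s = xv i ^+ n * m.
    by apply/div_coefv => a c an; apply: hz => //; apply: leq_trans nn'.
  by apply: (surV_div (m := m *: Tgen k p q i b n') hu); rewrite es em scalerA.
apply: (surV_div (m := 0) hu); rewrite scaler0 es; apply/Tgen_eq0/div_coefv => a c an.
by apply: hz => //; apply: ltn_trans nn'.
Qed.

Lemma surV_T' i b n' d n : surV (Tq k p q (~~ i) b n') i d n.
Proof.
move=> N u hu; exists n', 0; split; first exact: hom0.
by rewrite Tq_kill scaler0.
Qed.

Lemma surV_dsum (X Y : coh) i d n : surV X i d n -> surV Y i d n -> surV (dsum X Y) i d n.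
Proof.
move=> sX sY N [u v] [hu hv].
have [K1 [m1 [h1 e1]]] := sX N u hu; have [K2 [m2 [h2 e2]]] := sY N v hv.
exists (K1 + K2)%N, (xv (~~ i) ^+ K2 *: m1, xv (~~ i) ^+ K1 *: m2); split.
  congr pair.
    by rewrite addnA mulrnDr addrA; apply: hom_xv.
  by rewrite [(K1 + K2)%N]addnC addnA mulrnDr addrA; apply: hom_xv.
congr pair => /=.
  by rewrite addnC exprD -scalerA e1 !scalerA mulrC.
by rewrite exprD -scalerA e2 !scalerA mulrC.
Qed.

Lemma surB_dsum (X Y : coh) d : surB X d -> surB Y d -> surB (dsum X Y) d.
Proof.
move=> sX sY N [u v] [hu hv].
have [K1 [m1 [n1 [h1 g1 e1]]]] := sX N u hu; have [K2 [m2 [n2 [h2 g2 e2]]]] := sY N v hv.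
exists (K1 + K2)%N, (xv true ^+ K2 *: m1, xv true ^+ K1 *: m2),
  (xv false ^+ K2 *: n1, xv false ^+ K1 *: n2); split.
- congr pair.
    by rewrite addnA mulrnDr addrA; apply: hom_xv.
  by rewrite [(K1 + K2)%N]addnC addnA mulrnDr addrA; apply: hom_xv.
- congr pair.
    by rewrite addnA mulrnDr addrA; apply: hom_xv.
  by rewrite [(K1 + K2)%N]addnC addnA mulrnDr addrA; apply: hom_xv.
- congr pair => /=.
    transitivity ((xv true ^+ K2 * xv false ^+ K2) *: ((xv true ^+ K1 * xv false ^+ K1) *: u)).
      by mring.
    by rewrite e1 scalerBr; congr (_ - _); mring.
  transitivity ((xv true ^+ K1 * xv false ^+ K1) *: ((xv true ^+ K2 * xv false ^+ K2) *: v)).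
    by mring.
  by rewrite e2 scalerBr; congr (_ - _); mring.
Qed.

Lemma surB_zero d : surB (zero_sheaf k p q) d.
Proof. by move=> N u _; exists 0%N, 0, 0; split; [exact: hom0|exact: hom0|exact: triv_eq]. Qed.

Lemma surV_zero i d n : surV (zero_sheaf k p q) i d n.
Proof. by move=> N u _; exists 0%N, 0; split; [exact: hom0|exact: triv_eq]. Qed.

End Computations.

(** * Direct sums of bricks *)

Section KrullSchmidt.
Context (k : closedFieldType) (p q : nat) (p0 : (0 < p)%N) (q0 : (0 < q)%N).
Local Notation coh := (coh k p q).

(** Equality of morphisms in the quotient is [qeq], so identities between composites are proved by
    setoid rewriting. *)
Local Instance qeq_equivalence (M N : coh) : RelationClasses.Equivalence (@qeq k p q M N).
Proof.
split; [move=> f|move=> f g|move=> f g h].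
- exact: qeq_refl.
- exact: qeq_sym.
- exact: qeq_trans.
Qed.

Local Instance qcomp_proper (M N P : coh) :
  Morphisms.Proper (Morphisms.respectful (@qeq k p q N P)
    (Morphisms.respectful (@qeq k p q M N) (@qeq k p q M P))) (@qcomp k p q M N P).
Proof. by move=> g g' eg f f' ef; apply: qcomp_congr. Qed.

Local Hint Extern 0 (qeq _ _) => exact (qeq_refl p0 q0 _) : core.

Let cA (M N P R : coh) (f : qhom M N) (g : qhom N P) (h : qhom P R) :
  qeq (qcomp h (qcomp g f)) (qcomp (qcomp h g) f).
Proof. exact: qcompA. Qed.

Let cidl (M N : coh) (f : qhom M N) : qeq (qcomp (qid N) f) f.
Proof. exact: qcomp_idl. Qed.

Let cidr (M N : coh) (f : qhom M N) : qeq (qcomp f (qid M)) f.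
Proof. exact: qcomp_idr. Qed.

Lemma qsub_rel (M N : coh) (f g : qhom M N) :
  qrel (fun m n => exists n1 n2, [/\ f m n1, g m n2 & n = n1 - n2]).
Proof.
split.
- by exists 0, 0; rewrite subrr; split=> //; apply: graph0.
- move=> s m n m' n' [a [b [h1 h2 ->]]] [c [d [h3 h4 ->]]].
  exists (s *: a + c), (s *: b + d); rewrite scalerBr opprD addrACA.
  by split=> //; apply: graph_lin.
- move=> x m n [a [b [h1 h2 ->]]]; exists (hc x a), (hc x b); rewrite hcB.
  by split=> //; apply: graph_hc.
- move=> m; have [N1 h] := ev_and (dom_submod f) (dom_submod g) (qdom p0 q0 f m) (qdom p0 q0 g m).
  by exists N1 => i; have [[a ha] [b hb]] := h i; exists (a - b), a, b.
- move=> n [a [b [h1 h2 ->]]]; apply: nullB; first exact: (qind p0 q0 h1).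
  exact: (qind p0 q0 h2).
Qed.

Definition qsub (M N : coh) (f g : qhom M N) : qhom M N := mkq (qsub_rel f g).

Local Instance qsub_proper (M N : coh) :
  Morphisms.Proper (Morphisms.respectful (@qeq k p q M N)
    (Morphisms.respectful (@qeq k p q M N) (@qeq k p q M N))) (@qsub M N).
Proof.
move=> f f' /(qeqP p0 q0) ef g g' /(qeqP p0 q0) eg; apply/(qeqP p0 q0).
move=> m _ _ [a [b [h1 h2 ->]]] [c [d [h3 h4 ->]]].
rewrite opprD addrACA -opprD; apply: nullB; first exact: ef h1 h3.
exact: eg h2 h4.
Qed.

Lemma qsub_eq0 (M N : coh) (f g : qhom M N) : qeq (qsub f g) (qzero M N) <-> qeq f g.
Proof.
split=> [/(qeq0P p0 q0) h|/(qeqP p0 q0) h].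
  by apply/(qeqP p0 q0) => m n n' h1 h2; apply: (h m); exists n, n'.
by apply/(qeq0P p0 q0) => m _ [a [b [h1 h2 ->]]]; apply: h h1 h2.
Qed.

Lemma qsub0 (M N : coh) (f : qhom M N) : qeq (qsub f (qzero M N)) f.
Proof.
apply/(qeqP p0 q0) => m _ n' [a [b [h1 -> ->]]] h2; rewrite subr0.
exact: (qval p0 q0 h1 h2).
Qed.

Lemma qcomp0r (M N P : coh) (f : qhom N P) : qeq (qcomp f (qzero M N)) (qzero M P).
Proof. by apply/(qeq0P p0 q0) => m n [l [-> h]]; apply: (qind p0 q0 h). Qed.

Lemma qcomp0l (M N P : coh) (f : qhom M N) : qeq (qcomp (qzero N P) f) (qzero M P).
Proof. by apply/(qeq0P p0 q0) => m n [l [_ ->]]; apply: null0. Qed.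

Lemma qcompBr (M N P : coh) (f g : qhom M N) (h : qhom N P) :
  qeq (qcomp h (qsub f g)) (qsub (qcomp h f) (qcomp h g)).
Proof.
apply/(qeqP p0 q0) => m n _ [_ [[a [b [h1 h2 ->]]] h3]] [c [d [[c' [h4 h5]] [d' [h6 h7]] ->]]].
apply: (qnull2 p0 q0 h3 (graph_sub h5 h7)).
rewrite opprD addrACA -opprD; apply: nullB; first exact: (qval p0 q0 h1 h4).
exact: (qval p0 q0 h2 h6).
Qed.

Lemma qcompBl (M N P : coh) (f : qhom M N) (g h : qhom N P) :
  qeq (qcomp (qsub g h) f) (qsub (qcomp g f) (qcomp h f)).
Proof.
apply/(qeqP p0 q0) => m _ _ [l [h1 [a [b [h2 h3 ->]]]]] [c [d [[c' [h4 h5]] [d' [h6 h7]] ->]]].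
rewrite opprD addrACA -opprD; apply: nullB.
  exact: (qnull2 p0 q0 h2 h5 (qval p0 q0 h1 h4)).
exact: (qnull2 p0 q0 h3 h7 (qval p0 q0 h1 h6)).
Qed.

Lemma gfun_inl (M N : coh) : @gfun k p q M (dsum M N) (fun m => (m, 0)).
Proof. by split=> *; congr pair; rewrite ?addr0 ?scaler0 ?hc0. Qed.
Lemma gfun_inr (M N : coh) : @gfun k p q N (dsum M N) (fun m => (0, m)).
Proof. by split=> *; congr pair; rewrite ?addr0 ?scaler0 ?hc0. Qed.
Lemma gfun_fst (M N : coh) : @gfun k p q (dsum M N) M (fun m => m.1).
Proof. by []. Qed.
Lemma gfun_snd (M N : coh) : @gfun k p q (dsum M N) N (fun m => m.2).
Proof. by []. Qed.

Definition qinl (M N : coh) : qhom M (dsum M N) := qfun (gfun_inl M N).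
Definition qinr (M N : coh) : qhom N (dsum M N) := qfun (gfun_inr M N).
Definition qfst (M N : coh) : qhom (dsum M N) M := qfun (gfun_fst M N).
Definition qsnd (M N : coh) : qhom (dsum M N) N := qfun (gfun_snd M N).

Lemma fst_inl (M N : coh) : qeq (qcomp (qfst M N) (qinl M N)) (qid M).
Proof. by apply/(qeqP p0 q0) => m _ _ [_ [-> ->]] -> /=; rewrite subrr; apply: null0. Qed.
Lemma snd_inr (M N : coh) : qeq (qcomp (qsnd M N) (qinr M N)) (qid N).
Proof. by apply/(qeqP p0 q0) => m _ _ [_ [-> ->]] -> /=; rewrite subrr; apply: null0. Qed.
Lemma fst_inr (M N : coh) : qeq (qcomp (qfst M N) (qinr M N)) (qzero N M).
Proof. by apply/(qeq0P p0 q0) => m _ [_ [-> ->]]; apply: null0. Qed.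
Lemma dsum_id (M N : coh) :
  qeq (qsub (qid (dsum M N)) (qcomp (qinl M N) (qfst M N))) (qcomp (qinr M N) (qsnd M N)).
Proof.
apply/(qeqP p0 q0) => m _ _ [_ [_ [-> [_ [-> ->]] ->]]] [_ [-> ->]].
case: m => a b; rewrite (_ : _ - _ = 0); first exact: null0.
by congr pair => /=; rewrite ?subrr ?subr0 ?subrr.
Qed.

(** The identity of the direct sum, split into its two projectors, is inserted between [g] and
    [f]. *)
Lemma dsum_decomp (M N P R : coh) (f : qhom (dsum M N) P) (g : qhom R (dsum M N)) :
  qeq (qsub (qcomp f g) (qcomp (qcomp f (qinl M N)) (qcomp (qfst M N) g)))
      (qcomp (qcomp f (qinr M N)) (qcomp (qsnd M N) g)).
Proof.
have e := dsum_id M N.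
transitivity (qcomp (qcomp f (qsub (qid (dsum M N)) (qcomp (qinl M N) (qfst M N)))) g).
  rewrite qcompBr qcompBl.
  have -> : qeq (qcomp f (qid _)) f by apply: cidr.
  by rewrite !cA.
by rewrite e !cA.
Qed.

Lemma orth_dsum (X A B : coh) : orth X A -> orth X B -> orth X (dsum A B).
Proof.
move=> oA oB f g; have := dsum_decomp g f.
by rewrite (oA _ _) (oB _ _) qsub0.
Qed.

Lemma orth_zero (X : coh) : orth X (zero_sheaf k p q).
Proof.
apply: orth_Hom1 => // f; apply/(qeq0P p0 q0) => m n _.
by rewrite (triv_eq n 0); apply: null0.
Qed.

Local Notation Z0 := (zero_sheaf k p q).

Fixpoint bin (s : seq coh) (d : nat) : qhom (nth Z0 s d) (big_dsum s) :=
  match s, d return qhom (nth Z0 s d) (big_dsum s) with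
  | [::], d => qzero _ _
  | X :: s', 0%N => qinl X (big_dsum s')
  | X :: s', d'.+1 => qcomp (qinr X (big_dsum s')) (bin s' d')
  end.

Fixpoint bpr (s : seq coh) (d : nat) : qhom (big_dsum s) (nth Z0 s d) :=
  match s, d return qhom (big_dsum s) (nth Z0 s d) with
  | [::], d => qzero _ _
  | X :: s', 0%N => qfst X (big_dsum s')
  | X :: s', d'.+1 => qcomp (bpr s' d') (qsnd X (big_dsum s'))
  end.

Definition pairwise_orth (s : seq coh) : Prop :=
  forall i j, (i < size s)%N -> (j < size s)%N -> i <> j -> orth (nth Z0 s i) (nth Z0 s j).

Lemma pairwise_orth_behead (X : coh) s : pairwise_orth (X :: s) -> pairwise_orth s.
Proof. by move=> h i j hi hj ij; apply: (h i.+1 j.+1) => // -[]. Qed.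

Lemma orth_big_dsum (X : coh) s : (forall j, (j < size s)%N -> orth X (nth Z0 s j)) -> orth X (big_dsum s).
Proof.
elim: s => [|Y s IH] h; first exact: orth_zero.
apply: orth_dsum; first exact: (h 0%N).
by apply: IH => j hj; apply: (h j.+1).
Qed.

(** The other summands contribute round trips through sheaves orthogonal to the [d]-th, which
    vanish. *)
Lemma off_diag s d (f : qhom (big_dsum s) (nth Z0 s d)) (g : qhom (nth Z0 s d) (big_dsum s)) :
  pairwise_orth s -> (d < size s)%N ->
  qeq (qcomp f g) (qcomp (qcomp f (bin s d)) (qcomp (bpr s d) g)).
Proof.
elim: s d f g => [|X s IH] [|d] f g po ds //=.
  apply/qsub_eq0; rewrite dsum_decomp.
  by apply: orth_big_dsum => j hj; apply: (po 0%N j.+1).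
have := dsum_decomp f g.
have -> : qeq (qcomp (qcomp f (qinl _ _)) (qcomp (qfst _ _) g)) (qzero _ _).
  exact: (po d.+1 0%N).
rewrite qsub0 => ->; rewrite (IH d) //; last exact: pairwise_orth_behead po.
by rewrite !cA.
Qed.

(** Eliminating the first summand leaves the Schur complement of [h22]. Its diagonal entries are
    still identities, because the correction [h21 h12] contributes round trips through [X].
    Induction then makes [f] vanish. *)
Lemma elim_diag s (Y : coh) (f : qhom Y (big_dsum s)) (h : qhom (big_dsum s) (big_dsum s)) :
  pairwise_orth s ->
  (forall d, (d < size s)%N -> qeq (qcomp (bpr s d) (qcomp h (bin s d))) (qid _)) ->
  qeq (qcomp h f) (qzero _ _) -> qeq f (qzero _ _).
Proof.
elim: s f h => [|X s IH] f h po hd hf /=.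
  by apply/(qeq0P p0 q0) => m n _; rewrite (triv_eq n 0); apply: null0.
set T := big_dsum s in f h hf hd *.
pose f1 := qcomp (qfst X T) f; pose f2 := qcomp (qsnd X T) f.
pose h12 := qcomp (qfst X T) (qcomp h (qinr X T)).
pose h21 := qcomp (qsnd X T) (qcomp h (qinl X T)).
pose h22 := qcomp (qsnd X T) (qcomp h (qinr X T)).
have e1 : qeq (qsub (qzero _ _) f1) (qcomp h12 f2).
  have := dsum_decomp (qcomp (qfst X T) h) f.
  rewrite -[X in qsub X _]cA hf qcomp0r.
  have -> : qeq (qcomp (qcomp (qfst X T) h) (qinl X T)) (qid X).
    by rewrite -cA; apply: (hd 0%N).
  by rewrite cidl -[X in qcomp X (qcomp (qsnd _ _) _)]cA.
have e2 : qeq (qsub (qzero _ _) (qcomp h21 f1)) (qcomp h22 f2).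
  have := dsum_decomp (qcomp (qsnd X T) h) f.
  rewrite -[X in qsub X _]cA hf qcomp0r.
  by rewrite -[X in qcomp X (qcomp (qfst _ _) _)]cA -[X in qcomp X (qcomp (qsnd _ _) _)]cA.
have e3 : qeq (qcomp (qsub h22 (qcomp h21 h12)) f2) (qzero _ _).
  rewrite qcompBl; apply/qsub_eq0; rewrite -e2 -cA -e1 qcompBr.
  by rewrite qcomp0r.
have f20 : qeq f2 (qzero _ _).
  apply: (IH f2 _ (pairwise_orth_behead po) _ e3) => d ds.
  rewrite qcompBl qcompBr.
  have -> : qeq (qcomp (bpr s d) (qcomp (qcomp h21 h12) (bin s d))) (qzero _ _).
    rewrite -(cA (bin s d) h12 h21) (cA (qcomp h12 (bin s d)) h21 (bpr s d)).
    by apply: (po d.+1 0%N).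
  rewrite qsub0; have := hd d.+1 ds => /= <-.
  by rewrite /h22 !cA.
have f10 : qeq f1 (qzero _ _).
  by symmetry; apply/qsub_eq0; rewrite e1 f20 qcomp0r.
have := dsum_decomp (qid (dsum X T)) f.
by rewrite -/f1 -/f2 f10 f20 !qcomp0r qsub0 cidl.
Qed.

Lemma qscal_comp (M N : coh) (f : qhom M N) c : qeq (qcomp (qscal N c) f) (qcomp f (qscal M c)).
Proof.
apply/(qeqP p0 q0) => m _ n [l [h1 ->]] [_ [-> h2]].
exact: (qval p0 q0 (graphZ _ h1) h2).
Qed.

Lemma qscalM (M : coh) c d : qeq (qcomp (qscal M c) (qscal M d)) (qscal M (c * d)).
Proof.
apply/(qeqP p0 q0) => m _ _ [_ [-> ->]] ->.
by rewrite scalkA subrr; apply: null0.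
Qed.

Lemma qscal_eq (M : coh) c d : ~ is_zero M -> qeq (qscal M c) (qscal M d) -> c = d.
Proof.
move=> nz /(qeqP p0 q0) h; apply: contrapT => /eqP; rewrite -subr_eq0 => cd.
apply: nz; apply/(is_zeroP p0 q0) => m.
have := nullZ ((c - d)^-1%:P%:P) (h m _ _ (erefl _) (erefl _)).
have -> : scalk c m - scalk d m = scalk (c - d) m by rewrite /scalk !polyCB scalerBl.
by rewrite -/(scalk _ _) scalkA mulVf // /scalk !polyC1 scale1r.
Qed.

Lemma qscal0 (M : coh) : qeq (qscal M 0) (qzero M M).
Proof.
by apply/(qeq0P p0 q0) => m _ ->; rewrite /scalk !polyC0 scale0r; apply: null0.
Qed.

Lemma qscal_inj (M : coh) c : c != 0 -> qeq (qscal M c) (qzero M M) -> is_zero M.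
Proof.
by move=> c0 h; apply: contrapT => nz; move: c0; rewrite (@qscal_eq M c 0) ?eqxx // qscal0.
Qed.

Lemma bpr_bin s d : (d < size s)%N -> qeq (qcomp (bpr s d) (bin s d)) (qid _).
Proof.
elim: s d => [|X s IH] [|d] //= ds; first exact: fst_inl.
rewrite -cA (cA (bin s d) (qinr _ _) (qsnd _ _)).
by rewrite snd_inr cidl; apply: IH.
Qed.

(** On each brick the diagonal entries are scalars. The relations between the two copies of [Y] give
    [c11 c22 = 0] and [c11 = c12 c21 = c22], so the idempotent [a1 b1] has zero diagonal. Then
    [1 - a1 b1] has no kernel by [elim_diag], yet it kills [a1]. *)
Lemma multiplicity_free_bricks s : pairwise_orth s ->
  (forall d, (d < size s)%N -> brick (nth Z0 s d)) -> multiplicity_free (big_dsum s).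
Proof.
move=> po hb Y Z [u [v [vu uv]]]; set T := big_dsum s in u v vu uv.
pose a1 := qcomp v (qcomp (qinl (dsum Y Y) Z) (qinl Y Y)).
pose a2 := qcomp v (qcomp (qinl (dsum Y Y) Z) (qinr Y Y)).
pose b1 := qcomp (qcomp (qfst Y Y) (qfst (dsum Y Y) Z)) u.
pose b2 := qcomp (qcomp (qsnd Y Y) (qfst (dsum Y Y) Z)) u.
have ba (r : qhom (dsum Y Y) Y) (t : qhom Y (dsum Y Y)) :
    qeq (qcomp (qcomp (qcomp r (qfst (dsum Y Y) Z)) u) (qcomp v (qcomp (qinl (dsum Y Y) Z) t)))
        (qcomp r t).
  rewrite -(cA _ u) (cA _ v u) uv cidl.
  by rewrite -(cA _ _ r) (cA t) fst_inl cidl.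
have b11 : qeq (qcomp b1 a1) (qid Y) by rewrite ba fst_inl.
have b12 : qeq (qcomp b1 a2) (qzero Y Y) by rewrite ba fst_inr.
have b22 : qeq (qcomp b2 a2) (qid Y) by rewrite ba snd_inr.
have key d : (d < size s)%N ->
    qeq (qcomp (bpr s d) (qcomp (qcomp a1 b1) (bin s d))) (qzero _ _).
  move=> ds; have [nz br] := hb d ds.
  pose l (a : qhom Y T) (b : qhom T Y) := qcomp (qcomp (bpr s d) a) (qcomp b (bin s d)).
  have [c11 e11] := br (l a1 b1); have [c22 e22] := br (l a2 b2).
  have [c12 e12] := br (l a1 b2); have [c21 e21] := br (l a2 b1).
  have E (a a' : qhom Y T) (b b' : qhom T Y) :
     qeq (qcomp (qcomp (bpr s d) a) (qcomp (qcomp b a') (qcomp b' (bin s d))))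
       (qcomp (l a b) (l a' b')).
    transitivity (qcomp (qcomp (qcomp (bpr s d) a) b) (qcomp a' (qcomp b' (bin s d)))).
      by rewrite !cA.
    by rewrite off_diag // /l !cA.
  have z1 : c11 * c22 = 0.
    apply: (qscal_eq nz); rewrite -qscalM -e11 -e22 -E b12 qcomp0l qcomp0r.
    by rewrite qscal0.
  have z2 : c11 = c12 * c21.
    by apply: (qscal_eq nz); rewrite -qscalM -e12 -e21 -E b22 cidl -e11.
  have z3 : c22 = c21 * c12.
    by apply: (qscal_eq nz); rewrite -qscalM -e12 -e21 -E b11 cidl -e22.
  have : c11 = 0.
    by move: z1; rewrite z3 [c21 * _]mulrC -z2 => /eqP; rewrite mulf_eq0 orbb => /eqP.
  move=> c0; move: e11; rewrite c0 qscal0 /l => <-.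
  by rewrite !cA.
have hz : qeq a1 (qzero _ _).
  apply: (@elim_diag s Y a1 (qsub (qid T) (qcomp a1 b1))) => //.
    move=> d ds; rewrite qcompBl qcompBr key // qsub0 cidl.
    exact: bpr_bin.
  by rewrite qcompBl; apply/qsub_eq0; rewrite cidl -cA b11 cidr.
by rewrite /is_zero -b11 hz qcomp0r.
Qed.

(** The projector onto [Y], transported to [X], is a scalar [c]; transported back, [c] acts as 1 on
    [Y] and as 0 on [Z]. *)
Lemma brick_indecomposable (X : coh) : brick X -> indecomposable X.
Proof.
move=> [nz br]; split=> // Y Z [u [v [vu uv]]].
have [c ec] := br (qcomp v (qcomp (qcomp (qinl Y Z) (qfst Y Z)) u)).
have E (W : coh) (t : qhom W (dsum Y Z)) (r : qhom (dsum Y Z) W) :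
   qeq (qcomp r (qcomp (qcomp (qinl Y Z) (qfst Y Z)) t)) (qcomp (qscal W c) (qcomp r t)).
  transitivity (qcomp (qcomp r u) (qcomp (qscal X c) (qcomp v t))).
    rewrite -ec -!cA (cA t v u) uv cidl.
    by rewrite (cA _ v u) uv cidl.
  rewrite cA -qscal_comp -!cA (cA t v u) uv cidl.
  by [].
have [c0|c0] := eqVneq c 0.
  left; have := E Y (qinl Y Z) (qfst Y Z).
  rewrite c0 qscal0 qcomp0l -cA fst_inl cidr fst_inl => h.
  exact: h.
right; apply: (qscal_inj c0).
have := E Z (qinr Y Z) (qsnd Y Z).
rewrite snd_inr cidr -cA fst_inr !qcomp0r => <-.
by [].
Qed.

Lemma gfun_iso (M N : coh) (f : M -> N) (g : N -> M) : gfun f -> cancel f g -> cancel g f -> iso M N.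
Proof.
move=> gf fg gf'; exists (qfun gf); apply/(is_isoP p0 q0); split=> [m _ -> |n].
  move=> [a ha]; exists a => i; have [_ fZ _] := gf; have := ha i.
  rewrite -fZ => /(congr1 g); rewrite fg => ->.
  have f0 : f 0 = 0 by rewrite -(scale0r (0 : M)) fZ scale0r.
  by rewrite -f0 fg.
by exists 0%N => i; exists (g (xv i ^+ 0 *: n)); rewrite /= gf'.
Qed.

Lemma iso_dsum (A A' B B' : coh) : iso A A' -> iso B B' -> iso (dsum A B) (dsum A' B').
Proof.
move=> [f /(is_isoP p0 q0)[jf sf]] [g /(is_isoP p0 q0)[jg sg]].
have nd (M N : coh) (u : dsum M N) : null u <-> null u.1 /\ null u.2.
  split=> [[a ha]|[[a ha] [b hb]]].
    by split; exists a => i; have := ha i; case: u {ha} => m n [].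
  exists (a + b)%N => i; case: u ha hb => m n /= ha hb; congr pair => /=.
    by rewrite addnC exprD -scalerA ha scaler0.
  by rewrite exprD -scalerA hb scaler0.
have hr : @qrel k p q (dsum A B) (dsum A' B') (fun u v => f u.1 v.1 /\ g u.2 v.2).
  split.
  - by split; apply: graph0.
  - by move=> s m n m' n' [h1 h2] [h3 h4]; split; apply: graph_lin.
  - by move=> x m n [h1 h2]; split; apply: graph_hc.
  - move=> [m n]; have [a ha] := qdom p0 q0 f m; have [b hb] := qdom p0 q0 g n.
    exists (a + b)%N => i; have [m' hm] := ha i; have [n' hn] := hb i.
    exists (xv i ^+ b *: m', xv i ^+ a *: n'); split => /=.
      by rewrite addnC exprD -scalerA; apply: graphZ.
    by rewrite exprD -scalerA; apply: graphZ.
  - by move=> v [h1 h2]; apply/nd; split; [apply: (qind p0 q0 h1)|apply: (qind p0 q0 h2)].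
exists (mkq hr); apply/(is_isoP p0 q0); split.
  by move=> u v [h1 h2] /nd[h3 h4]; apply/nd; split; [apply: jf h1 h3|apply: jg h2 h4].
move=> [m n]; have [a ha] := sf m; have [b hb] := sg n.
exists (a + b)%N => i; have [m' hm] := ha i; have [n' hn] := hb i.
exists (xv i ^+ b *: m', xv i ^+ a *: n'); split => /=.
  by rewrite addnC exprD -scalerA; apply: graphZ.
by rewrite exprD -scalerA; apply: graphZ.
Qed.

Lemma dsumC (A B : coh) : iso (dsum A B) (dsum B A).
Proof.
by apply: (@gfun_iso (dsum A B) (dsum B A) (fun u => (u.2, u.1)) (fun u => (u.2, u.1))) => [|[]|[]].
Qed.

Lemma dsumA (A B C : coh) : iso (dsum A (dsum B C)) (dsum (dsum A B) C).
Proof.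
by apply: (@gfun_iso (dsum A (dsum B C)) (dsum (dsum A B) C)
  (fun u => ((u.1, u.2.1), u.2.2)) (fun u => (u.1.1, (u.1.2, u.2)))) => [|[a [b c]]|[[a b] c]].
Qed.

Lemma big_dsum_remove (s1 s2 : seq coh) X :
  iso (big_dsum (s1 ++ X :: s2)) (dsum (big_dsum (s1 ++ s2)) X).
Proof.
elim: s1 => [|Y s1 IH] /=; first exact: dsumC.
apply: (iso_trans p0 q0 (iso_dsum (iso_refl p0 q0 Y) IH)); exact: dsumA.
Qed.

Lemma big_dsum_iso (T : Type) (F F' : T -> coh) (s : seq T) :
  (forall x, iso (F x) (F' x)) -> iso (big_dsum (map F s)) (big_dsum (map F' s)).
Proof.
move=> h; elim: s => [|x s IH] /=; first exact: iso_refl.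
exact: iso_dsum.
Qed.

Lemma Hom_zero_iso (A A' X : coh) : iso A A' -> Hom_zero A X -> Hom_zero A' X.
Proof.
move=> [f [g [gf fg]]] h u; rewrite -(cidr u) -fg cA.
by rewrite (h (qcomp u f)) qcomp0l.
Qed.

Lemma Ext1_zero_iso1 (A A' X : coh) : iso A A' -> Ext1_zero A X -> Ext1_zero A' X.
Proof.
move=> [f [g [gf fg]]] h E i c /(short_exactP p0 q0)[ji sc [ex1 ex2]].
have [jg sg] : inj g /\ sur g by apply/(is_isoP p0 q0); exists f.
apply: (h E i (qcomp g c)); apply/(short_exactP p0 q0); split=> //.
  exact: qcomp_sur.
split=> [m n l h1 [y [h2 h3]]|n l [y [h2 h3]] hl].
  by apply: (qnull p0 q0 h3); apply: ex1 h1 h2.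
by apply: ex2 h2 _; apply: jg h3 hl.
Qed.

Lemma Ext1_zero_iso2 (A X X' : coh) : iso X X' -> Ext1_zero A X -> Ext1_zero A X'.
Proof.
move=> [f [g [gf fg]]] h E i c /(short_exactP p0 q0)[ji sc [ex1 ex2]].
have [jf sf] : inj f /\ sur f by apply/(is_isoP p0 q0); exists g.
have [|r er] := h E (qcomp i f) c.
  apply/(short_exactP p0 q0); split=> //; first exact: qcomp_inj.
  split=> [m n l [y [h1 h2]] h3|n l h1 h2]; first exact: ex1 h2 h3.
  apply: ev_vars => [|j]; first exact: ran_submod.
  have [a /(_ j)[m hm]] := ex2 _ _ h1 h2; have [b /(_ j)[x hx]] := sf m.
  exists (b + a)%N, x, (xv j ^+ b *: m); split=> //.
  by rewrite exprD -scalerA; apply: graphZ.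
exists (qcomp f r).
have e : qeq (qcomp f (qcomp (qcomp r i) f)) (qcomp (qid X') f).
  by rewrite -cA er cidr cidl.
rewrite -(cidr (qcomp (qcomp f r) i)) -fg cA -(cA i r f) .
by rewrite -(cA f (qcomp r i) f) e -cA fg cidl.
Qed.

(** An extension of [A] becomes one of [dsum A B] by adding [B] to its middle term. *)
Lemma Ext1_zero_dsuml (A B X : coh) : Ext1_zero (dsum A B) X -> Ext1_zero A X.
Proof.
move=> h E i c /(short_exactP p0 q0)[ji sc [ex1 ex2]].
have nd (M N : coh) (u : dsum M N) : null u <-> null u.1 /\ null u.2.
  split=> [[a ha]|[[a ha] [b hb]]].
    by split; exists a => j; have := ha j; case: u {ha} => m n [].
  exists (a + b)%N => j; case: u ha hb => m n /= ha hb; congr pair => /=.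
    by rewrite addnC exprD -scalerA ha scaler0.
  by rewrite exprD -scalerA hb scaler0.
have hr : @qrel k p q (dsum E B) (dsum A B) (fun u v => c u.1 v.1 /\ v.2 = u.2).
  split.
  - by split=> //; apply: graph0.
  - by move=> s m n m' n' [h1 h2] [h3 h4]; split; [apply: graph_lin|rewrite /= h2 h4].
  - by move=> x m n [h1 h2]; split; [apply: graph_hc|rewrite /= h2].
  - move=> [m n]; have [a ha] := qdom p0 q0 c m; exists a => j.
    by have [m' hm] := ha j; exists (m', xv j ^+ a *: n).
  - move=> v [h1 h2]; apply/nd; split; first exact: (qind p0 q0 h1).
    by rewrite h2; apply: null0.
have [|r er] := h (dsum E B) (qcomp (qinl E B) i) (mkq hr).
  apply/(short_exactP p0 q0); split.
  - move=> x u [e [h1 ->]] /nd[h2 _]; exact: ji h1 h2.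
  - move=> [m n]; have [a ha] := sc m; exists a => j; have [m' hm] := ha j.
    by exists (m', xv j ^+ a *: n).
  - split=> [x _ l [e [h1 ->]] [h2 h3]|u l [h1 h2] /nd[h3 h4]].
      by apply/nd; split; [apply: ex1 h1 h2|rewrite h3; apply: null0].
    have [a ha] := ex2 _ _ h1 h3; have [b hb] := h4.
    exists (a + b)%N => j; have [x hx] := ha j; exists (xv j ^+ b *: x).
    exists (xv j ^+ (a + b) *: u.1); split.
      by rewrite addnC exprD -scalerA; apply: graphZ.
    congr pair => /=; by rewrite exprD -scalerA -h2 hb scaler0.
by exists (qcomp r (qinl E B)); rewrite -er cA.
Qed.

Lemma Hom_zero_dsuml (A B X : coh) : Hom_zero (dsum A B) X -> Hom_zero A X.
Proof.
move=> h f; have := h (qcomp f (qfst A B)) => e.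
by rewrite -(cidr f) -(fst_inl A B) cA e qcomp0l.
Qed.

Lemma perp_big_dsum (s : seq coh) (X : coh) : Hom_zero (big_dsum s) X -> Ext1_zero (big_dsum s) X ->
  forall d, (d < size s)%N -> Hom_zero (nth Z0 s d) X /\ Ext1_zero (nth Z0 s d) X.
Proof.
elim: s => [|Y s IH] //= h1 h2 [|d] ds /=.
  by split; [apply: Hom_zero_dsuml h1|apply: Ext1_zero_dsuml h2].
apply: IH => //.
  exact: Hom_zero_dsuml (Hom_zero_iso (dsumC _ _) h1).
exact: Ext1_zero_dsuml (Ext1_zero_iso1 (dsumC _ _) h2).
Qed.

Lemma tilting_iso (T T' : coh) : iso T T' -> tilting T -> tilting T'.
Proof.
move=> e [h1 h2 h3]; have e' := iso_sym e; split.
- exact: Ext1_zero_iso1 e (Ext1_zero_iso2 e h1).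
- move=> X a b; apply: h2; first exact: Hom_zero_iso e' a.
  exact: Ext1_zero_iso1 e' b.
- by move=> Y Z hY; apply: (h3 Y Z); apply: (iso_trans p0 q0 e hY).
Qed.

Lemma indecomposable_iso (X X' : coh) : iso X X' -> indecomposable X -> indecomposable X'.
Proof.
move=> e [nz h]; split; first by move=> z; apply: nz; apply: (is_zero_iso p0 q0 (iso_sym e) z).
by move=> Y Z hY; apply: h; apply: (iso_trans p0 q0 e hY).
Qed.

End KrullSchmidt.

(** * Uniserial torsion sheaves *)

Section Classification.
Context (k : closedFieldType) (p q : nat) (p0 : (0 < p)%N) (q0 : (0 < q)%N).
Local Notation coh := (coh k p q).

Definition multiples (X : coh) (w xi : X) : Prop := exists u : S k, null (xi - u *: w).

Lemma multiples_submod (X : coh) (w : X) : submod (multiples w).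
Proof.
split; first by exists 0; rewrite scale0r subr0; apply: null0.
move=> a m n [u hu] [v hv]; exists (a * u + v).
rewrite scalerDl -scalerA opprD addrACA -scalerBr.
by apply: nullD => //; apply: nullZ.
Qed.

(** The subsheaf generated by [w] is a line bundle modulo the elements annihilating [w] up to null
    elements; the graph absorbs null elements, so the range is exactly [multiples w]. *)
Lemma cyclic_sub (X : coh) d (w : X) : homog d w ->
  exists (C : coh) (f : qhom C X), mono f /\ forall xi, ran f xi <-> multiples w xi.
Proof.
move=> hw.
have sQ : submod (fun u : O k (- d) => null ((u : S k) *: w)).
  split; first by rewrite scale0r; apply: null0.
  move=> a u v hu hv.
  rewrite (_ : (a *: u + v : S k) *: w = a *: ((u : S k) *: w) + (v : S k) *: w).
    by apply: nullD => //; apply: nullZ.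
  by rewrite scalerA -scalerDl.
have hQ x (u : O k (- d)) : null ((u : S k) *: w) -> null ((hc x u : S k) *: w).
  by move=> h; rewrite hom_O addrC -(hcZ _ _ hw); apply: null_hc.
pose Q := @GSub k p q (O k (- d)) _ sQ hQ.
have hr : @qrel k p q (Quot Q) X (fun U xi => exists u : S k, U = cpi Q u /\ null (xi - u *: w)).
  split.
  - by exists 0; rewrite scale0r subr0 -(cpi0 Q); split=> //; apply: null0.
  - move=> s m n m' n' [u [-> hu]] [v [-> hv]]; exists (s * u + v); split.
      by rewrite -cpiZ -cpiD.
    rewrite scalerDl -scalerA opprD addrACA -scalerBr.
    by apply: nullD => //; apply: nullZ.
  - move=> x m n [u [-> hu]]; exists (Shc (x - d) u); split.
      by rewrite -cpi_hc hom_O addrC.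
    by rewrite -(hcZ _ _ hw) -hcB; apply: null_hc.
  - move=> U; exists 0%N => i; rewrite expr0 scale1r; have [u ->] := cpi_surj U.
    by exists ((u : S k) *: w), u; rewrite subrr; split=> //; apply: null0.
  - move=> n [u [/esym/cpi_eq0 h1 h2]]; rewrite -(subrK (u *: w) n).
    exact: nullD.
exists (Quot Q), (mkq hr); split.
  apply/(mono_injP p0 q0) => U xi [u [-> hu]] hxi; apply: (ev_in (@submod0 _ _ _ _)).
  by apply/cpi_eq0 => /=; rewrite -[u *: w](subKr xi); apply: nullB.
move=> xi; split=> [[U [u [_ hu]]]|[u hu]]; first by exists u.
by exists (cpi Q u), u.
Qed.

Lemma null_ev (X : coh) (P : X -> Prop) xi : submod P -> null xi -> ev P xi.
Proof. by move=> sP; apply: ev_sub => n ->; case: sP. Qed.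

Lemma ev_null_add (X : coh) (P : X -> Prop) xi eta : submod P ->
  null (xi - eta) -> ev P eta -> ev P xi.
Proof.
move=> sP hn he; rewrite -(subrK eta xi); apply: submodD; first exact: ev_submod.
  exact: null_ev.
exact: he.
Qed.

Lemma sub_le_ran (Y Z X : coh) (f : qhom Y X) (g : qhom Z X) :
  mono g -> sub_le f g <-> forall xi, ran f xi -> ev (ran g) xi.
Proof.
move=> /(mono_injP p0 q0) jg; split=> [[h /(qeqP p0 q0) e] xi [y hy]|H].
  apply: ev_vars => [|i]; first exact: ran_submod.
  have [a /(_ i)[eta [z [h1 h2]]]] := qdom p0 q0 (qcomp g h) y.
  have [b /(_ i) hb] : null (xv i ^+ a *: xi - eta).
    rewrite -opprB; apply: nullN; apply: e _ (graphZ _ hy).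
    by exists z.
  exists (b + a)%N, (xv i ^+ b *: z); move/eqP: hb; rewrite scalerBr subr_eq0 => /eqP hb.
  by rewrite exprD -scalerA hb; apply: graphZ.
have hr : qrel (fun (y : Y) (z : Z) => exists n, f y n /\ g z n).
  split.
  - by exists 0; split; apply: graph0.
  - by move=> s m n m' n' [l [a1 a2]] [l' [a3 a4]]; exists (s *: l + l'); split; apply: graph_lin.
  - by move=> x m n [l [a1 a2]]; exists (hc x l); split; apply: graph_hc.
  - move=> z; apply: ev_vars.
      split; first by exists 0, 0; split; apply: graph0.
      move=> a u v [m [n [a1 a2]]] [m' [n' [a3 a4]]].
      by exists (a *: m + m'), (a *: n + n'); split; apply: graph_lin.
    move=> i; have [a /(_ i)[l hl]] := qdom p0 q0 f z.
    have [b /(_ i)[m hm]] := H l (ex_intro (fun y => f y l) _ hl).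
    exists (b + a)%N, m, (xv i ^+ b *: l); split=> //.
    by rewrite exprD -scalerA; apply: graphZ.
  - by move=> m [n [a1 a2]]; apply: jg a2 (qind p0 q0 a1).
exists (mkq hr); apply/(qeqP p0 q0) => y n n' [z [[l [h1 h2]] h3]] h4.
rewrite -(subrKA l); apply: nullD; [exact: (qval p0 q0 h3 h2)|exact: (qval p0 q0 h1 h4)].
Qed.

(** [t] is the least exponent of [xv i] in [s]. Homogeneity leaves one monomial with that exponent,
    so the cofactor is invertible at the point where [xv i] vanishes. *)
Lemma homog_factor i (y : L p q) (s : S k) : Shc y s = s -> s != 0 ->
  exists t (c : k) f g, [/\ c != 0, s = xv i ^+ t * (c%:P%:P * xv (~~ i) ^+ f + xv i * g) &
    exists y' : L p q, Shc y' (c%:P%:P * xv (~~ i) ^+ f + xv i * g) = c%:P%:P * xv (~~ i) ^+ f + xv i * g].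
Proof.
move=> hs s0.
have ex : exists a, `[< exists b, coefv i s a b != 0 >].
  apply: contrapT => h; move/eqP: s0; apply; apply: (@coefv_ext _ i) => a b; rewrite coefv0.
  by apply: contrapT => /eqP nz; apply: h; exists a; apply/asboolP; exists b.
pose t := ex_minn ex.
have [f hf ht] : exists2 f, coefv i s t f != 0 & forall a b, (a < t)%N -> coefv i s a b = 0.
  rewrite /t; case: ex_minnP => a /asboolP[f hf] hm; exists f => // a' b lt.
  apply: contrapT => /eqP nz; have : (a <= a')%N by apply: hm; apply/asboolP; exists b.
  by rewrite leqNgt lt.
have [h eh] : exists h, s = xv i ^+ t * h by apply/div_coefv.
have hh : Shc (y - ee i *+ t) h = h.
  apply: (@xv_inj _ i t); rewrite -eh -[RHS]hs [in RHS]eh.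
  by rewrite -(Shc_mulh _ _ (@Shc_xvX k p q i t)) subrK.
have ch a b : coefv i h a b = coefv i s (a + t) b.
  by rewrite eh coefv_xM ltnNge leq_addl /= addnK.
pose c := coefv i s t f.
have [g eg] : exists g, h - c%:P%:P * xv (~~ i) ^+ f = xv i ^+ 1 * g.
  apply/div_coefv => a b; rewrite ltnS leqn0 => /eqP ->.
  have cN (u v : S k) x z : coefv i (u - v) x z = coefv i u x z - coefv i v x z.
    by case: (i); rewrite /coefv !coefB.
  rewrite cN mulrC coefv_yM ch add0n.
  have E (w : k) z : coefv i (w%:P%:P : S k) 0 z = if z == 0%N then w else 0.
    by case: (i); rewrite /coefv coefC; case: z => [|z] //=; rewrite ?coefC ?coef0.
  rewrite E subn_eq0; case: ltnP => [bf|fb] /=.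
    rewrite subr0; apply: contrapT => /eqP nz.
    have := coefv_deg hs nz; rewrite -(coefv_deg hs hf) => /D_eq[r [h1 h2]].
    have P1 := per_gt0 p0 q0 i; nia.
  case: leqP => [bf|bf].
    have -> : b = f by apply/eqP; rewrite eqn_leq bf fb.
    by rewrite /c subrr.
  rewrite subr0; apply: contrapT => /eqP nz.
  have := coefv_deg hs nz; rewrite -(coefv_deg hs hf) => /D_eq[r [h1 h2]].
  have P1 := per_gt0 p0 q0 i; nia.
have e : c%:P%:P * xv (~~ i) ^+ f + xv i * g = h by rewrite -[xv i]expr1 -eg addrC subrK.
by exists t, c, f, g; rewrite e; split=> //; exists (y - ee i *+ t).
Qed.

(** A form of Nakayama's lemma for uniserial [X]: an element [m] over the generator of the top
    generates [X], and so do its multiples by homogeneous elements prime to [xv i]. Hence the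
    annihilator of [m] is generated by some [xv i ^+ n], and counting subsheaves by the powers of
    [xv i] gives [n = j]. *)
Lemma classify (i : bool) (b : int) j (X Y : coh) z (cc : qhom (O k z) Y) :
  z = ee i *~ b -> sur cc ->
  (forall (s : S k) l, cc (xv i * s : S k) l -> null l) ->
  (forall (s : S k) l, cc s l -> null l -> exists g, s = xv i ^+ 1 * g) ->
  torsion X -> uniserial X -> has_length X j -> is_top X Y ->
  iso X (Tq k p q i b j).
Proof.
move=> ez scc cc0 ccN tX uX lX [R [r [c [[mr _] ck]]]].
have sc := cokernel_sur p0 q0 ck.
have cr := fun n l => @cokernel_ran k p q p0 q0 _ _ _ c r n l ck.
have rc : forall rho xi l, r rho xi -> c xi l -> null l.
  move=> rho xi l h1 h2; have [/(qeq0P p0 q0) h _ _] := ck.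
  by apply: (h rho); exists xi.
pose d : L p q := - (ee i *~ b).
have hz : homog d (Ogen k z) by rewrite /d -ez; apply: (cyclic_O k z).1.
(* m lifts the generator of the top of X *)
have [N [m [y [hm cm ccy]]]] : exists N m y, [/\ homog (d + ee (~~ i) *+ N) m, c m y &
    cc (xv (~~ i) ^+ N : S k) y].
  have [A [e [w hew]]] := lift_at p0 q0 cc sc hz.
  have [h1 h2 h3] := hew (~~ i); exists A, (e (~~ i)), (w (~~ i)); split=> //.
  by move: h2; congr (cc _ _); exact: mulr1.
(* The subsheaf generated by [s *: m] is comparable with the radical. It is not contained in it,
   since its image in the top is nonzero; so it contains the radical, and it maps onto the top. *)
have key s (y' : L p q) : Shc y' s = s -> ~ (exists g, s = xv i ^+ 1 * g) ->
   (exists (c : k) f g, c != 0 /\ s = c%:P%:P * xv (~~ i) ^+ f + xv i * g) ->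
   forall xi : X, ev (multiples (s *: m)) xi.
  move=> hs ndiv [a [f [g [a0 es]]]] xi.
  have hw : homog (d + ee (~~ i) *+ N + y') (s *: m) by apply: homZ.
  have cw : c (s *: m) (s *: y) by apply: graphZ.
  have ccw : cc (s * xv (~~ i) ^+ N : S k) (s *: y) by apply: graphZ.
  have [C [io [mio hio]]] := cyclic_sub hw.
  have rsub : forall eta, ev (ran r) eta -> ev (multiples (s *: m)) eta.
    have [/(sub_le_ran _ mr) h|/(sub_le_ran _ mio) h] := uX _ _ io r mio mr.
      case: ndiv; have : null (s *: y).
        have [|K hK] := h (s *: m).
          by apply/hio; exists 1; rewrite scale1r subrr; apply: null0.
        apply: null_xv => v; exists K; have [rho hrho] := hK v.
        exact: rc hrho (graphZ _ cw).
      move=> /(ccN _ _ ccw)[G eG].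
      have : xv (~~ i) ^+ N * s = xv i ^+ 1 * G by rewrite mulrC.
      exact: div_coprime.
    move=> eta he; apply: ev_ev; first exact: multiples_submod.
    by apply: ev_sub he => u /h; apply: ev_sub => u' /hio.
  apply: ev_xv => [|v]; first exact: multiples_submod.
  have [A /(_ v)[l hl]] := qdom p0 q0 c xi.
  have [B /(_ v)[u hu]] := scc l.
  have hl' := graphZ (xv v ^+ B) hl.
  have [vi|vi] := eqVneq v i.
    exists (1 + (B + A))%N; apply: rsub; apply: (cr _ (xv i *: (xv v ^+ B *: l))).
      by have := graphZ (xv i) hl'; rewrite vi exprD expr1 exprD -!scalerA.
    apply: (cc0 (u : S k)); exact: (graphZ (xv i) hu).
  have {vi} ev_ : v = ~~ i by case: (v) (i) vi => [] [].
  rewrite ev_ in hl' hu *.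
  exists (f + N + (B + A))%N.
  pose t : S k := a^-1%:P%:P * (u : S k).
  have h1 : c (xv (~~ i) ^+ (f + N + (B + A)) *: xi - t *: (s *: m))
     (xv (~~ i) ^+ (f + N) *: (xv (~~ i) ^+ B *: l) - t *: (s *: y)).
    apply: graph_sub; last exact: graphZ.
    by have := graphZ (xv (~~ i) ^+ (f + N)) hl'; congr (c _ _); rewrite !scalerA -!exprD addnA.
  have h2 : null (xv (~~ i) ^+ (f + N) *: (xv (~~ i) ^+ B *: l) - t *: (s *: y)).
    have hh := graph_sub (graphZ (xv (~~ i) ^+ (f + N)) hu) (graphZ t ccw).
    apply: (cc0 (- (a^-1%:P%:P * (u : S k) * xv (~~ i) ^+ N * g))).
    move: hh; congr (cc _ _).
    have E : xv (~~ i) ^+ (f + N) * (u : S k) - t * (s * xv (~~ i) ^+ N) =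
       xv i * (- (a^-1%:P%:P * (u : S k) * xv (~~ i) ^+ N * g)).
      rewrite /t es exprD.
      have a1 : a^-1%:P%:P * a%:P%:P = 1 :> S k by rewrite -!polyCM mulVf.
      transitivity ((1 - a^-1%:P%:P * a%:P%:P) * (xv (~~ i) ^+ f * xv (~~ i) ^+ N * (u : S k))
         + xv i * (- (a^-1%:P%:P * (u : S k) * xv (~~ i) ^+ N * g))); first by ring.
      by rewrite a1 subrr mul0r add0r.
    exact: E.
  have h3 := rsub _ (cr _ _ h1 h2).
  rewrite -(subrK (t *: (s *: m)) (_ *: xi)); apply: submodD h3 _.
    exact/ev_submod/multiples_submod.
  apply: ev_in; first exact: multiples_submod.
  by exists t; rewrite subrr; apply: null0.
have nd1 (a : k) f g : a != 0 -> ~ (exists g', a%:P%:P * xv (~~ i) ^+ f + xv i * g = xv i ^+ 1 * g' :> S k).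
  move=> a0 [g' e]; have : xv (~~ i) ^+ f * (a%:P%:P : S k) = xv i ^+ 1 * (g' - g).
    by rewrite mulrBr -e expr1; ring.
  move=> /div_coprime[G] /(congr1 (fun s : S k => coefv i s 0%N 0%N))/eqP.
  by rewrite coefv_xM /= /coefv; case: (i); rewrite coefC /= coefC /= (negPf a0).
have key2 (a : k) f g (y' : L p q) : a != 0 ->
   Shc y' (a%:P%:P * xv (~~ i) ^+ f + xv i * g) = a%:P%:P * xv (~~ i) ^+ f + xv i * g ->
   forall (xi : X) t, null (t *: ((a%:P%:P * xv (~~ i) ^+ f + xv i * g) *: m)) -> null (t *: xi).
  move=> a0 hs xi t ht; have [K hK] : ev (multiples ((a%:P%:P * xv (~~ i) ^+ f + xv i * g) *: m)) xi.
    by apply: (key _ y' hs); [apply: nd1|exists a, f, g].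
  apply: null_xv => v; exists K; have [u hu] := hK v.
  rewrite scalerA mulrC -scalerA -(subrK (u *: ((a%:P%:P * xv (~~ i) ^+ f + xv i * g) *: m)) (_ *: xi)).
  rewrite scalerDr; apply: nullD; first exact: nullZ.
  by rewrite scalerA mulrC -scalerA; apply: nullZ.
have gen_m (xi : X) : ev (multiples m) xi.
  have := key 1 0 (Shc1 k p q); rewrite scale1r; apply.
    by have := @nd1 1 0%N 0 (oner_neq0 k); rewrite !polyC1 mul1r expr0 mulr0 addr0.
  by exists 1, 0%N, 0; rewrite !polyC1 mul1r expr0 mulr0 addr0 oner_neq0.
have nm : ~ null m.
  move=> /(qnull p0 q0 cm) /(ccN _ _ ccy)[g].
  have := @nd1 1 N 0 (oner_neq0 k); rewrite !polyC1 mul1r mulr0 addr0 => h e.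
  by apply: h; exists g.
(* [n] is the least exponent killing [m]. One exists because [X] is torsion and [key2] cancels the
   factor prime to [xv i] of a homogeneous annihilator. *)
have [n [n1 n2]] : exists n, null (xv i ^+ n *: m) /\ forall t, (t < n)%N -> ~ null (xv i ^+ t *: m).
  have ex : exists n, `[< null (xv i ^+ n *: m) >].
    have [s s0 sm] := tX m.
    have [x hx] : exists x, Shc (x : L p q) s != 0.
      apply: contrapT => h; have [t [_ es]] := Shc_sum p q s.
      move/eqP: s0; apply; rewrite es big1 // => x _.
      by apply/eqP; apply: contrapT => /negP nz; apply: h; exists x.
    have hx' : Shc x (Shc x s) = Shc x s by rewrite Shc_proj eqxx.
    have xm : Shc x s *: m = 0.
      have := congr1 (hc (d + ee (~~ i) *+ N + x)) sm.
      by rewrite (hcZ _ _ hm) hc0 addrAC subrr add0r.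
    have [t [a [f [g [a0 es [y' hy']]]]]] := homog_factor i hx' hx.
    exists t; apply/asboolP; apply: (key2 a f g y' a0 hy').
    by rewrite scalerA -es xm; apply: null0.
  exists (ex_minn ex); case: ex_minnP => n /asboolP h1 h2; split=> // t lt h.
  by have /h2 : `[< null (xv i ^+ t *: m) >]; [apply/asboolP|rewrite leqNgt lt].
have ann (s : S k) : null (s *: m) -> exists g, s = xv i ^+ n * g.
  move=> hs; have hc' y' : exists g, Shc (y' : L p q) s = xv i ^+ n * g.
    have h1 : null (Shc y' s *: m).
      have := null_hc (d + ee (~~ i) *+ N + y') hs.
      by rewrite (hcZ _ _ hm) addrAC subrr add0r.
    have [->|nz] := eqVneq (Shc y' s) 0; first by exists 0; rewrite mulr0.
    have h2 : Shc y' (Shc y' s) = Shc y' s by rewrite Shc_proj eqxx.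
    have [t [a [f [g [a0 es [y'' hy']]]]]] := homog_factor i h2 nz.
    have nt : (n <= t)%N.
      rewrite leqNgt; apply/negP => /n2; apply; apply: (key2 a f g y'' a0 hy').
      by rewrite scalerA -es.
    by rewrite es -(subnKC nt) exprD -mulrA; eexists.
  have [t [_ ->]] := Shc_sum p q s.
  elim: t => [|x t [g IH]]; first by exists 0; rewrite big_nil mulr0.
  have [g' hg'] := hc' x; exists (g' + g).
  by rewrite big_cons IH hg' mulrDr.
have [f [f1 f2]] := hom_data_T hm n1.
have isoX : iso (Tq k p q i b n) X.
  exists f; apply/(is_isoP p0 q0); split=> [u xi fu hxi|xi].
    have [s es] := (cyclic_T k p q i b n).2 u.
    have h1 := graphZ s f1; have h2 := graphZ (xv (~~ i) ^+ N) fu.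
    have h3 : f (xv (~~ i) ^+ N *: u) (s *: m).
      by move: h1; congr (f _ _); rewrite es !scalerA mulrC.
    have : null (s *: m).
      rewrite -(subKr (xv (~~ i) ^+ N *: xi) (s *: m)); apply: nullB; first exact: nullZ.
      exact: (qval p0 q0 h2 h3).
    by move=> /ann h; rewrite es; have /Tgen_eq0 -> := h; apply: null0.
  apply: ev_vars => [|v]; first exact: ran_submod.
  have [K /(_ v)[u [K' /(_ v)/eqP]]] := gen_m xi.
  rewrite scalerBr subr_eq0 => /eqP h; exists (K' + K)%N.
  exists ((xv v ^+ K' * u) *: (xv (~~ i) ^+ N *: Tgen k p q i b n)).
  have -> : xv v ^+ (K' + K) *: xi = (xv v ^+ K' * u) *: m by rewrite exprD -scalerA h scalerA.
  exact: graphZ.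
suff -> : j = n by apply: iso_sym.
(* A subsheaf is recorded by the exponents [a] for which it contains [xv i ^+ a *: m]; [sub2] shows
   that they determine it. *)
pose V (Z : coh) (g : qhom Z X) a := ev (ran g) (xv i ^+ a *: m).
have Vmono Z (g : qhom Z X) a a' : (a <= a')%N -> V Z g a -> V Z g a'.
  move=> le h; rewrite /V -(subnK le) exprD -scalerA.
  by apply: submodZ h; apply/ev_submod/ran_submod.
have sub1 Z Z' (g : qhom Z X) (g' : qhom Z' X) a : mono g' -> sub_le g g' -> V Z g a -> V Z' g' a.
  move=> mg' /(sub_le_ran _ mg') h hv; apply: ev_ev; first exact: ran_submod.
  exact: ev_sub h hv.
have sub2 Z Z' (g : qhom Z X) (g' : qhom Z' X) : mono g' ->
    (forall a, V Z g a -> V Z' g' a) -> sub_le g g'.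
  move=> mg' h; apply/(sub_le_ran _ mg') => xi0 [z0 hz0].
  have sg := ran_submod g; have sg' := ran_submod g'.
  apply: (hom_sum (ev_submod sg')) => x.
  have := graph_hc x hz0; set xi := hc x xi0 => hxi.
  have hxih : homog x xi by apply: hom_hc.
  apply: ev_xv => // v; have [K /(_ v)[u0 hu0]] := gen_m xi; exists K.
  have [u [y' [hu hun]]] : exists u y', Shc (y' : L p q) u = u /\ null (xv v ^+ K *: xi - u *: m).
    exists (Shc (x + ee v *+ K - (d + ee (~~ i) *+ N)) u0), (x + ee v *+ K - (d + ee (~~ i) *+ N)).
    split; first by rewrite Shc_proj eqxx.
    have := null_hc (x + ee v *+ K) hu0.
    by rewrite hcB (hcZ _ _ hm) hcX hxih.
  have [u00|nz] := eqVneq u 0.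
    by apply: null_ev => //; move: hun; rewrite u00 scale0r subr0.
  have [t [a [ff [gg [a0 es [y'' hy'']]]]]] := homog_factor i hu nz.
  set hh := a%:P%:P * xv (~~ i) ^+ ff + xv i * gg in es hy''.
  have e1 : ev (ran g) (u *: m).
    apply: (ev_null_add sg (eta := xv v ^+ K *: xi)).
      by rewrite -opprB; apply: nullN.
    by apply: ev_in => //; exists (xv v ^+ K *: hc x z0); apply: graphZ.
  have e2 : V Z g t.
    have [K2 hK2] : ev (multiples (hh *: m)) m.
      by apply: (key _ y'' hy''); [apply: nd1|exists a, ff, gg].
    apply: ev_xv => // w; exists K2; have [u' hu'] := hK2 w.
    apply: (ev_null_add sg (eta := u' *: (u *: m))); last first.
      by apply: submodZ => //; apply: ev_submod.
    rewrite (_ : _ - _ = xv i ^+ t *: (xv w ^+ K2 *: m - u' *: (hh *: m))); first exact: nullZ.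
    by rewrite scalerBr es !scalerA; congr (_ *: _ - _ *: _); ring.
  apply: (ev_null_add sg' hun); rewrite es mulrC -scalerA.
  by apply: submodZ; [apply: ev_submod|apply: h].
have cyc e : exists (C : coh) (g : qhom C X), mono g /\ forall a, V C g a <-> (e <= a)%N \/ (n <= a)%N.
  have [C [g [mg hg]]] := cyclic_sub (hom_xv i e hm).
  exists C, g; split=> // a; split=> [[K /(_ (~~ i))/hg[u]]|].
    rewrite !scalerA -scalerBl => /ann[G eG].
    have [ea|ea] := leqP e a; first by left.
    have [na|na] := leqP n a; first by right.
    have E : xv (~~ i) ^+ K * (1 : S k) = xv i ^+ 1 * (u * xv i ^+ (e - a.+1) + xv i ^+ (n - a.+1) * G).
      apply: (@xv_inj _ i a).
      have F1 : xv i ^+ e = xv i ^+ a * xv i ^+ 1 * xv i ^+ (e - a.+1) :> S k by rewrite -!exprD addn1 subnKC.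
      have F2 : xv i ^+ n = xv i ^+ a * xv i ^+ 1 * xv i ^+ (n - a.+1) :> S k by rewrite -!exprD addn1 subnKC.
      transitivity (u * xv i ^+ e + xv i ^+ n * G); last by rewrite F1 F2; ring.
      by rewrite -eG; ring.
    have [G' e'] := div_coprime E; case: (@nd1 1 0%N 0 (oner_neq0 k)).
    by exists G'; rewrite !polyC1 mul1r expr0 mulr0 addr0.
  case=> h; last first.
    apply: null_ev; first exact: ran_submod.
    by rewrite -(subnK h) exprD -scalerA; apply: nullZ.
  apply: ev_in; first exact: ran_submod.
  apply/hg; exists (xv i ^+ (a - e)); rewrite scalerA -exprD subnK // subrr.
  exact: null0.
have [Ys [io [z0 isj mo st]]] := lX.
(* The [t]-th member of the composition series contains exactly the exponents from [n - t] on. *)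
have H t : (t <= j)%N -> (t <= n)%N /\ forall a, V _ (io t) a <-> (n - t <= a)%N.
  elim: t => [_|t IH tj].
    split=> // a; rewrite subn0; split=> [[K hK]|na].
      rewrite leqNgt; apply/negP => /n2; apply; apply: null_xv => v; exists K.
      have [zz hz1] := hK v; apply: (qnull p0 q0 hz1).
      by move/(is_zeroP p0 q0): z0; apply.
    apply: null_ev; first exact: ran_submod.
    by rewrite -(subnK na) exprD -scalerA; apply: nullZ.
  have [tn IHa] := IH (ltnW tj); have [s1 s2 s3] := st t tj.
  have m1 := mo t (ltnW tj); have m2 := mo t.+1 tj.
  have [a [Va nVa]] : exists a, V _ (io t.+1) a /\ ~ V _ (io t) a.
    apply: contrapT => h; apply: s2; apply: sub2 => // a Va.
    by apply: contrapT => nVa; apply: h; exists a.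
  have an : (a < n - t)%N by rewrite ltnNge; apply/negP => /IHa.
  have tn' : (t < n)%N by rewrite -subn_gt0; apply: leq_ltn_trans an.
  split=> // a'; split=> [Va'|na]; last first.
    by apply: Vmono Va; lia.
  have [C [g [mg hg]]] := cyc (n - t.+1)%N.
  have [||h|h] := s3 C g mg.
  - by apply: sub2 => // a1 /IHa h; apply/hg; left; lia.
  - apply: sub2 => // a1 /hg[h|h]; apply: Vmono Va; lia.
  - have /IHa : V _ (io t) (n - t.+1)%N by apply: (sub1 _ _ _ _ _ m1 h); apply/hg; left.
    lia.
  - by have /hg := sub1 _ _ _ _ _ mg h Va'; lia.
have [jn Hj] := H j (leqnn j).
have /Hj : V _ (io j) 0%N.
  by have /(is_isoP p0 q0)[_ sj] := isj; apply: sj.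
by rewrite leqn0 subn_eq0 => nj; apply/eqP; rewrite eqn_leq jn nj.
Qed.

Lemma classify_inf b j (X : coh) : is_torsion_inf b j X -> iso X (Tq k p q true b j).
Proof.
move=> [tX uX lX [Y [[cc ck] tY]]].
have sc := cokernel_sur p0 q0 ck.
apply: (@classify true b j X Y _ cc) => //.
- by rewrite -[X in _ + X]mulr1z -mulrzDr subrK.
- move=> s l h; have [/(qeq0P p0 q0) h1 _ _] := ck.
  by apply: (h1 (s : S k)); exists (x1 * s).
- move=> s l h1 h2; have [N hN] := cokernel_ran p0 q0 ck h1 h2.
  have [g hg] := hN false; exact: (@div_coprime _ true 1 N s g).
Qed.

Lemma classify_zero b j (X : coh) : is_torsion_zero b j X -> iso X (Tq k p q false b j).
Proof.
move=> [tX uX lX [Y [[cc ck] tY]]].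
have sc := cokernel_sur p0 q0 ck.
apply: (@classify false b j X Y _ cc) => //.
- by rewrite -[X in _ + X]mulr1z -mulrzDr subrK.
- move=> s l h; have [/(qeq0P p0 q0) h1 _ _] := ck.
  by apply: (h1 (s : S k)); exists (x2 * s).
- move=> s l h1 h2; have [N hN] := cokernel_ran p0 q0 ck h1 h2.
  have [g hg] := hN true; exact: (@div_coprime _ false 1 N s g).
Qed.

End Classification.

(** * Chords of the strip *)

Section Chords.

(* The marked points of the strip in the cyclic order of its boundary, cut at -oo:
   first the outer ones from left to right, then the inner ones from right to left. *)
Definition ltm (u v : marked) : bool :=
  match u, v with
  | Outer a, Outer b => a < b
  | Outer _, Inner _ => true
  | Inner _, Outer _ => false
  | Inner a, Inner b => b < a
  end.

Definition btw (x y z : marked) : bool := (ltm x z && ltm z y) || (ltm y z && ltm z x).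

(** The complementary open arc of the boundary; the first two conjuncts exclude the endpoints. *)
Definition ext (x y z : marked) : bool :=
  [&& ltm x z || ltm z x, ltm y z || ltm z y & ~~ btw x y z].

(* The chords xy and zw interleave: their endpoints are distinct and alternate. *)
Definition cr (x y z w : marked) : bool :=
  (btw x y z && ext x y w) || (btw x y w && ext x y z).

End Chords.

(** Once the marked points are destructed, a statement about crossings is linear integer
    arithmetic. *)
Ltac chord_cases :=
  repeat match goal with u : marked |- _ => destruct u end;
  rewrite /cr /ext /btw /ltm /=.

Section Crossings.

(** The chord [a b] enters the triangle bounded by [u z] and the two diagonals; as it does not leave
    through [z w], it leaves through [u v]. This makes the number of crossings drop in the
    induction. *)
Lemma side_cross u v z w a b :
  cr u v z w -> ~~ cr z w a b -> cr u z a b -> cr u v a b.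
Proof. chord_cases; lia. Qed.

Lemma cr_swap1 u v z w : cr v u z w = cr u v z w.
Proof. chord_cases; lia. Qed.

Lemma cr_swap2 u v z w : cr u v w z = cr u v z w.
Proof. chord_cases; lia. Qed.

Lemma cr_sym u v z w : cr z w u v = cr u v z w.
Proof. chord_cases; lia. Qed.

Lemma cr_endpoint u v z : cr u v u z = false.
Proof. chord_cases; lia. Qed.

Definition nqm (u v : marked) : bool := ltm u v || ltm v u.

Lemma nqmP u v : reflect (u <> v) (nqm u v).
Proof.
apply: (iffP idP) => [h e|h]; first by move: h; rewrite e /nqm; case: v {e} => a /=; lia.
by case: u v h => a [] b //= h; rewrite /nqm /=; case: ltgtP => // e; case: h; rewrite e.
Qed.

Lemma crE w z a b : cr w z a b =
  [&& nqm a w, nqm a z, nqm b w, nqm b z & btw w z a (+) btw w z b].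
Proof. rewrite /nqm; chord_cases; lia. Qed.

(** As [a] lies on the same side of [w z] as [u], the chord reaches [w z] only across a side of the
    triangle on [w], [u], [z]. *)
Lemma cr_split w z a b u : nqm u w -> nqm u z -> nqm u a -> btw w z a = btw w z u ->
  cr w z a b -> cr w u a b || cr z u a b.
Proof. rewrite /nqm; chord_cases; lia. Qed.

(** Two triangles on the same side of [u v] with different apexes overlap. *)
Lemma cr_same_side u v w z : nqm u v -> nqm u w -> nqm v w -> nqm u z -> nqm v z -> nqm w z ->
  btw u v w = btw u v z -> cr u w v z || cr v w u z.
Proof. rewrite /nqm; chord_cases; lia. Qed.

Context (p q : nat) (p0 : (0 < p)%N) (q0 : (0 < q)%N).

(** The deck transformation shifting the strip by [n]. *)
Definition tr (n : int) (u : marked) : marked :=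
  match u with
  | Inner i => Inner (i + n * p%:Z)
  | Outer j => Outer (j + n * q%:Z)
  end.

(* Among the chords, the lifts of arcs: a longer peripheral chord crosses its own translate. *)
Definition arcok (u v : marked) : bool :=
  match u, v with
  | Outer _, Inner _ => true
  | Inner a, Inner b => (a + 2 <= b) && (b <= a + p%:Z)
  | Outer a, Outer b => (a + 2 <= b) && (b <= a + q%:Z)
  | Inner _, Outer _ => false
  end.

Lemma arcok_oriented u v : arcok u v -> oriented u v.
Proof. by case: u v => a [] b //= /andP[]. Qed.

Lemma tr_tr n m u : tr n (tr m u) = tr (m + n) u.
Proof. by case: u => a /=; rewrite mulrDl addrA. Qed.

Lemma tr0 u : tr 0 u = u.
Proof. by case: u => a /=; rewrite mul0r addr0. Qed.

Lemma cr_tr n u v z w : cr (tr n u) (tr n v) (tr n z) (tr n w) = cr u v z w.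
Proof.
have E a b : ltm (tr n a) (tr n b) = ltm a b.
  by case: a b => a [] b //=; rewrite ltrD2r.
by rewrite /cr /ext /btw !E.
Qed.

Lemma arcok_tr n u v : arcok (tr n u) (tr n v) = arcok u v.
Proof. by case: u v => a [] b //=; lia. Qed.

Lemma arcok_self n u v : arcok u v -> ~~ cr u v (tr n u) (tr n v).
Proof.
move=> h; have [->|n0] := eqVneq n 0; first by rewrite !tr0; move: h; chord_cases; lia.
(* Naming the products makes the problem linear: a nonzero translation moves by at least one full
   period. *)
have [x ex] : exists x, x = n * p%:Z by eexists.
have [y ey] : exists y, y = n * q%:Z by eexists.
have hx : (x <= - p%:Z /\ y <= - q%:Z) \/ (p%:Z <= x /\ q%:Z <= y).
  by rewrite ex ey; nia.
by move: h; case: u => a; case: v => b; rewrite /tr -?ex -?ey; chord_cases; lia.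
Qed.

Section Family.
Context (A : marked -> marked -> Prop).
Hypothesis A_arc : forall u v, A u v -> arcok u v.
Hypothesis A_tr : forall n u v, A u v -> A (tr n u) (tr n v).
Hypothesis A_nc : forall u v z w, A u v -> A z w -> ~~ cr u v z w.

(** [side] for an abstract family [A] in place of the lifts of the arcs of a triangulation. *)
Definition sideA (u v : marked) : Prop := [\/ boundary_side u v, A u v | A v u].

Lemma boundary_nc u v a b : boundary_side u v -> ~~ cr u v a b.
Proof. by case: u v => x [] y //= [] ->; chord_cases; lia. Qed.

Lemma side_nc u v a b : sideA u v -> A a b -> ~~ cr u v a b.
Proof.
case=> h hA; first exact: boundary_nc.
  exact: A_nc.
by rewrite -cr_swap1; apply: A_nc.
Qed.

Lemma side_neq u v : sideA u v -> u <> v.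
Proof.
move=> h e; subst v; case: h => [|/A_arc|/A_arc].
- by case: u => a /= [] h; lia.
- by case: u => a //=; lia.
- by case: u => a //=; lia.
Qed.

Lemma side_nc2 u v z w : sideA u v -> sideA z w -> ~~ cr u v z w.
Proof.
move=> h1 [h|h|h]; first by rewrite cr_sym; apply: boundary_nc.
  exact: side_nc.
by rewrite -cr_swap2; apply: side_nc.
Qed.

(** Apexes on the same side of [u v] would make sides of the two triangles cross. *)
Lemma flip_cross u v w z : A u v -> sideA u w -> sideA v w -> sideA u z -> sideA v z ->
  w <> z -> cr u v w z.
Proof.
move=> huv uw vw uz vz wz.
have n1 := side_neq (Or32 _ _ huv); have n2 := side_neq uw; have n3 := side_neq vw.
have n4 := side_neq uz; have n5 := side_neq vz.
have c1 := side_nc2 uw vz; have c2 := side_nc2 vw uz.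
rewrite crE; apply/and5P.
have e : btw u v w (+) btw u v z.
  rewrite -negb_eqb; apply/negP => /eqP e.
  have := cr_same_side (introT (nqmP _ _) n1) (introT (nqmP _ _) n2) (introT (nqmP _ _) n3)
    (introT (nqmP _ _) n4) (introT (nqmP _ _) n5) (introT (nqmP _ _) wz) e.
  by rewrite (negPf c1) (negPf c2).
by split=> //; apply/nqmP => h; [apply: n2|apply: n3|apply: n4|apply: n5].
Qed.

Lemma side_ok u v : sideA u v ->
  match u, v with
  | Inner a, Inner b => (a <= b + p%:Z) && (b <= a + p%:Z)
  | Outer a, Outer b => (a <= b + q%:Z) && (b <= a + q%:Z)
  | _, _ => true
  end.
Proof.
by case=> [|/A_arc|/A_arc]; case: u v => a [] b //=; lia.
Qed.

(** The width of a peripheral diagonal is in question. Its far vertex lies either on the same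
    boundary, where a side at that vertex bounds the width, or on the other one, where a translate
    of one bridging side would otherwise cross the other. *)
Lemma flip_arcok u v w z : A u v -> sideA u w -> sideA v w -> sideA u z -> sideA v z ->
  w <> z -> oriented w z -> arcok w z.
Proof.
move=> huv uw vw uz vz wz ho.
have c := flip_cross huv uw vw uz vz wz.
have key u' v' : sideA u' w -> sideA v' w -> sideA u' z -> sideA v' z -> cr u' v' w z ->
    btw w z u' -> arcok w z.
  move=> h1 h2 h3 h4 c' b'.
  have g1 := side_ok h1; have g2 := side_ok h2; have g3 := side_ok h3; have g4 := side_ok h4.
  have {c'}: [&& ~~ btw w z v', nqm v' w & nqm v' z].
    by move: c'; rewrite -cr_sym crE b' => /and5P[_ _ -> -> /=]; case: btw.
  clear -h2 h4 b' g2 g4 ho A_arc A_nc A_tr p0 q0.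
  case: w z v' ho h2 h4 b' g2 g4 => a [] b [] x //= ho h2 h4 b' g2 g4 c'.
  - move: c'; rewrite /nqm /btw /=; lia.
  - have A1 : A (Outer x) (Inner a) by case: h2 => // /A_arc.
    have A2 : A (Outer x) (Inner b) by case: h4 => // /A_arc.
    have := A_nc (A_tr 1 A1) A2; rewrite /= !mul1r /cr /ext /btw /=; lia.
  - have A1 : A (Outer a) (Inner x) by case: h2 => // /A_arc.
    have A2 : A (Outer b) (Inner x) by case: h4 => // /A_arc.
    have := A_nc (A_tr 1 A1) A2; rewrite /= !mul1r /cr /ext /btw /=; lia.
  - move: c'; rewrite /nqm /btw /=; lia.
have : btw w z u (+) btw w z v by move: c; rewrite -cr_sym crE => /and5P[].
case h : (btw w z u) => /= h'; first exact: (key u v).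
by apply: (key v u) => //; rewrite cr_swap1.
Qed.

(** A chord of [A] crossing [w z] crosses none of the four sides, so by [cr_split] each endpoint is
    the vertex on its side of [w z]; orientation fixes the order. *)
Lemma flip_only u v w z a b : A u v -> sideA u w -> sideA v w -> sideA u z -> sideA v z ->
  cr u v w z -> A a b -> cr w z a b -> a = u /\ b = v.
Proof.
move=> huv uw vw uz vz c hab c'.
have c1 := side_nc uw hab; have c2 := side_nc vw hab.
have c3 := side_nc uz hab; have c4 := side_nc vz hab.
have key x y t : nqm t w -> nqm t z -> btw w z x = btw w z t -> cr w z x y ->
    ~~ cr t w x y -> ~~ cr t z x y -> x = t.
  move=> h1 h2 e h3 h4 h5; apply: contrapT => xt.
  have nt : nqm t x by apply/nqmP => e'; apply: xt.
  by have := cr_split h1 h2 nt e h3; rewrite (cr_swap1 t w) (cr_swap1 t z) (negPf h4) (negPf h5).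
have o1 := A_arc huv; have o2 := A_arc hab.
have hc := c; rewrite -cr_sym crE in hc; case/and5P: hc => u1 u2 v1 v2 uvb.
have hc' := c'; rewrite crE in hc'; case/and5P: hc' => a1 a2 b1 b2 abb.
have [e|e] := eqVneq (btw w z a) (btw w z u).
  have eb : btw w z b = btw w z v.
    by move: uvb abb; rewrite e; case: (btw w z u) (btw w z v) (btw w z b) => [] [] [].
  split; first exact: (key a b u).
  by apply: (key b a v v1 v2 eb); rewrite cr_swap2.
have ea : btw w z a = btw w z v.
  by move: uvb e; case: (btw w z u) (btw w z v) (btw w z a) => [] [] [].
have eb : btw w z b = btw w z u.
  by move: uvb abb; rewrite ea; case: (btw w z u) (btw w z v) (btw w z b) => [] [] [].
have av : a = v by apply: (key a b v).
have bu : b = u by apply: (key b a u u1 u2 eb); rewrite cr_swap2.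
by move: o1 o2; rewrite av bu; clear; case: u v => x [] y //=; lia.
Qed.

(** A translation carrying [u v] to the side [u w] would fix a point or force a side wider than a
    period. Hence the sides at [u] survive when [u v] and its translates are removed. *)
Lemma side_not_translate n u v w : A u v -> sideA u w -> sideA v w -> w <> v ->
  ~ (u = tr n u /\ w = tr n v) /\ ~ (w = tr n u /\ u = tr n v).
Proof.
move=> huv uw vw wv; have o := A_arc huv; have g := side_ok vw.
have [x ex] : exists x, x = n * p%:Z by eexists.
have [y ey] : exists y, y = n * q%:Z by eexists.
have hx : [\/ n = 0, (x <= - p%:Z /\ y <= - q%:Z) | (p%:Z <= x /\ q%:Z <= y)].
  have [->|n0] := eqVneq n 0; first exact: Or31.
  have [h|h] : n <= -1 \/ 1 <= n by lia.
    by apply: Or32; rewrite ex ey; nia.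
  by apply: Or33; rewrite ex ey; nia.
split=> -[e1 e2].
  case: hx => [n0|h|h]; first by apply: wv; rewrite e2 n0 tr0.
    by move: e1; case: (u) => a /= [] /eqP; rewrite -?ex -?ey; lia.
  by move: e1; case: (u) => a /= [] /eqP; rewrite -?ex -?ey; lia.
case: hx => [n0|h|h].
- by rewrite n0 !tr0 in e1 e2; move: o; rewrite e2; case: (v) => a //=; lia.
- by move: o g; rewrite e1 {1 3}e2; case: (u) (v) e2 => a [] b //= [] e2; rewrite -?ex -?ey in e2 *; lia.
- by move: o g; rewrite e1; case: (u) (v) e2 => a [] b //= [] e2; rewrite -?ex -?ey in e2 *; lia.
Qed.

Hypothesis A_max : forall u v, arcok u v -> (forall z w, A z w -> ~~ cr u v z w) -> A u v.

(** The left end of a longest interval works: an interval around it would overlap the longest one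
    without nesting, or be longer. *)
Lemma uncovered (L : int -> int -> Prop) (P : nat) :
  (forall a b, L a b -> a + 2 <= b /\ b <= a + P%:Z) ->
  (forall a b c d, L a b -> L c d -> ~ (c < a /\ a < d /\ d < b)) ->
  exists i, forall a b, L a b -> ~ (a < i /\ i < b).
Proof.
move=> h1 h2; have [[a0 [b0 h0]]|no] := pselect (exists a b, L a b); last first.
  by exists 0 => a b hab; case: no; exists a, b.
pose Q (n : nat) := `[< exists a b, L a b /\ b - a = n%:Z >].
have exQ : exists n, Q n.
  have := h1 _ _ h0 => hab; exists `|b0 - a0|%N; apply/asboolP; exists a0, b0; split=> //; lia.
have bdQ n : Q n -> (n <= P)%N.
  by move=> /asboolP[a [b [/h1 h e]]]; lia.
case: (ex_maxnP exQ bdQ) => n /asboolP[a [b [hab e]]] hmax; exists a => c d hcd [ca ad].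
have [db|bd] := ltP d b; first exact: (h2 _ _ _ _ hab hcd).
have [x y] := h1 _ _ hcd.
have : Q `|d - c|%N by apply/asboolP; exists c, d; split=> //; lia.
by move/hmax; lia.
Qed.

(** A bridging chord between uncovered points crosses no peripheral chord, so without bridging
    chords in [A] maximality would add it. *)
Lemma exists_bridging : exists l i, A (Outer l) (Inner i).
Proof.
have [i hi] := @uncovered (fun a b => A (Inner a) (Inner b)) p
  (fun a b h => elimT andP (A_arc h))
  (fun a b c d h h' => ltac:(move=> hh; have := A_nc h h'; chord_cases; lia)).
have [l hl] := @uncovered (fun a b => A (Outer a) (Outer b)) q
  (fun a b h => elimT andP (A_arc h))
  (fun a b c d h h' => ltac:(move=> hh; have := A_nc h h'; chord_cases; lia)).
apply: contrapT => no; have no' := no; apply: no; exists l, i; apply: A_max => // z w hzw.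
case: z w hzw => a [] b hzw.
- apply/negP => c; apply: (hi _ _ hzw); move: c (A_arc hzw); clear; chord_cases; lia.
- by have := A_arc hzw.
- by case: no'; exists a, b.
- apply/negP => c; apply: (hl _ _ hzw); move: c (A_arc hzw); clear; chord_cases; lia.
Qed.

(** An oriented chord that is not [arcok] is peripheral and wider than a period, so some translate
    of a bridging chord ends strictly inside it. *)
Lemma chord_or_cross u v : oriented u v -> A u v \/ exists z w, A z w /\ cr u v z w.
Proof.
move=> o; apply: contrapT => /not_orP[nA nc].
have nc' z w : A z w -> ~~ cr u v z w.
  by move=> h; apply/negP => c; apply: nc; exists z, w.
have [ok|nok] := boolP (arcok u v); first by apply: nA; apply: A_max.
have [l [i hli]] := exists_bridging.
have per (P : nat) (x a b : int) : (0 < P)%N -> a + P%:Z < b -> exists n : int, a < x + n * P%:Z /\ x + n * P%:Z < b.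
  move=> P0 ab; exists (divz (a - x) P%:Z + 1).
  have := divz_eq (a - x) P%:Z; have := ltz_pmod (a - x) (d := P%:Z).
  have P0' : P%:Z != 0 by lia.
  have := modz_ge0 (a - x) P0'; rewrite mulrDl mul1r ltz_nat P0 => h1 /(_ isT) h2 h3.
  by lia.
case: u v o nok nc' {nA nc} => a [] b //= o nok nc'.
  have [|n [h1 h2]] := per p i a b p0; first by lia.
  have := nc' _ _ (A_tr n hli) => /=; chord_cases; lia.
have [|n [h1 h2]] := per q l a b q0; first by lia.
have := nc' _ _ (A_tr n hli) => /=; chord_cases; lia.
Qed.

End Family.

End Crossings.

(** * Generation by crossing induction *)

Local Notation In := List.In.

Section IndexEquivalence.
Context (k : closedFieldType) (p q : nat).
Context (X : coh k p q).

(** The other variable is invertible in the localization, so its coordinate in the degree can be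
    changed. *)
Lemma V_shift i a b b' n : bijV X i (D p q i a b) n -> bijV X i (D p q i a b') n.
Proof.
move=> [j s]; have [M [M' e]] : exists M M' : nat, b' + M%:Z = b + M'%:Z.
  by exists (absz (b - b')), (absz (b' - b + (absz (b - b'))%:Z)); lia.
split=> [N m hm h|N u hu]; [rewrite ?D1 ?D2 in hm|rewrite ?D1 ?D2 in hu].
  apply: (@tors_xv _ _ _ _ _ M); apply: (j (M' + N)%N); first by hdeg.
  by rewrite scalerA mulrC -scalerA h scaler0.
have [|K [m [hm em]]] := s (M' + N)%N (xv (~~ i) ^+ M *: u); first by hdeg.
exists (K + M)%N, m; rewrite ?D1 ?D2 in hm *; split; first by hdeg.
by rewrite exprD -scalerA em.
Qed.

(* Multiplication by powers of x_i identifies the localizations of X away from the other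
   variable in the degrees a and a'. *)
Definition EV i (a a' : int) : Prop :=
  exists n : nat, (a' = a + n%:Z /\ bijV X i (D p q i a 0) n) \/
                  (a = a' + n%:Z /\ bijV X i (D p q i a' 0) n).

Lemma EV_refl i a : EV i a a.
Proof. by exists 0%N; left; rewrite addr0; split=> //; apply: V_refl. Qed.

Lemma EV_sym i a a' : EV i a a' -> EV i a' a.
Proof. by case=> n [] h; exists n; [right|left]. Qed.

Lemma EV_trans i a b c : EV i a b -> EV i b c -> EV i a c.
Proof.
move=> [n [[e1 h1]|[e1 h1]]] [m [[e2 h2]|[e2 h2]]].
- exists (n + m)%N; left; split; first by lia.
  by apply: V_trans h1 _; rewrite D1 -e1.
- have [mn|nm] := leqP m n.
    exists (n - m)%N; left; split; first by lia.
    rewrite -(subnK mn) in h1; apply: V_right h1 _.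
    by rewrite D1; have -> : a + (n - m)%N%:Z = c by lia.
  exists (m - n)%N; right; split; first by lia.
  rewrite -(subnK (ltnW nm)) in h2; apply: V_right h2 _.
  by rewrite D1; have -> : c + (m - n)%N%:Z = a by lia.
- have [nm|mn] := leqP n m.
    exists (m - n)%N; left; split; first by lia.
    rewrite -(subnKC nm) in h2; have := V_left h2 h1.
    by rewrite D1; have -> : b + n%:Z = a by lia.
  exists (n - m)%N; right; split; first by lia.
  rewrite -(subnKC (ltnW mn)) in h1; have := V_left h1 h2.
  by rewrite D1; have -> : b + m%:Z = c by lia.
- exists (m + n)%N; right; split; first by lia.
  by apply: V_trans h2 _; rewrite D1 -e2.
Qed.

Definition BJ (a b : int) : Prop := bijB X (D p q true a b).

Lemma D_swap i a b : D p q i a b = D p q (~~ i) b a.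
Proof. by rewrite /D negbK addrC. Qed.

Lemma EV_of_B i a a' b : bijB X (D p q i a b) -> bijB X (D p q i a' b) -> EV i a a'.
Proof.
move=> h h'; have [le|lt] := leP a a'.
  exists (absz (a' - a)); left; split; first by lia.
  apply: (@V_shift i a b); apply: B_V => //.
  by rewrite D1; have -> : a + (absz (a' - a))%:Z = a' by lia.
exists (absz (a - a')); right; split; first by lia.
apply: (@V_shift i a' b); apply: B_V => //.
by rewrite D1; have -> : a' + (absz (a - a'))%:Z = a by lia.
Qed.

Lemma EV_B i a a' b : EV i a a' -> bijB X (D p q i a b) -> bijB X (D p q i a' b).
Proof.
move=> [n [[-> h1]|[e h1]]] h.
  by rewrite -D1; apply: V_B h; apply: V_shift h1.
by apply: (@V_B' _ _ _ X i _ n); [apply: V_shift h1|rewrite D1 -e].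
Qed.

Lemma EV_BJ a a' b : EV true a a' -> BJ a b -> BJ a' b.
Proof. exact: EV_B. Qed.

Lemma EV_BJ' a b b' : EV false b b' -> BJ a b -> BJ a b'.
Proof. by move=> h; rewrite /BJ !(D_swap true); apply: EV_B. Qed.

Lemma BJ_EV a a' b : BJ a b -> BJ a' b -> EV true a a'.
Proof. exact: EV_of_B. Qed.

Lemma BJ_EV' a b b' : BJ a b -> BJ a b' -> EV false b b'.
Proof. by rewrite /BJ !(D_swap true); apply: EV_of_B. Qed.

(* The vanishing of Hom and Ext^1 from the sheaf of the chord uv to X, as a bijectivity
   condition on X; a boundary segment gives a trivial condition. *)
Definition perpc (u v : marked) : Prop :=
  match u, v with
  | Outer l, Inner i | Inner i, Outer l => BJ (- i) l
  | Inner a, Inner b => if a < b then EV true (- b) (- a - 1) else EV true (- a) (- b - 1)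
  | Outer a, Outer b => if a < b then EV false a (b - 1) else EV false b (a - 1)
  end.

Lemma perpc_sym u v : u <> v -> perpc u v -> perpc v u.
Proof.
case: u v => a [] b //= ne; case: (ltgtP a b) => // e; by case: ne; rewrite e.
Qed.

Lemma perpc_boundary u v : boundary_side u v -> perpc u v.
Proof.
case: u v => a [] b //= [] ->.
- rewrite ltrDl ltr01 opprD; exact: EV_refl.
- rewrite ltNge lerDl ler01 /= opprD; exact: EV_refl.
- rewrite ltrDl ltr01 addrK; exact: EV_refl.
- rewrite ltNge lerDl ler01 /= addrK; exact: EV_refl.
Qed.

Lemma perpc_inner a b : a < b -> perpc (Inner a) (Inner b) -> EV true (- b) (- a - 1).
Proof. by rewrite /= => ->. Qed.
Lemma perpc_outer a b : a < b -> perpc (Outer a) (Outer b) -> EV false a (b - 1).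
Proof. by rewrite /= => ->. Qed.

(** A peripheral chord links its right end to its left end; the links compose along the path [b],
    [c], [d], [a]. The next three lemmas are similar paths. *)
Lemma resolve_inner a b c d : perpc (Inner c) (Inner d) ->
  perpc (Inner a) (Inner d) -> perpc (Inner c) (Inner b) ->
  a < c -> c < b -> b < d -> perpc (Inner a) (Inner b).
Proof.
move=> h h1 h2 ac cb bd.
have cd := lt_trans cb bd; have ad := lt_trans ac cd; have ab := lt_trans ac cb.
rewrite /= ab; move: h h1 h2; rewrite /= cd ad cb => h h1 h2.
exact: EV_trans (EV_trans h2 (EV_sym h)) h1.
Qed.

Lemma resolve_inner' a b c d : perpc (Inner a) (Inner b) ->
  perpc (Inner a) (Inner d) -> perpc (Inner c) (Inner b) ->
  a < c -> c < b -> b < d -> perpc (Inner c) (Inner d).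
Proof.
move=> h h1 h2 ac cb bd.
have cd := lt_trans cb bd; have ad := lt_trans ac cd; have ab := lt_trans ac cb.
rewrite /= cd; move: h h1 h2; rewrite /= ab ad cb => h h1 h2.
exact: EV_trans h1 (EV_trans (EV_sym h) h2).
Qed.

Lemma resolve_outer a b c d : perpc (Outer c) (Outer d) ->
  perpc (Outer a) (Outer d) -> perpc (Outer c) (Outer b) ->
  a < c -> c < b -> b < d -> perpc (Outer a) (Outer b).
Proof.
move=> h h1 h2 ac cb bd.
have cd := lt_trans cb bd; have ad := lt_trans ac cd; have ab := lt_trans ac cb.
rewrite /= ab; move: h h1 h2; rewrite /= cd ad cb => h h1 h2.
exact: EV_trans (EV_trans h1 (EV_sym h)) h2.
Qed.

Lemma resolve_outer' a b c d : perpc (Outer a) (Outer b) ->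
  perpc (Outer a) (Outer d) -> perpc (Outer c) (Outer b) ->
  a < c -> c < b -> b < d -> perpc (Outer c) (Outer d).
Proof.
move=> h h1 h2 ac cb bd.
have cd := lt_trans cb bd; have ad := lt_trans ac cd; have ab := lt_trans ac cb.
rewrite /= cd; move: h h1 h2; rewrite /= ab ad cb => h h1 h2.
exact: EV_trans h2 (EV_trans (EV_sym h) h1).
Qed.

Lemma cr_neq u v z w : cr u v z w -> [/\ u <> z, u <> w, v <> z & v <> w].
Proof.
rewrite crE => /and5P[/nqmP a /nqmP b /nqmP c /nqmP d _].
by split=> e; [apply: a|apply: c|apply: b|apply: d].
Qed.

(** In each distribution of the endpoints over the two boundaries, the condition for [z w] and those
    for two of the sides compose to the one for [u v]. *)
Lemma resolve u v z w : cr u v z w -> perpc z w ->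
  perpc u z -> perpc u w -> perpc v z -> perpc v w -> perpc u v.
Proof.
move=> c h; have [n1 n2 n3 n4] := cr_neq c.
have n5 : z <> w by move=> e; move: c; rewrite e crE addbb !andbF.
have n6 : u <> v by move=> e; move: c; rewrite e -cr_sym crE addbb !andbF.
wlog zw : z w c h n1 n2 n3 n4 n5 / ltm z w.
  move=> W h1 h2 h3 h4; have [zw|wz] : ltm z w \/ ltm w z by have /nqmP/orP := n5.
    exact: (W z w).
  apply: (W w z) => //; first by rewrite cr_swap2.
    exact: perpc_sym h.
  by move=> e; apply: n5.
wlog uv : u v c n1 n2 n3 n4 n6 / ltm u v.
  move=> W h1 h2 h3 h4; have [uv|vu] : ltm u v \/ ltm v u by have /nqmP/orP := n6.
    exact: (W u v).
  apply: perpc_sym; first by move=> e; apply: n6.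
  by apply: (W v u) => //; [rewrite cr_swap1|move=> e; apply: n6].
move=> h1 h2 h3 h4.
have S1 := perpc_sym n1 h1; have S2 := perpc_sym n2 h2.
have S3 := perpc_sym n3 h3; have S4 := perpc_sym n4 h4.
have Sh := perpc_sym n5 h.
case: u v uv c n6 h1 h2 h3 h4 S1 S2 S3 S4 {n1 n2 n3 n4} => u [] v // uv;
  case: z w zw h n5 Sh => z [] w // zw h n5 Sh c n6 h1 h2 h3 h4 S1 S2 S3 S4;
  rewrite /cr /ext /btw /ltm in c zw uv.
- apply: perpc_sym; first by move=> e; apply: n6.
  have [o|o] : (v < w /\ w < u /\ u < z) \/ (w < v /\ v < z /\ z < u).
    by move: c zw uv; clear; lia.
    by case: o => o1 [o2 o3]; apply: (@resolve_inner v u w z).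
  by case: o => o1 [o2 o3]; apply: (@resolve_inner' w z v u).
- have [o1 o2] : v < w /\ w < u by move: c zw uv; clear; lia.
  rewrite /= ltNge ltW ?(lt_trans o1 o2) //=.
  apply: EV_trans (BJ_EV h1 h) _.
  exact: perpc_inner o1 h4.
- have [o1 o2] : w < v /\ v < z by move: c zw uv; clear; lia.
  have g1 := perpc_inner (lt_trans o1 o2) Sh; have g2 := perpc_inner o1 S4.
  exact: EV_BJ (EV_trans g1 (EV_sym g2)) h1.
- exact: EV_BJ (BJ_EV h S3) h2.
- have [o1 o2] : z < u /\ u < w by move: c zw uv; clear; lia.
  have g1 := perpc_outer (lt_trans o1 o2) h; have g2 := perpc_outer o2 h2.
  exact: EV_BJ' (EV_trans g1 (EV_sym g2)) S3.
- have [o1 o2] : u < z /\ z < v by move: c zw uv; clear; lia.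
  rewrite /= (lt_trans o1 o2).
  exact: EV_trans (BJ_EV' h2 h) (perpc_outer o2 S3).
- have [o|o] : (u < z /\ z < v /\ v < w) \/ (z < u /\ u < w /\ w < v).
    by move: c zw uv; clear; lia.
    by case: o => o1 [o2 o3]; apply: (@resolve_outer u v z w).
  by case: o => o1 [o2 o3]; apply: (@resolve_outer' z w u v).
Qed.

Section Generation.
Context (p0 : (0 < p)%N) (q0 : (0 < q)%N).
Context (A : marked -> marked -> Prop).
Hypothesis A_arc : forall u v, A u v -> arcok p q u v.
Hypothesis A_tr : forall n u v, A u v -> A (tr p q n u) (tr p q n v).
Hypothesis A_nc : forall u v z w, A u v -> A z w -> ~~ cr u v z w.
Hypothesis A_max : forall u v, arcok p q u v -> (forall z w, A z w -> ~~ cr u v z w) -> A u v.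
Hypothesis A_fin : exists cs : seq (marked * marked), forall u v, A u v ->
  exists c n, [/\ In c cs, u = tr p q n c.1 & v = tr p q n c.2].
Hypothesis A_perp : forall u v, A u v -> perpc u v.

(** A far translate is separated from [u v]: as [p] and [q] are at least 1, a shift beyond the sum
    of all indices suffices. *)
Lemma cr_bound u v z w : exists K : nat, forall n,
  cr u v (tr p q n z) (tr p q n w) -> `|n| <= K%:Z.
Proof.
pose val x : nat := match x with Inner i | Outer i => `|i|%N end.
exists (val u + val v + val z + val w)%N => n.
set K := (val u + _ + _ + _)%N.
have [x ex] : exists x, x = n * p%:Z by eexists.
have [y ey] : exists y, y = n * q%:Z by eexists.
move=> c; rewrite leNgt; apply/negP => h.
have hx : (x < - K%:Z /\ y < - K%:Z) \/ (K%:Z < x /\ K%:Z < y).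
  have [n0|n0] := leP 0 n.
    by right; rewrite ex ey; move: h p0 q0; clear -n0; nia.
  by left; rewrite ex ey; move: h p0 q0; clear -n0; nia.
move: c hx; rewrite /K /val; clear -ex ey; rewrite crE /nqm /btw.
by case: u v z w => a [] b [] c [] d; rewrite /tr -?ex -?ey /ltm /=; clear; lia.
Qed.

Lemma count_lt (T : Type) (P Q : pred T) (s : seq T) x : In x s ->
  (forall y, In y s -> P y -> Q y) -> Q x -> ~~ P x -> (count P s < count Q s)%N.
Proof.
elim: s => //= y s IH xs sub Qx Px.
have le : (count P s <= count Q s)%N.
  elim: s sub {IH xs} => //= z s IHs sub; apply: leq_add; last first.
    by apply: IHs => t [<-|ts]; apply: sub; [left|right; right].
  by case hP: (P z) => //; rewrite (sub z _ hP) //; right; left.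
case: xs => [->|xs].
  by rewrite Qx (negPf Px) add0n add1n ltnS.
rewrite -addnS; apply: leq_add; last first.
  by apply: IH => // t ts; apply: sub; right.
by case hP: (P y) => //; rewrite (sub y _ hP) //; left.
Qed.

Lemma perpc_all u v : u <> v -> perpc u v.
Proof.
have [cs hcs] := A_fin.
move=> uv.
(* [L] contains all chords of [A] crossing [u v]. It stays fixed, and the induction is on how many
   of its members cross the current chord. *)
have [L [LA hL]] : exists L : seq (marked * marked), (forall c, In c L -> A c.1 c.2) /\
    forall z w, A z w -> cr u v z w -> In (z, w) L.
  have [K hK] : exists K : nat, forall c, In c cs -> forall n,
      cr u v (tr p q n c.1) (tr p q n c.2) -> `|n| <= K%:Z.
    elim: cs {hcs} => [|c cs [K IH]]; first by exists 0%N.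
    have [K' hK'] := cr_bound u v c.1 c.2; exists (K + K')%N => c' [<-|h] n hc.
      by have := hK' _ hc; lia.
    by have := IH _ h _ hc; lia.
  pose L0 := [seq (tr p q (n%:Z - K%:Z) c.1, tr p q (n%:Z - K%:Z) c.2) |
    c <- [seq c <- cs | `[< A c.1 c.2 >]], n <- iota 0 (K + K).+1].
  have inP (T T' : Type) (f : T -> T') x s : In x s -> In (f x) (map f s).
    by elim: s => //= y s IH [->|/IH]; [left|right].
  have in_cat' (T : Type) (x : T) s t : In x s \/ In x t -> In x (s ++ t).
    by elim: s => [|y s IH] /= [] // => [[->|h]|h]; [left|right; apply: IH; left|right; apply: IH; right].
  have in_pairs (T T' T'' : Type) (f : T -> T' -> T'') x y s t :
      In x s -> In y t -> In (f x y) [seq f a b | a <- s, b <- t].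
    elim: s => //= z s IH h hy; apply: in_cat'; case: h => [->|/IH h].
      by left; apply: inP.
    by right; apply: h.
  have in_iota m n0 x : (m <= x)%N -> (x < m + n0)%N -> In x (iota m n0).
    elim: n0 m => [|n0 IH] m h1 h2 /=; first by lia.
    have [->|ne] := eqVneq m x; [by left|right; apply: IH; lia].
  exists [seq c <- L0 | `[< A c.1 c.2 >]]; split.
    by move=> c; elim: L0 => //= c' L0 IH; case: asboolP => // h [<-|].
  move=> z w hzw hc; have [c [n [hin ez ew]]] := hcs _ _ hzw.
  have hn : `|n| <= K%:Z by apply: (hK c hin); rewrite -ez -ew.
  have hA : A c.1 c.2.
    have := A_tr (- n) hzw; rewrite ez ew !tr_tr addrN !tr0 //.
  have : In (z, w) L0.
    rewrite /L0; have : In c [seq c <- cs | `[< A c.1 c.2 >]].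
      elim: (cs) hin => //= c' s IH [->|/IH h]; last by case: ifP => // _; right.
      by case: asboolP => // _; left.
    have hn' : In (absz (n + K%:Z)) (iota 0 (K + K).+1) by apply: in_iota; lia.
    have -> : (z, w) = (fun (c : marked * marked) (n : nat) =>
        (tr p q (n%:Z - K%:Z) c.1, tr p q (n%:Z - K%:Z) c.2)) c (absz (n + K%:Z)).
      by rewrite /= ez ew; have -> : (absz (n + K%:Z))%:Z - K%:Z = n by lia.
    by move=> h; apply: in_pairs hn'.
  elim: L0 => //= c' s IH [e|/IH h]; last by case: ifP => // _; right.
  by rewrite e /=; case: asboolP => // _; left.
have [m] := ubnP (count (fun c => cr u v c.1 c.2) L).
elim: m u v uv hL => // m IH u v uv hL hm.
wlog o : u v uv hL hm / ltm u v.
  move=> W; have /nqmP/orP[o|o] := uv; first exact: W.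
  apply: perpc_sym; first by move=> e; apply: uv.
  apply: W => //; first by move=> e; apply: uv.
    by move=> z w; rewrite cr_swap1; apply: hL.
  by rewrite (eq_count (a2 := fun c => cr u v c.1 c.2)) // => c; rewrite cr_swap1.
have [b|nb] := pselect (boundary_side u v); first exact: perpc_boundary.
have [hA|[z [w [hzw c]]]] : (A u v \/ A v u) \/ exists z w, A z w /\ cr u v z w.
  have [o'|o'] : oriented u v \/ oriented v u.
    move: o nb; case: (u) (v) => a [] b //= o nb; [right|left|left] => //.
      by have e : b + 1 <> a; [move=> e; apply: nb; right|move: o e; clear; lia].
    by have e : a + 1 <> b; [move=> e; apply: nb; left|move: o e; clear; lia].
  - have [h|h] := chord_or_cross p0 q0 A_arc A_tr A_nc A_max o'; first by left; left.
    by right.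
  - have [h|[z [w [h1 h2]]]] := chord_or_cross p0 q0 A_arc A_tr A_nc A_max o'; first by left; right.
    by right; exists z, w; rewrite -cr_swap1.
  case: hA => [/A_perp //|/A_perp]; apply: perpc_sym => e; by apply: uv.
have [n1 n2 n3 n4] := cr_neq c.
(* A side of the quadrilateral crosses only chords that [u v] crosses, and no longer [z w], with
   which it shares an endpoint. *)
have sub x y (xy : (x = u /\ y = v) \/ (x = v /\ y = u)) t (tzw : t = z \/ t = w) : perpc x t.
  have cxy : cr x y z w by case: xy => -[-> ->] //; rewrite cr_swap1.
  have key a b : cr x t a b -> A a b -> cr u v a b.
    move=> c' hab; have nc := A_nc hzw hab.
    have : cr x y a b.
      case: tzw => tt; rewrite tt in c'; first exact: side_cross cxy nc c'.
      apply: (@side_cross x y w z) => //; [by rewrite cr_swap2|by rewrite cr_swap1].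
    by case: xy => -[-> ->] //; rewrite cr_swap1.
  apply: IH.
  - by case: xy tzw => -[-> _] [->|->].
  - by move=> a b hab c'; apply: hL => //; apply: key c' hab.
  - rewrite ltnS in hm; apply: leq_trans hm; apply: (@count_lt _ _ _ _ (z, w)) => //.
    + exact: hL.
    + by move=> y' /LA hy c'; apply: key.
    + case: tzw => -> /=; first by rewrite -cr_sym -cr_swap2 cr_endpoint.
      by rewrite -cr_sym -cr_swap1 -cr_swap2 cr_endpoint.
apply: (resolve c (A_perp hzw)); apply: sub; try (by left); try (by right).
Qed.

End Generation.

End IndexEquivalence.

(** * Tilting sheaves from chords *)

Section Tilting.
Context (k : closedFieldType) (p q : nat) (p0 : (0 < p)%N) (q0 : (0 < q)%N).
Local Notation coh := (coh k p q).
Local Notation D := (D p q).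
Local Notation tr := (tr p q).
Local Notation arcok := (arcok p q).

Lemma DD i a b c d : D i a b + D i c d = D i (a + c) (b + d).
Proof. by rewrite /D addrACA !mulrzDr. Qed.

Lemma DN i a b : - D i a b = D i (- a) (- b).
Proof. by rewrite /D opprD !mulrNz. Qed.

Lemma eeD i b : ee i *~ b = D i b 0.
Proof. by rewrite /D mulr0z addr0. Qed.

Lemma OD i l : e1 *~ i - e2 *~ l = D true i (- l).
Proof. by rewrite /D mulrNz. Qed.

(** Explicit models for the values of [phi]; the zero sheaf is a default for pairs that are not
    oriented. *)
Definition conc (u v : marked) : coh :=
  match u, v with
  | Outer l, Inner i => O k (D true i (- l))
  | Inner a, Inner b => Tq k p q true b (absz (b - a - 1)%R)
  | Outer a, Outer b => Tq k p q false (- a) (absz (b - a - 1)%R)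
  | Inner _, Outer _ => zero_sheaf k p q
  end.

Lemma perp_conc X u v : arcok u v -> Hom_zero (conc u v) X -> Ext1_zero (conc u v) X ->
  perpc X u v.
Proof.
case: u v => a [] b //= ok h1 h2.
- have ab : a < b by move: ok; clear; lia.
  rewrite ab; exists (absz (b - a - 1)%R); left; split; first by move: ok; clear; lia.
  have := conj (Hom_injV p0 q0 h1) (Ext_surV p0 q0 h2).
  by rewrite eeD DN oppr0.
- have := conj (Hom_injB p0 q0 h1) (Ext_surB p0 q0 h2).
  by rewrite DN opprK.
- have ab : a < b by move: ok; clear; lia.
  rewrite ab; exists (absz (b - a - 1)%R); left; split; first by move: ok; clear; lia.
  have := conj (Hom_injV p0 q0 h1) (Ext_surV p0 q0 h2).
  by rewrite eeD DN opprK oppr0.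
Qed.

Definition surC (u v : marked) (X : coh) : Prop :=
  match u, v with
  | Outer l, Inner i => surB X (D true (- i) l)
  | Inner a, Inner b => surV X true (D true (- b) 0) (absz (b - a - 1)%R)
  | Outer a, Outer b => surV X false (D false a 0) (absz (b - a - 1)%R)
  | Inner _, Outer _ => True
  end.

Lemma surC_lift u v X : surC u v X -> liftE (conc u v) X.
Proof.
case: u v => a [] b /= h.
- by apply: (lift_T p0 q0); rewrite eeD DN oppr0.
- by apply: (liftE_zero p0 q0); apply/(is_zeroP p0 q0) => m; rewrite (triv_eq m 0); apply: null0.
- by apply: (lift_O p0 q0); rewrite DN opprK.
- by apply: (lift_T p0 q0); rewrite eeD DN opprK oppr0.
Qed.

Lemma surC_zero u v : surC u v (zero_sheaf k p q).
Proof. by case: u v => a [] b //=; [apply: surV_zero|apply: surB_zero|apply: surV_zero]. Qed.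

Lemma surC_dsum u v X Y : surC u v X -> surC u v Y -> surC u v (dsum X Y).
Proof. by case: u v => a [] b //=; [apply: surV_dsum|apply: surB_dsum|apply: surV_dsum]. Qed.

(** A monomial obstructing surjectivity solves an equation in the grading group. The integer in it
    selects a translate of the second chord, and the bounds on the exponents say that this translate
    crosses [u v]. *)
Lemma surC_conc u v u' v' : arcok u v -> arcok u' v' ->
  (forall n, ~~ cr u v (tr n u') (tr n v')) -> surC u v (conc u' v').
Proof.
case: u v => a [] b //= ok; case: u' v' => c [] d //= ok' h.
- apply: surV_T => N x y; rewrite eeD DD D1 D2 D_eq => -[n []] /=.
  have := h n; rewrite /cr /ext /btw /ltm /=.
  set z := n * p%:Z; clearbody z; move: ok ok'; clear; lia.
- apply: surV_O => N x y; rewrite DD D1 D2 D_eq => -[n []] /=.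
  have := h n; rewrite /cr /ext /btw /ltm /=.
  set z := n * p%:Z; clearbody z; move: ok ok'; clear; lia.
- exact: (surV_T' (i := true)).
- exact: surB_T.
- apply: surB_O => N x y; rewrite DD (D1 p q true) (D2 p q true) D_eq => -[n []] /=.
  have := h n; rewrite /cr /ext /btw /ltm /=.
  set z := n * p%:Z; set t := n * q%:Z; clearbody z t; move: ok ok'; clear; lia.
- exact: surB_T.
- exact: (surV_T' (i := false)).
- apply: surV_O => N x y; rewrite (D_swap p q true) DD D1 D2 D_eq => -[n []] /=.
  have := h (- n); rewrite /cr /ext /btw /ltm /= !mulNr.
  set z := n * p%:Z; set t := n * q%:Z; clearbody z t; move: ok ok'; clear; lia.
- apply: surV_T => N x y; rewrite eeD DD D1 D2 D_eq => -[n []] /=.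
  have := h (- n); rewrite /cr /ext /btw /ltm /= !mulNr.
  set z := n * q%:Z; clearbody z; move: ok ok'; clear; lia.
Qed.

Lemma brick_conc u v : arcok u v -> brick (conc u v).
Proof.
case: u v => a [] b //= ok; last 1 first.
- by apply: (brick_T _ p0 q0); rewrite /per; move: ok; clear; lia.
- by apply: (brick_T _ p0 q0); rewrite /per; move: ok; clear; lia.
- exact: brick_O.
Qed.

Lemma orth_conc u v u' v' : arcok u v -> arcok u' v' ->
  (forall n, ~ (u = tr n u' /\ v = tr n v')) -> orth (conc u v) (conc u' v').
Proof.
case: u v => a [] b //= ok; case: u' v' => c [] d //= ok' h.
- apply: orth_T => //=; try (by move: ok ok'; clear; lia).
  move=> [[r e1] e2]; apply: (h (- r)); rewrite !mulNr.
  by split; congr Inner; move: e1 e2 ok ok'; set z := r * p%:Z; clearbody z; clear; lia.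
- refine (@orth_Hom1 k p q p0 q0 _ _ _); exact: (Hom_zero_TO p0 q0).
- refine (@orth_Hom1 k p q p0 q0 _ _ _); exact: (@Hom_zero_TT k p q p0 q0 true).
- refine (@orth_Hom2 k p q p0 q0 _ _ _); exact: (Hom_zero_TO p0 q0).
- apply: orth_O => //; apply/negP => /eqP; rewrite D_eq => -[r /= [e1 e2]]; apply: (h r).
  by split; [congr Outer|congr Inner]; lia.
- refine (@orth_Hom2 k p q p0 q0 _ _ _); exact: (Hom_zero_TO p0 q0).
- refine (@orth_Hom1 k p q p0 q0 _ _ _); exact: (@Hom_zero_TT k p q p0 q0 false).
- refine (@orth_Hom1 k p q p0 q0 _ _ _); exact: (Hom_zero_TO p0 q0).
- apply: orth_T => //=; try (by move: ok ok'; clear; lia).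
  move=> [[r e1] e2]; apply: (h r).
  by split; congr Outer; move: e1 e2 ok ok'; set z := r * q%:Z; clearbody z; clear; lia.
Qed.

Local Notation m0 := (Inner 0, Inner 0).

Lemma In_nth (T : Type) (x0 : T) s i : (i < size s)%N -> In (nth x0 s i) s.
Proof. by elim: s i => // x s IH [|i] /= h; [left|right; apply: IH]. Qed.

Lemma tilting_chords (cs : seq (marked * marked)) :
  (forall c, In c cs -> arcok c.1 c.2) ->
  (forall c c', In c cs -> In c' cs -> forall n, ~~ cr c.1 c.2 (tr n c'.1) (tr n c'.2)) ->
  (forall i j, (i < size cs)%N -> (j < size cs)%N -> i <> j -> forall n,
     ~ ((nth m0 cs i).1 = tr n (nth m0 cs j).1 /\ (nth m0 cs i).2 = tr n (nth m0 cs j).2)) ->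
  (forall X : coh, (forall c, In c cs -> perpc X c.1 c.2) ->
     forall u v, u <> v -> perpc X u v) ->
  tilting (big_dsum [seq conc c.1 c.2 | c <- cs]).
Proof.
move=> H1 H2 H3 H4; split.
- apply: (liftE_Ext1 p0 q0).
  have H c : In c cs -> surC c.1 c.2 (big_dsum [seq conc c.1 c.2 | c <- cs]).
    move=> hc; have : forall c', In c' cs -> In c' cs by [].
    elim: {1 3}cs => [|c' s IH] /= sub; first exact: surC_zero.
    apply: surC_dsum; last by apply: IH => t ht; apply: sub; right.
    by apply: surC_conc; [apply: H1|apply: H1; apply: sub; left|
      move=> n; apply: H2 => //; apply: sub; left].
  move: H; move: {1 3}(big_dsum _) => X; elim: (cs) => [|c s IH] /= H.
    (* The empty sum is the zero sheaf, which is [conc] of this default pair. *)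
    by apply: (@surC_lift (Inner 0) (Outer 0)).
  apply: (liftE_dsum p0 q0); last by apply: IH => t ht; apply: H; right.
  by apply: surC_lift; apply: H; left.
- move=> X h1 h2; have P c : In c cs -> perpc X c.1 c.2.
    move=> hc; have [i [hi ei]] : exists i, (i < size cs)%N /\ c = nth m0 cs i.
      elim: (cs) hc => //= c' s IH [<-|/IH[i [hi ei]]]; first by exists 0%N.
      by exists i.+1.
    have [|a1 a2] := perp_big_dsum p0 q0 h1 h2 (d := i); first by rewrite size_map.
    by rewrite (nth_map m0) // -ei in a1 a2; apply: perp_conc a1 a2; apply: H1.
  apply/(is_zeroP p0 q0) => m; apply: bijB_zero => d.
  have [a [b ->]] := D_ex true d.
  have := H4 X P (Outer b) (Inner (- a)); rewrite /= /BJ opprK; exact.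
- apply: (multiplicity_free_bricks p0 q0) => [i j|i]; rewrite size_map.
    move=> hi hj ij; rewrite !(nth_map m0) //.
    by apply: orth_conc; [apply: H1; apply: In_nth|apply: H1; apply: In_nth|apply: H3].
  by move=> hi; rewrite (nth_map m0) //; apply: brick_conc; apply: H1; apply: In_nth.
Qed.

End Tilting.

(** * Lifting curves from the annulus *)

Local Open Scope classical_set_scope.

Section Continuity.
Context (R : realType) (T : topologicalType).
Implicit Types f g : T -> R.

Lemma contD f g : continuous f -> continuous g -> continuous (fun x => f x + g x).
Proof. by move=> hf hg x; apply: cvgD; [apply: hf|apply: hg]. Qed.

Lemma contN f : continuous f -> continuous (fun x => - f x).
Proof. by move=> hf x; apply: cvgN; apply: hf. Qed.

Lemma contB f g : continuous f -> continuous g -> continuous (fun x => f x - g x).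
Proof. by move=> hf hg; apply: contD => //; apply: contN. Qed.

Lemma contM f g : continuous f -> continuous g -> continuous (fun x => f x * g x).
Proof. by move=> hf hg x; apply: cvgM; [apply: hf|apply: hg]. Qed.

Lemma contC (c : R) : continuous (fun _ : T => c).
Proof. by move=> x; apply: cvg_cst. Qed.

Lemma cont_comp (U : topologicalType) (h : U -> R) (w : T -> U) :
  continuous h -> continuous w -> continuous (fun x => h (w x)).
Proof. by move=> hh hw x; apply: continuous_comp; [apply: hw|apply: hh]. Qed.

Lemma cvg_sum_nat n (F : nat -> T -> R) x :
  (forall i, (i < n)%N -> F i y @[y --> x] --> F i x) ->
  (\sum_(i < n) F i y) @[y --> x] --> \sum_(i < n) F i x.
Proof.
elim: n => [|n IH] h.
  by under eq_fun do rewrite big_ord0; rewrite big_ord0; apply: cvg_cst.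
under eq_fun do rewrite big_ord_recr; rewrite big_ord_recr /=.
by apply: cvgD; [apply: IH => i hi; apply: h; apply: ltnW|apply: h].
Qed.

Lemma cont_pair (U V : topologicalType) (f : T -> U) (g : T -> V) :
  continuous f -> continuous g -> continuous (fun x => (f x, g x)).
Proof. by move=> hf hg x; apply: cvg_pair; [apply: hf|apply: hg]. Qed.

End Continuity.

Section Clamp.
Context (R : realType).

Definition clamp (x : R) : R := Num.max 0 (Num.min x 1).

Lemma clamp_bounds x : 0 <= clamp x <= 1.
Proof. by rewrite le_max lexx ge_max ler01 ge_min lexx orbT. Qed.

Lemma clamp_id x : 0 <= x <= 1 -> clamp x = x.
Proof. by rewrite /clamp => /andP[h0 h1]; rewrite min_l // max_r. Qed.

Lemma cont_clamp : continuous clamp.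
Proof.
apply: max_fun_continuous; first exact: contC.
by apply: min_fun_continuous; [move=> x; apply: cvg_id|apply: contC].
Qed.

(** The retraction of the line onto the unit interval; through it curves and homotopies extend to
    the whole line and plane, where the analysis is done. *)
Definition kap (x : R) : unit_itv R := mk_itv (clamp_bounds x).

Lemma rval_kap x : rval (kap x) = clamp x.
Proof. by []. Qed.

Lemma rval_inj : injective (@rval R).
Proof. exact: val_inj. Qed.

Lemma rval_mk x (h : 0 <= x <= 1) : rval (mk_itv h : unit_itv R) = x.
Proof. by []. Qed.

Lemma rval_i0 : rval (i0 R) = 0. Proof. by []. Qed.
Lemma rval_i1 : rval (i1 R) = 1. Proof. by []. Qed.

Lemma kap_rval t : kap (rval t) = t.
Proof. by apply: rval_inj; rewrite rval_kap clamp_id // unit_itv_bounds. Qed.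

Lemma kap0 : kap 0 = i0 R.
Proof. by apply: rval_inj; rewrite rval_kap clamp_id // lexx ler01. Qed.

Lemma kap1 : kap 1 = i1 R.
Proof. by apply: rval_inj; rewrite rval_kap clamp_id // lexx ler01. Qed.

Lemma cont_rval : continuous (@rval R).
Proof. exact: initial_continuous. Qed.

Lemma cont_itv (T : topologicalType) (w : T -> unit_itv R) :
  continuous (fun x => rval (w x)) -> continuous w.
Proof. exact: (@continuous_comp_initial _ T R (@set_val R _)). Qed.

Lemma cont_kap : continuous kap.
Proof. apply: cont_itv; exact: cont_clamp. Qed.

End Clamp.

Section UniformContinuity.
Context (R : realType).
Local Notation sq := (R * R)%type.

Definition in_sq (x : sq) : Prop := 0 <= x.1 <= 1 /\ 0 <= x.2 <= 1.

(** Heine-Cantor, from the near-covering form of compactness; the modulus has the form of the mesh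
    of a subdivision. *)
Lemma sq_unif (f : sq -> R) (e : R) : continuous f -> 0 < e ->
  \forall n \near \oo, forall x y, in_sq x ->
    `|x.1 - y.1| <= n.+1%:R^-1 -> `|x.2 - y.2| <= n.+1%:R^-1 -> `|f x - f y| < e.
Proof.
move=> cf e0.
have K : compact (`[0 : R, 1]%classic `*` `[0 : R, 1]%classic).
  by apply: compact_setX; apply: segment_compact.
have := K; rewrite compact_near_coveringP => /(_ nat \oo
  (fun n x => forall y : sq, `|x.1 - y.1| <= n.+1%:R^-1 -> `|x.2 - y.2| <= n.+1%:R^-1 ->
    `|f x - f y| < e) _) => H.
have {}H := H _; have [] := H.
  move=> x _.
  have e2 : 0 < e / 2 by lra.
  have := cf x; move/cvgrPdist_lt/(_ _ e2)/nbhs_ballP => -[d /= d0 hd].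
  have d2 : 0 < d / 2 by lra.
  exists (ball x (d / 2), [set n | n.+1%:R^-1 < d / 2]).
    split; first exact: nbhsx_ballx.
    by near=> n; near: n; exact: (near_infty_natSinv_lt (PosNum d2)).
  move=> [x' n] /= [[b1 b2] hn] y h1 h2.
  rewrite /ball /= in b1 b2.
  have g1 : `|f x - f x'| < e / 2.
    by apply: hd; split; rewrite /ball /=; [apply: lt_trans b1 _|apply: lt_trans b2 _]; lra.
  have g2 : `|f x - f y| < e / 2.
    apply: hd; split; rewrite /ball /=.
      by apply: le_lt_trans (ler_distD x'.1 _ _) _; rewrite [d]splitr; apply: ltrD => //; apply: le_lt_trans h1 hn.
    by apply: le_lt_trans (ler_distD x'.2 _ _) _; rewrite [d]splitr; apply: ltrD => //; apply: le_lt_trans h2 hn.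
  by apply: le_lt_trans (ler_distD (f x) _ _) _; rewrite [e]splitr distrC; apply: ltrD.
move=> N _ hN; exists N => // n /= hn x y [h1 h2]; apply: hN => //.
Unshelve. all: by end_near. Qed.

End UniformContinuity.

(** * Angles in turns and lifting from the circle *)

Section Circle.
Context (R : realType).
Local Notation sq := (R * R)%type.

Definition tau : R := pi *+ 2.

Lemma tauE : tau = 2 * pi. Proof. by rewrite /tau mulr2n; ring. Qed.

(** Angles are measured in turns, so that the period is 1 as for the strip. *)
Definition cosc (t : R) : R := cos (tau * t).
Definition sinc (t : R) : R := sin (tau * t).

Lemma cont_cosc : continuous cosc.
Proof.
apply: cont_comp; first exact: continuous_cos.
by apply: contM; [apply: contC|move=> x; apply: cvg_id].
Qed.

Lemma cont_sinc : continuous sinc.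
Proof.
apply: cont_comp; first exact: continuous_sin.
by apply: contM; [apply: contC|move=> x; apply: cvg_id].
Qed.

Lemma coscD s t : cosc (s + t) = cosc s * cosc t - sinc s * sinc t.
Proof. by rewrite /cosc mulrDr cosD. Qed.

Lemma sincD s t : sinc (s + t) = sinc s * cosc t + cosc s * sinc t.
Proof. by rewrite /sinc mulrDr sinD. Qed.

Lemma cosc2sinc2 t : cosc t ^+ 2 + sinc t ^+ 2 = 1.
Proof. exact: cos2Dsin2. Qed.

Lemma trigc_nat n : cosc n%:R = 1 /\ sinc n%:R = 0.
Proof.
elim: n => [|n [h1 h2]]; first by rewrite /cosc /sinc mulr0 cos0 sin0.
have [c1 s1] : cosc 1 = 1 /\ sinc 1 = 0.
  by rewrite /cosc /sinc mulr1 /tau cos2pi sin2pi.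
by rewrite mulrSr coscD sincD h1 h2 c1 s1; split; ring.
Qed.

Lemma trigc_int t : t \is a Num.int -> cosc t = 1 /\ sinc t = 0.
Proof.
move=> /intrP[n ->]; have [h1 h2] := trigc_nat `|n|%N.
case: n h1 h2 => n /= h1 h2; first by [].
by rewrite NegzE mulrNz /cosc /sinc mulrN cosN sinN; move: h1 h2; rewrite /cosc /sinc => -> ->;
  rewrite oppr0.
Qed.

(** By the half-angle formula the fractional part [r] satisfies [sin (pi * r) = 0], whereas this
    sine is positive for [r] strictly between 0 and 1. *)
Lemma cosc_eq1 t : cosc t = 1 -> t \is a Num.int.
Proof.
move=> h; have [m hm] : exists m : int, m%:~R <= t < m%:~R + 1.
  exists (Num.floor t); have := Num.Theory.floor_itv t; rewrite intrD; exact.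
pose r := t - m%:~R; have hr : cosc r = 1.
  have [c s] := trigc_int (intr_int _ m).
  by have := h; rewrite -{1}(subrK m%:~R t) coscD c s mulr0 subr0 mulr1.
have [r0|r0] := eqVneq r 0; first by rewrite -(subrK m%:~R t) -/r r0 add0r intr_int.
have : 0 < sin (pi * r).
  apply: sin_gt0_pi; rewrite pmulr_rgt0 ?pi_gt0 // gtr_pMr ?pi_gt0 //.
  by rewrite lt_def r0 /= /r; move: hm; lra.
have : sin (pi * r) ^+ 2 = 0.
  have e : cosc r = 1 - 2 * sin (pi * r) ^+ 2.
    rewrite /cosc (_ : tau * r = pi * r + pi * r); last by rewrite tauE; ring.
    by rewrite cosD; have := cos2Dsin2 (pi * r); rewrite !expr2; lra.
  by rewrite hr in e; lra.
by move=> /eqP; rewrite expf_eq0 /= => /eqP ->; rewrite ltxx.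
Qed.

Lemma trigc_inj s t : cosc s = cosc t -> sinc s = sinc t -> s - t \is a Num.int.
Proof.
move=> h1 h2; apply: cosc_eq1.
rewrite /cosc mulrBr cosB -/(cosc s) -/(sinc s) -/(cosc t) -/(sinc t) h1 h2 -!expr2.
exact: cosc2sinc2.
Qed.

Lemma trigc_exists a b : a ^+ 2 + b ^+ 2 = 1 -> exists t, a = cosc t /\ b = sinc t.
Proof.
move=> h; have b1 : -1 <= a <= 1 by nra.
have t0 : tau != 0 by rewrite tauE mulf_neq0 // gt_eqF // pi_gt0.
have e : `|b| = Num.sqrt (1 - a ^+ 2) by rewrite -h [a ^+ 2 + _]addrC addrK sqrtr_sqr.
have c1 : cos (acos a) = a by rewrite acosK // in_itv.
have [b0|b0] := leP 0 b.
  exists (acos a / tau); rewrite /cosc /sinc mulrC divfK // c1 sin_acos // -e.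
  by rewrite ger0_norm.
exists (- (acos a / tau)); rewrite /cosc /sinc mulrN cosN sinN mulrC divfK // c1 sin_acos // -e.
by rewrite ltr0_norm // opprK.
Qed.

Definition clamp2 (x : sq) : sq := (clamp x.1, clamp x.2).

Lemma clamp2_id x : in_sq x -> clamp2 x = x.
Proof. by case: x => a b [h1 h2]; rewrite /clamp2 !clamp_id. Qed.

Lemma cont_fst' : continuous (fst : sq -> R). Proof. by move=> x; apply: cvg_fst. Qed.
Lemma cont_snd' : continuous (snd : sq -> R). Proof. by move=> x; apply: cvg_snd. Qed.

(** The segment from the origin to [x] is cut into steps over which the value turns by less than a
    quarter turn. The angle at [x] is the initial angle plus the arcsines of these steps, a finite
    sum continuous in [x]. *)
Lemma circle_lift (a b : sq -> R) : continuous a -> continuous b ->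
  (forall x, in_sq x -> a x ^+ 2 + b x ^+ 2 = 1) ->
  exists th : sq -> R, continuous th /\
    forall x, in_sq x -> a x = cosc (th x) /\ b x = sinc (th x).
Proof.
move=> ca cb ab.
(* A variation of both coordinates below 1/4 keeps the scalar product of successive values
   positive. *)
have e0 : (0 : R) < 1 / 4 by lra.
have [n [ha hb]] : exists n : nat,
  (forall x y, in_sq x -> `|x.1 - y.1| <= n.+1%:R^-1 -> `|x.2 - y.2| <= n.+1%:R^-1 ->
     `|a x - a y| < 1 / 4) /\
  (forall x y, in_sq x -> `|x.1 - y.1| <= n.+1%:R^-1 -> `|x.2 - y.2| <= n.+1%:R^-1 ->
     `|b x - b y| < 1 / 4).
  have [N _ hN] := sq_unif ca e0; have [M _ hM] := sq_unif cb e0.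
  exists (N + M)%N; split; [apply: (hN (N + M)%N) => /=|apply: (hM (N + M)%N) => /=].
    exact: leq_addr.
  exact: leq_addl.
have n0 : (0 : R) < n.+1%:R by rewrite ltr0n.
pose pt (i : nat) (x : sq) : sq :=
  (i%:R / n.+1%:R * (clamp2 x).1, i%:R / n.+1%:R * (clamp2 x).2).
have pt_sq i x : (i <= n.+1)%N -> in_sq (pt i x).
  move=> hi; have h : 0 <= (i%:R / n.+1%:R : R) <= 1.
    by rewrite divr_ge0 //= ler_pdivrMr // mul1r ler_nat.
  have /andP[h1 h2] := clamp_bounds x.1; have /andP[h3 h4] := clamp_bounds x.2.
  by rewrite /pt /clamp2 /in_sq /=; move: (i%:R / _) h => z /andP[z0 z1]; split; nra.
have cpt i : continuous (pt i).
  apply: cont_pair; apply: contM; try exact: contC.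
    exact: (cont_comp (@cont_clamp R) cont_fst').
  exact: (cont_comp (@cont_clamp R) cont_snd').
have step i x : `|(pt i x).1 - (pt i.+1 x).1| <= n.+1%:R^-1 /\
    `|(pt i x).2 - (pt i.+1 x).2| <= n.+1%:R^-1.
  have E (c : R) : 0 <= c <= 1 -> `|i%:R / n.+1%:R * c - i.+1%:R / n.+1%:R * c| <= n.+1%:R^-1.
    move=> /andP[c0 c1]; rewrite -[i.+1%:R]natr1.
    have -> : i%:R / n.+1%:R * c - (i%:R + 1) / n.+1%:R * c = - (n.+1%:R^-1 * c) by ring.
    by rewrite normrN ger0_norm ?mulr_ge0 ?invr_ge0 // ler_piMr // invr_ge0.
  by split; apply: E; apply: clamp_bounds.
(* With [dot], the sine and cosine of the angle between successive values. *)
pose cross i x := a (pt i x) * b (pt i.+1 x) - b (pt i x) * a (pt i.+1 x).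
pose dot i x := a (pt i x) * a (pt i.+1 x) + b (pt i x) * b (pt i.+1 x).
have small i x : (i <= n)%N -> -1 < cross i x < 1 /\ 0 < dot i x.
  move=> hi; have s0 := pt_sq i x (leqW hi); have [s1 s2] := step i x.
  have := ha _ _ s0 s1 s2; have := hb _ _ s0 s1 s2; have := ab _ s0.
  have := ab _ (pt_sq i.+1 x hi).
  rewrite /cross /dot; move: (a _) (b _) (a _) (b _) => A B A' B' h h'.
  rewrite !ltr_norml => /andP[u1 u2] /andP[u3 u4].
  have Ab : -1 <= A <= 1 by nra. have Bb : -1 <= B <= 1 by nra.
  have A'b : -1 <= A' <= 1 by nra. have B'b : -1 <= B' <= 1 by nra.
  by split; [apply/andP; split|]; nra.
have tau0 : tau != 0 by rewrite tauE mulf_neq0 // gt_eqF // pi_gt0.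
have z0 : in_sq (0 : R, 0 : R) by split=> /=; rewrite ?lexx ?ler01.
have [t0 [ta tb]] := trigc_exists (ab _ z0).
pose th m x := t0 + \sum_(i < m) asin (cross i x) / tau.
have key m x : (m <= n.+1)%N -> a (pt m x) = cosc (th m x) /\ b (pt m x) = sinc (th m x).
  elim: m => [|m IH] hm.
    have -> : pt 0%N x = (0, 0) by rewrite /pt mul0r !mul0r.
    by rewrite /th big_ord0 addr0.
  have [h1 h2] := IH (ltnW hm); have [c1 d0] := small m x hm.
  have eq1 := ab _ (pt_sq m x (ltnW hm)); have eq2 := ab _ (pt_sq m.+1 x hm).
  have -> : th m.+1 x = th m x + asin (cross m x) / tau by rewrite /th big_ord_recr /= addrA.
  have c2 : -1 <= cross m x <= 1 by move: c1 => /andP[? ?]; rewrite !ltW.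
  have es : sinc (asin (cross m x) / tau) = cross m x.
    by rewrite /sinc mulrC divfK // asinK // in_itv.
  have ec : cosc (asin (cross m x) / tau) = dot m x.
    rewrite /cosc mulrC divfK // cos_asin //.
    have -> : 1 - cross m x ^+ 2 = dot m x ^+ 2.
      rewrite -[1](mulr1 1) -{1}eq1 -eq2 /cross /dot; ring.
    by rewrite sqrtr_sqr gtr0_norm.
  rewrite coscD sincD es ec -h1 -h2 /cross /dot; split.
    rewrite -[LHS]mul1r -eq1; ring.
  rewrite -[LHS]mul1r -eq1; ring.
exists (th n.+1); split.
  move=> x; apply: cvgD; first exact: cvg_cst.
  apply: (@cvg_sum_nat R sq n.+1 (fun i x => asin (cross i x) / tau)) => i hi.
  apply: cvgM; last exact: cvg_cst.
  have [c1 _] := small i x hi.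
  apply: (continuous_comp (f := cross i) (g := @asin R)); last exact: continuous_asin.
  have c : continuous (cross i); last exact: c.
  by apply: contB; apply: contM; apply: cont_comp => //; apply: cpt.
move=> x hx; have [h1 h2] := key n.+1 x (leqnn _).
have e : pt n.+1 x = x by rewrite /pt divff ?gt_eqF // !mul1r clamp2_id // -surjective_pairing.
by rewrite e in h1 h2.
Qed.

End Circle.

Section IntermediateValues.
Context (R : realType).
Implicit Types g : R -> R.

Lemma ivt01 g a b v : continuous g -> 0 <= a <= 1 -> 0 <= b <= 1 -> g a <= v <= g b ->
  exists2 c, 0 <= c <= 1 & g c = v.
Proof.
move=> cg ha hb /andP[av vb].
have W x y : x <= y -> 0 <= x <= 1 -> 0 <= y <= 1 ->
    Num.min (g x) (g y) <= v <= Num.max (g x) (g y) -> exists2 c, 0 <= c <= 1 & g c = v.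
  move=> xy hx hy hv; have [c hc <-] := IVT xy (continuous_subspaceT cg) hv.
  by exists c => //; move: hc; rewrite in_itv /=; lra.
have [ab|/ltW ba] := leP a b; first by apply: (W a b) => //; rewrite ge_min av le_max vb orbT.
by apply: (W b a) => //; rewrite ge_min av orbT le_max vb.
Qed.

Lemma half_int (m : int) : (m%:~R + 2^-1 : R) \isn't a Num.int.
Proof.
apply/negP => /intrP[n e].
have : (m * 2 + 1)%:~R = (n * 2)%:~R :> R by rewrite intrD !intrM -e; lra.
by move=> /intr_inj; lia.
Qed.

(** A jump would pass through a half-integer. *)
Lemma int_valued_const g : continuous g -> (forall t, 0 <= t <= 1 -> g t \is a Num.int) ->
  forall t, 0 <= t <= 1 -> g t = g 0.
Proof.
move=> cg hg t ht.
have h0 : 0 <= (0 : R) <= 1 by lra.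
have W x y : 0 <= x <= 1 -> 0 <= y <= 1 -> ~ g x < g y.
  move=> hx hy xy; have /intrP[m em] := hg x hx; have /intrP[n en] := hg y hy.
  have mn : m + 1 <= n by move: xy; rewrite em en ltr_int; lia.
  have mn' : m%:~R + 1 <= n%:~R :> R by rewrite -(intrD _ m 1) ler_int.
  have [|c hc e] := @ivt01 g x y (m%:~R + 2^-1) cg hx hy; first by rewrite em en; lra.
  by have := hg c hc; rewrite e (negPf (half_int m)).
by case: (ltgtP (g t) (g 0)) => // h; [case: (W t 0)|case: (W 0 t)].
Qed.

End IntermediateValues.

Section AnnulusMaps.
Context (R : realType).

Lemma annulus_map (g : strip R -> R) : continuous g ->
  (forall u v, strip_rel u v -> g u = g v) ->
  exists2 G : annulus R -> R, continuous G & forall u, G (proj u) = g u.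
Proof.
move=> cg hg.
have inv (a b : strip R) : proj a == proj b -> g a == g b.
  by rewrite proj_eq => /hg ->.
exists (g \o repr); first exact: repr_comp_continuous.
by move=> u /=; apply/eqP; apply: inv; rewrite /proj reprK.
Qed.

Lemma proj_surj (P : annulus R) : exists u, P = proj u.
Proof. by exists (repr P); rewrite /proj reprK. Qed.

Lemma cont_proj : continuous (@proj R).
Proof. exact: pi_continuous. Qed.

Lemma proj_int (x y : R) t : x - y \is a Num.int -> proj ((x, t) : strip R) = proj ((y, t) : strip R).
Proof. by move=> h; apply/eqP; rewrite proj_eq /strip_rel /= h eqxx. Qed.

Lemma annulus_trig : exists C S Y : annulus R -> R,
  [/\ continuous C, continuous S, continuous Y &
      forall u, [/\ C (proj u) = cosc u.1, S (proj u) = sinc u.1 & Y (proj u) = rval u.2]].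
Proof.
have ci (u v : strip R) : strip_rel u v -> cosc u.1 = cosc v.1 /\ sinc u.1 = sinc v.1.
  case/andP => /trigc_int[h1 h2] _; have e : u.1 = (u.1 - v.1) + v.1 by rewrite subrK.
  move: h1 h2 e; move: (u.1 - v.1) => d h1 h2 ->.
  by rewrite coscD sincD h1 h2 !mul1r !mul0r subr0 add0r.
have cf : continuous (fst : strip R -> R) by move=> x; apply: cvg_fst.
have [C cC hC] := annulus_map (cont_comp (@cont_cosc R) cf) (fun u v h => (ci u v h).1).
have [S cS hS] := annulus_map (cont_comp (@cont_sinc R) cf) (fun u v h => (ci u v h).2).
have cy : continuous (fun u : strip R => rval u.2).
  by apply: (cont_comp (@cont_rval R)) => x; apply: cvg_snd.
have [|Y cY hY] := annulus_map cy; first by move=> u v /andP[_ /eqP ->].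
by exists C, S, Y.
Qed.

End AnnulusMaps.

Section Lifting.
Context (R : realType).
Local Notation sq := (R * R)%type.

(** Only the angular coordinate needs lifting; the height is a function on the annulus. *)
Lemma lift_square (h : sq -> annulus R) : continuous h ->
  exists th y : sq -> R, [/\ continuous th, continuous y &
    forall x, in_sq x -> h x = proj ((th x, kap (y x)) : strip R)].
Proof.
move=> ch; have [C [S [Y [cC cS cY hu]]]] := annulus_trig R.
have [||x _|th [cth hth]] := @circle_lift R (C \o h) (S \o h).
- exact: cont_comp ch.
- exact: cont_comp ch.
- have [u e] := proj_surj (h x); have [h1 h2 _] := hu u.
  by rewrite /= e h1 h2 cosc2sinc2.
exists th, (Y \o h); split=> //; first exact: cont_comp ch.
move=> x hx; have [h1 h2] := hth x hx; have [u e] := proj_surj (h x).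
have [g1 g2 g3] := hu u; rewrite /= e g1 g2 in h1 h2.
rewrite /= e g3 kap_rval (surjective_pairing u); apply: proj_int.
exact: trigc_inj.
Qed.

Lemma proj_eq_int (x y : R) s t : proj ((x, s) : strip R) = proj ((y, t) : strip R) ->
  x - y \is a Num.int /\ s = t.
Proof. by move/eqP; rewrite proj_eq => /andP[/= h /eqP]. Qed.

(** The homotopy is lifted as a map of the square. On one side the lift differs from the segment by
    an integer constant [m]; it is constant in the abscissa where the homotopy fixes the endpoints.
    Subtracting [m] makes the lift of [c] run from [P] to [Q]. *)
Lemma lift_homotopic (P Q : strip R) (c : unit_itv R -> annulus R) :
  homotopic (@proj R \o segment P Q) c ->
  exists X Y : R -> R, [/\ continuous X, continuous Y,
    (X 0 = P.1 /\ kap (Y 0) = P.2), (X 1 = Q.1 /\ kap (Y 1) = Q.2) &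
    forall t, c t = proj ((X (rval t), kap (Y (rval t))) : strip R)].
Proof.
move=> [H [cH H0 H1 Hs0 Hs1]].
pose h (x : sq) := H (kap x.1, kap x.2).
have ck : continuous (fun x : sq => (kap x.1, kap x.2)).
  apply: cont_pair => x.
    by apply: continuous_comp; [apply: cvg_fst|apply: cont_kap].
  by apply: continuous_comp; [apply: cvg_snd|apply: cont_kap].
have ch : continuous h by move=> x; apply: continuous_comp; [apply: ck|apply: cH].
have [th [y [cth cy hth]]] := lift_square ch.
have b0 : 0 <= (0 : R) <= 1 by lra.
have b1 : 0 <= (1 : R) <= 1 by lra.
have cl (a : R) : continuous (fun t : R => (a, t)).
  by apply: cont_pair; [move=> x; apply: cvg_cst|move=> x; apply: cvg_id].
have cr' (a : R) : continuous (fun t : R => (t, a)).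
  by apply: cont_pair; [move=> x; apply: cvg_id|move=> x; apply: cvg_cst].
have e0 t : 0 <= t <= 1 ->
    th (0, t) - ((1 - t) * P.1 + t * Q.1) = th (0, 0) - P.1.
  move=> ht; have -> : th (0, 0) - P.1 = th (0, 0) - ((1 - 0) * P.1 + 0 * Q.1).
    by rewrite subr0 mul1r mul0r addr0.
  apply: (@int_valued_const R (fun t => th (0, t) - ((1 - t) * P.1 + t * Q.1))) ht.
    apply: contB; first exact: (cont_comp cth (cl 0)).
    apply: contD; apply: contM; try exact: contC; last by move=> x; apply: cvg_id.
    by apply: contB; [apply: contC|move=> x; apply: cvg_id].
  move=> s hs; have := hth (0, s) (conj b0 hs); rewrite /h /= kap0 H0 /= /segment.
  by move=> /esym /proj_eq_int[+ _]; rewrite rval_kap clamp_id.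
have e1 s : 0 <= s <= 1 -> th (s, 0) = th (0, 0).
  move=> hs; apply: (addIr (- P.1)).
  apply: (@int_valued_const R (fun s => th (s, 0) - P.1)) hs.
    by apply: contB; [apply: (cont_comp cth (cr' 0))|apply: contC].
  move=> r hr; have := hth (r, 0) (conj hr b0); rewrite /h /= kap0 Hs0 /= /segment.
  by move=> /esym /proj_eq_int[+ _]; rewrite /rval /= subr0 mul1r mul0r addr0.
have e2 s : 0 <= s <= 1 -> th (s, 1) = th (0, 1).
  move=> hs; apply: (addIr (- Q.1)).
  apply: (@int_valued_const R (fun s => th (s, 1) - Q.1)) hs.
    by apply: contB; [apply: (cont_comp cth (cr' 1))|apply: contC].
  move=> r hr; have := hth (r, 1) (conj hr b1); rewrite /h /= kap1 Hs1 /= /segment.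
  by move=> /esym /proj_eq_int[+ _]; rewrite /rval /= subrr mul1r mul0r add0r.
pose m := th (0, 0) - P.1.
have im : m \is a Num.int.
  have := hth (0, 0) (conj b0 b0); rewrite /h /= kap0 Hs0 /= /segment.
  by move=> /esym /proj_eq_int[+ _]; rewrite /rval /= subr0 mul1r mul0r addr0.
have y0 : kap (y (1, 0)) = P.2.
  have := hth (1, 0) (conj b1 b0); rewrite /h /= kap0 Hs0 /= /segment.
  move=> /esym /proj_eq_int[_ ->]; apply: rval_inj.
  by rewrite rval_mk rval_i0 subr0 mul1r mul0r addr0.
have y1 : kap (y (1, 1)) = Q.2.
  have := hth (1, 1) (conj b1 b1); rewrite /h /= kap1 Hs1 /= /segment.
  move=> /esym /proj_eq_int[_ ->]; apply: rval_inj.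
  by rewrite rval_mk rval_i1 subrr mul1r mul0r add0r.
exists (fun t => th (1, t) - m), (fun t => y (1, t)); split.
- by apply: contB; [apply: (cont_comp cth (cl 1))|apply: contC].
- exact: (cont_comp cy (cl 1)).
- by rewrite e1 // /m; split=> //; ring.
- split=> //; rewrite e2 //; have := e0 1 b1; rewrite subrr mul0r add0r mul1r /m => <-.
  by ring.
- move=> t; have ht := unit_itv_bounds t.
  have := hth (1, rval t) (conj b1 ht); rewrite /h /= kap1 kap_rval H1 => ->.
  by apply: proj_int; rewrite opprB addrCA subrr addr0.
Qed.

End Lifting.

(** * Interleaving chords cross *)

Section Sectors.
Context (R : realType).
Implicit Types (t : R) (k m : int).

(* [idx t k]: k mod 4 tells whether the direction of angle 2 pi t is the positive real
   axis (0), the open upper half-plane (1), the negative real axis (2) or the open lower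
   half-plane (3), and k div 4 counts the turns. *)
Definition idx t k : Prop := exists m,
  [\/ t = m%:~R /\ k = 4 * m,
      m%:~R < t < m%:~R + 2^-1 /\ k = 4 * m + 1,
      t = m%:~R + 2^-1 /\ k = 4 * m + 2 |
      m%:~R + 2^-1 < t < m%:~R + 1 /\ k = 4 * m + 3].

Lemma trigc_half : cosc (2^-1 : R) = -1 /\ sinc (2^-1 : R) = 0.
Proof.
have e : tau R * 2^-1 = pi by rewrite tauE; field.
by rewrite /cosc /sinc e cospi sinpi.
Qed.

Lemma trigc_half_add t : cosc (t + 2^-1) = - cosc t /\ sinc (t + 2^-1) = - sinc t.
Proof. by have [c s] := trigc_half; rewrite coscD sincD c s; split; ring. Qed.

Lemma trigc_int_add m t : cosc (m%:~R + t) = cosc t /\ sinc (m%:~R + t) = sinc t.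
Proof. by have [c s] := trigc_int (@intr_int R m); rewrite coscD sincD c s; split; ring. Qed.

Lemma sinc_gt0 t : 0 < t < 2^-1 -> 0 < sinc t.
Proof.
move=> /andP[t0 t1]; apply: sin_gt0_pi; have := @pi_gt0 R => p0.
by rewrite tauE; apply/andP; split; nra.
Qed.

Lemma idx_exists t : exists k, idx t k.
Proof.
have [m hm] : exists m : int, m%:~R <= t < m%:~R + 1.
  by exists (Num.floor t); have := Num.Theory.floor_itv t; rewrite intrD; exact.
have [e|n] := eqVneq t m%:~R; first by exists (4 * m), m; apply: Or41.
have [e'|n'] := eqVneq t (m%:~R + 2^-1); first by exists (4 * m + 2), m; apply: Or43.
have [l|l] := ltP t (m%:~R + 2^-1).
  by exists (4 * m + 1), m; apply: Or42; split=> //; rewrite lt_def n; move: hm; lra.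
exists (4 * m + 3), m; apply: Or44; split=> //; rewrite lt_def n' l /=; move: hm; lra.
Qed.

Lemma idx_trig t k : idx t k -> exists m,
  [\/ k = 4 * m /\ (sinc t = 0 /\ 0 < cosc t), k = 4 * m + 1 /\ 0 < sinc t,
      k = 4 * m + 2 /\ (sinc t = 0 /\ cosc t < 0) | k = 4 * m + 3 /\ sinc t < 0].
Proof.
case=> m h; exists m; case: h => -[ht ->].
- apply: Or41; split=> //; rewrite ht; have [-> ->] := trigc_int (@intr_int R m).
  by rewrite ltr01.
- apply: Or42; split=> //; rewrite -(subrK m%:~R t) addrC (trigc_int_add m _).2.
  by apply: sinc_gt0; move: ht; lra.
- apply: Or43; split=> //; rewrite ht !(trigc_int_add m _).1 !(trigc_int_add m _).2.
  by have [-> ->] := trigc_half; rewrite ltrN10.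
- apply: Or44; split=> //; rewrite -(subrK (m%:~R + 2^-1) t) addrC -addrA (trigc_int_add m _).2.
  rewrite addrC (trigc_half_add _).2 oppr_lt0; apply: sinc_gt0; move: ht; lra.
Qed.

Lemma idx_bounds m t k : idx t k ->
  [/\ m%:~R <= t -> 4 * m <= k, t <= m%:~R + 2^-1 -> k <= 4 * m + 2,
      m%:~R + 2^-1 <= t -> 4 * m + 2 <= k & t <= m%:~R + 1 -> k <= 4 * m + 4].
Proof.
case=> n h.
have L (a b : int) : a%:~R < b%:~R + 1 :> R -> a <= b.
  by rewrite -(intrD _ b 1) ltr_int; lia.
have L' (a b : int) : a%:~R < b%:~R :> R -> a < b by rewrite ltr_int.
have L1 (a b : int) : a%:~R <= b%:~R :> R -> a <= b by rewrite ler_int.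
have L2 (a b : int) : a%:~R <= b%:~R + 1 :> R -> a <= b + 1.
  by rewrite -(intrD _ b 1) ler_int.
have L3 (a b : int) : a%:~R < b%:~R + 2^-1 :> R -> a <= b by move=> h'; apply: L; lra.
case: h => -[ht ->]; split=> h'.
- by have := L1 m n; move: ht h'; lra || (move=> -> h' /(_ h'); lia).
- have : n <= m by apply: L; lra.
  lia.
- have : m < n by apply: L'; lra.
  lia.
- have : n <= m + 1 by apply: L2; lra.
  lia.
- have : m <= n by apply: L; lra.
  lia.
- have : n <= m by apply: L; lra.
  lia.
- have : m < n + 0 by rewrite addr0; apply: L'; lra.
  lia.
- have : n <= m by apply: L; lra.
  lia.
- have : m <= n by apply: L; lra.
  lia.
- have : n <= m by apply: L1; lra.
  lia.
- have : m <= n by apply: L1; lra.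
  lia.
- have : n <= m by apply: L; lra.
  lia.
- have : m <= n by apply: L; lra.
  lia.
- have : n < m by apply: L'; lra.
  lia.
- have : m <= n by apply: L; lra.
  lia.
- have : n <= m by apply: L; lra.
  lia.
Qed.

(** Leaving a closed upper half turn means passing through angles of negative sine. *)
Lemma upper_range (g : R -> R) : continuous g -> (forall t, 0 <= t <= 1 -> 0 <= sinc (g t)) ->
  exists m : int, forall t, 0 <= t <= 1 -> m%:~R <= g t <= m%:~R + 2^-1.
Proof.
move=> cg h; have b0 : 0 <= (0 : R) <= 1 by lra.
have neg (m : int) (x : R) : m%:~R + 2^-1 < x < m%:~R + 1 -> sinc x < 0.
  move=> hx; have -> : x = m%:~R + (x - (m%:~R + 2^-1) + 2^-1) by ring.
  by rewrite (trigc_int_add m _).2 (trigc_half_add _).2 oppr_lt0; apply: sinc_gt0; move: hx; lra.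
have avoid (m : int) (t t' : R) : 0 <= t <= 1 -> 0 <= t' <= 1 ->
    g t <= m%:~R + 2^-1 -> m%:~R + 2^-1 < g t' -> False.
  (* The intermediate value is capped at [m + 3/4] to stay where the sine is negative. *)
  move=> ht ht' h1 h2; have [|c hc e] := @ivt01 R g t t' (Num.min (g t') (m%:~R + 3 / 4)) cg ht ht'.
    by rewrite ge_min lexx /= le_min; move: h1 h2; lra.
  have := h c hc; rewrite e leNgt (neg m) //.
  by rewrite lt_min h2 gt_min; lra.
have [m hm] : exists m : int, m%:~R <= g 0 <= m%:~R + 2^-1.
  have [m hm] : exists m : int, m%:~R <= g 0 < m%:~R + 1.
    by exists (Num.floor (g 0)); have := Num.Theory.floor_itv (g 0); rewrite intrD; exact.
  exists m; have [l|l] := leP (g 0) (m%:~R + 2^-1); first by move: hm; lra.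
  by have := h 0 b0; rewrite leNgt (neg m) //; move: hm; lra.
exists m => t ht; apply/andP; split; rewrite leNgt; apply/negP => l.
  have e : (m - 1)%:~R = m%:~R - 1 :> R by rewrite intrD.
  have [l'|l'] := leP (g t) ((m - 1)%:~R + 2^-1).
    by apply: (avoid (m - 1) t 0) => //; move: hm; rewrite e; lra.
  by have := h t ht; rewrite leNgt (neg (m - 1)) //; move: l'; rewrite e; lra.
by apply: (avoid m 0 t) => //; move: hm; lra.
Qed.

Lemma lower_range (g : R -> R) : continuous g -> (forall t, 0 <= t <= 1 -> sinc (g t) <= 0) ->
  exists m : int, forall t, 0 <= t <= 1 -> m%:~R + 2^-1 <= g t <= m%:~R + 1.
Proof.
move=> cg h; have [||m hm] := @upper_range (fun t => g t + 2^-1).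
- by apply: contD => //; apply: contC.
- by move=> t /h; rewrite (trigc_half_add _).2 oppr_ge0.
exists (m - 1) => t /hm; rewrite intrD; lra.
Qed.

End Sectors.

Section Corners.

(** The sector of the vector from [z] to [u], in the indexing of [idx]. *)
Definition corner (u z : marked) (k : int) : Prop := exists m : int,
  match u, z with
  | Outer a, Outer b | Inner a, Inner b => (a < b /\ k = 4 * m + 2) \/ (b < a /\ k = 4 * m)
  | Outer _, Inner _ => k = 4 * m + 3
  | Inner _, Outer _ => k = 4 * m + 1
  end.

Definition upper (k k' : int) : Prop := exists m : int,
  [/\ 4 * m <= k, k <= 4 * m + 2, 4 * m <= k' & k' <= 4 * m + 2].
Definition lower (k k' : int) : Prop := exists m : int,
  [/\ 4 * m + 2 <= k, k <= 4 * m + 4, 4 * m + 2 <= k' & k' <= 4 * m + 4].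

(** The corner indices are known modulo 4 from the cyclic order, and on each side of the square the
    angle stays within one half turn. For interleaving chords these changes cannot close up around
    the square. *)
Lemma no_index u v z w k00 k01 k10 k11 : cr u v z w ->
  corner u z k00 -> corner u w k01 -> corner v z k10 -> corner v w k11 ->
  (if u is Inner _ then upper k00 k01 else lower k00 k01) ->
  (if v is Inner _ then upper k10 k11 else lower k10 k11) ->
  (if z is Inner _ then lower k00 k10 else upper k00 k10) ->
  (if w is Inner _ then lower k01 k11 else upper k01 k11) -> False.
Proof.
move=> c [m0 h0] [m1 h1] [m2 h2] [m3 h3].
by move: c h0 h1 h2 h3; case: u => a; case: v => b; case: z => d; case: w => e;
  rewrite /cr /ext /btw /ltm /= => c h0 h1 h2 h3 [n0 [? ? ? ?]] [n1 [? ? ? ?]] [n2 [? ? ? ?]]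
    [n3 [? ? ? ?]]; lia.
Qed.

End Corners.

Section Crossing.
Context (R : realType) (p q : nat) (p0 : (0 < p)%N) (q0 : (0 < q)%N).
Local Notation sq := (R * R)%type.
Local Notation pt u := (point_of R p q u).

Lemma inner_lt (n : nat) (a b : int) : (0 < n)%N ->
  (a%:~R / n%:R < b%:~R / n%:R :> R) = (a < b).
Proof. by move=> n0; rewrite ltr_pM2r ?invr_gt0 ?ltr0n // ltr_int. Qed.

Lemma point_neq u z : u <> z ->
  ~ ((pt u).1 = (pt z).1 /\ rval (pt u).2 = rval (pt z).2).
Proof.
have i10 : (1 : R) <> 0 by move/eqP; rewrite oner_eq0.
case: u z => a [] b /= n []; rewrite ?rval_i0 ?rval_i1.
- move=> e _; apply: n; congr Inner; apply/eqP; rewrite eq_le !leNgt.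
  by rewrite -!(inner_lt _ _ p0) e ltxx.
- by move=> _ /i10.
- by move=> _ /esym/i10.
- move=> e _; apply: n; congr Outer; apply/eqP; rewrite eq_le !leNgt.
  by rewrite -!(inner_lt _ _ q0) e ltxx.
Qed.

Lemma corner_idx u z (th r : R) k : 0 < r -> u <> z ->
  ((pt u).1 - (pt z).1) / r = cosc th -> (rval (pt u).2 - rval (pt z).2) / r = sinc th ->
  idx th k -> corner u z k.
Proof.
move=> r0 uz e1 e2 /idx_trig[m h].
have r1 : 0 < r^-1 by rewrite invr_gt0.
have s1 (x : R) : (x / r < 0) = (x < 0) by rewrite pmulr_llt0.
have s2 (x : R) : (0 < x / r) = (0 < x) by rewrite pmulr_lgt0.
have case_same (n : nat) (a b : int) : (0 < n)%N -> (a%:~R / n%:R - b%:~R / n%:R) / r = cosc th ->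
    sinc th = 0 -> (a < b /\ k = 4 * m + 2) \/ (b < a /\ k = 4 * m).
  move=> n0 ec es; case: h => -[ek].
  - by move=> [_]; rewrite -ec s2 subr_gt0 inner_lt //; right.
  - by rewrite es ltxx.
  - by move=> [_]; rewrite -ec s1 subr_lt0 inner_lt //; left.
  - by rewrite es ltxx.
exists m; case: u z uz e1 e2 => a [] b /= uz e1; rewrite ?rval_i0 ?rval_i1 => e2.
- by apply: (case_same p) => //; rewrite -e2 subrr mul0r.
- have : 0 < sinc th by rewrite -e2 s2 subr0 ltr01.
  by case: h => -[ek]; [move=> [-> _]|move=> _|move=> [-> _]|move=> h /(lt_trans h)];
    rewrite ?ltxx.
- have : sinc th < 0 by rewrite -e2 s1 sub0r oppr_lt0 ltr01.
  by case: h => -[ek]; [move=> [-> _]|move=> h /lt_trans/(_ h)|move=> [-> _]|move=> _];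
    rewrite ?ltxx.
- by apply: (case_same q) => //; rewrite -e2 subrr mul0r.
Qed.

Lemma upper_idx (g : R -> R) k k' : continuous g ->
  (forall t, 0 <= t <= 1 -> 0 <= sinc (g t)) -> idx (g 0) k -> idx (g 1) k' -> upper k k'.
Proof.
move=> cg h i i'; have [m hm] := upper_range cg h; exists m.
have b0 : 0 <= (0 : R) <= 1 by lra. have b1 : 0 <= (1 : R) <= 1 by lra.
have /andP[h1 h2] := hm 0 b0; have /andP[h3 h4] := hm 1 b1.
by have [a1 a2 _ _] := idx_bounds m i; have [a3 a4 _ _] := idx_bounds m i'; split; auto.
Qed.

Lemma lower_idx (g : R -> R) k k' : continuous g ->
  (forall t, 0 <= t <= 1 -> sinc (g t) <= 0) -> idx (g 0) k -> idx (g 1) k' -> lower k k'.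
Proof.
move=> cg h i i'; have [m hm] := lower_range cg h; exists m.
have b0 : 0 <= (0 : R) <= 1 by lra. have b1 : 0 <= (1 : R) <= 1 by lra.
have /andP[h1 h2] := hm 0 b0; have /andP[h3 h4] := hm 1 b1.
by have [_ _ a1 a2] := idx_bounds m i; have [_ _ a3 a4] := idx_bounds m i'; split; auto.
Qed.

Lemma open01 (t : R) : 0 <= t <= 1 -> t != 0 -> t != 1 -> 0 < t < 1.
Proof. by move=> /andP[a b] t0 t1; rewrite lt_neqAle eq_sym t0 a lt_neqAle t1 b. Qed.

Definition lifts (u v : marked) (X Y : R -> R) : Prop :=
  [/\ continuous X, continuous Y, (X 0 = (pt u).1 /\ kap (Y 0) = (pt u).2),
      (X 1 = (pt v).1 /\ kap (Y 1) = (pt v).2) &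
      forall t, 0 < t < 1 -> 0 < clamp (Y t) < 1].

Lemma crossing u v z w X Y X' Y' : lifts u v X Y -> lifts z w X' Y' -> cr u v z w ->
  exists s t, [/\ 0 < s < 1, 0 < t < 1, X s = X' t & kap (Y s) = kap (Y' t)].
Proof.
move=> [cX cY [X0 Y0] [X1 Y1] hY] [cX' cY' [X0' Y0'] [X1' Y1'] hY'] c.
apply: contrapT => no.
have /and5P[/nqmP zu /nqmP zv /nqmP wu /nqmP wv _] : [&& nqm z u, nqm z v, nqm w u, nqm w v &
  btw u v z (+) btw u v w] by rewrite -crE.
have uz : u <> z by move/esym. have vz : v <> z by move/esym.
have uw : u <> w by move/esym. have vw : v <> w by move/esym.
have b0 : 0 <= (0 : R) <= 1 by lra. have b1 : 0 <= (1 : R) <= 1 by lra.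
pose F1 (x : sq) := X (clamp x.1) - X' (clamp x.2).
pose F2 (x : sq) := clamp (Y (clamp x.1)) - clamp (Y' (clamp x.2)).
have c1 : continuous (fun x : sq => clamp x.1).
  exact: (cont_comp (@cont_clamp R) (@cont_fst' R)).
have c2 : continuous (fun x : sq => clamp x.2).
  exact: (cont_comp (@cont_clamp R) (@cont_snd' R)).
have cF1 : continuous F1.
  by apply: contB; [apply: (cont_comp cX c1)|apply: (cont_comp cX' c2)].
have cF2 : continuous F2.
  by apply: contB; apply: (cont_comp (@cont_clamp R));
    [apply: (cont_comp cY c1)|apply: (cont_comp cY' c2)].
have yb (x : R) : 0 <= clamp x <= 1 := clamp_bounds x.
have val (a : R) (s : unit_itv R) : kap a = s -> clamp a = rval s by move=> <-.
have v0 := val _ _ Y0; have v1 := val _ _ Y1; have v0' := val _ _ Y0'; have v1' := val _ _ Y1'.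
have ybd y : rval (pt y).2 = 0 \/ rval (pt y).2 = 1.
  by case: y => a /=; [right|left].
(* The difference vector vanishes nowhere: in the open square by assumption, on its sides because
   the curves are strictly inside the strip between their endpoints, at its corners because the
   endpoints of the two chords differ. *)
have nz x : F1 x = 0 -> F2 x = 0 -> False.
  rewrite /F1 /F2 => /subr0_eq e1 /subr0_eq e2.
  move: e1 e2; have := yb x.1; have := yb x.2; move: (clamp x.1) (clamp x.2) => s t ht hs e1 e2.
  have [s0|s0] := eqVneq s 0.
    rewrite s0 v0 X0 in e1 e2; have [t0|t0] := eqVneq t 0.
      by rewrite t0 v0' X0' in e1 e2; apply: (point_neq uz).
    have [t1|t1] := eqVneq t 1; first by rewrite t1 v1' X1' in e1 e2; apply: (point_neq uw).
    have := hY' t; rewrite -e2 => /(_ _); case: (ybd u) => ->; rewrite ltxx ?andbF /= => H;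
      have := H (open01 ht t0 t1); by [].
  have [s1|s1] := eqVneq s 1.
    rewrite s1 v1 X1 in e1 e2; have [t0|t0] := eqVneq t 0.
      by rewrite t0 v0' X0' in e1 e2; apply: (point_neq vz).
    have [t1|t1] := eqVneq t 1; first by rewrite t1 v1' X1' in e1 e2; apply: (point_neq vw).
    have := hY' t; rewrite -e2 => /(_ _); case: (ybd v) => ->; rewrite ltxx ?andbF /= => H;
      have := H (open01 ht t0 t1); by [].
  have hs' := open01 hs s0 s1.
  have := hY s hs'; rewrite e2; have [t0|t0] := eqVneq t 0.
    by rewrite t0 v0'; case: (ybd z) => ->; rewrite ltxx ?andbF.
  have [t1|t1] := eqVneq t 1; first by rewrite t1 v1'; case: (ybd w) => ->; rewrite ltxx ?andbF.
  move=> _; apply: no; exists s, t; split=> //; last by apply: rval_inj.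
  exact: open01.
pose N (x : sq) := Num.sqrt (F1 x ^+ 2 + F2 x ^+ 2).
have N2 x : 0 < F1 x ^+ 2 + F2 x ^+ 2.
  rewrite lt_def addr_ge0 ?sqr_ge0 // andbT paddr_eq0 ?sqr_ge0 // !sqrf_eq0.
  by apply/negP => /andP[/eqP h1 /eqP h2]; apply: (nz x).
have N0 x : 0 < N x by rewrite sqrtr_gt0.
have cN : continuous N.
  apply: (cont_comp (@sqrt_continuous R)).
  by apply: contD; rewrite /GRing.exp /=; apply: contM.
have cV : continuous (fun x => (N x)^-1).
  by move=> x; apply: cvgV; [rewrite gt_eqF|apply: cN].
have [||x _|th [cth hth]] := @circle_lift R (fun x => F1 x / N x) (fun x => F2 x / N x).
- exact: contM.
- exact: contM.
- by rewrite !expr_div_n -mulrDl sqr_sqrtr ?(ltW (N2 x)) // divff // gt_eqF.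
have [k00 i00] := idx_exists (th (0, 0)); have [k01 i01] := idx_exists (th (0, 1)).
have [k10 i10] := idx_exists (th (1, 0)); have [k11 i11] := idx_exists (th (1, 1)).
have cl0 : clamp (0 : R) = 0 by apply: clamp_id.
have cl1 : clamp (1 : R) = 1 by apply: clamp_id.
have cv (a : R) : continuous (fun t : R => th (a, t)).
  apply: (cont_comp cth); apply: cont_pair; first by move=> x; apply: cvg_cst.
  by move=> x; apply: cvg_id.
have ch (a : R) : continuous (fun t : R => th (t, a)).
  apply: (cont_comp cth); apply: cont_pair; first by move=> x; apply: cvg_id.
  by move=> x; apply: cvg_cst.
have Ni x : 0 <= (N x)^-1 by rewrite invr_ge0 ltW.
(* On each side of the square one curve sits at an endpoint on the boundary of the strip, which
   fixes the sign of the vertical component. *)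
apply: (no_index c (k00 := k00) (k01 := k01) (k10 := k10) (k11 := k11)).
- have [] := hth (0, 0) (conj b0 b0); rewrite /F1 /F2 /= cl0 X0 X0' v0 v0' => e1 e2.
  exact: (corner_idx (N0 (0, 0))) e1 e2 i00.
- have [] := hth (0, 1) (conj b0 b1); rewrite /F1 /F2 /= cl0 cl1 X0 X1' v0 v1' => e1 e2.
  exact: (corner_idx (N0 (0, 1))) e1 e2 i01.
- have [] := hth (1, 0) (conj b1 b0); rewrite /F1 /F2 /= cl0 cl1 X1 X0' v1 v0' => e1 e2.
  exact: (corner_idx (N0 (1, 0))) e1 e2 i10.
- have [] := hth (1, 1) (conj b1 b1); rewrite /F1 /F2 /= cl1 X1 X1' v1 v1' => e1 e2.
  exact: (corner_idx (N0 (1, 1))) e1 e2 i11.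
- have S t (ht : 0 <= t <= 1) : sinc (th (0, t)) = (rval (pt u).2 - clamp (Y' t)) / N (0, t).
    by have [_ <-] := hth (0, t) (conj b0 ht); rewrite /F2 /= cl0 v0 (clamp_id ht).
  case: (u) S => a /= S; rewrite ?rval_i0 ?rval_i1 in S.
    apply: (upper_idx (cv 0)) => // t ht; rewrite S // mulr_ge0 // subr_ge0.
    by case/andP: (yb (Y' t)).
  apply: (lower_idx (cv 0)) => // t ht; rewrite S // mulr_le0_ge0 // sub0r oppr_le0.
  by case/andP: (yb (Y' t)).
- have S t (ht : 0 <= t <= 1) : sinc (th (1, t)) = (rval (pt v).2 - clamp (Y' t)) / N (1, t).
    by have [_ <-] := hth (1, t) (conj b1 ht); rewrite /F2 /= cl1 v1 (clamp_id ht).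
  case: (v) S => a /= S; rewrite ?rval_i0 ?rval_i1 in S.
    apply: (upper_idx (cv 1)) => // t ht; rewrite S // mulr_ge0 // subr_ge0.
    by case/andP: (yb (Y' t)).
  apply: (lower_idx (cv 1)) => // t ht; rewrite S // mulr_le0_ge0 // sub0r oppr_le0.
  by case/andP: (yb (Y' t)).
- have S t (ht : 0 <= t <= 1) : sinc (th (t, 0)) = (clamp (Y t) - rval (pt z).2) / N (t, 0).
    by have [_ <-] := hth (t, 0) (conj ht b0); rewrite /F2 /= cl0 v0' (clamp_id ht).
  case: (z) S => a /= S; rewrite ?rval_i0 ?rval_i1 in S.
    apply: (lower_idx (ch 0)) => // t ht; rewrite S // mulr_le0_ge0 // subr_le0.
    by case/andP: (yb (Y t)).
  apply: (upper_idx (ch 0)) => // t ht; rewrite S // mulr_ge0 // subr0.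
  by case/andP: (yb (Y t)).
- have S t (ht : 0 <= t <= 1) : sinc (th (t, 1)) = (clamp (Y t) - rval (pt w).2) / N (t, 1).
    by have [_ <-] := hth (t, 1) (conj ht b1); rewrite /F2 /= cl1 v1' (clamp_id ht).
  case: (w) S => a /= S; rewrite ?rval_i0 ?rval_i1 in S.
    apply: (lower_idx (ch 1)) => // t ht; rewrite S // mulr_le0_ge0 // subr_le0.
    by case/andP: (yb (Y t)).
  apply: (upper_idx (ch 1)) => // t ht; rewrite S // mulr_ge0 // subr0.
  by case/andP: (yb (Y t)).
Qed.

End Crossing.

(** * Representatives of arcs *)

Section RealGeometry.
Context (R : realType).
Implicit Types A B x e : R.

(** The product [(x - A) * (B - x)] grows strictly with the interval, and intervals without a common
    interior point contain no common [x]. *)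
Lemma parabolas_meet A B A' B' x e : 0 < e -> A < x < B -> A' < x < B' ->
  e * ((x - A) * (B - x)) = e * ((x - A') * (B' - x)) ->
  [\/ B <= A', B' <= A, A <= A' /\ B' <= B | A' <= A /\ B <= B'] -> A = A' /\ B = B'.
Proof.
move=> e0 /andP[h1 h2] /andP[h3 h4] /(mulfI (lt0r_neq0 e0)) E.
have W a b a' b' : a < x -> x < b -> a' < x -> x < b' ->
    (x - a) * (b - x) = (x - a') * (b' - x) -> a <= a' -> b' <= b -> a = a' /\ b = b'.
  by move=> ? ? ? ? E' ? ?; split; apply/eqP; rewrite eq_le; apply/andP; split=> //; nra.
case=> [h|h|[h h']|[h h']]; try lra.
  exact: (W A B A' B').
by have [-> ->] := W A' B' A B h3 h4 h1 h2 (esym E) h h'.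
Qed.

(* A segment from [l] to [i] meeting a parabola of small curvature based at [A] and [B],
   both parametrized by the distance [y] to the boundary line of the parabola. *)
Lemma segment_parabola A B x y l i e : 0 < e -> A < x < B -> B - A <= 1 -> e * `|i - l| < 1 ->
  y = e * ((x - A) * (B - x)) -> x = (1 - y) * i + y * l -> i <= A \/ B <= i -> False.
Proof.
move=> e0 /andP[h1 h2] BA em -> E h.
have [m1 m2] : e * (i - l) < 1 /\ - 1 < e * (i - l).
  by move: em; rewrite -(gtr0_norm e0) -normrM (gtr0_norm e0) ltr_norml => /andP[].
have E' : i - x = e * (i - l) * ((x - A) * (B - x)) by rewrite {1}E; ring.
move: (e * (i - l)) m1 m2 E' => c m1 m2 E' {E}.
case: h => h.
  have k1 : x - A <= - c * (B - x) * (x - A) by nra.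
  have k2 : 1 <= - c * (B - x) by rewrite -(ler_pM2r (_ : 0 < x - A)) ?subr_gt0 // mul1r.
  nra.
have k1 : B - x <= c * (x - A) * (B - x) by nra.
have k2 : 1 <= c * (x - A) by rewrite -(ler_pM2r (_ : 0 < B - x)) ?subr_gt0 // mul1r.
nra.
Qed.

End RealGeometry.

Section Representatives.
Context (R : realType) (p q : nat) (p0 : (0 < p)%N) (q0 : (0 < q)%N).
Local Notation pt u := (point_of R p q u).
Local Notation tr := (tr p q).
Local Notation arcok := (arcok p q).
Local Notation arc_class := (@arc_class R p q).
Local Notation px u := (point_of R p q u).1.

Lemma px_tr n u : px (tr n u) = px u + n%:~R.
Proof.
have E (r : nat) (a : int) : (0 < r)%N -> (a + n * r%:Z)%:~R / r%:R = a%:~R / r%:R + n%:~R :> R.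
  by move=> r0; rewrite intrD intrM mulrDl mulfK // pnatr_eq0 -lt0n.
by case: u => a /=; apply: E.
Qed.

Lemma py_tr n u : (pt (tr n u)).2 = (pt u).2.
Proof. by case: u. Qed.

Lemma arc_class_tr n u v : arc_class (tr n u) (tr n v) = arc_class u v.
Proof.
rewrite /Defs.arc_class; suff -> : @proj R \o segment (pt (tr n u)) (pt (tr n v)) =
  @proj R \o segment (pt u) (pt v) by [].
apply/funext => t /=; rewrite /segment !px_tr.
have -> : mk_itv (conv_bounds t (pt (tr n u)).2 (pt (tr n v)).2) =
    mk_itv (conv_bounds t (pt u).2 (pt v).2).
  by apply: rval_inj; rewrite !rval_mk !py_tr.
apply: proj_int.
have -> : (1 - rval t) * (px u + n%:~R) + rval t * (px v + n%:~R)
  - ((1 - rval t) * px u + rval t * px v) = n%:~R by ring.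
exact: intr_int.
Qed.

Lemma rep_lifts u v c : simple_rep (arc_class u v) c ->
  exists X Y : R -> R, lifts p q u v X Y /\
    forall t, c t = proj ((X (rval t), kap (Y (rval t))) : strip R).
Proof.
move=> [hc hi _]; have [X [Y [cX cY h0 h1 hX]]] := lift_homotopic hc.
exists X, Y; split=> //; split=> // t ht.
have ht' : 0 <= t <= 1 by move: ht; lra.
have [|[x y] /= hy] := hi (kap t); first by rewrite /inside rval_kap clamp_id.
by rewrite hX rval_kap clamp_id // => /proj_eq_int[_ e]; move: hy; rewrite e rval_kap.
Qed.

Lemma rep_cross u v z w c c' : simple_rep (arc_class u v) c -> simple_rep (arc_class z w) c' ->
  cr u v z w -> exists s t X X' (Y : unit_itv R), [/\ inside s, inside t,
    c s = proj ((X, Y) : strip R), c' t = proj ((X', Y) : strip R) & X = X'].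
Proof.
move=> h h' C; have [X [Y [l e]]] := rep_lifts h; have [X' [Y' [l' e']]] := rep_lifts h'.
have [s [t [hs ht E1 E2]]] := crossing p0 q0 l l' C.
have hs' : 0 <= s <= 1 by move: hs; lra. have ht' : 0 <= t <= 1 by move: ht; lra.
exists (kap s), (kap t), (X s), (X' t), (kap (Y s)); split=> //.
- by rewrite /inside rval_kap clamp_id.
- by rewrite /inside rval_kap clamp_id.
- by rewrite e rval_kap clamp_id.
- by rewrite e' rval_kap clamp_id // E2.
Qed.

Lemma noncrossing_cr u v z w : noncrossing (arc_class u v) (arc_class z w) -> ~~ cr u v z w.
Proof.
move=> [c [c' [h h' nc]]]; apply/negP => C.
have [s [t [X [X' [Y [hs ht e e' E]]]]]] := rep_cross h h' C.
by apply: (nc s t hs ht); rewrite e e' E.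
Qed.

(** A chord that is too wide crosses its translate by 1. The crossing gives two parameters with one
    image, equal by simplicity; but then the abscissa equals itself plus 1. *)
Lemma simple_arcok u v c : oriented u v -> simple_rep (arc_class u v) c -> arcok u v.
Proof.
move=> o h; apply: contrapT => nok.
have C : cr u v (tr 1 u) (tr 1 v).
  by move: o nok; case: u {h} => a; case: v => b; rewrite /cr /ext /btw /ltm /= ?mul1r //; clear -p0 q0; lia.
have [X [Y [l e]]] := rep_lifts h.
have [cX cY [X0 Y0] [X1 Y1] hY] := l.
have l' : lifts p q (tr 1 u) (tr 1 v) (fun t => X t + 1) Y.
  split=> //; first by apply: contD => //; apply: contC.
    by rewrite px_tr py_tr X0.
  by rewrite px_tr py_tr X1.
have [s [t [hs ht E1 E2]]] := crossing p0 q0 l l' C.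
have hs' : 0 <= s <= 1 by move: hs; lra. have ht' : 0 <= t <= 1 by move: ht; lra.
have [_ _ inj] := h.
have : kap s = kap t.
  apply: inj; rewrite /inside ?rval_kap ?clamp_id // !e !rval_kap !clamp_id // E1 E2.
  by apply: proj_int; rewrite addrAC subrr add0r.
move=> /(congr1 (@rval R)); rewrite !rval_kap !clamp_id // => st.
by move: E1; rewrite st => /eqP; rewrite -subr_eq0 opprD addrA subrr sub0r oppr_eq0 oner_eq0.
Qed.

(** A peripheral curve is a flat parabola: at abscissa [x] its distance to the boundary line is
    [e * (x - px u) * (px v - x)]. A bridging curve is straight. *)
Definition height (e : R) (u v : marked) (t : R) : R :=
  match u, v with
  | Outer _, Inner _ => t
  | Inner _, Inner _ => 1 - e * ((px v - px u) ^+ 2 * (t * (1 - t)))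
  | Outer _, Outer _ => e * ((px v - px u) ^+ 2 * (t * (1 - t)))
  | Inner _, Outer _ => 0
  end.

Definition abscissa (u v : marked) (t : R) : R := (1 - t) * px u + t * px v.

Definition curve (e : R) (u v : marked) (t : unit_itv R) : annulus R :=
  proj ((abscissa u v (rval t), kap (height e u v (rval t))) : strip R).

Lemma inner_le (n : nat) (a b : int) : (0 < n)%N ->
  (a%:~R / n%:R <= b%:~R / n%:R :> R) = (a <= b).
Proof. by move=> n0; rewrite ler_pM2r ?invr_gt0 ?ltr0n // ler_int. Qed.

Lemma arcok_width u v : arcok u v -> (forall l i, ~ (u = Outer l /\ v = Inner i)) ->
  0 < px v - px u <= 1.
Proof.
have E (r : nat) (a b : int) : (0 < r)%N -> a + 2 <= b <= a + r%:Z ->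
    0 < (b%:~R / r%:R - a%:~R / r%:R : R) <= 1.
  move=> r0 /andP[h1 h2]; rewrite subr_gt0 inner_lt //; apply/andP; split; first by lia.
  rewrite -mulrBl ler_pdivrMr ?ltr0n // mul1r lerBlDl.
  by have : b%:~R <= (a + r%:Z)%:~R :> R; [rewrite ler_int|rewrite intrD].
by case: u v => a [] b //= ok h; [apply: E|case: (h a b)|apply: E].
Qed.

Lemma height_inside e u v t : 0 < e <= 1 -> arcok u v -> 0 < t < 1 -> 0 < height e u v t < 1.
Proof.
move=> e01 ok t01; have W := arcok_width ok.
have K d : 0 < d <= 1 -> 0 < e * (d ^+ 2 * (t * (1 - t))) < 1.
  move=> d01; have a1 : 0 < t * (1 - t) < 1 by nra.
  have a2 : 0 < d ^+ 2 <= 1 by rewrite expr2; nra.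
  have a3 : 0 < d ^+ 2 * (t * (1 - t)) < 1 by move: (d ^+ 2) (t * _) a1 a2 => x y; nra.
  by move: (d ^+ 2 * _) a3 => x; nra.
case: u v ok W => a [] b //= ok W; last by apply: K; apply: W => l i [].
have := K _ (W (ltac:(by move=> l i []))).
move: (e * _) => x; lra.
Qed.

(** The curve and the segment have the same abscissa at each parameter, so interpolating the heights
    is a homotopy. *)
Lemma curve_homotopic e u v : arcok u v -> arc_class u v (curve e u v).
Proof.
move=> ok.
have h0 : height e u v 0 = rval (pt u).2 /\ height e u v 1 = rval (pt v).2.
  by case: u v ok => a [] b //= _; rewrite ?rval_i0 ?rval_i1; split; ring.
pose lin (t : R) := (1 - t) * rval (pt u).2 + t * rval (pt v).2.
exists (fun x => proj ((abscissa u v (rval x.2),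
  kap ((1 - rval x.1) * lin (rval x.2) + rval x.1 * height e u v (rval x.2))) : strip R)).
have cid : continuous (fun t : R => t) by move=> t; apply: cvg_id.
have c1t : continuous (fun t : R => 1 - t) by apply: contB => //; apply: contC.
have cf : continuous (fun x : unit_itv R * unit_itv R => rval x.1).
  by apply: (cont_comp (@cont_rval R)) => x; apply: cvg_fst.
have cs : continuous (fun x : unit_itv R * unit_itv R => rval x.2).
  by apply: (cont_comp (@cont_rval R)) => x; apply: cvg_snd.
have chg : continuous (height e u v).
  have K : continuous (fun t : R => e * ((px v - px u) ^+ 2 * (t * (1 - t)))).
    by apply: contM; [apply: contC|apply: contM; [apply: contC|apply: contM]].
  case: u v {ok h0 lin} K => a [] b K //=; first by apply: contB => //; apply: contC.
  exact: contC.
have clin (a b : R) : continuous (fun t : R => (1 - t) * a + t * b).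
  by apply: contD; apply: contM => //; apply: contC.
split.
- have cst : continuous (fun x : unit_itv R * unit_itv R => ((abscissa u v (rval x.2),
    kap ((1 - rval x.1) * lin (rval x.2) + rval x.1 * height e u v (rval x.2))) : strip R)).
    apply: cont_pair; first exact: (cont_comp (clin _ _) cs).
    move=> x; apply: continuous_comp; last exact: cont_kap.
    have c : continuous (fun x : unit_itv R * unit_itv R =>
        (1 - rval x.1) * lin (rval x.2) + rval x.1 * height e u v (rval x.2)).
      apply: contD; apply: contM => //.
      + exact: (cont_comp c1t cf).
      + exact: (cont_comp (clin _ _) cs).
      + exact: (cont_comp chg cs).
    exact: c.
  by move=> x; apply: continuous_comp; [apply: cst|apply: cont_proj].
- move=> t /=; congr proj; rewrite /segment; congr (_, _); apply: rval_inj.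
  by rewrite rval_mk rval_i0 subr0 mul1r mul0r addr0 rval_kap clamp_id // conv_bounds.
- by move=> t /=; rewrite /curve rval_i1 subrr mul0r mul1r add0r.
- move=> s /=; congr proj; rewrite /segment; congr (_, _); apply: rval_inj.
  rewrite rval_mk rval_i0 rval_kap h0.1 /lin subr0 mul1r mul0r addr0 -mulrDl subrK mul1r.
  by rewrite clamp_id // unit_itv_bounds.
- move=> s /=; congr proj; rewrite /segment; congr (_, _); apply: rval_inj.
  rewrite rval_mk rval_i1 rval_kap h0.2 /lin subrr mul1r mul0r add0r -mulrDl subrK mul1r.
  by rewrite clamp_id // unit_itv_bounds.
Qed.

Lemma abscissa_inj u v s t : px u != px v -> abscissa u v s = abscissa u v t -> s = t.
Proof.
move=> uv e; have : (s - t) * (px v - px u) = 0.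
  by move: e; rewrite /abscissa => e; apply/eqP; move/eqP: e; rewrite -subr_eq0; congr (_ == _); ring.
move/eqP; rewrite mulf_eq0 !subr_eq0 [px v == _]eq_sym (negPf uv) orbF; by move/eqP.
Qed.

Lemma curve_eq e u v e' z w s t : 0 < e <= 1 -> 0 < e' <= 1 -> arcok u v -> arcok z w ->
  inside s -> inside t -> curve e u v s = curve e' z w t ->
  exists n, abscissa u v (rval s) = abscissa (tr n z) (tr n w) (rval t) /\
    height e u v (rval s) = height e' (tr n z) (tr n w) (rval t).
Proof.
move=> e0 e0' ok ok' hs ht /proj_eq_int[/intrP[n en] hy]; exists n; split.
  move/eqP: en; rewrite subr_eq => /eqP ->.
  rewrite /abscissa !px_tr; ring.
have -> : height e' (tr n z) (tr n w) (rval t) = height e' z w (rval t).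
  have E : px (tr n w) - px (tr n z) = px w - px z by rewrite !px_tr; ring.
  by move: E; case: (z) (w) => a [] b //= ->.
move: hy => /(congr1 (@rval R)); rewrite !rval_kap !clamp_id //.
  by have := height_inside e0' ok' ht; lra.
by have := height_inside e0 ok hs; lra.
Qed.

Lemma curve_simple e u v : 0 < e <= 1 -> arcok u v -> simple_rep (arc_class u v) (curve e u v).
Proof.
move=> e01 ok; split.
- exact: curve_homotopic.
- move=> t ht; exists (abscissa u v (rval t), kap (height e u v (rval t))) => //=.
  have h := height_inside e01 ok ht; rewrite rval_kap clamp_id //; move: h; lra.
- move=> s t hs ht /(curve_eq e01 e01 ok ok hs ht)[n [h1 h2]]; apply: rval_inj.
  have [hB|W] := pselect (exists l i, u = Outer l /\ v = Inner i).
    by case: hB => l [i [eu ev]]; move: h2; rewrite eu ev.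
  have w := arcok_width ok (fun l i h => W (ex_intro _ l (ex_intro _ i h))).
  apply: (@abscissa_inj u v); first by apply/eqP => e'; move: w; rewrite e' subrr ltxx.
  move: h1 hs ht; rewrite /abscissa !px_tr /inside => h1 hs ht.
  suff n0 : n = 0 by rewrite h1 n0 !addr0.
  have E : (rval s - rval t) * (px v - px u) = n%:~R.
    apply: subr0_eq; move/eqP: h1; rewrite -subr_eq0 => /eqP <-; ring.
  (* The parameters differ by less than 1 and the width is at most 1, which leaves [n = 0]. *)
  have [b1 b2] : (-1 < n%:~R :> R) /\ (n%:~R < 1 :> R) by rewrite -E; split; nra.
  by move: b1 b2; rewrite -(intrN _ 1) -[1]/(1%:~R) !ltr_int; lia.
Qed.

Lemma arcok_is_arc u v : arcok u v -> is_arc p q (arc_class u v).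
Proof.
move=> ok; split; first by exists u, v; split=> //; apply: arcok_oriented ok.
by exists (curve 1 u v); apply: curve_simple => //; rewrite ltr01 lexx.
Qed.

Lemma peripheral_bounds u v t : 0 < px v - px u -> 0 < t < 1 ->
  px u < abscissa u v t < px v /\
  (px v - px u) ^+ 2 * (t * (1 - t)) = (abscissa u v t - px u) * (px v - abscissa u v t).
Proof. by rewrite /abscissa => d0 t01; split; [nra|ring]. Qed.

(** The bound [e <= 2^-1] separates parabolas on opposite boundaries by the line of height 1/2; the
    bounds on [e] times the horizontal extents keep segments off the parabolas. Curves of the same
    kind are compared through their endpoints. *)
Lemma curves_disjoint e u v z w s t : 0 < e -> e <= 2^-1 ->
  e * `|px u - px v| < 1 -> e * `|px z - px w| < 1 ->
  arcok u v -> arcok z w -> ~~ cr u v z w -> ~ (u = z /\ v = w) -> 0 < s < 1 -> 0 < t < 1 ->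
  abscissa u v s = abscissa z w t -> height e u v s = height e z w t -> False.
Proof.
move=> e0 e1 m1 m2 ok ok' nc ne hs ht ex ey.
have W := arcok_width ok; have W' := arcok_width ok'.
have P := fun h => @peripheral_bounds u v s h hs.
have P' := fun h => @peripheral_bounds z w t h ht.
have small d r : 0 < d <= 1 -> 0 < r < 1 -> e * (d ^+ 2 * (r * (1 - r))) < 2^-1.
  move=> d01 r01; have a1 : 0 < r * (1 - r) <= 4^-1 by have := sqr_ge0 (r - 2^-1); rewrite expr2; nra.
  have a2 : 0 < d ^+ 2 <= 1 by rewrite expr2; nra.
  have a3 : 0 < d ^+ 2 * (r * (1 - r)) <= 4^-1 by move: (d ^+ 2) (r * _) a1 a2 => x y; nra.
  by move: (d ^+ 2 * _) a3 => x; nra.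
case: u ok nc ne m1 ex ey W P => a; case: v => b //= ok nc ne m1 ex ey W P;
  case: z ok' nc ne m2 ex ey W' P' => c; case: w => d //= ok' nc ne m2 ex ey W' P'.
- have /andP[w1 w2] := W (ltac:(by move=> ? ? [])); have [P1 P2] := P w1.
  have /andP[w1' w2'] := W' (ltac:(by move=> ? ? [])); have [P1' P2'] := P' w1'.
  rewrite P2 P2' -ex in ey; rewrite -ex in P1'.
  have [//||E1 E2] := parabolas_meet e0 P1 P1'; first by move: ey; lra.
    rewrite !inner_le //; move: nc ok ok'; rewrite /cr /ext /btw /ltm /= => nc ok ok'.
    have [h|[h|[h|h]]] : b <= c \/ d <= a \/ (a <= c /\ d <= b) \/ (c <= a /\ b <= d).
      by move: nc ok ok'; clear; lia.
    + exact: Or41.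
    + exact: Or42.
    + by case: h => ? ?; apply: Or43.
    + by case: h => ? ?; apply: Or44.
  by apply: ne; split; congr Inner; apply/eqP; rewrite eq_le -!(inner_le _ _ p0) ?E1 ?E2 lexx.
- have /andP[w1 w2] := W (ltac:(by move=> ? ? [])); have [P1 P2] := P w1.
  rewrite P2 ex in ey; rewrite ex in P1.
  apply: (segment_parabola (l := c%:~R / q%:R) (i := d%:~R / p%:R) (y := 1 - t) e0 P1 w2).
  + by rewrite distrC.
  + exact: etrans (congr1 (fun r => 1 - r) (esym ey)) (subKr _ _).
  + by rewrite /abscissa /=; ring.
  + by rewrite !inner_le //; move: nc ok; rewrite /cr /ext /btw /ltm /=; clear; lia.
- have w := W (ltac:(by move=> ? ? [])); have w' := W' (ltac:(by move=> ? ? [])).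
  by have := small _ _ w hs; have := small _ _ w' ht; lra.
- have /andP[w1 w2] := W' (ltac:(by move=> ? ? [])); have [P1 P2] := P' w1.
  rewrite P2 -ex in ey; rewrite -ex in P1.
  apply: (segment_parabola (l := a%:~R / q%:R) (i := b%:~R / p%:R) (y := 1 - s) e0 P1 w2).
  + by rewrite distrC.
  + exact: etrans (congr1 (fun r => 1 - r) ey) (subKr _ _).
  + by rewrite /abscissa /=; ring.
  + by rewrite !inner_le //; move: nc ok'; rewrite /cr /ext /btw /ltm /=; clear; lia.
- rewrite -ey /abscissa /= in ex.
  have : (1 - s) * (c%:~R / q%:R - a%:~R / q%:R) + s * (d%:~R / p%:R - b%:~R / p%:R) = 0 :> R.
    by apply/eqP; move/eqP: (esym ex); rewrite -subr_eq0; congr (_ == _); ring.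
  have H : (a <= c /\ b <= d) \/ (c <= a /\ d <= b).
    by move: nc; rewrite /cr /ext /btw /ltm /=; clear; lia.
  have ne' (A B C D : R) : (1 - s) * (C - A) + s * (D - B) = 0 ->
      A <= C -> B <= D -> A = C /\ B = D.
    by move=> E ? ?; split; apply/eqP; rewrite eq_le; apply/andP; split=> //; nra.
  move=> E; apply: ne.
  have [E1 E2] : a%:~R / q%:R = c%:~R / q%:R :> R /\ b%:~R / p%:R = d%:~R / p%:R :> R.
    case: H => -[h1 h2]; first by apply: ne' E _ _; rewrite inner_le.
    have E' : (1 - s) * (a%:~R / q%:R - c%:~R / q%:R) + s * (b%:~R / p%:R - d%:~R / p%:R) = 0 :> R.
      by apply: oppr_inj; rewrite oppr0 -E; ring.
    have [||-> ->] := ne' _ _ _ _ E'; by rewrite ?inner_le.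
  by split; [congr Outer|congr Inner]; apply/eqP; rewrite eq_le;
    [rewrite -!(inner_le _ _ q0) ?E1 lexx|rewrite -!(inner_le _ _ p0) ?E2 lexx].
- have /andP[w1 w2] := W' (ltac:(by move=> ? ? [])); have [P1 P2] := P' w1.
  rewrite P2 -ex in ey; rewrite -ex in P1.
  apply: (segment_parabola (l := b%:~R / p%:R) (i := a%:~R / q%:R) (y := s) e0 P1 w2 m1 ey (erefl _)).
  by rewrite !inner_le //; move: nc ok'; rewrite /cr /ext /btw /ltm /=; clear; lia.
- have w := W (ltac:(by move=> ? ? [])); have w' := W' (ltac:(by move=> ? ? [])).
  by have := small _ _ w hs; have := small _ _ w' ht; lra.
- have /andP[w1 w2] := W (ltac:(by move=> ? ? [])); have [P1 P2] := P w1.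
  rewrite P2 ex in ey; rewrite ex in P1.
  apply: (segment_parabola (l := d%:~R / p%:R) (i := c%:~R / q%:R) (y := t) e0 P1 w2 m2 (esym ey) (erefl _)).
  by rewrite !inner_le //; move: nc ok; rewrite /cr /ext /btw /ltm /=; clear; lia.
- have /andP[w1 w2] := W (ltac:(by move=> ? ? [])); have [P1 P2] := P w1.
  have /andP[w1' w2'] := W' (ltac:(by move=> ? ? [])); have [P1' P2'] := P' w1'.
  rewrite P2 P2' -ex in ey; rewrite -ex in P1'.
  have [|E1 E2] := parabolas_meet e0 P1 P1' ey.
    rewrite !inner_le //; move: nc ok ok'; rewrite /cr /ext /btw /ltm /= => nc ok ok'.
    have [h|[h|[h|h]]] : b <= c \/ d <= a \/ (a <= c /\ d <= b) \/ (c <= a /\ b <= d).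
      by move: nc ok ok'; clear; lia.
    + exact: Or41.
    + exact: Or42.
    + by case: h => ? ?; apply: Or43.
    + by case: h => ? ?; apply: Or44.
  by apply: ne; split; congr Outer; apply/eqP; rewrite eq_le -!(inner_le _ _ q0) ?E1 ?E2 lexx.
Qed.

Lemma cr_noncrossing u v z w : arcok u v -> arcok z w ->
  (forall n, ~~ cr u v (tr n z) (tr n w)) -> (forall n, ~ (u = tr n z /\ v = tr n w)) ->
  noncrossing (arc_class u v) (arc_class z w).
Proof.
(* The summand 2 gives [e <= 2^-1], the others bound [e] times the horizontal extents. These are
   invariant under translation, so one [e] serves for all lifts. *)
move=> ok ok' nc ne; pose e : R := (2 + `|px u - px v| + `|px z - px w|)^-1.
have n1 := normr_ge0 (px u - px v); have n2 := normr_ge0 (px z - px w).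
have d0 : 0 < 2 + `|px u - px v| + `|px z - px w| by lra.
have e0 : 0 < e by rewrite invr_gt0.
have e2 : e <= 2^-1 by rewrite lef_pV2 ?posrE //; lra.
have e1 : 0 < e <= 1 by rewrite e0 (le_trans e2) //; lra.
exists (curve e u v), (curve e z w); split; try exact: curve_simple.
move=> s t hs ht /(curve_eq e1 e1 ok ok' hs ht)[n [h1 h2]].
have m1 : e * `|px u - px v| < 1 by rewrite mulrC ltr_pdivrMr // mul1r; lra.
have m2 : e * `|px (tr n z) - px (tr n w)| < 1.
  have -> : px (tr n z) - px (tr n w) = px z - px w by rewrite !px_tr; ring.
  by rewrite mulrC ltr_pdivrMr // mul1r; lra.
by apply: (curves_disjoint e0 e2 m1 m2 ok _ (nc n) (ne n) hs ht h1 h2); rewrite arcok_tr.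
Qed.

End Representatives.

(** * Mutation *)

Local Close Scope classical_set_scope.

Section Translation.
Context (k : closedFieldType) (p q : nat) (X : coh k p q).

Lemma bijB_tr n a b : BJ X (a - n * p%:Z) (b + n * q%:Z) <-> BJ X a b.
Proof.
rewrite /BJ; suff -> : D p q true (a - n * p%:Z) (b + n * q%:Z) = D p q true a b by [].
by apply/D_eq; exists (- n); rewrite /per /=; split; ring.
Qed.

Lemma EV_tr i n a b : EV X i a b -> EV X i (a + n * (per p q i)%:Z) (b + n * (per p q i)%:Z).
Proof.
have E c : D p q i (c + n * (per p q i)%:Z) 0 = D p q i c (n * (per p q (~~ i))%:Z).
  by apply/D_eq; exists n; split; ring.
move=> [m [[e h]|[e h]]]; exists m; [left|right]; (split; first by rewrite e; ring);
  by rewrite E; apply: V_shift h.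
Qed.

(** Translating a chord changes its degrees by a relation of the grading group. *)
Lemma perpc_tr n u v : perpc X u v -> perpc X (tr p q n u) (tr p q n v).
Proof.
case: u v => a [] b /=; rewrite ?ltrD2r.
- by case: ifP => _ /(EV_tr (- n)); rewrite /per /= !mulNr; congr (EV X _ _ _); ring.
- by move=> h; rewrite opprD; apply/bijB_tr.
- by move=> h; rewrite opprD; apply/bijB_tr.
- by case: ifP => _ /(EV_tr n); rewrite /per /=; congr (EV X _ _ _); ring.
Qed.

End Translation.

Section Mutation.
Context (k : closedFieldType) (R : realType) (p q : nat).
Context (p0 : (0 < p)%N) (q0 : (0 < q)%N).
Context (phi : hclass R -> coh k p q) (hphi : is_phi phi).
Context (G : {fset hclass R}) (hG : triangulation p q G).
Local Notation tr := (tr p q).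
Local Notation arcok := (arcok p q).
Local Notation cls := (@arc_class R p q).
Local Notation conc := (conc k p q).

Lemma phi_conc u v : arcok u v -> iso (phi (cls u v)) (conc u v).
Proof.
have [h1 h2 h3] := hphi; case: u v => a [] b //= ok.
- apply: (classify_inf p0 q0); have := h2 b `|(b - a - 1)%R|%N (ltac:(move: ok; clear; lia)).
  by congr (is_torsion_inf _ _ (phi (cls (Inner _) _))); move: ok; clear; lia.
- by rewrite -OD; apply: h1.
- apply: (classify_zero p0 q0); have := h3 (- a) `|(b - a - 1)%R|%N (ltac:(move: ok; clear; lia)).
  by congr (is_torsion_zero _ _ (phi (cls (Outer _) (Outer _)))); move: ok; clear; lia.
Qed.

(* The sheaves attached by phi tell arcs apart, which spares the uniqueness of lifts. *)
Lemma class_translate u v z w : arcok u v -> arcok z w -> cls u v = cls z w ->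
  exists n, u = tr n z /\ v = tr n w.
Proof.
move=> ok ok' e; apply: contrapT => no.
have o : orth (conc u v) (conc z w).
  by refine (orth_conc _ _ ok ok' _) => // n h; apply: no; exists n.
apply: (orth_sym p0 q0 (brick_conc k p0 q0 ok) (brick_conc k p0 q0 ok') o).
have h := phi_conc ok; rewrite e in h.
exact: (iso_trans p0 q0 (iso_sym h) (phi_conc ok')).
Qed.

Definition inG (u v : marked) : Prop := oriented u v /\ cls u v \in G.

Lemma inG_arc u v : inG u v -> arcok u v.
Proof.
move=> [o h]; have [h1 _ _] := hG; have [_ [c hc]] := h1 _ h.
exact: (simple_arcok p0 q0 o hc).
Qed.

Lemma inG_tr n u v : inG u v -> inG (tr n u) (tr n v).
Proof.
move=> h; split; last by rewrite arc_class_tr //; case: h.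
by apply: (@arcok_oriented p q); rewrite arcok_tr //; apply: inG_arc.
Qed.

(** Lifts of one arc are translates of each other and fall under [arcok_self]; lifts of different
    arcs fall under [noncrossing_cr]. *)
Lemma inG_nc u v z w : inG u v -> inG z w -> ~~ cr u v z w.
Proof.
move=> h h'; have [e|ne] := pselect (cls u v = cls z w).
  have [n [-> ->]] := class_translate (inG_arc h) (inG_arc h') e.
  by rewrite cr_sym; apply: arcok_self => //; apply: inG_arc.
by have [_ h2 _] := hG; apply: (noncrossing_cr p0 q0 (h2 _ _ h.2 h'.2 ne)).
Qed.

Lemma inG_rep : exists rep : hclass R -> marked * marked,
  forall d, d \in G -> inG (rep d).1 (rep d).2 /\ d = cls (rep d).1 (rep d).2.
Proof.
have H d : exists c : marked * marked, d \in G -> inG c.1 c.2 /\ d = cls c.1 c.2.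
  have [dG|nG] := pselect (d \in G); last by exists (Inner 0, Inner 0).
  have [h1 _ _] := hG; have [[u [v [o e]]] _] := h1 _ dG.
  by exists (u, v) => _; rewrite /inG /= -e.
by have [rep hrep] := choice H; exists rep.
Qed.

(** Chords that do not interleave are realized by disjoint curves, so the maximality of [G] applies
    to the class of [u v]. *)
Lemma inG_max u v : arcok u v -> (forall z w, inG z w -> ~~ cr u v z w) -> inG u v.
Proof.
move=> ok nc; split; first exact: (@arcok_oriented p q).
apply: contrapT => nG; apply: (nG); have [_ _ h3] := hG.
apply: h3; first exact: arcok_is_arc.
have [rep hrep] := inG_rep.
move=> d dG; have [h e] := hrep d dG; rewrite e.
apply: (cr_noncrossing R p0 q0 ok (inG_arc h)) => n; first exact: nc (inG_tr n h).
by move=> [eu ev]; apply: nG; rewrite eu ev arc_class_tr // -e.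
Qed.

Section Chosen.
Context (rep : hclass R -> marked * marked).
Hypothesis hrep : forall d, d \in G -> inG (rep d).1 (rep d).2 /\ d = cls (rep d).1 (rep d).2.

Lemma inG_list u v : inG u v -> exists n, u = tr n (rep (cls u v)).1 /\ v = tr n (rep (cls u v)).2.
Proof.
by move=> h; have [h' e] := hrep h.2; apply: (class_translate (inG_arc h) (inG_arc h') e).
Qed.

Lemma In_map_mem (T : eqType) (U : Type) (f : T -> U) s c :
  In c (map f s) -> exists2 x, x \in s & c = f x.
Proof.
elim: s => //= x s IH [<-|/IH[y ys ->]]; first by exists x; rewrite ?mem_head.
by exists y; rewrite // in_cons ys orbT.
Qed.

Lemma mem_In_map (T : eqType) (U : Type) (f : T -> U) s x : x \in s -> In (f x) (map f s).
Proof.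
elim: s => //= y s IH; rewrite in_cons => /orP[/eqP ->|/IH]; first by left.
by right.
Qed.

Lemma generation (X : coh k p q) :
  (forall d, d \in G -> perpc X (rep d).1 (rep d).2) -> forall u v, u <> v -> perpc X u v.
Proof.
move=> h; apply: (perpc_all p0 q0 inG_arc inG_tr inG_nc inG_max).
  exists [seq rep d | d <- enum_fset G] => u v huv; have [n [e1 e2]] := inG_list huv.
  by exists (rep (cls u v)), n; split=> //; apply: mem_In_map; case: huv.
by move=> u v huv; have [n [e1 e2]] := inG_list huv; have := perpc_tr n (h _ huv.2);
  rewrite -e1 -e2.
Qed.

Lemma sheaf_chords (s : seq (hclass R)) : {subset s <= G} ->
  iso (big_dsum [seq phi d | d <- s]) (big_dsum [seq conc c.1 c.2 | c <- [seq rep d | d <- s]]).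
Proof.
move=> sG; rewrite -map_comp.
pose F d := if d \in G then conc (rep d).1 (rep d).2 else phi d.
have -> : [seq ((fun c => conc c.1 c.2) \o rep) d | d <- s] = [seq F d | d <- s].
  by elim: s sG => //= d s IH sG; rewrite /F sG ?mem_head // IH // => e es; apply: sG;
    rewrite in_cons es orbT.
apply: (big_dsum_iso p0 q0) => d; rewrite /F; case: ifP => dG; last exact: (iso_refl p0 q0).
by have [h e] := hrep dG; rewrite {1}e; apply: phi_conc; apply: inG_arc.
Qed.

Lemma tilting_triangulation : tilting (sheaf_of phi G).
Proof.
apply: (tilting_iso p0 q0 (iso_sym (sheaf_chords (s := enum_fset G) (fun _ h => h)))).
apply: (tilting_chords p0 q0).
- by move=> c /(@In_map_mem (hclass R) _ rep)[d dG ->]; apply: inG_arc; case: (hrep dG).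
- move=> c c' /(@In_map_mem (hclass R) _ rep)[d dG ->] /(@In_map_mem (hclass R) _ rep)[d' dG' ->] n; have [h _] := hrep dG.
  by have [h' _] := hrep dG'; apply: inG_nc => //; apply: inG_tr.
- rewrite size_map => i j hi hj ij n [].
  rewrite !(nth_map (fun=> False : Prop)) // => e1 e2; apply: ij.
  have di := mem_nth (fun=> False : Prop) hi; have dj := mem_nth (fun=> False : Prop) hj.
  have [_ ei] := hrep di; have [_ ej] := hrep dj.
  apply/eqP; rewrite -(nth_uniq (fun=> False : Prop) hi hj (fset_uniq G)).
  by rewrite ei ej e1 e2 arc_class_tr.
- move=> X hX; apply: generation => d dG; apply: hX; exact: mem_In_map.
Qed.

End Chosen.

Lemma side_not_translate' n u v w : inG u v -> sideA inG u w -> w <> u ->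
  ~ (v = tr n u /\ w = tr n v) /\ ~ (w = tr n u /\ v = tr n v).
Proof.
move=> huv uw wu; have g := side_ok p0 q0 inG_arc uw.
have fix0 x : tr n x = x -> n = 0 by case: x => a [] e; move: p0 q0; clear -e; nia.
split=> -[e1 e2]; last by apply: wu; rewrite e1 (fix0 v) // tr0.
move: g; rewrite e2 e1 tr_tr => g; apply: wu; rewrite e2 e1 tr_tr.
suff -> : n + n = 0 by rewrite tr0.
by move: g; case: (u) => a /= g; move: p0 q0; clear -g; nia.
Qed.

Lemma flip_mutation g g' : g \in G -> is_flip p q G g g' ->
  is_mutation (sheaf_of phi G) (phi g) (phi g').
Proof.
move=> gG [u [v [w [z [[o eg] [suv svw suw] [_ svz suz] wz [owz eg']]]]]].
have huv : inG u v by split=> //; rewrite -eg.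
have okuv := inG_arc huv.
have okwz : arcok w z := flip_arcok p0 q0 inG_arc inG_tr inG_nc huv suw svw suz svz wz owz.
have C : cr u v w z := flip_cross p0 q0 inG_arc inG_nc huv suw svw suz svz wz.
have uv : u <> v := side_neq p0 q0 inG_arc (Or32 _ _ huv).
have uw : u <> w := side_neq p0 q0 inG_arc suw. have vw : v <> w := side_neq p0 q0 inG_arc svw.
have uz : u <> z := side_neq p0 q0 inG_arc suz. have vz : v <> z := side_neq p0 q0 inG_arc svz.
(* A lift of the new arc in [G] would cross a translate of [u v]. *)
have nwz n : ~ inG (tr n w) (tr n z).
  by move=> h; have := inG_nc (inG_tr n huv) h; rewrite cr_tr C.
have [rep hrep] := inG_rep.
have T1 := tilting_triangulation hrep.
have iuv := phi_conc okuv; have iwz := phi_conc okwz.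
rewrite -eg in iuv; rewrite -eg' in iwz.
have buv := brick_conc k p0 q0 okuv; have bwz := brick_conc k p0 q0 okwz.
split.
- by apply: (indecomposable_iso p0 q0 (iso_sym iuv)); apply: brick_indecomposable.
- by apply: (indecomposable_iso p0 q0 (iso_sym iwz)); apply: brick_indecomposable.
- move=> e; apply: (orth_sym p0 q0 buv bwz).
    by refine (orth_conc _ _ okuv okwz _) => // n [e1 e2]; apply: (nwz n); rewrite -e1 -e2.
  exact: (iso_trans p0 q0 (iso_sym iuv) (iso_trans p0 q0 e iwz)).
have us := fset_uniq G.
have hs : g \in enum_fset G by [].
(* Deleting [g] from the enumeration gives the common complement. *)
case/splitPr es : {-}(enum_fset G) / hs => [s1 s2].
have hsub d : d \in s1 ++ s2 -> d \in G /\ d <> g.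
  move=> hd; have dG : d \in enum_fset G.
    by rewrite es mem_cat in_cons; move: hd; rewrite mem_cat => /orP[->|->]; rewrite ?orbT.
  split=> // e; move: us; rewrite es -cat_rcons.
  have -> : uniq (rcons s1 g ++ s2) = uniq (g :: s1 ++ s2).
    by apply: perm_uniq; rewrite cat_rcons perm_catC /= perm_cons perm_catC.
  by rewrite /= -e hd.
have us' : uniq (s1 ++ s2).
  move: us; rewrite es; rewrite -cat_rcons.
  have -> : uniq (rcons s1 g ++ s2) = uniq (g :: s1 ++ s2).
    by apply: perm_uniq; rewrite cat_rcons perm_catC /= perm_cons perm_catC.
  by case/andP.
exists (big_dsum [seq phi d | d <- s1 ++ s2]); split=> //.
  by rewrite /sheaf_of es map_cat /= map_cat; apply: (big_dsum_remove p0 q0).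
have sub : {subset s1 ++ s2 <= G} by move=> d /hsub[].
pose cs := [seq rep d | d <- s1 ++ s2].
have I2 := iso_dsum p0 q0 iwz (sheaf_chords hrep sub).
apply: (tilting_iso p0 q0 (iso_trans p0 q0 (iso_sym I2) (dsumC p0 q0 _ _))).
have := @tilting_chords k p q p0 q0 ((w, z) :: cs); rewrite /=; apply.
- by move=> c [<-//|/(@In_map_mem (hclass R) _ rep)[d /sub dG ->]]; apply: inG_arc; case: (hrep d dG).
(* By [flip_only], a remaining arc crossing the new diagonal would be [g] itself. *)
- have ncx d n : d \in s1 ++ s2 -> ~~ cr w z (tr n (rep d).1) (tr n (rep d).2).
    move=> hd; have [dG dg] := hsub d hd; have [h e] := hrep d dG; apply/negP => c.
    have [e1 e2] := flip_only p0 q0 inG_arc inG_nc huv suw svw suz svz C (inG_tr n h) c.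
    by apply: dg; rewrite e eg -e1 -e2 arc_class_tr.
  move=> c c' [<-|/(@In_map_mem (hclass R) _ rep)[d hd ->]] [<-|/(@In_map_mem (hclass R) _ rep)[d' hd' ->]] n /=.
  + exact: arcok_self.
  + exact: ncx.
  + have := ncx d (- n) hd; rewrite -(cr_tr p q n) !tr_tr addNr !tr0 cr_sym; exact.
  + have [h _] := hrep d (sub d hd); have [h' _] := hrep d' (sub d' hd').
    by apply: inG_nc => //; apply: inG_tr.
- have sz : size cs = size (s1 ++ s2) by rewrite size_map.
  pose d0 : hclass R := fun=> False.
  have nt i : (i < size cs)%N ->
      nth (Inner 0, Inner 0) cs i = rep (nth d0 (s1 ++ s2) i) /\ nth d0 (s1 ++ s2) i \in s1 ++ s2.
    by rewrite sz => hi; rewrite (nth_map d0) //; split=> //; apply: mem_nth.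
  move=> [|i] [|j] //= hi hj ij n [].
  + have [-> hm] := nt j hj => e1 e2; have [h _] := hrep _ (sub _ hm).
    by apply: (nwz 0); rewrite !tr0 e1 e2; apply: inG_tr.
  + have [-> hm] := nt i hi => e1 e2; have [h _] := hrep _ (sub _ hm).
    by apply: (nwz n); rewrite -e1 -e2.
  + have [-> hmi] := nt i hi; have [-> hmj] := nt j hj => e1 e2; apply: ij; congr _.+1.
    have [_ ei] := hrep _ (sub _ hmi); have [_ ej] := hrep _ (sub _ hmj).
    rewrite sz in hi hj; apply/eqP; rewrite -(nth_uniq d0 hi hj us').
    by rewrite ei ej e1 e2 arc_class_tr.
(* The sides of the quadrilateral are boundary segments or lifts of remaining arcs. With the new
   diagonal they give the condition for [u v], and [generation] for the old triangulation
   concludes. *)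
- move=> X hX; have pwz : perpc X w z by apply: (hX (w, z)); left.
  have perp d : d \in s1 ++ s2 -> perpc X (rep d).1 (rep d).2.
    by move=> hd; apply: hX; right; apply: mem_In_map.
  have perpA x y : inG x y -> (forall n, ~ (x = tr n u /\ y = tr n v)) -> perpc X x y.
    move=> hxy nt; have [n [ex ey]] := inG_list hrep hxy.
    suff : perpc X (rep (cls x y)).1 (rep (cls x y)).2 by move/(perpc_tr n); rewrite -ex -ey.
    apply: perp; have : cls x y \in enum_fset G by case: hxy.
    rewrite es !mem_cat in_cons => /or3P[->|/eqP h|->]; rewrite ?orbT //.
    have [m [e1 e2]] := class_translate (inG_arc hxy) okuv (etrans h eg).
    by case: (nt m).
  have pu y : sideA inG u y -> sideA inG v y -> perpc X u y.
    move=> sy sy'; have uy := side_neq p0 q0 inG_arc sy; have vy := side_neq p0 q0 inG_arc sy'.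
    have N n := side_not_translate p0 q0 inG_arc n huv sy sy' (not_eq_sym vy).
    case: (sy) => h; first exact: perpc_boundary.
      by apply: perpA => // n; case: (N n).
    apply: perpc_sym; first exact: not_eq_sym.
    by apply: perpA => // n; case: (N n).
  have pv y : sideA inG u y -> sideA inG v y -> perpc X v y.
    move=> sy sy'; have uy := side_neq p0 q0 inG_arc sy; have vy := side_neq p0 q0 inG_arc sy'.
    have N n := side_not_translate' n huv sy (not_eq_sym uy).
    case: (sy') => h; first exact: perpc_boundary.
      by apply: perpA => // n; case: (N n).
    apply: perpc_sym; first exact: not_eq_sym.
    by apply: perpA => // n; case: (N n).
  have puv : perpc X u v by apply: (resolve C pwz); [apply: pu|apply: pu|apply: pv|apply: pv].
  apply: (generation hrep) => d dG; have [h e] := hrep d dG.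
  have [[n [-> ->]]|no] := pselect (exists n, (rep d).1 = tr n u /\ (rep d).2 = tr n v).
    exact: perpc_tr.
  by apply: perpA => // n h'; apply: no; exists n.
Qed.

End Mutation.

Theorem proposition4p7 (k : closedFieldType) (R : realType) (p q : nat)
    (hp : (1 <= p)%N) (hpq : (p <= q)%N)
    (phi : hclass R -> coh k p q) (hphi : is_phi phi)
    (G : {fset hclass R}) (hG : triangulation p q G)
    (g : hclass R) (hg : g \in G)
    (g' : hclass R) (hg' : is_flip p q G g g') :
  is_mutation (sheaf_of phi G) (phi g) (phi g').
Proof. exact: (flip_mutation hp (leq_trans hp hpq) hphi hG hg hg'). Qed.
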